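(* Let $\underline{b}>0$ and suppose that $\mathbb{E}[g_m^2(X)]\ge \underline{b}$ for all $m=1,\dots,d$, and that $\mathbb{E}[|h_m(X,X')|^{2+\ell}]\le B_n^\ell$ for $\ell=1,2$ and all $m=1,\dots,d$. Suppose that $\log d\le \bar b n$ for some constant $\bar b>0$. Set $$\varpi_{1,n}=\left(\frac{B_n^2\log^7(nd)}{n}\right)^{1/6},\qquad \varpi_{2,n}=\left(\frac{B_n^2\log^3(nd)}{n^{1-2/q}}\right)^{1/3}.$$ (i) If $\|h_m(X,X')\|_{\psi_1}\le B_n$ for all $m=1,\dots,d$, then there exists a constant $C>0$ depending only on $\underline b,\bar b$ such that $\rho^{re}(T_n,Y)\le C\varpi_{1,n}$. (ii) If $\mathbb{E}[\max_{1\le m\le d}(|h_m(X,X')|/B_n)^q]\le 1$ for some $q\ge 4$, then there exists a constant $C>0$ depending only on $\underline b,\bar b,q$ such that $\rho^{re}(T_n,Y)\le C\{\varpi_{1,n}+\varpi_{2,n}\}$.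
   Context: Throughout $n\ge 4$, $d\ge 3$. $X_1,\dots,X_n$ are iid random vectors in $\mathbb{R}^p$ with distribution $F$, and $X,X'$ are independent with distribution $F$, independent of $X_1,\dots,X_n$. $h:\mathbb{R}^p\times\mathbb{R}^p\to\mathbb{R}^d$ is a fixed measurable function with $h(x_1,x_2)=h(x_2,x_1)$ and $\mathbb{E}|h_k(X_1,X_2)|<\infty$ for all $k$. Put $\theta=\mathbb{E}[h(X_1,X_2)]$, $$U_n=\frac1{n(n-1)}\sum_{1\le i\ne j\le n}h(X_i,X_j),\qquad T_n=\sqrt n(U_n-\theta)/2,$$ $g(x)=\mathbb{E}[h(x,X')]-\theta$, $\Gamma=\mathrm{Cov}(g(X))$ ($d\times d$), and $Y\sim N(0,\Gamma)$. $p,d,F$ may depend on $n$; $B_n\ge 1$ is a sequence of real numbers possibly tending to infinity. $\mathcal{A}^{re}$ is the class of all hyperrectangles $\{x\in\mathbb{R}^d: a_j\le x_j\le b_j,\ j=1,\dots,d\}$ with $-\infty\le a_j\le b_j\le\infty$, and $\rho^{re}(V,W)=\sup_{A\in\mathcal{A}^{re}}|\mathbb{P}(V\in A)-\mathbb{P}(W\in A)|$. For a real random variable $\xi$, $\|\xi\|_{\psi_1}=\inf\{C>0:\mathbb{E}[\exp(|\xi|/C)-1]\le 1\}$. *)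

(* Defs.v *)
From HB Require Import structures.
From mathcomp Require Import all_boot all_order all_algebra.
From mathcomp Require Import all_classical all_reals all_analysis.

Set Implicit Arguments.
Unset Strict Implicit.
Unset Printing Implicit Defensive.

Import Order.TTheory GRing.Theory Num.Theory.
Import numFieldNormedType.Exports.

Local Open Scope classical_set_scope.
Local Open Scope ring_scope.

(* R^k is represented by k.-tuple R, whose sigma-algebra is the one generated
   by the coordinate maps, i.e. the Borel sigma-algebra of R^k. *)

(* The sets A i range over all measurable sets, setT included, so that the
   product rule for the whole family contains the rule for every subfamily. *)
Definition mutually_independent (R : realType) (dO dS : measure_display)
    (Om : measurableType dO) (S : measurableType dS) (P : probability Om R)
    (I : finType) (Z : I -> {RV P >-> S}) : Prop :=
  forall A : I -> set S, (forall i, measurable (A i)) ->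
    P (\bigcap_(i in [set: I]) (Z i @^-1` A i)) =
    (\prod_(i : I) P (Z i @^-1` A i))%E.

Definition iid (R : realType) (dO dS : measure_display)
    (Om : measurableType dO) (S : measurableType dS) (P : probability Om R)
    (F : set S -> \bar R) (I : finType) (Z : I -> {RV P >-> S}) : Prop :=
  (forall i A, measurable A -> P (Z i @^-1` A) = F A) /\
  mutually_independent Z.

Definition with_copies (R : realType) (dO dS : measure_display)
    (Om : measurableType dO) (S : measurableType dS) (P : probability Om R)
    (n : nat) (Xs : 'I_n -> {RV P >-> S}) (X X' : {RV P >-> S})
    (s : 'I_n + bool) : {RV P >-> S} :=
  match s with
  | inl i => Xs i
  | inr b => if b then X else X'
  end.

(* Y ~ N(0, Gamma), Gamma possibly singular: Y has the law of A Z, where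
   A A^T = Gamma and Z is a vector of independent N(0, 1) variables. *)
Definition centered_normal (R : realType) (dO : measure_display)
    (Om : measurableType dO) (Q : probability Om R) (d : nat)
    (Y : {RV Q >-> d.-tuple R}) (Gamma : 'M[R]_d) : Prop :=
  exists (k : nat) (A : 'M[R]_(d, k)),
    A *m A^T = Gamma /\
    exists (dO' : measure_display) (Om' : measurableType dO')
           (P' : probability Om' R) (Z : 'I_k -> {RV P' >-> R}),
      iid (normal_prob 0 1 : set R -> \bar R) Z /\
      forall S : set (d.-tuple R), measurable S ->
        Q (Y @^-1` S) =
        P' ((fun w => [tuple \sum_(l < k) A j l * Z l w | j < d]) @^-1` S).

Definition hyperrectangle (R : realType) (d : nat) : set (set (d.-tuple R)) :=
  [set A | exists a b : 'I_d -> \bar R, (forall j, (a j <= b j)%E) /\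
     A = [set x | forall j, (a j <= (tnth x j)%:E <= b j)%E]].

Definition rho_re (R : realType) (d : nat) (dO dO' : measure_display)
    (Om : measurableType dO) (Om' : measurableType dO')
    (P : probability Om R) (V : Om -> d.-tuple R)
    (Q : probability Om' R) (W : Om' -> d.-tuple R) : \bar R :=
  ereal_sup [set `|P (V @^-1` A) - Q (W @^-1` A)|%E | A in @hyperrectangle R d].

(* The value is +oo when no C is admissible. *)
Definition psi1_norm (R : realType) (dO : measure_display)
    (Om : measurableType dO) (P : probability Om R) (xi : Om -> R) : \bar R :=
  ereal_inf [set C%:E | C in
    [set C : R | 0 < C /\ ('E_P[(fun w => expR (`|xi w| / C) - 1)%R] <= 1)%E]].

Section Ustatistic.
Variables (R : realType) (dO : measure_display) (Om : measurableType dO)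
  (P : probability Om R) (n p d : nat)
  (h : p.-tuple R -> p.-tuple R -> d.-tuple R)
  (Xs : 'I_n -> {RV P >-> p.-tuple R}) (X X' : {RV P >-> p.-tuple R}).

Definition hXX (m : 'I_d) (w : Om) : R := tnth (h (X w) (X' w)) m.

Definition theta (m : 'I_d) : R := fine 'E_P[hXX m].

Definition Ustat (w : Om) (m : 'I_d) : R :=
  (n * n.-1)%:R^-1 *
  \sum_(i < n) \sum_(j < n | i != j) tnth (h (Xs i w) (Xs j w)) m.

Definition Tstat (w : Om) : d.-tuple R :=
  [tuple Num.sqrt n%:R * (Ustat w m - theta m) / 2 | m < d].

Definition hajek (m : 'I_d) (x : p.-tuple R) : R :=
  fine 'E_P[fun w => tnth (h x (X' w)) m] - theta m.

Definition Gamma : 'M[R]_d :=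
  \matrix_(i, j) fine (covariance P (hajek i \o X) (hajek j \o X)).

Record assumptions (b bbar B : R) (F : probability (p.-tuple R) R) : Prop := {
  n_ge4 : (4 <= n)%N;
  d_ge3 : (3 <= d)%N;
  B_ge1 : 1 <= B;
  sample_iid : iid F (with_copies Xs X X');
  h_measurable :
    measurable_fun [set: p.-tuple R * p.-tuple R] (fun x => h x.1 x.2);
  h_symmetric : forall x y, h x y = h y x;
  h_integrable : forall m, P.-integrable [set: Om] (EFin \o hXX m);
  hajek_nondegenerate :
    forall m, (b%:E <= 'E_P[(fun w => hajek m (X w) ^+ 2)%R])%E;
  h_moments : forall (l : nat) (m : 'I_d), (1 <= l <= 2)%N ->
    ('E_P[(fun w => `|hXX m w| ^+ (2 + l))%R] <= (B ^+ l)%:E)%E;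
  log_d : ln (d%:R : R) <= bbar * n%:R
}.

End Ustatistic.

Definition varpi1 (R : realType) (n d : nat) (B : R) : R :=
  (B ^+ 2 * ln ((n * d)%:R) ^+ 7 / n%:R) `^ (1 / 6).

Definition varpi2 (R : realType) (n d : nat) (q B : R) : R :=
  (B ^+ 2 * ln ((n * d)%:R) ^+ 3 / n%:R `^ (1 - 2 / q)) `^ (1 / 3).

(* Main.v *)
(* The statistic is a sum of the independent projections sqrt(n)^-1 g(X_j) plus a
   degenerate U-statistic.  A hyperrectangle is an orthant for the vector of its
   signed finite sides, and its indicator is sandwiched between smooth functions
   of a soft maximum.  For such functions the projections are exchanged one at a
   time for Gaussian vectors with the same covariance; the third-order remainder
   only counts near the boundary of the orthant, whose probability is bounded by
   Gaussian anti-concentration plus the very distance being estimated, so that the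
   bound improves itself.  The degenerate part is controlled in the sup norm by
   following a soft maximum along the sample. *)
Require Import Defs.
From HB Require Import structures.
From mathcomp Require Import all_boot all_order all_algebra.
From mathcomp Require Import all_classical all_reals all_analysis measurable_realfun.
From mathcomp Require Import ring lra.

Set Implicit Arguments.
Unset Strict Implicit.
Unset Printing Implicit Defensive.

Import Order.TTheory GRing.Theory Num.Theory.
Import numFieldNormedType.Exports.

Local Open Scope classical_set_scope.
Local Open Scope ring_scope.

(** * Independent sequences and translation operators *)

(** The observations and the Gaussian vectors live on unrelated spaces and are never coupled. A law
    acts on functions by averaging translates, sums of independent terms become compositions, and
    these operators commute; hence any one summand can be exchanged. Scales: let [l = ln (n d)],
    smoothing width [1 / phi] and soft maximum parameter [beta = phi l]. Anti-concentration makes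
    smoothing cost about [sqrt l / phi]. The [n] third-order remainders cost about
    [phi beta^2 B / sqrt n] times a near-boundary probability. With [phi = sqrt l / (K w)] the first
    is [K w] and the second factor is [B l^(7/2) / (K^3 w^3 sqrt n)], below a fixed small constant
    once [w^6 >= B^2 l^7 / n]: this is the first rate. That factor need not be of size [w], because
    it multiplies the distance itself. Increments above [1 / beta] escape this localization and are
    paid for by [cubic_excess]. Exponential tails make that cost negligible; moments of order [q]
    require in addition [w^3 >= B^2 l^3 / n^(1 - 2/q)], the second rate. *)

Lemma mfun_of d1 d2 (T1 : measurableType d1) (T2 : measurableType d2)
    (f : T1 -> T2) : measurable_fun setT f ->
  exists g : {mfun T1 >-> T2}, g = f :> (T1 -> T2).
Proof.
move=> mf.
pose g : {mfun T1 >-> T2} := HB.pack f (isMeasurableFun.Build _ _ _ _ f mf).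
by exists g.
Qed.

Section independence.
Context {R : realType} {dO : measure_display} {Om : measurableType dO}.
Variable P : probability Om R.

Definition independent2 d1 d2 (T1 : measurableType d1) (T2 : measurableType d2)
    (V : Om -> T1) (W : Om -> T2) : Prop :=
  forall A B, measurable A -> measurable B ->
    P (V @^-1` A `&` W @^-1` B) = (P (V @^-1` A) * P (W @^-1` B))%E.

(** The joint law agrees with a product measure on rectangles, hence everywhere, and Tonelli
    integrates the second variable out. Nonnegative extended values spare all integrability
    conditions; inner integrals may be infinite. *)
Lemma independent2_integral d1 d2 (T1 : measurableType d1) (T2 : measurableType d2)
    (V : Om -> T1) (W : Om -> T2) (F : probability T2 R)
    (f : T1 * T2 -> \bar R) :
  measurable_fun setT V -> measurable_fun setT W ->
  (forall B, measurable B -> P (W @^-1` B) = F B) ->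
  independent2 V W ->
  measurable_fun [set: T1 * T2] f -> (forall z, 0 <= f z)%E ->
  (\int[P]_w f (V w, W w) = \int[P]_w \int[F]_x f (V w, x))%E.
Proof.
move=> mV mW WF VW mf f0.
have mVW : measurable_fun setT (fun w => (V w, W w)) by exact: measurable_fun_pair.
have [V' eV] := mfun_of mV; have [VW' eVW] := mfun_of mVW.
pose PV : probability T1 R := distribution P V'.
pose PVW : probability (T1 * T2)%type R := distribution P VW'.
have E : forall X, measurable X -> (PV \x F)%E X = PVW X.
  move=> X mX; apply: product_measure_unique => // A B mA mB.
  suff: P (VW' @^-1` (A `*` B)) = (P (V' @^-1` A) * F B)%E by [].
  by rewrite eV eVW -WF // -VW.
transitivity (\int[distribution P VW']_z f z)%E.
  by rewrite ge0_integral_distribution //; apply: eq_integral => w _ /=; rewrite eVW.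
rewrite (@eq_measure_integral _ _ _ setT (PV \x F)%E (distribution P VW')); last first.
  by move=> A mA _; exact: (esym (E A mA)).
rewrite fubini_tonelli1 //.
rewrite (ge0_integral_distribution V') //.
- by apply: eq_integral => w _ /=; rewrite eV.
- exact: measurable_fun_fubini_tonelli_F.
- by move=> x; apply: integral_ge0.
Qed.

(* Product rule for the first n terms of a sequence; the values beyond n are
   irrelevant. *)
Definition iid_seq d (S : measurableType d) (F : set S -> \bar R) (n : nat)
    (X : nat -> Om -> S) : Prop :=
  [/\ forall i, measurable_fun setT (X i),
      forall i A, (i < n)%N -> measurable A -> P (X i @^-1` A) = F A &
      forall A : nat -> set S, (forall i, measurable (A i)) ->
        P (\bigcap_(i in `I_n) (X i @^-1` A i)) =
        (\prod_(i < n) P (X i @^-1` A i))%E].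

Definition history d (S : measurableType d) (X : nat -> Om -> S) (k : nat)
  (w : Om) : k.-tuple S := [tuple X i w | i < k].

Lemma measurable_history d (S : measurableType d) (X : nat -> Om -> S) k :
  (forall i, measurable_fun setT (X i)) -> measurable_fun setT (history X k).
Proof.
move=> mX; apply/measurable_fun_tnthP => i.
rewrite (_ : _ \o _ = X i) //.
by apply/funext => w /=; rewrite /history tnth_mktuple.
Qed.

Lemma iid_seq_widen d (S : measurableType d) (F : probability S R) m n
    (X : nat -> Om -> S) : (m <= n)%N -> iid_seq F n X -> iid_seq F m X.
Proof.
move=> mn [mX XF XI]; split => //.
  by move=> i A im; apply: XF; exact: leq_trans im mn.
move=> A mA.
(* Padding with [setT] beyond [m] reduces the product rule for [m] terms to the one for [n]. *)
pose A' i := if (i < m)%N then A i else setT.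
have mA' i : measurable (A' i) by rewrite /A'; case: ifP.
have := XI A' mA'.
rewrite (_ : \bigcap_(i in `I_n) _ = \bigcap_(i in `I_m) X i @^-1` A i); last first.
  apply/seteqP; split => w /= H i /= im.
    by have := H i (leq_trans im mn); rewrite /A' im.
  by rewrite /A'; case: ifPn => // im'; exact: H.
move=> ->.
rewrite -(subnKC mn) big_split_ord /= [X in (_ * X)%E]big1 ?mule1.
  by apply: eq_bigr => i _; rewrite /A' ltn_ord.
move=> i _; rewrite /A' ltnNge leq_addr /= preimage_setT.
exact: probability_setT.
Qed.

Lemma history_independent d (S : measurableType d) (F : probability S R) k n
    (X : nat -> Om -> S) : iid_seq F n X -> (k < n)%N ->
  independent2 (history X k) (X k).
Proof.
move=> iX kn; have {iX} [mX XF XI] := iid_seq_widen kn iX.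
move=> A B mA mB.
have mH := @measurable_history _ _ X k mX.
have [H eH] := mfun_of mH.
have mXB : measurable (X k @^-1` B).
  by rewrite -[X in measurable X]setTI; exact: (mX k).
(* For fixed [B] both sides are finite measures in [A]; they are compared on the boxes [G], a
   generating class stable under intersection. *)
pose m1 : measure (k.-tuple S) R := pushforward (mrestr P mXB) (history X k).
have c0 : (0 <= fine (P (X k @^-1` B)))%R by rewrite fine_ge0 ?measure_ge0.
pose m2 : measure (k.-tuple S) R := mscale (NngNum c0) (distribution P H).
suff : m1 mH A = m2 A.
  rewrite (_ : m1 _ _ = P (history X k @^-1` A `&` X k @^-1` B)) // => ->.
  rewrite (_ : m2 _ = (fine (P (X k @^-1` B)))%:E * P (H @^-1` A))%E // eH.
  by rewrite fineK ?fin_num_measure// muleC.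
pose G : set (set (k.-tuple S)) :=
  [set C | exists D : nat -> set S, (forall i, measurable (D i)) /\
    C = [set t | forall i : 'I_k, D i (tnth t i)]].
apply: (@measure_unique _ _ _ G (fun=> setT)) => //.
- rewrite eqEsubset; split.
    apply: smallest_sub; first exact: smallest_sigma_algebra.
    rewrite -bigcup_seq; apply: bigcup_sub => i _ C [D mD <-].
    apply: sub_sigma_algebra; rewrite /G /=; exists (fun j : nat => if j == i :> nat then D else setT).
    split; first by move=> j; case: ifP.
    apply/seteqP; split => t /=.
      by move=> [_ Dt] j; case: eqP => // /ord_inj ->.
    by move=> Dt; split => //; move: (Dt i); rewrite eqxx.
  apply: smallest_sub; first exact: sigma_algebra_measurable.
  move=> C [D [mD ->]].
  rewrite (_ : [set _ | _] = \bigcap_(i in [set: 'I_k])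
     ((@tnth k S) ^~ i @^-1` D i)); last first.
    apply/seteqP; split => t /=; first by move=> Ht i _; exact: (Ht i).
    by move=> Ht i; exact: (Ht i I).
  apply: fin_bigcap_measurable; first exact: finite_finset.
  by move=> i _; rewrite -[X in measurable X]setTI; exact: measurable_tnth.
- move=> C1 C2 [D1 [mD1 ->]] [D2 [mD2 ->]].
  exists (fun i => D1 i `&` D2 i); split; first by move=> i; exact: measurableI.
  apply/seteqP; split => t /=; first by move=> [H1 H2] i; split.
  by move=> H12; split => i; case: (H12 i).
- by move=> _; exists (fun=> setT); split => //; apply/seteqP; split.
- by rewrite bigcup_const.
- move=> C [D [mD ->]].
  set Q := [set t | _].
  rewrite (_ : m1 _ _ = P (history X k @^-1` Q `&` X k @^-1` B)) //.
  rewrite (_ : m2 _ = (fine (P (X k @^-1` B)))%:E * P (H @^-1` Q))%E // eH.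
  rewrite fineK ?fin_num_measure// /Q.
  have e1 : history X k @^-1` [set t | forall i : 'I_k, D i (tnth t i)] =
            \bigcap_(i in `I_k) X i @^-1` D i.
    apply/seteqP; split => w /= Hw i.
      by move=> ik; have := Hw (Ordinal ik); rewrite /history tnth_mktuple.
    by rewrite /history tnth_mktuple; exact: (Hw _ (ltn_ord i)).
  have [_ _ XI'] := iid_seq_widen (leqnSn k) (And3 mX XF XI).
  rewrite -/(history X k) e1 XI' // muleC.
  (* A box for the history with [B] put in position [k] is a box for [k.+1] terms, where the product
     rule applies. *)
  pose D' (i : nat) := if i == k then B else D i.
  have mD' i : measurable (D' i) by rewrite /D'; case: ifP.
  have := XI D' mD'.
  have D'k : D' k = B by rewrite /D' eqxx.
  rewrite big_ord_recr /= D'k.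
  rewrite (eq_bigr (fun i : 'I_k => P (X i @^-1` D i))); last first.
    by move=> i _; rewrite /D' ltn_eqF.
  move=> <-; congr (P _); apply/seteqP; split => w /=.
    move=> [Hw Bw] i /=; rewrite ltnS leq_eqVlt /D' => /orP[/eqP -> |ik].
      by rewrite eqxx.
    by rewrite (ltn_eqF ik); exact: Hw.
  move=> Hw; split; last by have := Hw k (ltnSn k); rewrite /D' /= eqxx.
  move=> i /= ik; have := Hw i (ltn_trans ik (ltnSn k)).
  by rewrite /D' /= (ltn_eqF ik).
- move=> _; rewrite (_ : m1 _ _ = P (history X k @^-1` setT `&` X k @^-1` B)) //.
  rewrite preimage_setT setTI; apply: le_lt_trans (ltry 1).
  exact: probability_le1.
Qed.

End independence.

Section coordinatewise_measurability.
Context {R : realType} (I : finType).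

Definition addv (w y : I -> R) : I -> R := fun i => w i + y i.

(* Measurability of a function of a vector, tested against every family of
   measurable coordinates, which spares a sigma-algebra on (I -> R). *)
Definition cmeas d' (U : measurableType d') (f : (I -> R) -> U) : Prop :=
  forall d (T : measurableType d) (v : I -> T -> R),
    (forall i, measurable_fun setT (v i)) ->
    measurable_fun setT (fun t => f (fun i => v i t)).

(** The law of [g] under [mu] seen as an operator on functions: adding an independent summand to a
    vector composes such operators. *)
Definition shift_op d (S : measurableType d) (mu : probability S R)
    (g : S -> I -> R) (f : (I -> R) -> \bar R) (w : I -> R) : \bar R :=
  (\int[mu]_x f (addv w (g x)))%E.

Section shift_op.
Context d (S : measurableType d) (mu : probability S R) (g : S -> I -> R).
Hypothesis mg : forall i, measurable_fun setT (fun x => g x i).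

Lemma shift_op_ge0 f w : (forall w, 0 <= f w)%E -> (0 <= shift_op mu g f w)%E.
Proof. by move=> f0; apply: integral_ge0. Qed.

Lemma cmeas_shift_op (f : (I -> R) -> \bar R) :
  cmeas f -> (forall w, 0 <= f w)%E -> cmeas (shift_op mu g f).
Proof.
move=> mf f0 d' T v mv.
pose h := (fun z : T * S => f (addv (v^~ z.1) (g z.2))).
apply: (@measurable_fun_fubini_tonelli_F _ _ T S R mu h); last by move=> z; exact: f0.
apply: mf => i; apply: measurable_funD.
  exact: (measurableT_comp (mv i) measurable_fst).
exact: (measurableT_comp (mg i) measurable_snd).
Qed.

Lemma cmeas_translate d' (U : measurableType d') (f : (I -> R) -> U) (w : I -> R) :
  cmeas f -> measurable_fun setT (fun x => f (addv w (g x))).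
Proof. by move=> mf; apply: mf => i; exact: measurable_funD. Qed.

End shift_op.

(** Translations commute, and Tonelli exchanges the two averages. Lindeberg's method relies on this
    to average the exchanged summand first. *)
Lemma shift_op_comm d1 (S1 : measurableType d1) (mu1 : probability S1 R)
    (g1 : S1 -> I -> R) d2 (S2 : measurableType d2) (mu2 : probability S2 R)
    (g2 : S2 -> I -> R) (f : (I -> R) -> \bar R) :
  (forall i, measurable_fun setT (fun x => g1 x i)) ->
  (forall i, measurable_fun setT (fun x => g2 x i)) ->
  cmeas f -> (forall w, 0 <= f w)%E ->
  shift_op mu1 g1 (shift_op mu2 g2 f) = shift_op mu2 g2 (shift_op mu1 g1 f).
Proof.
move=> mg1 mg2 mf f0; apply/funext => w; rewrite /shift_op.
pose h := (fun z : S1 * S2 => f (addv (addv w (g1 z.1)) (g2 z.2))).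
have := @fubini_tonelli _ _ S1 S2 R mu1 mu2 h _ _; rewrite /h /= => ->//.
  apply: eq_integral => y _; apply: eq_integral => x _; congr f.
  by apply/funext => i; rewrite /addv addrAC.
apply: mf => i; apply: measurable_funD.
  apply: measurable_funD => //.
  exact: (measurableT_comp (mg1 i) measurable_fst).
exact: (measurableT_comp (mg2 i) measurable_snd).
Qed.

(** The operator of index [k'] acts first, so that unfolding matches peeling the last summand off a
    sum. *)
Fixpoint shift_ops d (S : measurableType d) (mu : probability S R)
    (g : nat -> S -> I -> R) (k : nat) (f : (I -> R) -> \bar R) :=
  if k is k'.+1 then shift_ops mu g k' (shift_op mu (g k') f) else f.

(** Induction on the number of terms: the last one is independent of the history, so integrating it
    out replaces [f] by its average over translates. *)
Lemma integral_iid_sum d (S : measurableType d) (F : probability S R)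
    dO (Om : measurableType dO) (P : probability Om R) (n : nat)
    (X : nat -> Om -> S) (g : nat -> S -> I -> R) (f : (I -> R) -> \bar R) w :
  (forall k i, measurable_fun setT (fun x => g k x i)) ->
  cmeas f -> (forall w, 0 <= f w)%E -> iid_seq P F n X ->
  (\int[P]_t f (addv w (fun i => \sum_(j < n) g j (X j t) i))%R =
   shift_ops F g n f w)%E.
Proof.
move=> mg; elim: n f => [|n IH] f mf f0 iX /=.
  under eq_integral => t _.
    rewrite (_ : addv _ _ = w); last by apply/funext => i; rewrite /addv big_ord0 addr0.
    over.
  by rewrite integral_cst //= probability_setT mule1.
rewrite -IH; last 3 first.
- exact: cmeas_shift_op.
- by move=> w'; exact: shift_op_ge0.
- exact: iid_seq_widen iX.
have [mX XF _] := iX.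
pose h := fun z : n.-tuple S * S =>
  f (addv (addv w (fun i => \sum_(j < n) g j (tnth z.1 j) i)) (g n z.2)).
transitivity (\int[P]_t h (history X n t, X n t))%E.
  apply: eq_integral => t _; congr f; apply/funext => i.
  rewrite /addv big_ord_recr /= addrA; congr (_ + _ + _).
  by apply: eq_bigr => j _; rewrite /history tnth_mktuple.
rewrite (@independent2_integral _ _ _ P _ _ _ _ (history X n) (X n) F) //.
- apply: eq_integral => t _; apply: eq_integral => x _; congr f.
  apply/funext => i; rewrite /addv; congr (_ + _ + _).
  by apply: eq_bigr => j _; rewrite /history tnth_mktuple.
- exact: measurable_history.
- by move=> B mB; exact: XF.
- exact: (history_independent iX).
- apply: mf => i; apply: measurable_funD; last first.
  exact: (measurableT_comp (mg n i) measurable_snd).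
apply: measurable_funD => //; apply: measurable_sum => j.
apply: (measurableT_comp (mg j i)).
exact: (measurableT_comp (measurable_tnth j) measurable_fst).
- by move=> z; exact: f0.
Qed.

End coordinatewise_measurability.

(** * Averaging operators on bounded functions *)

Section expectation_operators.
Context {R : realType}.

Lemma bounded_integrable d (S : measurableType d) (mu : probability S R)
    (f : S -> R) (M : R) : measurable_fun setT f -> (forall x, `|f x| <= M) ->
  mu.-integrable setT (EFin \o f).
Proof.
move=> mf fM.
apply: (@le_integrable _ _ _ mu setT measurableT _ (EFin \o cst M)) => //; last first.
- exact: finite_measure_integrable_cst.
- by move=> x _ /=; rewrite lee_fin (le_trans (fM x)) //; exact: ler_norm.
- exact/measurable_EFinP.
Qed.

Variable I : finType.
Implicit Types f g : (I -> R) -> R.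

(** Bounded functions form a vector space on which averages are real numbers. The subclass [ufun],
    with values in [[0,1]], has in addition the nonnegativity under which Tonelli holds for extended
    values. *)
Definition bfun f := cmeas f /\ exists M, forall w, `|f w| <= M.
Definition ufun f := cmeas f /\ forall w, 0 <= f w <= 1.

Lemma ufun_bfun f : ufun f -> bfun f.
Proof.
move=> [mf f01]; split => //; exists 1 => w.
by have /andP[f0 f1] := f01 w; rewrite ger0_norm.
Qed.

Lemma bfun_cst c : bfun (fun=> c).
Proof. by split; [move=> d T v _; exact: measurable_cst | exists `|c|]. Qed.

Lemma bfunD f g : bfun f -> bfun g -> bfun (fun w => f w + g w).
Proof.
move=> [mf [M fM]] [mg [N gN]]; split.
  by move=> d T v mv; apply: measurable_funD; [exact: mf|exact: mg].
by exists (M + N) => w; apply: le_trans (ler_normD _ _) _; exact: lerD.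
Qed.

Lemma bfunZ c f : bfun f -> bfun (fun w => c * f w).
Proof.
move=> [mf [M fM]]; split.
  by move=> d T v mv; apply: measurable_funM => //; exact: mf.
by exists (`|c| * M) => w; rewrite normrM ler_wpM2l.
Qed.

Lemma bfunB f g : bfun f -> bfun g -> bfun (fun w => f w - g w).
Proof.
move=> bf bg; have := bfunD bf (bfunZ (-1) bg).
by under eq_fun do rewrite mulN1r.
Qed.

Definition expect_op d (S : measurableType d) (mu : probability S R)
    (g : S -> I -> R) f (w : I -> R) : R := \int[mu]_x f (addv w (g x)).

Section one_operator.
Context d (S : measurableType d) (mu : probability S R) (g : S -> I -> R).
Hypothesis mg : forall i, measurable_fun setT (fun x => g x i).

Lemma bfun_translate_integrable f w : bfun f ->
  mu.-integrable setT (EFin \o (fun x => f (addv w (g x)))).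
Proof.
move=> [mf [M fM]]; apply: (@bounded_integrable _ _ _ _ M) => //.
exact: cmeas_translate.
Qed.

Lemma EFin_expect_op f w : bfun f ->
  (expect_op mu g f w)%:E = (\int[mu]_x (f (addv w (g x)))%:E)%E.
Proof.
move=> bf; rewrite /expect_op /Rintegral fineK //.
by apply: integrable_fin_num => //; exact: bfun_translate_integrable.
Qed.

Lemma expect_opD f1 f2 : bfun f1 -> bfun f2 ->
  expect_op mu g (fun w => f1 w + f2 w) =
  (fun w => expect_op mu g f1 w + expect_op mu g f2 w).
Proof.
move=> b1 b2; apply/funext => w.
by rewrite /expect_op RintegralD //; exact: bfun_translate_integrable.
Qed.

Lemma expect_opZ c f : bfun f ->
  expect_op mu g (fun w => c * f w) = (fun w => c * expect_op mu g f w).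
Proof.
move=> bf; apply/funext => w.
by rewrite /expect_op RintegralZl //; exact: bfun_translate_integrable.
Qed.

Lemma expect_op_cst c : expect_op mu g (fun=> c) = (fun=> c).
Proof.
apply/funext => w; rewrite /expect_op Rintegral_cst //.
rewrite -[RHS]mulr1; congr (_ * _); exact: (congr1 fine (@probability_setT _ _ _ mu)).
Qed.

Lemma le_expect_op f1 f2 : bfun f1 -> bfun f2 -> (forall w, f1 w <= f2 w) ->
  forall w, expect_op mu g f1 w <= expect_op mu g f2 w.
Proof.
move=> b1 b2 f12 w; apply: le_Rintegral => //; exact: bfun_translate_integrable.
Qed.

Lemma bfun_expect_op f : bfun f -> bfun (expect_op mu g f).
Proof.
move=> bf; have [mf [M fM]] := bf; split; last first.
  exists M => w; rewrite ler_norml; apply/andP; split.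
    rewrite -[leLHS](f_equal (fun h => h w) (expect_op_cst (- M))).
    apply: le_expect_op => //; first exact: bfun_cst.
    by move=> w'; have := fM w'; rewrite ler_norml => /andP[].
  rewrite -[leRHS](f_equal (fun h => h w) (expect_op_cst M)).
  apply: le_expect_op => //; first exact: bfun_cst.
  by move=> w'; have := fM w'; rewrite ler_norml => /andP[].
move=> d' T v mv.
(* Measurability of averages is known for nonnegative functions, so [f] is raised by its bound and
   lowered again. *)
have bfM : bfun (fun w => f w + M) by apply: bfunD => //; exact: bfun_cst.
rewrite (_ : (fun t => _) = (fun t => expect_op mu g (fun w => f w + M)
    (fun i => v i t) - M)); last first.
  apply/funext => t; rewrite expect_opD //; last exact: bfun_cst.
  by rewrite expect_op_cst addrK.
apply: measurable_funB => //.
apply/measurable_EFinP.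
rewrite (_ : _ \o _ = fun t => shift_op mu g (EFin \o (fun w => f w + M))
    (fun i => v i t)).
  apply: (@cmeas_shift_op _ _ _ _ _ g mg) => //.
    move=> d2 T2 v2 mv2; apply/measurable_EFinP.
    by apply: measurable_funD => //; exact: mf.
  move=> w; rewrite lee_fin -lerBlDr sub0r.
  by have := fM w; rewrite ler_norml => /andP[].
by apply/funext => t /=; rewrite EFin_expect_op.
Qed.

Lemma ufun_expect_op f : ufun f -> ufun (expect_op mu g f).
Proof.
move=> uf; have bf := ufun_bfun uf.
split; first by case: (bfun_expect_op bf).
move=> w; apply/andP; split.
  rewrite -[leLHS](f_equal (fun h => h w) (expect_op_cst 0)).
  apply: le_expect_op => //; first exact: bfun_cst.
  by move=> w'; case: uf => _ /(_ w') /andP[].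
rewrite -[leRHS](f_equal (fun h => h w) (expect_op_cst 1)).
apply: le_expect_op => //; first exact: bfun_cst.
by move=> w'; case: uf => _ /(_ w') /andP[].
Qed.

Lemma EFin_expect_op_ufun f w : ufun f ->
  (expect_op mu g f w)%:E = shift_op mu g (EFin \o f) w.
Proof. by move=> /ufun_bfun bf; rewrite EFin_expect_op. Qed.

End one_operator.

Lemma ufun_EFin f : ufun f -> cmeas (EFin \o f) /\ forall w, (0 <= (EFin \o f) w)%E.
Proof.
move=> [mf f01]; split.
  by move=> d T v mv; apply/measurable_EFinP; exact: mf.
by move=> w; rewrite lee_fin; case/andP: (f01 w).
Qed.

Lemma expect_op_comm d1 (S1 : measurableType d1) (mu1 : probability S1 R)
    (g1 : S1 -> I -> R) d2 (S2 : measurableType d2) (mu2 : probability S2 R)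
    (g2 : S2 -> I -> R) f :
  (forall i, measurable_fun setT (fun x => g1 x i)) ->
  (forall i, measurable_fun setT (fun x => g2 x i)) -> ufun f ->
  expect_op mu1 g1 (expect_op mu2 g2 f) = expect_op mu2 g2 (expect_op mu1 g1 f).
Proof.
move=> mg1 mg2 uf; apply/funext => w; apply: EFin_inj.
rewrite !EFin_expect_op_ufun //; [|exact: ufun_expect_op..].
have E d (S : measurableType d) (mu : probability S R) (g : S -> I -> R) :
   (forall i, measurable_fun setT (fun x => g x i)) ->
  EFin \o expect_op mu g f = shift_op mu g (EFin \o f).
  by move=> mg; apply/funext => w' /=; rewrite EFin_expect_op_ufun.
rewrite !E // shift_op_comm //; first by case: (ufun_EFin uf).
by case: (ufun_EFin uf).
Qed.

Fixpoint expect_ops d (S : measurableType d) (mu : probability S R)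
    (g : nat -> S -> I -> R) (k : nat) f :=
  if k is k'.+1 then expect_ops mu g k' (expect_op mu (g k') f) else f.

Lemma ufun_expect_ops d (S : measurableType d) (mu : probability S R)
    (g : nat -> S -> I -> R) k f :
  (forall k i, measurable_fun setT (fun x => g k x i)) -> ufun f ->
  ufun (expect_ops mu g k f).
Proof.
by move=> mg; elim: k f => [//|k IH] f uf /=; apply: IH; exact: ufun_expect_op.
Qed.

Lemma Rintegral_iid_sum d (S : measurableType d) (F : probability S R)
    dO (Om : measurableType dO) (P : probability Om R) (n : nat)
    (X : nat -> Om -> S) (g : nat -> S -> I -> R) f w :
  (forall k i, measurable_fun setT (fun x => g k x i)) ->
  ufun f -> iid_seq P F n X ->
  \int[P]_t f (addv w (fun i => \sum_(j < n) g j (X j t) i)) =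
  expect_ops F g n f w.
Proof.
move=> mg uf iX; rewrite /Rintegral.
have [mf f0] := ufun_EFin uf.
have := integral_iid_sum w mg mf f0 iX => /= ->.
rewrite (_ : shift_ops F g n (EFin \o f) w = (expect_ops F g n f w)%:E) //.
elim: n f uf {iX mf f0} => //= n IH f uf.
rewrite -IH; last exact: ufun_expect_op.
congr (shift_ops _ _ _ _ _); apply/funext => w' /=.
by rewrite EFin_expect_op_ufun.
Qed.

(** The common interface of hybrids and Gaussian means, which are iterated integrals without a
    single underlying measure. *)
Definition averaging (H : ((I -> R) -> R) -> R) : Prop :=
  [/\ forall f g, bfun f -> bfun g -> H (fun w => f w + g w) = H f + H g,
      forall c f, bfun f -> H (fun w => c * f w) = c * H f,
      forall c, H (fun=> c) = c &
      forall f g, bfun f -> bfun g -> (forall w, f w <= g w) -> H f <= H g].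

Lemma averaging_at (w : I -> R) : averaging (fun f => f w).
Proof. by split. Qed.

Lemma averaging_expect_op (H : ((I -> R) -> R) -> R) d (S : measurableType d)
    (mu : probability S R) (g : S -> I -> R) :
  (forall i, measurable_fun setT (fun x => g x i)) ->
  averaging H -> averaging (fun f => H (expect_op mu g f)).
Proof.
move=> mg [HD HZ HC HL]; split.
- by move=> f1 f2 b1 b2; rewrite expect_opD // HD //; exact: bfun_expect_op.
- by move=> c f bf; rewrite expect_opZ // HZ //; exact: bfun_expect_op.
- by move=> c; rewrite expect_op_cst.
- move=> f1 f2 b1 b2 f12; apply: HL; [exact: bfun_expect_op..|].
  exact: le_expect_op.
Qed.

Lemma averaging_iter (H : ((I -> R) -> R) -> R) d (S : measurableType d)
    (mu : probability S R) (g : S -> I -> R) k :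
  (forall i, measurable_fun setT (fun x => g x i)) ->
  averaging H -> averaging (fun f => H (iter k (expect_op mu g) f)).
Proof.
move=> mg aH; elim: k => [//|k IH].
rewrite (_ : (fun f => _) = (fun f => H (iter k (expect_op mu g)
   (expect_op mu g f)))); first exact: (averaging_expect_op _ mg IH).
by apply/funext => f; rewrite iterSr.
Qed.

Lemma averagingB H f g : averaging H -> bfun f -> bfun g ->
  H (fun w => f w - g w) = H f - H g.
Proof.
move=> [HD HZ _ _] bf bg.
have := HD f (fun w => -1 * g w) bf (bfunZ (-1) bg).
rewrite HZ // mulN1r => <-; congr H; apply/funext => w; by rewrite mulN1r.
Qed.

End expectation_operators.

(** * One-variable calculus and a smooth cutoff *)

Section calculus.
Context {R : realType}.
Implicit Types (f g : R -> R) (x a b s K : R).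

Lemma der_eq f x a b : is_derive (x : R) (1 : R) f a -> a = b -> is_derive (x : R) (1 : R) f b.
Proof. by move=> h <-. Qed.

Lemma der_cst (c : R) x : is_derive (x : R) (1 : R) (fun=> c) 0.
Proof. exact: is_derive_cst. Qed.

Lemma der_id x : is_derive (x : R) (1 : R) (fun t : R => t) 1.
Proof. exact: is_derive_id. Qed.

Lemma derD f g x a b : is_derive (x : R) (1 : R) f a -> is_derive (x : R) (1 : R) g b ->
  is_derive (x : R) (1 : R) (fun t => f t + g t) (a + b).
Proof. by move=> hf hg; exact: (is_deriveD hf hg). Qed.

Lemma derM f g x a b : is_derive (x : R) (1 : R) f a -> is_derive (x : R) (1 : R) g b ->
  is_derive (x : R) (1 : R) (fun t => f t * g t) (a * g x + f x * b).
Proof.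
move=> hf hg; apply: der_eq (is_deriveM hf hg) _.
by rewrite addrC mulrC.
Qed.

Lemma derZ c f x a : is_derive (x : R) (1 : R) f a -> is_derive (x : R) (1 : R) (fun t => c * f t) (c * a).
Proof.
by move=> hf; apply: der_eq (derM (der_cst c x) hf) _; rewrite mul0r add0r.
Qed.

Lemma derB f g x a b : is_derive (x : R) (1 : R) f a -> is_derive (x : R) (1 : R) g b ->
  is_derive (x : R) (1 : R) (fun t => f t - g t) (a - b).
Proof. by move=> hf hg; exact: (is_deriveB hf hg). Qed.

Lemma derN f x a : is_derive (x : R) (1 : R) f a ->
  is_derive (x : R) (1 : R) (fun t => - f t) (- a).
Proof. by move=> hf; exact: (is_deriveN hf). Qed.

Lemma derV f x a : f x != 0 -> is_derive (x : R) (1 : R) f a ->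
  is_derive (x : R) (1 : R) (fun t => (f t)^-1) (- (f x ^- 2 * a)).
Proof. by move=> f0 hf; apply: der_eq (is_deriveV f0 hf) _; rewrite scaleNr. Qed.

Lemma der_comp f g x a b : is_derive (g x : R) (1 : R) f a -> is_derive (x : R) (1 : R) g b ->
  is_derive (x : R) (1 : R) (fun t => f (g t)) (a * b).
Proof. by move=> hf hg; exact: (is_derive1_comp hf hg). Qed.

Lemma der_sum (I : finType) (h : I -> R -> R) (dh : I -> R) x :
  (forall i, is_derive (x : R) (1 : R) (h i) (dh i)) ->
  is_derive (x : R) (1 : R) (fun t => \sum_i h i t) (\sum_i dh i).
Proof.
move=> H; elim: (index_enum I) => [|i s IH].
  rewrite big_nil; under eq_fun do rewrite big_nil; exact: der_cst.
rewrite big_cons; under eq_fun do rewrite big_cons; exact: derD.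
Qed.

(** A quadratic remainder leaves an error of order [u] in the difference quotient. This covers the
    kink of the truncated square, where no differentiation rule applies. *)
Lemma der_quadratic f x a K :
  (forall u, `|f (x + u) - f x - a * u| <= K * u ^+ 2) -> is_derive (x : R) (1 : R) f a.
Proof.
move=> H.
have C : h^-1 *: (f (h + x) - f x) @[h --> 0^'] --> a.
  apply/cvgrPdist_le => e e0.
  have K1 : 0 < `|K| + 1 by rewrite ltr_wpDl.
  near=> h.
  have h0 : h != 0 by near: h; exact: nbhs_dnbhs_neq.
  rewrite distrC /GRing.scale /=.
  rewrite (_ : _ - a = h^-1 * (f (x + h) - f x - a * h)); last first.
    by rewrite (addrC h x); field.
  rewrite normrM normfV ler_pdivrMl ?normr_gt0 //.
  apply: (le_trans (H h)).
  have he : `|h| < e / (`|K| + 1).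
    by near: h; apply: dnbhs0_lt; rewrite divr_gt0.
  rewrite -real_normK ?num_real // expr2 mulrCA ler_wpM2l //.
  move: he; rewrite ltr_pdivlMr // => /ltW; apply: le_trans.
  rewrite mulrC ler_wpM2l //; apply: (le_trans (ler_norm K)).
  by rewrite lerDl.
have E : (fun h : R => h^-1 *: ((f \o shift x) (h *: 1) - f x)) =
         (fun h => h^-1 *: (f (h + x) - f x)).
  by apply/funext => h /=; rewrite /GRing.scale /= mulr1.
split; first by rewrite /derivable E; apply: cvgP C.
by rewrite /derive E; exact: cvg_lim.
Unshelve. all: by end_near.
Qed.

Lemma mvt_bound f (df : R -> R) K : (forall x, is_derive (x : R) (1 : R) f (df x)) ->
  (forall x, 0 <= x <= 1 -> `|df x| <= K) ->
  forall t : R, 0 <= t <= 1 -> `|f t - f 0| <= K.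
Proof.
move=> fd dK t /andP[t0 t1].
have [c cI ->] := @MVT_segment R f df 0 t t0 (fun x _ => fd x)
  (derivable_within_continuous (fun x _ => @ex_derive _ _ _ _ _ _ _ (fd x))).
move: cI; rewrite in_itv /= => /andP[c0 ct].
have c01 : 0 <= c <= 1 by rewrite c0 (le_trans ct).
rewrite subr0 normrM -[leRHS]mulr1 ler_pM //; first exact: dK.
by rewrite ger0_norm.
Qed.

(** The mean value bound is applied to each derivative minus its own Taylor polynomial, from the top
    down; the factor 1/6 is given away. *)
Lemma taylor2 f f1 f2 f3 K :
  (forall x, is_derive (x : R) (1 : R) f (f1 x)) -> (forall x, is_derive (x : R) (1 : R) f1 (f2 x)) ->
  (forall x, is_derive (x : R) (1 : R) f2 (f3 x)) ->
  (forall x, 0 <= x <= 1 -> `|f3 x| <= K) ->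
  `|f 1 - f 0 - f1 0 - f2 0 / 2| <= K.
Proof.
move=> d1 d2 d3 f3K.
have h2 := mvt_bound d3 f3K.
have d2' x : is_derive (x : R) (1 : R) (fun t => f1 t - f2 0 * t) (f2 x - f2 0).
  by apply: derB (d2 x) _; apply: der_eq (derZ _ (der_id x)) _; rewrite mulr1.
have h1 := mvt_bound d2' h2.
have d1' x : is_derive (x : R) (1 : R) (fun t => f t - (f1 0 * t + f2 0 / 2 * (t * t)))
    (f1 x - f2 0 * x - (f1 0 - f2 0 * 0)).
  apply: der_eq (derB (d1 x) (derD (derZ _ (der_id x))
     (derZ _ (derM (der_id x) (der_id x))))) _.
  by field.
have := mvt_bound d1' h1 (t := 1); rewrite ler01 lexx => /(_ isT).
by congr (`|_| <= _); field.
Qed.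

Lemma taylor1 f f1 f2 K :
  (forall x, is_derive (x : R) (1 : R) f (f1 x)) -> (forall x, is_derive (x : R) (1 : R) f1 (f2 x)) ->
  (forall x, 0 <= x <= 1 -> `|f2 x| <= K) -> `|f 1 - f 0 - f1 0| <= K.
Proof.
move=> d1 d2 f2K.
have h1 := mvt_bound d2 f2K.
have d1' x : is_derive (x : R) (1 : R) (fun t => f t - f1 0 * t) (f1 x - f1 0).
  by apply: derB (d1 x) _; apply: der_eq (derZ _ (der_id x)) _; rewrite mulr1.
have := mvt_bound d1' h1 (t := 1); rewrite ler01 lexx => /(_ isT).
by congr (`|_| <= _); field.
Qed.

Definition pospart (s : R) : R := Num.max s 0.

Lemma pospart_ge0 s : 0 <= pospart s.
Proof. by rewrite /pospart le_max lexx orbT. Qed.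

Lemma pospartE s : 0 <= s -> pospart s = s.
Proof. by move=> s0; rewrite /pospart max_l. Qed.

Lemma pospart0 s : s <= 0 -> pospart s = 0.
Proof. by move=> s0; rewrite /pospart max_r. Qed.

Lemma der_pospart2 s : is_derive (s : R) (1 : R) (fun t => pospart t ^+ 2) (2 * pospart s).
Proof.
apply: (@der_quadratic _ _ _ 1) => u; rewrite mul1r /pospart.
rewrite ler_norml; case: (leP (s + u) 0) => h1; case: (leP s 0) => h2.
all: by apply/andP; split; nra.
Qed.

Lemma pospartX s n : pospart s ^+ n.+2 = s * pospart s ^+ n.+1.
Proof.
rewrite exprS; have [s0|s0] := leP s 0; last by rewrite (pospartE (ltW s0)).
by rewrite (pospart0 s0) exprS !mul0r mulr0.
Qed.

Lemma der_pospartX s n :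
  is_derive (s : R) (1 : R) (fun t => pospart t ^+ n.+2) (n.+2%:R * pospart s ^+ n.+1).
Proof.
elim: n => [|n IH]; first exact: der_pospart2.
under eq_fun do rewrite pospartX.
apply: der_eq (derM (der_id s) IH) _.
rewrite mul1r mulrCA -pospartX -[X in X + _]mul1r -mulrDl.
by rewrite -[in RHS]addn1 natrD addrC.
Qed.

Lemma der_pospartX_shift (k : R) s n :
  is_derive (s : R) (1 : R) (fun t => pospart (t - k) ^+ n.+2)
    (n.+2%:R * pospart (s - k) ^+ n.+1).
Proof.
apply: der_eq (der_comp (f := fun t => pospart t ^+ n.+2)
  (der_pospartX _ _) (derB (der_id s) (der_cst k s))) _.
by rewrite subr0 mulr1.
Qed.

(* Fourth difference of the truncated power, i.e. an unnormalized integrated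
   cubic B-spline for n = 4 and its derivatives for n = 3, 2, 1. *)
Definition bspline (n : nat) (s : R) : R :=
  pospart (s - 0) ^+ n - 4 * pospart (s - 1) ^+ n + 6 * pospart (s - 2) ^+ n
  - 4 * pospart (s - 3) ^+ n + pospart (s - 4) ^+ n.

Lemma der_bspline n s : is_derive (s : R) (1 : R) (bspline n.+2) (n.+2%:R * bspline n.+1 s).
Proof.
have D k := der_pospartX_shift k s n.
apply: der_eq (derD (derB (derD (derB (D 0) (derZ 4 (D 1))) (derZ 6 (D 2)))
  (derZ 4 (D 3))) (D 4)) _.
by rewrite /bspline; ring.
Qed.

(** The fourth difference of [s^4] is 4! = 24, so the value falls from 1 for [s <= 0] to 0 for
    [s >= 4]. Four is the least degree for which truncated powers have three derivatives
    everywhere. *)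
Definition cutoff (s : R) : R := 1 - bspline 4 s / 24.
Definition cutoff1 (s : R) : R := - (bspline 3 s / 6).
Definition cutoff2 (s : R) : R := - (bspline 2 s / 2).
Definition cutoff3 (s : R) : R := - bspline 1 s.

Lemma der_cutoff s : is_derive (s : R) (1 : R) cutoff (cutoff1 s).
Proof.
apply: der_eq (derB (der_cst 1 s) (derM (der_bspline 2 s) (der_cst _ s))) _.
by rewrite /cutoff1; field.
Qed.

Lemma der_cutoff1 s : is_derive (s : R) (1 : R) cutoff1 (cutoff2 s).
Proof.
apply: der_eq (derN (derM (der_bspline 1 s) (der_cst (6^-1) s))) _.
by rewrite /cutoff2; field.
Qed.

Lemma der_cutoff2 s : is_derive (s : R) (1 : R) cutoff2 (cutoff3 s).
Proof.
apply: der_eq (derN (derM (der_bspline 0 s) (der_cst (2^-1) s))) _.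
by rewrite /cutoff3; field.
Qed.

Lemma bspline_le0 n s : s <= 0 -> bspline n.+1 s = 0.
Proof.
move=> s0; rewrite /bspline !pospart0; try lra.
all: by rewrite !exprS !mul0r; ring.
Qed.

Lemma bspline_ge4 s : 4 <= s ->
  [/\ bspline 1 s = 0, bspline 2 s = 0, bspline 3 s = 0 & bspline 4 s = 24].
Proof. by move=> s4; rewrite /bspline !pospartE; try lra; split; ring. Qed.

Lemma cutoff_le0 s : s <= 0 -> cutoff s = 1.
Proof. by move=> s0; rewrite /cutoff bspline_le0 // mul0r subr0. Qed.

Lemma cutoff_ge4 s : 4 <= s -> cutoff s = 0.
Proof.
by case/bspline_ge4 => _ _ _ h4; rewrite /cutoff h4 divff ?subrr // pnatr_eq0.
Qed.

Lemma cutoff_outside s : s <= 0 \/ 4 <= s ->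
  [/\ cutoff1 s = 0, cutoff2 s = 0 & cutoff3 s = 0].
Proof.
rewrite /cutoff1 /cutoff2 /cutoff3 => -[s0|/bspline_ge4[-> -> -> _]].
  by rewrite !bspline_le0 // !mul0r oppr0.
by rewrite !mul0r oppr0.
Qed.

(** 16 = 1 + 4 + 6 + 4 + 1 adds up the coefficients, and each truncated power is at most
    [4 ^+ n]. *)
Lemma bspline_bound n s : s <= 4 -> `|bspline n s| <= 16 * 4 ^+ n.
Proof.
move=> s4.
have H k : 0 <= k -> 0 <= pospart (s - k) ^+ n <= 4 ^+ n.
  move=> k0; rewrite exprn_ge0 ?pospart_ge0 //= lerXn2r ?nnegrE ?pospart_ge0 //.
  by rewrite /pospart ge_max; apply/andP; split; lra.
have := (H 0 (lexx _)); have := H 1 ler01; have := H 2 (ler0n _ _).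
have := H 3 (ler0n _ _); have := H 4 (ler0n _ _).
rewrite /bspline ler_norml.
move=> /andP[? ?] /andP[? ?] /andP[? ?] /andP[? ?] /andP[? ?].
by apply/andP; split; lra.
Qed.

(** 1024 = 16 * 4^3 is the largest of the three spline bounds before division; beyond 4 all three
    derivatives vanish. *)
Lemma cutoff_bounds s :
  [/\ `|cutoff1 s| <= 1024, `|cutoff2 s| <= 1024 & `|cutoff3 s| <= 1024].
Proof.
have [s4|/ltW s4] := leP s 4; last first.
  have [|-> -> ->] := @cutoff_outside s; first by right.
  by rewrite normr0 !ler0n.
have h1 := bspline_bound 1 s4; have h2 := bspline_bound 2 s4.
have h3 := bspline_bound 3 s4.
move: h1 h2 h3; rewrite /cutoff1 /cutoff2 /cutoff3 !ler_norml.
by move=> /andP[? ?] /andP[? ?] /andP[? ?]; split; apply/andP; split; lra.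
Qed.

Lemma cutoff01 s : 0 <= cutoff s <= 1.
Proof.
have [s0|s0] := leP s 0; first by rewrite cutoff_le0 // ler01 lexx.
have [s4|s4] := leP 4 s; first by rewrite cutoff_ge4 // ler01 lexx.
rewrite /cutoff.
suff : 0 <= bspline 4 s <= 24.
  by move=> /andP[h1 h2]; apply/andP; split; lra.
rewrite /bspline.
(* On each unit interval the spline is written in the distance to the left end, where the bounds 0
   and 24 are elementary inequalities on [[0,1]]. *)
have [s1|s1] := leP s 1.
  rewrite (pospartE (s := s - 0)); last lra.
  have v4 : 0 <= s ^+ 4 <= 1 by rewrite exprn_ge0 ?exprn_ile1 // ltW.
  by rewrite !pospart0; try lra; rewrite subr0; lra.
have [s2|s2] := leP s 2.
  rewrite (pospartE (s := s - 0)) ?(pospartE (s := s - 1)); try lra.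
  rewrite !pospart0; try lra.
  have -> : s = 1 + (s - 1) by lra.
  set v := s - 1; have v0 : 0 <= v by rewrite /v; lra.
  have v1 : v <= 1 by rewrite /v; lra.
  rewrite [X in 0 <= X <= _](_ : _ = 1 + 4 * v + 6 * v ^+ 2 + 4 * v ^+ 3 - 3 * v ^+ 4); last by ring.
  have w2 : 0 <= v ^+ 2 <= 1 by rewrite exprn_ge0 //= exprn_ile1.
  have w3 : 0 <= v ^+ 3 <= 1 by rewrite exprn_ge0 //= exprn_ile1.
  have w4 : 0 <= v ^+ 4 <= 1 by rewrite exprn_ge0 //= exprn_ile1.
  have w34 : v ^+ 4 <= v ^+ 3 by rewrite exprSr ler_piMr ?exprn_ge0.
  by apply/andP; split; lra.
have [s3|s3] := leP s 3.
  rewrite (pospartE (s := s - 0)) ?(pospartE (s := s - 1)) ?(pospartE (s := s - 2)); try lra.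
  rewrite !pospart0; try lra.
  have -> : s = 2 + (s - 2) by lra.
  set v := s - 2; have v0 : 0 <= v by rewrite /v; lra.
  have v1 : v <= 1 by rewrite /v; lra.
  rewrite [X in 0 <= X <= _](_ : _ = 12 + 16 * v - 8 * v ^+ 3 + 3 * v ^+ 4); last by ring.
  have w3 : v ^+ 3 <= v by rewrite exprSr ler_piMl // exprn_ile1.
  have w4 : v ^+ 4 <= v ^+ 3 by rewrite exprSr ler_piMr ?exprn_ge0.
  have w40 : 0 <= v ^+ 4 by rewrite exprn_ge0.
  by apply/andP; split; nra.
rewrite (pospartE (s := s - 0)) ?(pospartE (s := s - 1)) ?(pospartE (s := s - 2))
  ?(pospartE (s := s - 3)); try lra.
rewrite pospart0; try lra.
have -> : s = 3 + (s - 3) by lra.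
set v := s - 3; have v0 : 0 <= v by rewrite /v; lra.
have v1 : v <= 1 by rewrite /v; lra.
have w4 : 0 <= (1 - v) ^+ 4 <= 1.
  by rewrite exprn_ge0 ?subr_ge0 //= exprn_ile1 ?subr_ge0 // lerBlDr lerDl.
rewrite [X in 0 <= X <= _](_ : _ = 24 - (1 - v) ^+ 4); last by ring.
by apply/andP; split; lra.
Qed.

End calculus.

(** * The soft maximum and smoothed orthant indicators *)

Section weighted_means.
Context {R : realType} (I : finType) (p : I -> R).
Hypotheses (p0 : forall i, 0 <= p i) (p1 : \sum_i p i = 1).

(** Half of the double sum of [p i * p j * ((f i - f j) * (g i - g j))] is the covariance of [f] and
    [g] under the weights. *)
Lemma chebyshev_sum (f g : I -> R) :
  (forall i j, 0 <= (f i - f j) * (g i - g j)) ->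
  (\sum_i p i * f i) * (\sum_i p i * g i) <= \sum_i p i * (f i * g i).
Proof.
move=> fg.
have E : \sum_i \sum_j p i * p j * ((f i - f j) * (g i - g j)) =
  2 * (\sum_i p i * (f i * g i) - (\sum_i p i * f i) * (\sum_i p i * g i)).
  transitivity (\sum_i \sum_j (p i * (f i * g i) * p j + p i * (p j * (f j * g j))
    - (p i * f i * (p j * g j) + p i * g i * (p j * f j)))).
    by apply: eq_bigr => i _; apply: eq_bigr => j _; ring.
  under eq_bigr do rewrite sumrB 2!big_split /= -!mulr_sumr p1.
  rewrite sumrB 2!big_split /= -!mulr_suml p1; ring.
have : 0 <= \sum_i \sum_j p i * p j * ((f i - f j) * (g i - g j)).
  by apply: sumr_ge0 => i _; apply: sumr_ge0 => j _; apply: mulr_ge0 => //; exact: mulr_ge0.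
by rewrite E pmulr_rge0 // subr_ge0.
Qed.

Variable z : I -> R.
Hypothesis z0 : forall i, 0 <= z i.

Let B k := \sum_i p i * z i ^+ k.

Lemma mean_pow_ge0 k : 0 <= B k.
Proof. by apply: sumr_ge0 => i _; rewrite mulr_ge0 ?exprn_ge0. Qed.

(** Powers of one nonnegative variable are positively correlated. Every product of lower moments met
    in the derivatives of the soft maximum is thus dominated by a single third moment. *)
Lemma mean_pow12 : B 1 * B 2 <= B 3.
Proof.
apply: le_trans (chebyshev_sum _) _; last first.
  by apply: ler_sum => i _; rewrite -exprD.
move=> i j; rewrite expr1 expr1 subr_sqr mulrA -expr2.
by rewrite mulr_ge0 ?sqr_ge0 ?addr_ge0.
Qed.

Lemma mean_pow11 : B 1 * B 1 <= B 2.
Proof.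
apply: le_trans (chebyshev_sum _) _; last first.
  by apply: ler_sum => i _; rewrite -exprD.
by move=> i j; rewrite -expr2 sqr_ge0.
Qed.

Lemma mean_pow111 : B 1 ^+ 3 <= B 3.
Proof.
apply: le_trans mean_pow12; rewrite exprS ler_wpM2l ?mean_pow_ge0 //.
by rewrite expr2 mean_pow11.
Qed.

End weighted_means.

(** * Derivatives of the soft maximum along a line *)

Section softmax.
Context {R : realType} (I : finType) (i0 : I) (beta : R).
Hypothesis beta_gt0 : 0 < beta.
Implicit Types w y : I -> R.

(** Log-sum-exp with inverse temperature [beta]; [softweight] is its gradient, a Gibbs distribution
    on the indices. *)
Definition lse w : R := beta^-1 * ln (\sum_i expR (beta * w i)).

Definition softweight w (i : I) : R :=
  expR (beta * w i) / \sum_j expR (beta * w j).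

Lemma sum_expR_gt0 w : 0 < \sum_i expR (beta * w i).
Proof.
rewrite (bigD1 i0) //= ltr_pwDl ?expR_gt0 //.
by apply: sumr_ge0 => i _; exact: expR_ge0.
Qed.

Lemma softweight_ge0 w i : 0 <= softweight w i.
Proof. by rewrite /softweight divr_ge0 ?expR_ge0 ?ltW ?sum_expR_gt0. Qed.

Lemma sum_softweight w : \sum_i softweight w i = 1.
Proof. by rewrite /softweight -mulr_suml divff // gt_eqF // sum_expR_gt0. Qed.

Lemma lse_ge w i : w i <= lse w.
Proof.
rewrite /lse ler_pdivlMl // -[leLHS]expRK ler_ln ?posrE ?expR_gt0 ?sum_expR_gt0 //.
rewrite (bigD1 i) //= lerDl; apply: sumr_ge0 => j _; exact: expR_ge0.
Qed.

Lemma lse_le w (a l : R) : ln #|I|%:R <= l -> (forall i, w i <= a) ->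
  lse w <= a + l / beta.
Proof.
move=> Il wa; rewrite /lse ler_pdivrMl // mulrDr mulrCA divff ?gt_eqF // mulr1.
apply: le_trans (_ : beta * a + ln #|I|%:R <= _); last by rewrite lerD2l.
have I0 : 0 < #|I|%:R :> R by rewrite ltr0n; apply/card_gt0P; exists i0.
rewrite -[X in X + _]expRK -lnM ?posrE ?expR_gt0 // ler_ln ?posrE ?sum_expR_gt0 //.
  rewrite mulr_natr -sumr_const; apply: ler_sum => i _.
  by rewrite ler_expR ler_pM2l.
by rewrite mulr_gt0 ?expR_gt0.
Qed.

Section line.
Variables w y : I -> R.

Definition line (t : R) : I -> R := fun i => w i + t * y i.

(** [A k] is the Gibbs mean of [y ^+ k] along the line, and differentiation raises its order by one.
    The derivatives [A 1], [L2], [L3] of the soft maximum are the first three cumulants of [y],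
    scaled by powers of [beta]. *)
Let M k (t : R) := \sum_i y i ^+ k * expR (beta * line t i).
Let A k (t : R) := M k t / M 0 t.

Let M0_gt0 t : 0 < M 0 t.
Proof.
rewrite /M; under eq_bigr do rewrite expr0 mul1r; exact: sum_expR_gt0.
Qed.

Let AE k t : A k t = \sum_i softweight (line t) i * y i ^+ k.
Proof.
rewrite /A /M mulr_suml; apply: eq_bigr => i _.
rewrite /softweight (eq_bigr (fun j => expR (beta * line t j))).
  by rewrite [RHS]mulrC mulrA.
by move=> j _; rewrite expr0 mul1r.
Qed.

Let der_M k t : is_derive (t : R) (1 : R) (M k) (beta * M k.+1 t).
Proof.
rewrite /M mulr_sumr; apply: der_sum => i.
have D1 : is_derive (t : R) (1 : R) (fun s => beta * line s i) (beta * y i).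
  apply: derZ; rewrite /line.
  apply: der_eq (derD (der_cst _ _) (derM (der_id _) (der_cst _ _))) _.
  by rewrite mulr0 mul1r addr0 add0r.
have D2 := der_comp (is_derive_expR _) D1.
apply: der_eq (derZ (y i ^+ k) D2) _.
by rewrite exprSr; ring.
Qed.

Let der_A k t :
  is_derive (t : R) (1 : R) (A k) (beta * (A k.+1 t - A k t * A 1 t)).
Proof.
have m0 : M 0 t != 0 by rewrite gt_eqF.
apply: der_eq (derM (der_M k t) (derV m0 (der_M 0 t))) _.
by rewrite /A; field.
Qed.

Let der_lse t : is_derive (t : R) (1 : R) (fun s => lse (line s)) (A 1 t).
Proof.
rewrite (_ : (fun s => _) = (fun s => beta^-1 * ln (M 0 s))); last first.
  apply/funext => s; rewrite /lse /M; congr (_ * ln _).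
  by apply: eq_bigr => i _; rewrite expr0 mul1r.
apply: der_eq (derZ _ (der_comp (is_derive1_ln (M0_gt0 t)) (der_M 0 t))) _.
rewrite /A; field; rewrite !gt_eqF //; exact: M0_gt0.
Qed.

Let L2 t := beta * (A 2 t - A 1 t * A 1 t).
Let L3 t := beta ^+ 2 * (A 3 t - A 2 t * A 1 t - 2 * A 1 t * (A 2 t - A 1 t * A 1 t)).

Let der_L2 t : is_derive (t : R) (1 : R) L2 (L3 t).
Proof.
apply: der_eq (derZ beta (derB (der_A 2 t) (derM (der_A 1 t) (der_A 1 t)))) _.
by rewrite /L3; ring.
Qed.

Definition abs_moment k t := \sum_i softweight (line t) i * `|y i| ^+ k.
Let B := abs_moment.

Let B_ge0 k t : 0 <= B k t.
Proof. by apply: mean_pow_ge0 => //; exact: softweight_ge0. Qed.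

Let A_le k t : `|A k t| <= B k t.
Proof.
rewrite AE (le_trans (ler_norm_sum _ _ _)) //; apply: ler_sum => i _.
by rewrite normrM normrX ger0_norm ?softweight_ge0.
Qed.

Let B12 t : B 1 t * B 2 t <= B 3 t.
Proof. by apply: mean_pow12 => //; [exact: softweight_ge0|exact: sum_softweight]. Qed.
Let B11 t : B 1 t * B 1 t <= B 2 t.
Proof. by apply: mean_pow11 => //; [exact: softweight_ge0|exact: sum_softweight]. Qed.
Let B111 t : B 1 t ^+ 3 <= B 3 t.
Proof. by apply: mean_pow111 => //; [exact: softweight_ge0|exact: sum_softweight]. Qed.

Let A11 t : `|A 1 t * A 1 t| <= B 2 t.
Proof. by rewrite normrM (le_trans _ (B11 t)) // ler_pM ?A_le. Qed.

Let L2_le t : `|L2 t| <= 2 * beta * B 2 t.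
Proof.
rewrite /L2 normrM gtr0_norm // (_ : 2 * beta * B 2 t = beta * (2 * B 2 t)); last by ring.
rewrite ler_pM2l //.
rewrite mulr_natl mulr2n (le_trans (ler_normB _ _)) // lerD //; exact: A_le.
Qed.

Let L3_le t : `|L3 t| <= 6 * beta ^+ 2 * B 3 t.
Proof.
rewrite /L3 normrM ger0_norm ?sqr_ge0 //.
rewrite (_ : 6 * beta ^+ 2 * B 3 t = beta ^+ 2 * (6 * B 3 t)); last by ring.
rewrite ler_wpM2l ?sqr_ge0 //.
have h3 := A_le 3 t.
have h21 : `|A 2 t * A 1 t| <= B 3 t.
  by rewrite normrM (le_trans _ (B12 t)) // [leRHS]mulrC ler_pM ?A_le.
have h111 : `|A 1 t * (A 1 t * A 1 t)| <= B 3 t.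
  by rewrite normrM (le_trans _ (B12 t)) // ler_pM ?A_le.
move: h3 h21 h111; rewrite !ler_norml.
by move=> /andP[? ?] /andP[? ?] /andP[? ?]; apply/andP; split; nra.
Qed.

(* The second derivative along a line is beta times the variance of y under the
   soft weights. *)
Lemma lse_taylor (b : R) : (forall i, `|y i| <= b) ->
  lse (fun i => w i + y i) <=
    lse w + \sum_i softweight w i * y i + 2 * beta * b ^+ 2.
Proof.
move=> yb.
have K t : 0 <= t <= 1 -> `|L2 t| <= 2 * beta * b ^+ 2.
  move=> _; apply: (le_trans (L2_le t)); rewrite (ler_wpM2l (mulr_ge0 (ler0n _ 2) (ltW beta_gt0))) //.
  rewrite -[leRHS]mul1r -(sum_softweight (line t)) mulr_suml.
  apply: ler_sum => i _; rewrite ler_wpM2l ?softweight_ge0 //.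
  by rewrite lerXn2r ?nnegrE // (le_trans _ (yb i)).
have := taylor1 der_lse (fun t => der_A 1 t) K.
rewrite AE (_ : line 0 = w); last by apply/funext => i; rewrite /line mul0r addr0.
rewrite (_ : line 1 = (fun i => w i + y i)); last first.
  by apply/funext => i; rewrite /line mul1r.
rewrite (eq_bigr (fun i => softweight w i * y i)); last by move=> i _; rewrite expr1.
by move=> /(le_trans (ler_norm _)); lra.
Qed.

(** Numerator and normalizer each change by a factor of at most [expR 1] when no coordinate moves by
    more than [1 / beta]. Moments along the segment thus come back to the weights at its start,
    which do not depend on the increment. *)
Lemma softweight_line (t : R) i : 0 <= t <= 1 ->
  (forall i, beta * `|y i| <= 1) ->
  softweight (line t) i <= expR 2 * softweight w i.
Proof.
move=> /andP[t0 t1] y1.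
have h j : - 1 <= beta * (t * y j) <= 1.
  rewrite -ler_norml normrM (gtr0_norm beta_gt0) (le_trans _ (y1 j)) //.
  rewrite ler_pM2l // normrM ger0_norm // ler_piMl //.
have h1 : expR (beta * line t i) <= expR 1 * expR (beta * w i).
  rewrite -expRD ler_expR /line mulrDr addrC lerD2r.
  by case/andP: (h i).
have h2 : \sum_j expR (beta * w j) <= expR 1 * \sum_j expR (beta * line t j).
  rewrite mulr_sumr; apply: ler_sum => j _; rewrite -expRD ler_expR /line mulrDr.
  by case/andP: (h j) => ? _; lra.
have s1 := sum_expR_gt0 (line t); have s0 := sum_expR_gt0 w.
rewrite /softweight ler_pdivrMr // (_ : 2 = 1 + 1 :> R); last by lra.
rewrite expRD (le_trans h1) //.
set b := expR (beta * w i); set S0 := \sum_j _; set S1 := \sum_j _ in s1 h2 *.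
rewrite (_ : expR 1 * expR 1 * (b / S0) * S1 = expR 1 * b * (expR 1 * S1 / S0)); last by ring.
rewrite ler_peMr ?mulr_ge0 ?expR_ge0 // ler_pdivlMr // mul1r.
exact: h2.
Qed.

(** The three terms of the third derivative in [d3] are at most 1, 3 * 2 and 6 times
    [1024 * phi * beta ^+ 2] times a third moment, whence 13312 = 13 * 1024; [phi <= beta] absorbs
    higher powers of [phi]. They all vanish unless the cutoff argument lies strictly between 0 and
    4, so the moment bound is asked for only there. *)
Lemma cutoff_lse_taylor (phi K : R) : 0 < phi <= beta -> 0 <= K ->
  (forall t, 0 <= t <= 1 -> 0 < phi * lse (line t) - 1 < 4 ->
     abs_moment 3 t <= K) ->
  `|cutoff (phi * lse (line 1) - 1) - cutoff (phi * lse (line 0) - 1)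
    - cutoff1 (phi * lse (line 0) - 1) * phi * \sum_i softweight (line 0) i * y i
    - (cutoff2 (phi * lse (line 0) - 1) * phi ^+ 2 *
         (\sum_i softweight (line 0) i * y i) ^+ 2 +
       cutoff1 (phi * lse (line 0) - 1) * phi * beta *
         (\sum_i softweight (line 0) i * y i ^+ 2 -
          (\sum_i softweight (line 0) i * y i) ^+ 2)) / 2|
  <= 13312 * (phi * beta ^+ 2) * K.
Proof.
move=> /andP[phi0 phib] K0 HK.
pose s t := phi * lse (line t) - 1.
have ds t : is_derive (t : R) (1 : R) s (phi * A 1 t).
  by apply: der_eq (derB (derZ phi (der_lse t)) (der_cst 1 t)) _; rewrite subr0.
have d1 t : is_derive (t : R) (1 : R) (fun t => cutoff (s t))
    (cutoff1 (s t) * (phi * A 1 t)) by exact: der_comp (der_cutoff _) (ds t).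
have ds1 t : is_derive (t : R) (1 : R) (fun t => phi * A 1 t) (phi * L2 t).
  exact: derZ (der_A 1 t).
have d2 t : is_derive (t : R) (1 : R) (fun t => cutoff1 (s t) * (phi * A 1 t))
    (cutoff2 (s t) * (phi * A 1 t) ^+ 2 + cutoff1 (s t) * (phi * L2 t)).
  apply: der_eq (derM (der_comp (der_cutoff1 _) (ds t)) (ds1 t)) _.
  by ring.
have d3 t : is_derive (t : R) (1 : R)
    (fun t => cutoff2 (s t) * (phi * A 1 t) ^+ 2 + cutoff1 (s t) * (phi * L2 t))
    (cutoff3 (s t) * (phi * A 1 t) ^+ 3
     + 3 * cutoff2 (s t) * (phi * A 1 t) * (phi * L2 t)
     + cutoff1 (s t) * (phi * L3 t)).
  under eq_fun do rewrite expr2.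
  apply: der_eq (derD (derM (der_comp (der_cutoff2 _) (ds t))
    (derM (ds1 t) (ds1 t)))
    (derM (der_comp (der_cutoff1 _) (ds t)) (derZ phi (der_L2 t)))) _.
  by ring.
have C0 : 0 <= 13312 * (phi * beta ^+ 2) :> R.
  by rewrite !mulr_ge0 ?ler0n ?sqr_ge0 // ltW.
have d3K t : 0 <= t <= 1 -> `|cutoff3 (s t) * (phi * A 1 t) ^+ 3
     + 3 * cutoff2 (s t) * (phi * A 1 t) * (phi * L2 t)
     + cutoff1 (s t) * (phi * L3 t)| <= 13312 * (phi * beta ^+ 2) * K.
  move=> t01.
  have [st|st] := boolP (0 < s t < 4); last first.
    have [|-> -> ->] := @cutoff_outside _ (s t).
      move: st; rewrite negb_and -!leNgt => /orP[h|h]; [by left|by right].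
    by rewrite !(mulr0, mul0r) !addr0 normr0 mulr_ge0.
  have B3K := HK _ t01 st.
  apply: le_trans (ler_wpM2l C0 B3K).
  have [c1 c2 c3] := cutoff_bounds (s t).
  have hb := B_ge0 3 t.
  have e1 : `|(phi * A 1 t) ^+ 3| <= phi * beta ^+ 2 * B 3 t.
    have p3 : phi ^+ 3 <= phi * beta ^+ 2.
      by rewrite exprS ler_pM2l // lerXn2r ?nnegrE // ltW.
    have p30 : 0 <= phi ^+ 3 by rewrite exprn_ge0 // ltW.
    rewrite exprMn normrM (ger0_norm p30); apply: ler_pM => //.
    rewrite normrX (le_trans _ (B111 t)) // lerXn2r ?nnegrE //; exact: A_le.
  have e2 : `|(phi * A 1 t) * (phi * L2 t)| <= 2 * (phi * beta ^+ 2 * B 3 t).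
    rewrite (_ : _ * _ * _ = (phi * phi) * (A 1 t * L2 t)); last by ring.
    rewrite (_ : 2 * _ = (phi * beta) * (2 * beta * B 3 t)); last by ring.
    have pp0 : 0 <= phi * phi by rewrite mulr_ge0 // ltW.
    rewrite normrM (ger0_norm pp0); apply: ler_pM => //.
      by rewrite ler_pM2l.
    rewrite normrM (le_trans (ler_pM _ _ (A_le 1 t) (L2_le t))) //.
    rewrite mulrCA; apply: ler_wpM2l; last exact: B12.
    by rewrite mulr_ge0 // ltW.
  have e3 : `|phi * L3 t| <= 6 * (phi * beta ^+ 2 * B 3 t).
    rewrite normrM gtr0_norm // (_ : 6 * _ = phi * (6 * beta ^+ 2 * B 3 t)); last by ring.
    by rewrite ler_pM2l.
  set Z := phi * beta ^+ 2 * B 3 t in e1 e2 e3 *.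
  have Z0 : 0 <= Z by rewrite !mulr_ge0 ?sqr_ge0 // ltW.
  have g1 := ler_pM (normr_ge0 _) (normr_ge0 _) c3 e1.
  have g2 := ler_pM (normr_ge0 _) (normr_ge0 _) c2 e2.
  have g3 := ler_pM (normr_ge0 _) (normr_ge0 _) c1 e3.
  rewrite -!normrM in g1 g2 g3.
  rewrite (_ : 3 * cutoff2 (s t) * (phi * A 1 t) * (phi * L2 t) =
    3 * (cutoff2 (s t) * (phi * A 1 t * (phi * L2 t)))); last by ring.
  rewrite -[leRHS]mulrA -[X in _ <= 13312 * X]/Z.
  rewrite (le_trans (ler_normD _ _)) //.
  have := ler_normD (cutoff3 (s t) * (phi * A 1 t) ^+ 3)
    (3 * (cutoff2 (s t) * (phi * A 1 t * (phi * L2 t)))).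
  rewrite (normrM 3) (ger0_norm (ler0n R 3)).
  by move=> h; lra.
have := taylor2 d1 d2 d3 d3K.
rewrite /L2 !AE -/(s 0) -/(s 1); apply: le_trans.
rewrite le_eqVlt; apply/orP; left; apply/eqP; congr (`|_|).
rewrite (eq_bigr (fun i => softweight (line 0) i * y i ^+ 1)); last first.
  by move=> i _; rewrite expr1.
by ring.
Qed.

End line.
End softmax.

Section smooth_orthant.
Context {R : realType} (I : finType) (i0 : I).
Implicit Types (w c y : I -> R).

Definition below c w : R := ([forall i, w i <= c i])%:R.

Definition raise c (a : R) : I -> R := fun i => c i + a.

Definition vmax y : R := \big[Num.max/0]_i `|y i|.

Lemma vmax_ge y i : `|y i| <= vmax y.
Proof. exact: (le_bigmax _ (fun i => `|y i|)). Qed.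

Lemma vmax_le y (a : R) : 0 <= a -> (forall i, `|y i| <= a) -> vmax y <= a.
Proof. by move=> a0 ya; apply: bigmax_le. Qed.

Lemma vmax_ge0 y : 0 <= vmax y.
Proof. by rewrite (le_trans _ (vmax_ge y i0)). Qed.

Variables (l phi : R).
Hypotheses (l_ge1 : 1 <= l) (card_le : ln #|I|%:R <= l) (phi_gt0 : 0 < phi).

(** This inverse temperature makes the possible excess [l / beta] of the soft maximum over the
    maximum equal to [phi^-1], the scale of the cutoff. *)
Definition bandwidth : R := phi * l.
Let beta := bandwidth.

(** Subtracting 1 absorbs the excess of the soft maximum: the value is 1 below [c], and 0 as soon as
    some coordinate exceeds [c] by [5 / phi]. *)
Definition smooth_below c w : R :=
  cutoff (phi * lse beta (fun i => w i - c i) - 1).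

(** Where the cutoff varies, the soft maximum lies between [1 / phi] and [5 / phi], hence the
    maximum between 0 and [5 / phi]. A further [1 / phi] on each side allows for a small
    increment. *)
Definition near_boundary c w : R :=
  below (raise c (6 / phi)) w - below (raise c (- phi^-1)) w.

(** The cube of an increment too large for [softweight_line]; it enters the Taylor bound without
    localization. *)
Definition cubic_excess y : R := if beta * vmax y <= 1 then 0 else vmax y ^+ 3.

Let l_gt0 : 0 < l. Proof. exact: lt_le_trans l_ge1. Qed.
Let beta_gt0 : 0 < beta. Proof. exact: mulr_gt0. Qed.
Let phi_beta : phi <= beta. Proof. by rewrite /beta /bandwidth ler_peMr // ltW. Qed.
Let l_beta : l / beta = phi^-1.
Proof. by rewrite /beta /bandwidth invfM mulrA mulrAC divff ?mul1r // gt_eqF. Qed.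

Lemma below01 c w : 0 <= below c w <= 1.
Proof. by rewrite /below; case: forallP => _; rewrite ?lexx ler01. Qed.

Lemma below_eq1 c w : (forall i, w i <= c i) -> below c w = 1.
Proof. by move=> h; rewrite /below; case: forallP. Qed.

Lemma below_eq0 c w i : c i < w i -> below c w = 0.
Proof.
move=> h; rewrite /below; case: forallP => // /(_ i).
by rewrite leNgt h.
Qed.

Lemma belowP c w : below c w = 1 /\ (forall i, w i <= c i) \/
  below c w = 0 /\ exists i, c i < w i.
Proof.
rewrite /below; case: forallP => h; [by left|right]; split => //.
apply: contrapT => /forallNP k; apply: h => i.
by rewrite leNgt; apply/negP; exact: k.
Qed.

Lemma le_below_smooth c w : below c w <= smooth_below c w.
Proof.
have [[-> h]|[-> _]] := belowP c w; last by case/andP: (cutoff01 (phi * lse beta (fun i => w i - c i) - 1)).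
rewrite /smooth_below cutoff_le0 // subr_le0 -ler_pdivlMl // mulr1.
by rewrite -l_beta -[leRHS]add0r; apply: lse_le => // i; rewrite subr_le0.
Qed.

Lemma le_smooth_below c w : smooth_below c w <= below (raise c (5 / phi)) w.
Proof.
have [[-> _]|[-> [i wi]]] := belowP (raise c (5 / phi)) w.
  by case/andP: (cutoff01 (phi * lse beta (fun i => w i - c i) - 1)).
rewrite /smooth_below cutoff_ge4 //.
have h : 5 / phi <= lse beta (fun i => w i - c i).
  apply: le_trans (lse_ge i0 beta_gt0 _ i).
  by rewrite lerBrDl ltW.
by move: h; rewrite ler_pdivrMr // mulrC => h; lra.
Qed.

Lemma near_boundary01 c w : 0 <= near_boundary c w <= 1.
Proof.
rewrite /near_boundary.
have [[-> h]|[-> [i wi]]] := belowP (raise c (6 / phi)) w.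
  have [[-> _]|[-> _]] := belowP (raise c (- phi^-1)) w.
    by rewrite subrr lexx ler01.
  by rewrite subr0 lexx ler01.
rewrite (@below_eq0 _ _ i) ?subr0 ?lexx ?ler01 //.
apply: le_lt_trans wi; rewrite /raise lerD2l.
have : 0 < phi^-1 by rewrite invr_gt0.
by move=> h; apply: (@le_trans _ _ 0); [rewrite oppr_le0 ltW|rewrite divr_ge0 ?ltW].
Qed.

(** The coefficients depend on [c] and [w] alone, so the first two moments of an increment determine
    all but the remainder. The remainder is localized by [near_boundary c w], except for large
    increments. *)
Lemma smooth_below_taylor c w : exists (a p : I -> R) (b : I -> I -> R),
  [/\ forall i, 0 <= p i, \sum_i p i = 1 & forall y,
  `|smooth_below c (fun i => w i + y i) - smooth_below c w - \sum_i a i * y i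
     - \sum_i \sum_j b i j * (y i * y j)|
   <= 13312 * expR 2 * (phi * beta ^+ 2) *
      (near_boundary c w * (\sum_i p i * `|y i| ^+ 3) + cubic_excess y)].
Proof.
pose wc := fun i => w i - c i.
pose p i := softweight beta wc i.
pose s0 := phi * lse beta wc - 1.
(* The gradient, the soft weights and half the Hessian at [w]. *)
exists (fun i => cutoff1 s0 * phi * p i), p, (fun i j =>
  (cutoff2 s0 * phi ^+ 2 * (p i * p j) +
   cutoff1 s0 * phi * beta * ((i == j)%:R * p i - p i * p j)) / 2).
have p0 i : 0 <= p i by exact: softweight_ge0.
have p1 : \sum_i p i = 1 by exact: sum_softweight.
split => // y.
have l0 : line wc y 0 = wc by apply/funext => i; rewrite /line mul0r addr0.
have l1 : line wc y 1 = (fun i => w i + y i - c i).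
  by apply/funext => i; rewrite /line /wc mul1r addrAC.
have S1 : (\sum_i p i * y i) ^+ 2 = \sum_i \sum_j p i * p j * (y i * y j).
  rewrite expr2 mulr_suml; apply: eq_bigr => i _; rewrite mulr_sumr.
  by apply: eq_bigr => j _; ring.
have S2 : \sum_i p i * y i ^+ 2 =
    \sum_i \sum_j (i == j)%:R * p i * (y i * y j).
  apply: eq_bigr => i _; rewrite (bigD1 i) //= eqxx mul1r expr2 big1 ?addr0 //.
  by move=> j /negbTE; rewrite eq_sym => ->; rewrite !mul0r.
pose K := expR 2 * (near_boundary c w * (\sum_i p i * `|y i| ^+ 3) + cubic_excess y).
have e1 : 1 <= expR 2 :> R.
  by rewrite -expR0 ler_expR.
have ce0 : 0 <= cubic_excess y.
  by rewrite /cubic_excess; case: ifP => // _; rewrite exprn_ge0 ?vmax_ge0.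
have m0 : 0 <= \sum_i p i * `|y i| ^+ 3.
  by apply: sumr_ge0 => i _; rewrite mulr_ge0 ?exprn_ge0.
have /andP[n0 n1] := near_boundary01 c w.
have nm0 : 0 <= near_boundary c w * \sum_i p i * `|y i| ^+ 3 by rewrite mulr_ge0.
have K0 : 0 <= K by rewrite mulr_ge0 ?expR_ge0 ?addr_ge0.
have phib : 0 < phi <= beta by rewrite phi_gt0.
have := @cutoff_lse_taylor _ _ i0 beta beta_gt0 wc y phi K phib K0.
rewrite l0 l1 -/s0 => T.
rewrite (_ : 13312 * expR 2 * _ * _ = 13312 * (phi * beta ^+ 2) * K); last first.
  by rewrite /K; ring.
rewrite /smooth_below -/wc -/s0 -/beta.
rewrite (_ : \sum_i cutoff1 s0 * phi * p i * y i =
    cutoff1 s0 * phi * \sum_i p i * y i); last first.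
  by rewrite mulr_sumr; apply: eq_bigr => i _; rewrite mulrA.
rewrite (_ : \sum_i \sum_j _ = (cutoff2 s0 * phi ^+ 2 * (\sum_i p i * y i) ^+ 2 +
   cutoff1 s0 * phi * beta * (\sum_i p i * y i ^+ 2 - (\sum_i p i * y i) ^+ 2)) / 2);
   last first.
  rewrite S1 S2 -sumrB !mulr_sumr -big_split /= mulr_suml.
  apply: eq_bigr => i _; rewrite -sumrB !mulr_sumr -big_split /= mulr_suml.
  by apply: eq_bigr => j _; ring.
apply: T => t t01 st; have /andP[t0 t1] := t01.
(* For a large increment the excess alone bounds the moment. For a small one, the cutoff varying
   somewhere on the segment forces [near_boundary c w = 1]. *)
have [y1|y1] := boolP (beta * vmax y <= 1); last first.
  rewrite /K /cubic_excess (negbTE y1).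
  apply: (@le_trans _ _ (vmax y ^+ 3)).
    rewrite /abs_moment -[leRHS]mul1r -(sum_softweight i0 beta (line wc y t)) mulr_suml.
    apply: ler_sum => i _; rewrite ler_wpM2l ?softweight_ge0 //.
    by rewrite lerXn2r ?nnegrE ?vmax_ge0 ?vmax_ge.
  rewrite -[leLHS]mul1r ler_pM ?exprn_ge0 ?vmax_ge0 //.
  by rewrite lerDr.
have yb i : beta * `|y i| <= 1.
  by apply: le_trans y1; rewrite ler_pM2l // vmax_ge.
have yphi i : `|t * y i| <= phi^-1.
  rewrite normrM ger0_norm //; apply: (@le_trans _ _ `|y i|).
    by rewrite ler_piMl.
  rewrite -[leRHS]mul1r ler_pdivlMr // mulrC; apply: le_trans (yb i).
  by rewrite ler_wpM2r.
rewrite /K /cubic_excess y1 addr0.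
have -> : near_boundary c w = 1.
  rewrite /near_boundary.
  have -> : below (raise c (6 / phi)) w = 1.
    apply: below_eq1 => i; rewrite leNgt; apply/negP => wi.
    move: st => /andP[_]; apply/negP; rewrite -leNgt.
    have : 5 / phi <= lse beta (line wc y t).
      apply: le_trans (lse_ge i0 beta_gt0 _ i).
      rewrite /line /wc; move: wi (yphi i); rewrite /raise ler_norml.
      by move=> wi /andP[hy _]; move: wi hy; lra.
    by rewrite ler_pdivrMr // mulrC => h; lra.
  have [[-> h]|[-> _]] := belowP (raise c (- phi^-1)) w; last by rewrite subr0.
  move: st => /andP[]; rewrite ltNge subr_le0 -ler_pdivlMl // mulr1 -l_beta.
  rewrite -[X in _ <= X]add0r (lse_le i0 beta_gt0 card_le) //.
  move=> i; have := h i; have := yphi i; rewrite /raise /line /wc ler_norml.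
  by move=> /andP[_ hy] hw; lra.
rewrite mul1r mulr_sumr; apply: ler_sum => i _.
by rewrite mulrA ler_wpM2r ?exprn_ge0 // softweight_line.
Qed.

End smooth_orthant.

(** * Lindeberg's method *)

Section finite_sums_of_integrals.
Context {R : realType} d (S : measurableType d) (mu : {measure set S -> \bar R}).

Lemma integrable_sumR (J : finType) (f : J -> S -> R) :
  (forall j, mu.-integrable setT (EFin \o f j)) ->
  mu.-integrable setT (EFin \o (fun x => \sum_j f j x)).
Proof.
move=> fi.
rewrite (_ : _ \o _ = (fun x => \sum_j (EFin \o f j) x)%E); last first.
  by apply/funext => x /=; rewrite sumEFin.
exact: integrable_sum.
Qed.

Lemma integrableZR (c : R) (f : S -> R) : mu.-integrable setT (EFin \o f) ->
  mu.-integrable setT (EFin \o (fun x => c * f x)).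
Proof. by move=> fi; apply: eq_integrable (integrableZl measurableT c fi). Qed.

Lemma integrableDR (f g : S -> R) : mu.-integrable setT (EFin \o f) ->
  mu.-integrable setT (EFin \o g) ->
  mu.-integrable setT (EFin \o (fun x => f x + g x)).
Proof. by move=> fi gi; apply: eq_integrable (integrableD measurableT fi gi). Qed.

Lemma integrableBR (f g : S -> R) : mu.-integrable setT (EFin \o f) ->
  mu.-integrable setT (EFin \o g) ->
  mu.-integrable setT (EFin \o (fun x => f x - g x)).
Proof. by move=> fi gi; apply: eq_integrable (integrableB measurableT fi gi). Qed.

Lemma Rintegral_sumR (J : finType) (f : J -> S -> R) :
  (forall j, mu.-integrable setT (EFin \o f j)) ->
  \int[mu]_x (\sum_j f j x) = \sum_j \int[mu]_x f j x.
Proof.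
move=> fi; rewrite /Rintegral.
under eq_integral do rewrite -sumEFin.
rewrite integral_sum // -sum_fine // => j _.
exact: integrable_fin_num (fi j).
Qed.

End finite_sums_of_integrals.

Section measurability.
Context {R : realType} (I : finType) (i0 : I).

Lemma cmeas_below (c : I -> R) : cmeas (below c).
Proof.
move=> d T v mv.
rewrite (_ : (fun t => _) = (fun t => \prod_i (if v i t <= c i then 1 else 0))); last first.
  apply/funext => t; have [[-> h]|[-> [i hi]]] := belowP c (v^~ t).
    by rewrite big1 // => i _; rewrite h.
  by rewrite (bigD1 i) //= leNgt hi mul0r.
apply: measurable_prod => i _.
have mle : measurable_fun setT (fun t => v i t <= c i) by exact: measurable_fun_ler.
exact: measurable_fun_ifT.
Qed.

Lemma ufun_below (c : I -> R) : ufun (below c).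
Proof. by split; [exact: cmeas_below | exact: below01]. Qed.

Lemma measurable_cutoff : measurable_fun setT (@cutoff R).
Proof.
have H (k : R) n : measurable_fun setT (fun s : R => pospart (s - k) ^+ n).
  apply: measurable_funX; apply: measurable_maxr => //.
  exact: measurable_funB.
apply: measurable_funB => //; apply: measurable_funM => //.
rewrite /bspline.
apply: measurable_funD => //; apply: measurable_funB.
  apply: measurable_funD; last exact: measurable_funM.
  by apply: measurable_funB => //; exact: measurable_funM.
exact: measurable_funM.
Qed.

Lemma measurable_lse d (T : measurableType d) (J : finType) (beta : R)
    (v : J -> T -> R) : (forall j, measurable_fun setT (v j)) ->
  measurable_fun setT (fun t => lse beta (v^~ t)).
Proof.
move=> mv; apply: measurable_funM => //.
apply: (measurableT_comp (@measurable_ln R)); apply: measurable_sum => j.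
by apply: (measurableT_comp (@measurable_expR R)); exact: measurable_funM.
Qed.

Lemma ufun_smooth_below (l phi : R) (c : I -> R) : ufun (smooth_below l phi c).
Proof.
split; last by move=> w; exact: cutoff01.
move=> d T v mv; apply: (measurableT_comp measurable_cutoff).
apply: measurable_funB => //; apply: measurable_funM => //.
apply: (@measurable_lse _ T I _ (fun i t => v i t - c i)) => i.
exact: measurable_funB.
Qed.

Lemma measurable_vmax d (T : measurableType d) (v : I -> T -> R) :
  (forall i, measurable_fun setT (v i)) ->
  measurable_fun setT (fun t => vmax (v^~ t)).
Proof.
move=> mv; rewrite /vmax; elim: (index_enum I) => [|i s IH].
  by under eq_fun do rewrite big_nil; exact: measurable_cst.
under eq_fun do rewrite big_cons; apply: measurable_maxr => //.
exact: measurableT_comp.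
Qed.

End measurability.

(** What Lindeberg's method must know of one increment: two laws sharing [G], [L] and [tau] can be
    exchanged at a cost governed by [L] and [tau]. *)
Record increment_moments {R : realType} (I : finType) (l phi : R)
    d (S : measurableType d) (mu : probability S R) (g : S -> I -> R)
    (G : I -> I -> R) (L tau : R) : Prop := {
  incr_measurable : forall i, measurable_fun setT (fun x => g x i);
  incr_int1 : forall i, mu.-integrable setT (EFin \o (fun x => g x i));
  incr_mean : forall i, \int[mu]_x g x i = 0;
  incr_int2 : forall i j, mu.-integrable setT (EFin \o (fun x => g x i * g x j));
  incr_cov : forall i j, \int[mu]_x (g x i * g x j) = G i j;
  incr_int3 : forall i, mu.-integrable setT (EFin \o (fun x => `|g x i| ^+ 3));
  incr_third : forall i, \int[mu]_x (`|g x i| ^+ 3) <= L;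
  incr_int_excess :
    mu.-integrable setT (EFin \o (fun x => cubic_excess l phi (g x)));
  incr_excess : \int[mu]_x cubic_excess l phi (g x) <= tau }.

(** * Exchanging one increment *)

Section one_step.
Context {R : realType} (I : finType) (i0 : I) (l phi : R).
Hypotheses (l_ge1 : 1 <= l) (card_le : ln #|I|%:R <= l) (phi_gt0 : 0 < phi).
Let beta := bandwidth l phi.
Let C := 13312 * expR 2 * (phi * beta ^+ 2).

Let C_ge0 : 0 <= C.
Proof.
apply: mulr_ge0; first by rewrite mulr_ge0 ?expR_ge0 ?ler0n.
by rewrite mulr_ge0 ?sqr_ge0 // ltW.
Qed.

(** [a] and [b] are fixed before the law of the increment, so one expansion serves both laws being
    exchanged and cancels in their difference. *)
Lemma increment_taylor (c w : I -> R) : exists a b,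
  forall (G : I -> I -> R) (L tau : R),
  forall d (S : measurableType d) (mu : probability S R) (g : S -> I -> R),
  increment_moments l phi mu g G L tau ->
  `|expect_op mu g (smooth_below l phi c) w - (a + \sum_i \sum_j b i j * G i j)|
    <= C * (near_boundary phi c w * L + tau).
Proof.
have [a [p [b [p0 p1 T]]]] := smooth_below_taylor i0 l_ge1 card_le phi_gt0 c w.
exists (smooth_below l phi c w), b => G L tau d S mu g [mg i1 m1 i2 m2 i3 m3 i4 m4].
set f := smooth_below l phi c in T *.
have bf : bfun f by apply: ufun_bfun; exact: ufun_smooth_below.
have fi := @bfun_translate_integrable _ _ _ _ mu g mg f w bf.
have ci (r : R) : mu.-integrable setT (EFin \o (fun=> r)).
  exact: finite_measure_integrable_cst.
have ai : mu.-integrable setT (EFin \o (fun x => \sum_i a i * g x i)).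
  by apply: integrable_sumR => i; exact: integrableZR.
have bi : mu.-integrable setT
    (EFin \o (fun x => \sum_i \sum_j b i j * (g x i * g x j))).
  by apply: integrable_sumR => i; apply: integrable_sumR => j; exact: integrableZR.
have pi' : mu.-integrable setT (EFin \o (fun x => \sum_i p i * `|g x i| ^+ 3)).
  by apply: integrable_sumR => i; exact: integrableZR.
have E : \int[mu]_x (f (addv w (g x)) - f w - \sum_i a i * g x i
     - \sum_i \sum_j b i j * (g x i * g x j)) =
   expect_op mu g f w - (f w + \sum_i \sum_j b i j * G i j).
  rewrite RintegralB //; last by apply: integrableBR => //; exact: integrableBR.
  rewrite RintegralB //; last exact: integrableBR.
  rewrite RintegralB // Rintegral_sumR; last by move=> i; exact: integrableZR.
  rewrite [X in _ - X - _]big1 ?subr0; last first.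
    by move=> i _; rewrite RintegralZl // m1 mulr0.
  rewrite Rintegral_sumR; last first.
    by move=> i; apply: integrable_sumR => j; exact: integrableZR.
  rewrite opprD addrA; congr (_ - _ - _).
    rewrite Rintegral_cst // -[RHS]mulr1; congr (_ * _).
    exact: (congr1 fine (@probability_setT _ _ _ mu)).
  apply: eq_bigr => i _; rewrite Rintegral_sumR; last by move=> j; exact: integrableZR.
  by apply: eq_bigr => j _; rewrite RintegralZl // m2.
rewrite -E.
have hi : mu.-integrable setT (EFin \o (fun x => f (addv w (g x)) - f w - \sum_i a i * g x i
     - \sum_i \sum_j b i j * (g x i * g x j))).
  by apply: integrableBR => //; apply: integrableBR => //; exact: integrableBR.
apply: (le_trans (le_normr_Rintegral _ hi)) => //.
have gi : mu.-integrable setT (EFin \o (fun x => C *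
    (near_boundary phi c w * (\sum_i p i * `|g x i| ^+ 3) + cubic_excess l phi (g x)))).
  by apply: integrableZR; apply: integrableDR => //; exact: integrableZR.
apply: (@le_trans _ _ (\int[mu]_x (C * (near_boundary phi c w *
   (\sum_i p i * `|g x i| ^+ 3) + cubic_excess l phi (g x))))).
  apply: le_Rintegral => //; first exact: integrable_norm.
  by move=> x _; exact: T.
rewrite RintegralZl //; last by apply: integrableDR => //; exact: integrableZR.
apply: ler_wpM2l => //; rewrite RintegralD //; last exact: integrableZR.
apply: lerD => //; rewrite RintegralZl //; apply: ler_wpM2l.
  by case/andP: (near_boundary01 phi_gt0 c w).
rewrite Rintegral_sumR; last by move=> i; exact: integrableZR.
rewrite -[leRHS]mul1r -p1 mulr_suml; apply: ler_sum => i _.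
by rewrite RintegralZl // ler_wpM2l.
Qed.

Definition near_boundary_wide (c w : I -> R) : R :=
  below (raise c (7 / phi)) w - below (raise c (- (2 / phi))) w.

(** The Taylor remainder sees a vector with one summand missing. By Markov's inequality the missing
    increment is at most [1 / beta] with probability at least one half, and adding it then widens
    the boundary layer by [1 / phi] only. A full hybrid is thus recovered at the price of a factor
    2. *)
Lemma near_boundary_mean (G : I -> I -> R) (L tau : R) d (S : measurableType d)
    (mu : probability S R) (g : S -> I -> R) (c w : I -> R) :
  increment_moments l phi mu g G L tau -> beta ^+ 3 * tau <= 1 / 2 ->
  near_boundary phi c w <= 2 * expect_op mu g (near_boundary_wide c) w.
Proof.
move=> [mg _ _ _ _ _ _ i4 m4] btau.
have /andP[n0 n1] := near_boundary01 phi_gt0 c w.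
have iphi : 0 < phi^-1 by rewrite invr_gt0.
have beta_gt0 : 0 < beta by rewrite mulr_gt0 // (lt_le_trans _ l_ge1).
(* [1 - beta ^+ 3 * cubic_excess] lies below the indicator of a small increment, since a nonzero
   excess exceeds [beta ^- 3]. *)
have key x : near_boundary phi c w * (1 - beta ^+ 3 * cubic_excess l phi (g x)) <=
    near_boundary_wide c (addv w (g x)).
  have wide0 : 0 <= near_boundary_wide c (addv w (g x)).
    rewrite /near_boundary_wide.
    have [[-> h]|[-> [i hi]]] := belowP (raise c (7 / phi)) (addv w (g x)).
      by rewrite subr_ge0; case/andP: (below01 (raise c (- (2 / phi))) (addv w (g x))).
    rewrite (@below_eq0 _ _ _ _ i) ?subrr //.
    apply: le_lt_trans hi; rewrite /raise lerD2l.
    by move: iphi; lra.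
  rewrite /cubic_excess -/beta; case: ifPn => [b1|]; last first.
    rewrite -ltNge => b1; apply: le_trans wide0.
    apply: mulr_ge0_le0 => //; rewrite subr_le0 -exprMn.
    by rewrite exprn_ege1 // ltW.
  rewrite mulr0 subr0 mulr1.
  have yphi i : `|g x i| <= phi^-1.
    rewrite -[leRHS]mul1r ler_pdivlMr //; apply: le_trans b1.
    rewrite mulrC; apply: ler_pM => //; first exact: ltW.
      by rewrite /beta /bandwidth ler_peMr // ltW.
    exact: vmax_ge.
  rewrite /near_boundary.
  have [[-> h]|[-> [i hi]]] := belowP (raise c (6 / phi)) w; last first.
    apply: le_trans wide0; rewrite sub0r oppr_le0.
    by case/andP: (below01 (raise c (- phi^-1)) w).
  have [[-> _]|[-> [i hi]]] := belowP (raise c (- phi^-1)) w; first by rewrite subrr.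
  rewrite subr0 /near_boundary_wide below_eq1; last first.
    move=> j; have := h j; have := yphi j; rewrite /raise /addv ler_norml.
    by move=> /andP[_ ?] ?; lra.
  rewrite (@below_eq0 _ _ _ _ i) ?subr0 //.
  have := yphi i; move: hi; rewrite /raise /addv ler_norml.
  by move=> ? /andP[? _]; lra.
have bw : bfun (near_boundary_wide c).
  by apply: bfunB; apply: ufun_bfun; exact: ufun_below.
have ci (r : R) : mu.-integrable setT (EFin \o (fun=> r)).
  exact: finite_measure_integrable_cst.
have ii : mu.-integrable setT (EFin \o (fun x => 1 - beta ^+ 3 * cubic_excess l phi (g x))).
  by apply: integrableBR => //; exact: integrableZR.
have := @le_Rintegral _ _ _ mu setT _ _ measurableT (integrableZR (near_boundary phi c w) ii)
  (bfun_translate_integrable mu mg w bw) (fun x _ => key x).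
rewrite RintegralZl // RintegralB //; last exact: integrableZR.
rewrite Rintegral_cst // RintegralZl // mul1r.
rewrite (_ : fine _ = 1); last exact: (congr1 fine (@probability_setT _ _ _ mu)).
rewrite -/(expect_op mu g (near_boundary_wide c) w) => h.
have : beta ^+ 3 * \int[mu]_x cubic_excess l phi (g x) <= 1 / 2.
  by apply: le_trans btau; rewrite ler_wpM2l // exprn_ge0 // ltW.
by move: h n0; set q := beta ^+ 3 * _; nra.
Qed.

End one_step.

(** * Telescoping over the hybrids *)

Section lindeberg.
Context {R : realType} (I : finType) (i0 : I) (l phi : R).
Hypotheses (l_ge1 : 1 <= l) (card_le : ln #|I|%:R <= l) (phi_gt0 : 0 < phi).
Let beta := bandwidth l phi.
Let C := 13312 * expR 2 * (phi * beta ^+ 2).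

Context d1 (S1 : measurableType d1) (mu1 : probability S1 R) (g1 : S1 -> I -> R).
Context d2 (S2 : measurableType d2) (mu2 : probability S2 R) (g2 : S2 -> I -> R).
Variables (G : I -> I -> R) (L tau : R).
Hypothesis m1 : increment_moments l phi mu1 g1 G L tau.
Hypothesis m2 : increment_moments l phi mu2 g2 G L tau.
Hypothesis tau_small : beta ^+ 3 * tau <= 1 / 2.

Let T1 := expect_op mu1 g1.
Let T2 := expect_op mu2 g2.
Let mg1 := incr_measurable m1.
Let mg2 := incr_measurable m2.

Let eps1 := 2 * C * L.
Let eps2 := 2 * C * tau.

Let C_ge0 : 0 <= C.
Proof.
apply: mulr_ge0; first by rewrite mulr_ge0 ?expR_ge0 ?ler0n.
by rewrite mulr_ge0 ?sqr_ge0 // ltW.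
Qed.

Let L_ge0 : 0 <= L.
Proof.
apply: le_trans (incr_third m1 i0).
by apply: Rintegral_ge0 => x _; rewrite exprn_ge0.
Qed.

Let tau_ge0 : 0 <= tau.
Proof.
apply: le_trans (incr_excess m1); apply: Rintegral_ge0 => x _.
by rewrite /cubic_excess; case: ifP => // _; rewrite exprn_ge0 // vmax_ge0.
Qed.

Let eps1_ge0 : 0 <= eps1. Proof. exact: mulr_ge0 (mulr_ge0 (ler0n _ 2) C_ge0) L_ge0. Qed.
Let eps2_ge0 : 0 <= eps2. Proof. exact: mulr_ge0 (mulr_ge0 (ler0n _ 2) C_ge0) tau_ge0. Qed.

Let one_step c w : `|T1 (smooth_below l phi c) w - T2 (smooth_below l phi c) w|
  <= eps1 * near_boundary phi c w + eps2.
Proof.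
have [a [b T]] := increment_taylor i0 l_ge1 card_le phi_gt0 c w.
have h1 := T _ _ _ _ _ _ _ m1; have h2 := T _ _ _ _ _ _ _ m2.
rewrite -/beta -/C in h1 h2.
set q := a + _ in h1 h2.
rewrite (_ : T1 _ w - T2 _ w = (T1 (smooth_below l phi c) w - q) -
   (T2 (smooth_below l phi c) w - q)); last by ring.
apply: (le_trans (ler_normB _ _)); apply: (le_trans (lerD h1 h2)).
by rewrite /eps1 /eps2; lra.
Qed.

Variables (n : nat) (w0 : I -> R).

Definition hybrid (k : nat) (f : (I -> R) -> R) : R :=
  iter k T1 (iter (n - k) T2 f) w0.

Let averaging_gen k m : averaging (fun f => iter k T1 (iter m T2 f) w0).
Proof.
apply: (@averaging_iter _ _ (fun f => iter k T1 f w0) _ _ mu2 g2 m mg2).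
exact: (@averaging_iter _ _ (fun f => f w0) _ _ mu1 g1 k mg1 (averaging_at w0)).
Qed.

Lemma averaging_hybrid k : averaging (hybrid k).
Proof. exact: averaging_gen. Qed.

Let iter_comm m f : ufun f -> T1 (iter m T2 f) = iter m T2 (T1 f).
Proof.
move=> uf; elim: m => [//|m IH]; rewrite 2!iterS -IH; apply: expect_op_comm => //.
by elim: m {IH} => [//|m IH]; exact: ufun_expect_op.
Qed.

Let hybrid_step c k : (k < n)%N ->
  `|hybrid k.+1 (smooth_below l phi c) - hybrid k (smooth_below l phi c)| <=
  2 * eps1 * hybrid k (near_boundary_wide phi c) + eps2.
Proof.
move=> kn; set f := smooth_below l phi c.
(* The average over the [n - 1] increments common to the two hybrids; commutation lets the exchanged
   increment be averaged first. *)
pose A h := iter k T1 (iter (n - k.+1) T2 h) w0.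
have aA : averaging A by exact: averaging_gen.
have uf : ufun f by exact: ufun_smooth_below.
have bw : bfun (near_boundary_wide phi c).
  by apply: bfunB; apply: ufun_bfun; exact: ufun_below.
have bn : bfun (near_boundary phi c).
  by apply: bfunB; apply: ufun_bfun; exact: ufun_below.
have e1 : hybrid k.+1 f = A (T1 f) by rewrite /hybrid iterSr iter_comm.
have e2 h : hybrid k h = A (T2 h) by rewrite /hybrid -(subnSK kn) iterSr.
have b1 : bfun (T1 f) by apply: bfun_expect_op => //; exact: ufun_bfun.
have b2 : bfun (T2 f) by apply: bfun_expect_op => //; exact: ufun_bfun.
have b3 : bfun (T2 (near_boundary_wide phi c)) by exact: bfun_expect_op.
rewrite e1 !e2 -averagingB //.
have [AD AZ AC AL] := aA.
have bR : bfun (fun w => 2 * eps1 * T2 (near_boundary_wide phi c) w + eps2).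
  by apply: bfunD; [exact: bfunZ|exact: bfun_cst].
have ER : A (fun w => 2 * eps1 * T2 (near_boundary_wide phi c) w + eps2) =
    2 * eps1 * A (T2 (near_boundary_wide phi c)) + eps2.
  by rewrite (AD _ _ (bfunZ (2 * eps1) b3) (@bfun_cst R I eps2)) AZ // AC.
rewrite -ER.
have key w : `|T1 f w - T2 f w| <= 2 * eps1 * T2 (near_boundary_wide phi c) w + eps2.
  apply: (le_trans (one_step c w)); rewrite lerD2r.
  rewrite (_ : 2 * eps1 * _ = eps1 * (2 * T2 (near_boundary_wide phi c) w)); last by ring.
  apply: ler_wpM2l => //.
  (* Restoring an increment of the second law yields hybrid [k] rather than [k.+1], which the strong
     induction can bound. *)
  by apply: near_boundary_mean m2 tau_small => //; exact: l_ge1.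
rewrite ler_norml; apply/andP; split.
  rewrite -mulN1r -AZ //; apply: AL; [exact: bfunZ|exact: bfunB|move=> w].
  by rewrite mulN1r; have := key w; rewrite ler_norml => /andP[].
apply: AL => //; first exact: bfunB.
by move=> w; have := key w; rewrite ler_norml => /andP[].
Qed.

Variables kappa kappa0 : R.
Hypotheses (kappa_ge0 : 0 <= kappa) (kappa0_ge0 : 0 <= kappa0).
Hypothesis anti_concentration : forall c a, 0 < a ->
  hybrid 0 (below (raise c a)) - hybrid 0 (below c) <= kappa * a + kappa0.
Hypothesis third_small : n%:R * eps1 <= 1 / 8.

(* The near-boundary probabilities in the telescoping sum are controlled by the
   very quantity being bounded; third_small makes that bound self-improving. *)
Lemma lindeberg_bound (k : nat) (c : I -> R) : (k <= n)%N ->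
  `|hybrid k (below c) - hybrid 0 (below c)| <=
  16 * kappa / phi + 4 * kappa0 + 2 * n%:R * eps2.
Proof.
have iphi : 0 < phi^-1 by rewrite invr_gt0.
set rho := 16 * kappa / phi + 4 * kappa0 + 2 * n%:R * eps2.
have bb (c' : I -> R) : bfun (below c') by apply: ufun_bfun; exact: ufun_below.
have bs (c' : I -> R) : bfun (smooth_below l phi c').
  by apply: ufun_bfun; exact: ufun_smooth_below.
have raiseD (c' : I -> R) a b : raise (raise c' a) b = raise c' (a + b).
  by apply/funext => i; rewrite /raise addrA.
have le_hyb j f g : bfun f -> bfun g -> (forall w, f w <= g w) ->
    hybrid j f <= hybrid j g.
  by have [_ _ _ AL] := averaging_hybrid j; exact: AL.
have kphi : 0 <= kappa / phi by rewrite mulr_ge0 // ltW.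
have eps2n : 0 <= n%:R * eps2 by exact: mulr_ge0 (ler0n _ _) eps2_ge0.
(* Strong induction with [c] generalized: the case [k] uses earlier hybrids at thresholds shifted
   away from [c]. *)
elim/ltn_ind: k c => k IH c kn.
(* The layer has width [9 / phi]. Anti-concentration is available for hybrid 0, and moving each of
   the two faces there costs one [rho]. *)
have near_le j c' : (j < k)%N -> hybrid j (near_boundary_wide phi c') <=
    9 * (kappa / phi) + kappa0 + 2 * rho.
  move=> jk; rewrite /near_boundary_wide averagingB //; last exact: averaging_hybrid.
  have jn : (j <= n)%N by rewrite (leq_trans (ltnW jk)).
  have := IH j jk (raise c' (7 / phi)) jn; have := IH j jk (raise c' (- (2 / phi))) jn.
  have h9 : 0 < 9 / phi by rewrite divr_gt0.
  have := anti_concentration (raise c' (- (2 / phi))) h9.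
  rewrite raiseD (_ : - (2 / phi) + 9 / phi = 7 / phi); last by field; rewrite gt_eqF.
  rewrite !ler_norml => h1 /andP[h2 h3] /andP[h4 h5].
  by move: h1; rewrite mulrCA; lra.
have smooth_le c' : `|hybrid k (smooth_below l phi c') - hybrid 0 (smooth_below l phi c')|
    <= k%:R * (2 * eps1 * (9 * (kappa / phi) + kappa0 + 2 * rho) + eps2).
  have : forall j, (j <= k)%N -> `|hybrid j (smooth_below l phi c') -
     hybrid 0 (smooth_below l phi c')|
    <= j%:R * (2 * eps1 * (9 * (kappa / phi) + kappa0 + 2 * rho) + eps2).
    elim=> [_|j IHj jk]; first by rewrite subrr normr0 mul0r.
    have := IHj (ltnW jk) => hj.
    have := hybrid_step c' (leq_trans jk kn) => hs.
    have hn := near_le j c' jk.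
    have hn' := ler_wpM2l (mulr_ge0 (ler0n R 2) eps1_ge0) hn.
    rewrite -[j.+1%:R]natr1 mulrDl mul1r.
    have := ler_normD (hybrid j.+1 (smooth_below l phi c') - hybrid j (smooth_below l phi c'))
      (hybrid j (smooth_below l phi c') - hybrid 0 (smooth_below l phi c')).
    rewrite (_ : _ - _ + (_ - _) = hybrid j.+1 (smooth_below l phi c') -
       hybrid 0 (smooth_below l phi c')); last by ring.
    move=> ht; move: hs hj hn' ht.
    set X := j%:R * _; set Y := 2 * eps1 * (_ + _); set Z := 2 * eps1 * hybrid _ _.
    by lra.
  by move/(_ k (leqnn k)).
pose D := k%:R * (2 * eps1 * (9 * (kappa / phi) + kappa0 + 2 * rho) + eps2).
have rho0 : 0 <= rho by rewrite /rho; move: kphi eps2n kappa0_ge0; rewrite -!mulrA; lra.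
have DE : D <= (9 * (kappa / phi) + kappa0 + 2 * rho) / 4 + n%:R * eps2.
  have h0 : 0 <= 9 * (kappa / phi) + kappa0 + 2 * rho.
    by rewrite /rho; move: kphi eps2n kappa0_ge0; rewrite -!mulrA; lra.
  apply: (@le_trans _ _ (n%:R * (2 * eps1 * (9 * (kappa / phi) + kappa0 + 2 * rho) + eps2))).
    rewrite /D ler_wpM2r ?ler_nat //.
    by apply: addr_ge0 => //; apply: mulr_ge0 => //; exact: mulr_ge0.
  rewrite mulrDr lerD2r.
  rewrite (_ : n%:R * (2 * eps1 * _) = (2 * (n%:R * eps1)) *
    (9 * (kappa / phi) + kappa0 + 2 * rho)); last by ring.
  rewrite [leRHS]mulrC ler_wpM2r //; move: third_small; lra.
have h5 : 0 < 5 / phi by rewrite divr_gt0.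
have up : hybrid k (below c) <= hybrid 0 (below c) + kappa * (5 / phi) + kappa0 + D.
  have s1 := le_hyb k _ _ (bb c) (bs c) (le_below_smooth i0 l_ge1 card_le phi_gt0 c).
  have s2 := le_hyb 0 _ _ (bs c) (bb _) (le_smooth_below i0 l_ge1 phi_gt0 c).
  have s3 := anti_concentration c h5.
  have := smooth_le c; rewrite -/D ler_norml => /andP[_ s4]; lra.
have low : hybrid 0 (below c) - kappa * (5 / phi) - kappa0 - D <= hybrid k (below c).
  set c' := raise c (- (5 / phi)).
  have cE : raise c' (5 / phi) = c.
    by apply/funext => i; rewrite /c' /raise subrK.
  have s1 := le_hyb k _ _ (bs c') (bb _) (le_smooth_below i0 l_ge1 phi_gt0 c').
  have s2 := le_hyb 0 _ _ (bb c') (bs c') (le_below_smooth i0 l_ge1 card_le phi_gt0 c').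
  have s3 := anti_concentration c' h5.
  rewrite cE in s1 s3.
  have := smooth_le c'; rewrite -/D ler_norml => /andP[s4 _]; lra.
(* [D] contains [rho / 2]. The other half must cover [(5 + 9/4) * (kappa / phi)],
   [(1 + 1/4) * kappa0] and [n * eps2], which explains the coefficients 16, 4 and 2 of [rho]. *)
have : kappa * (5 / phi) + kappa0 + D <= rho.
  have E5 : kappa * (5 / phi) = 5 * (kappa / phi) by ring.
  have ER : rho = 16 * (kappa / phi) + 4 * kappa0 + 2 * (n%:R * eps2).
    by rewrite /rho; ring.
  move: DE kphi eps2n kappa0_ge0; rewrite E5 ER.
  by move: (D) (kappa / phi) (n%:R * eps2) => ? ? ?; lra.
by rewrite ler_norml => h; apply/andP; split; lra.
Qed.

End lindeberg.

(** * Gaussian vectors and anti-concentration *)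

Section density.
Context {R : realType}.
Local Notation mu := (@lebesgue_measure R).
Local Notation N01 := (normal_prob (0 : R) 1 : probability (measurableTypeR R) R).

(** Uniqueness of the Radon-Nikodym derivative identifies it with [p] almost everywhere, and the
    change of variables for that derivative does the rest. *)
Lemma ge0_integral_density d (T : measurableType d)
    (nu : {finite_measure set T -> \bar R})
    (la : {sigma_finite_measure set T -> \bar R}) (p : T -> R) (f : T -> \bar R) :
  (forall x, 0 <= p x) -> la.-integrable setT (EFin \o p) ->
  (forall A, measurable A -> nu A = \int[la]_(x in A) (p x)%:E)%E ->
  measurable_fun setT f -> (forall x, 0 <= f x)%E ->
  (\int[nu]_x f x = \int[la]_x (f x * (p x)%:E))%E.
Proof.
move=> p0 ip nuE mf f0.
have dom : nu `<< la.
  apply/null_content_dominatesP => A mA laA0.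
  rewrite nuE //; apply: null_set_integral => //.
  exact: measurable_funTS (measurable_int _ ip).
rewrite -(Radon_Nikodym_SigmaFinite.change_of_variables dom) //.
have mRN : measurable_fun setT (Radon_Nikodym_SigmaFinite.f nu la).
  exact: measurable_int (Radon_Nikodym_SigmaFinite.f_integrable dom).
apply: ge0_ae_eq_integral => //.
- exact: emeasurable_funM.
- by apply: emeasurable_funM => //; exact: (measurable_int _ ip).
- by move=> x _; apply: mule_ge0 => //; exact: Radon_Nikodym_SigmaFinite.f_ge0.
- by move=> x _; apply: mule_ge0 => //; rewrite lee_fin.
apply: ae_eqe_mul2l; apply: integral_ae_eq => //.
- exact: Radon_Nikodym_SigmaFinite.f_integrable.
- exact: measurable_int ip.
- move=> E _ mE; rewrite -nuE //.
  by rewrite -Radon_Nikodym_SigmaFinite.f_integral.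
Qed.

Lemma measurable_id_sigma : measurable_fun [set: measurableTypeR R] (idfun : measurableTypeR R -> R).
Proof. by move=> _ A mA; rewrite setTI. Qed.

Definition gauss_id : {mfun (measurableTypeR R) >-> R} :=
  HB.pack (idfun : measurableTypeR R -> R)
    (isMeasurableFun.Build _ _ _ _ _ measurable_id_sigma).

(* normal_prob lives on R with the sigma-algebra generated by the half-open
   intervals as display; gauss is the same law on R with its default display. *)
Definition gauss : probability R R := distribution N01 gauss_id.

Lemma ge0_integral_gauss (f : R -> \bar R) :
  measurable_fun setT f -> (forall x, 0 <= f x)%E ->
  (\int[gauss]_x f x = \int[mu]_x (f x * (normal_pdf 0 1 x)%:E))%E.
Proof.
move=> mf f0; rewrite ge0_integral_distribution //.
apply: (@ge0_integral_density _ _ N01 mu (normal_pdf 0 1)) => //.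
- exact: normal_pdf_ge0.
- exact: integrable_normal_pdf.
Qed.

Lemma lebesgue_affine (a m : R) (A : set R) : 0 < a -> measurable A ->
  (mu A = a%:E * mu ((fun x => a * x + m)%R @^-1` A))%E.
Proof.
move=> a0 mA.
have mh : measurable_fun [set: measurableTypeR R]
    ((fun x => a * x + m) : measurableTypeR R -> measurableTypeR R).
  by apply: measurable_funD => //; exact: measurable_funM.
pose nu : measure (measurableTypeR R) R := pushforward mu
  ((fun x => a * x + m) : measurableTypeR R -> measurableTypeR R).
have c0 : 0 <= a by exact: ltW.
have := @lebesgue_measure_unique R (mscale (NngNum c0) (nu mh)) _ A mA.
rewrite /mscale /= => -> //= X /ocitvP[->|[[u v] /= uv ->]].
  by rewrite !measure0.
suff: mu `]u, v] = (a%:E * mu ((fun x => a * x + m)%R @^-1` `]u, v]))%E by [].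
rewrite (_ : _ @^-1` _ = `](u - m) / a, (v - m) / a]%classic); last first.
  apply/seteqP; split => x /=; rewrite !in_itv /= ltr_pdivrMr // ler_pdivlMr //;
  by rewrite ltrBlDr lerBrDr (mulrC x).
rewrite !lebesgue_measure_itv /= !lte_fin uv ltr_pM2r ?invr_gt0 // ltrD2r uv.
rewrite -!EFinB -EFinM; congr (_%:E).
by field; rewrite gt_eqF.
Qed.

Lemma ge0_integral_affine (a m : R) (f : R -> \bar R) : 0 < a ->
  measurable_fun setT f -> (forall x, 0 <= f x)%E ->
  (\int[mu]_x f (a * x + m)%R = a^-1%:E * \int[mu]_x f x)%E.
Proof.
move=> a0 mf f0.
have mh : measurable_fun [set: measurableTypeR R]
    ((fun x => a * x + m) : measurableTypeR R -> measurableTypeR R).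
  by apply: measurable_funD => //; exact: measurable_funM.
have := @ge0_integral_pushforward _ _ _ _ R _ mh mu setT f measurableT mf
  (fun x _ => f0 x).
rewrite preimage_setT => /= <-.
have c0 : 0 <= a by exact: ltW.
rewrite [in RHS](@eq_measure_integral _ _ _ setT
   (mscale (NngNum c0) (pushforward mu ((fun x => a * x + m) : measurableTypeR R -> measurableTypeR R)))); last first.
  by move=> A mA _; exact: (lebesgue_affine m a0 mA).
rewrite ge0_integral_mscale // muleA -EFinM /= mulVf ?mul1e // gt_eqF //.
Qed.

Lemma measurable_comp_affine (a m : R) (f : R -> \bar R) :
  measurable_fun setT f -> measurable_fun setT (fun x => f (a * x + m)%R).
Proof.
move=> mf; apply: (measurableT_comp mf).
by apply: measurable_funD => //; exact: measurable_funM.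
Qed.

Lemma normal_pdf_gt0E (m s x : R) : 0 < s ->
  normal_pdf m s x = normal_peak s * normal_fun m s x.
Proof. by move=> s0; rewrite normal_pdfE // gt_eqF. Qed.

Lemma normal_peak_scale (s : R) : 0 < s -> normal_peak s = s^-1 * normal_peak 1.
Proof.
move=> s0; rewrite /normal_peak -mulrnAr sqrtrM ?sqr_ge0 // sqrtr_sqr gtr0_norm //.
by rewrite expr1n mul1r invfM.
Qed.

Lemma normal_funE (m s x : R) :
  normal_fun m s x = expR (- (x - m) ^+ 2 / (2 * s ^+ 2)).
Proof. by rewrite /normal_fun mulr_natl. Qed.

Lemma normal_pdf_affine (a m x : R) : 0 < a ->
  normal_pdf 0 1 x = a * normal_pdf m a (a * x + m).
Proof.
move=> a0; rewrite !normal_pdf_gt0E // mulrA; congr (_ * _).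
  by rewrite (normal_peak_scale a0) mulrA divff ?gt_eqF // mul1r.
by rewrite !normal_funE; congr expR; field; rewrite gt_eqF.
Qed.

Lemma ge0_integral_gauss_affine (a m : R) (f : R -> \bar R) : 0 < a ->
  measurable_fun setT f -> (forall x, 0 <= f x)%E ->
  (\int[gauss]_x f (a * x + m)%R = \int[mu]_x (f x * (normal_pdf m a x)%:E))%E.
Proof.
move=> a0 mf f0.
rewrite (ge0_integral_gauss (measurable_comp_affine a m mf) (fun x => f0 (a * x + m)%R)).
have a0' : (0 <= a^-1%:E :> \bar R)%E by rewrite lee_fin invr_ge0 ltW.
have mfp : measurable_fun setT (fun x => f x * (normal_pdf m a x)%:E)%E.
  by apply: emeasurable_funM => //; apply/measurable_EFinP; exact: measurable_normal_pdf.
have fp0 x : (0 <= f x * (normal_pdf m a x)%:E)%E.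
  by rewrite mule_ge0 ?lee_fin ?normal_pdf_ge0.
transitivity (\int[mu]_x (a%:E * ((fun y => f y * (normal_pdf m a y)%:E) (a * x + m)%R)))%E.
  by apply: eq_integral => x _; rewrite (normal_pdf_affine m x a0) EFinM muleCA.
rewrite ge0_integralZl //.
- rewrite (ge0_integral_affine m a0 mfp fp0) muleA -EFinM divff ?mul1e //.
  by rewrite gt_eqF.
- exact: (measurable_comp_affine a m mfp).
- by rewrite lee_fin ltW.
Qed.

Lemma ge0_integral_gauss_shift (t : R) (f : R -> \bar R) :
  measurable_fun setT f -> (forall x, 0 <= f x)%E ->
  (\int[gauss]_x f (x + t)%R =
   \int[gauss]_x (f x * (expR (t * x - t ^+ 2 / 2))%:E))%E.
Proof.
move=> mf f0; transitivity (\int[gauss]_x f (1 * x + t)%R)%E.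
  by apply: eq_integral => x _; rewrite mul1r.
rewrite ge0_integral_gauss_affine // ge0_integral_gauss //; last 2 first.
- apply: emeasurable_funM => //; apply/measurable_EFinP.
  by apply: measurableT_comp => //; apply: measurable_funB => //; exact: measurable_funM.
- by move=> x; rewrite mule_ge0 ?lee_fin ?expR_ge0.
apply: eq_integral => x _; rewrite -muleA -EFinM; congr (_ * _%:E)%E.
rewrite !normal_pdf_gt0E // mulrCA; congr (_ * _).
by rewrite !normal_funE -expRD; congr expR; field.
Qed.

(** Completing the square: the joint density of [(x, y)] is factored through the law of [y] on one
    side and through that of [x] on the other. *)
Lemma normal_pdf_conv (a b x y : R) : 0 < a -> 0 < b ->
  normal_pdf (b * y) a x * normal_pdf 0 1 y =
  normal_pdf 0 (Num.sqrt (a ^+ 2 + b ^+ 2)) x *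
  normal_pdf (b * x / (a ^+ 2 + b ^+ 2)) (a / Num.sqrt (a ^+ 2 + b ^+ 2)) y.
Proof.
move=> a0 b0.
have c20 : 0 < a ^+ 2 + b ^+ 2 by rewrite addr_gt0 // exprn_gt0.
set c := Num.sqrt _.
have c0 : 0 < c by rewrite sqrtr_gt0.
have cE : c ^+ 2 = a ^+ 2 + b ^+ 2 by rewrite sqr_sqrtr // ltW.
have ac0 : 0 < a / c by rewrite divr_gt0.
rewrite -cE !normal_pdf_gt0E // mulrACA [RHS]mulrACA; congr (_ * _).
  rewrite (normal_peak_scale a0) (normal_peak_scale c0) (normal_peak_scale ac0).
  by field; rewrite !gt_eqF.
rewrite !normal_funE -!expRD; congr expR.
have -> : a ^+ 2 = c ^+ 2 - b ^+ 2 by rewrite cE addrK.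
rewrite !expr_div_n.
have -> : a ^+ 2 = c ^+ 2 - b ^+ 2 by rewrite cE addrK.
have nz : c ^+ 2 - b ^+ 2 != 0 by rewrite cE addrK gt_eqF // exprn_gt0.
by field; rewrite nz /= gt_eqF.
Qed.

Lemma ge0_integral_gauss_conv (a b : R) (f : R -> \bar R) : 0 < a -> 0 < b ->
  measurable_fun setT f -> (forall x, 0 <= f x)%E ->
  (\int[gauss]_y \int[gauss]_x f (a * x + b * y)%R =
   \int[gauss]_x f (Num.sqrt (a ^+ 2 + b ^+ 2) * x)%R)%E.
Proof.
move=> a0 b0 mf f0.
set c := Num.sqrt _.
have c0 : 0 < c by rewrite sqrtr_gt0 addr_gt0 // exprn_gt0.
pose h (z : R * R) := (f z.2 * (normal_pdf (b * z.1) a z.2)%:E * (normal_pdf 0 1 z.1)%:E)%E.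
have mpdf (u v : R * R -> R) (s : R) : 0 < s -> measurable_fun setT u ->
    measurable_fun setT v ->
    measurable_fun setT (fun z => (normal_pdf (u z) s (v z))%:E).
  move=> s0 mu' mv; apply/measurable_EFinP.
  rewrite (_ : (fun z => _) = (fun z => normal_peak s * normal_fun (u z) s (v z))); last first.
    by apply/funext => z; rewrite normal_pdf_gt0E.
  apply: measurable_funM => //; apply: measurableT_comp => //.
  apply: measurable_funM => //; apply: measurableT_comp => //.
  by apply: measurable_funX; exact: measurable_funB.
have mh : measurable_fun [set: R * R] h.
  apply: emeasurable_funM.
    apply: emeasurable_funM; first exact: (measurableT_comp mf measurable_snd).
    by apply: mpdf => //; apply: measurable_funM => //; exact: measurable_fst.
  exact: mpdf.
have h0 z : (0 <= h z)%E by rewrite /h !mule_ge0 ?lee_fin ?normal_pdf_ge0.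
transitivity (\int[mu]_y \int[mu]_x h (y, x))%E.
  rewrite ge0_integral_gauss; last 2 first.
  - pose k (z : R * R) := f (a * z.2 + b * z.1)%R.
    apply: (@measurable_fun_fubini_tonelli_F _ _ _ _ R gauss k) => //; last by move=> z; exact: f0.
    apply: (measurableT_comp mf); apply: measurable_funD; exact: measurable_funM.
  - by move=> y; apply: integral_ge0.
  apply: eq_integral => y _.
  rewrite ge0_integral_gauss_affine // -ge0_integralZr //.
  - apply: emeasurable_funM => //; apply/measurable_EFinP; exact: measurable_normal_pdf.
  - by move=> x _; rewrite mule_ge0 ?lee_fin ?normal_pdf_ge0.
  - by rewrite lee_fin normal_pdf_ge0.
rewrite (@fubini_tonelli _ _ _ _ R mu mu h) //.
rewrite (_ : (\int[gauss]_x _)%E = (\int[gauss]_x f (c * x + 0)%R)%E); last first.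
  by apply: eq_integral => x _; rewrite addr0.
rewrite ge0_integral_gauss_affine //; apply: eq_integral => x _.
(* After the exchange of integrals the factor in [y] is a normal density and integrates to 1. *)
rewrite /h /=; under eq_integral do rewrite -muleA -EFinM normal_pdf_conv // EFinM muleA.
rewrite ge0_integralZl //.
- by rewrite integral_normal_pdf mule1.
- by apply/measurable_EFinP; exact: measurable_normal_pdf.
- by move=> y _; rewrite lee_fin normal_pdf_ge0.
- by rewrite mule_ge0 ?lee_fin ?normal_pdf_ge0.
Qed.

End density.

(** * Gaussian averages: stability and exponential tilting *)

Section gaussian_operators.
Context {R : realType} (I : finType).
Implicit Types (A : nat -> I -> R) (w : I -> R).

(** A Gaussian vector is kept as a finite sum of columns [A k] times independent standard normals,
    so that a singular covariance needs no density. *)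
Definition column_map (s : R) A (k : nat) (z : R) (i : I) : R := s * A k i * z.

Lemma measurable_column_map s A k i : measurable_fun setT (fun z => column_map s A k z i).
Proof. exact: measurable_funM. Qed.

Let mcol := measurable_column_map.

Lemma gauss_op_conv A k (s t : R) f : 0 < s -> 0 < t -> ufun f ->
  expect_op gauss (column_map t A k) (expect_op gauss (column_map s A k) f) =
  expect_op gauss (column_map (Num.sqrt (s ^+ 2 + t ^+ 2)) A k) f.
Proof.
move=> s0 t0 uf; apply/funext => w; apply: EFin_inj.
have [mf f0] := ufun_EFin uf.
have E r w' : (expect_op gauss (column_map r A k) f w')%:E =
   shift_op gauss (column_map r A k) (EFin \o f) w'.
  by apply: EFin_expect_op_ufun => // i; exact: mcol.
rewrite EFin_expect_op_ufun; last 2 first.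
- by move=> i; exact: mcol.
- by apply: ufun_expect_op => // i; exact: mcol.
rewrite E /shift_op /=; under eq_integral do rewrite E /shift_op /=.
pose h (x : R) := (f (addv w (fun i => A k i * x)))%:E.
have mh : measurable_fun setT h.
  by apply: (@cmeas_translate _ _ _ _ (fun x i => A k i * x) _ _ _ (EFin \o f) w mf) => i; exact: measurable_funM.
have H := ge0_integral_gauss_conv s0 t0 mh (fun x => f0 _).
transitivity (\int[gauss]_y \int[gauss]_x h (s * x + t * y)%R)%E.
  apply: eq_integral => y _; apply: eq_integral => x _; congr (f _)%:E.
  by apply/funext => i; rewrite /addv /column_map; ring.
rewrite H; apply: eq_integral => x _; congr (f _)%:E.
by apply/funext => i; rewrite /addv /column_map; ring.
Qed.

Lemma iter_gauss_op A k n f : (0 < n)%N -> ufun f ->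
  iter n (expect_op gauss (column_map (Num.sqrt n%:R)^-1 A k)) f =
  expect_op gauss (column_map 1 A k) f.
Proof.
move=> n0 uf; set s := (Num.sqrt n%:R)^-1.
have s0 : 0 < s by rewrite invr_gt0 sqrtr_gt0 ltr0n.
have sE : s ^+ 2 = n%:R^-1 by rewrite exprVn sqr_sqrtr // ler0n.
suff H m : iter m.+1 (expect_op gauss (column_map s A k)) f =
    expect_op gauss (column_map (Num.sqrt (m.+1%:R * s ^+ 2)) A k) f.
  rewrite -(prednK n0) H prednK // sE divff ?sqrtr1 //.
  by rewrite pnatr_eq0 -lt0n.
elim: m => [|m IH].
  by rewrite mul1r sqrtr_sqr gtr0_norm.
rewrite iterS IH gauss_op_conv //; last by rewrite sqrtr_gt0 mulr_gt0 // exprn_gt0.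
suff -> : Num.sqrt (m.+1%:R * s ^+ 2) ^+ 2 + s ^+ 2 = m.+2%:R * s ^+ 2 by [].
rewrite sqr_sqrtr; last by rewrite mulr_ge0 // exprn_ge0 // ltW.
by rewrite -[m.+2%:R]natr1 mulrDl mul1r.
Qed.

Lemma ufun_gauss_ops s A k f : ufun f -> ufun (expect_ops gauss (column_map s A) k f).
Proof. by move=> uf; apply: ufun_expect_ops => // j i; exact: mcol. Qed.

Lemma ufun_gauss_op s A k f : ufun f -> ufun (expect_op gauss (column_map s A k) f).
Proof. by move=> uf; apply: ufun_expect_op => // i; exact: mcol. Qed.

(** A Gaussian vector is a sum of [n] independent copies of itself scaled by [1 / sqrt n], which is
    what allows term-by-term exchange with a sample of size [n]. For operators: a power of a product
    of commuting factors is the product of their powers. *)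
Lemma iter_gauss_ops A k n f : (0 < n)%N -> ufun f ->
  iter n (expect_ops gauss (column_map (Num.sqrt n%:R)^-1 A) k) f =
  expect_ops gauss (column_map 1 A) k f.
Proof.
move=> n0; set s := (Num.sqrt n%:R)^-1.
have ui m g j : ufun g -> ufun (iter m (expect_op gauss (column_map s A j)) g).
  by move=> ug; elim: m => //= m IH; exact: ufun_gauss_op.
have comm1 j k' g : ufun g ->
    expect_op gauss (column_map s A j) (expect_ops gauss (column_map s A) k' g) =
    expect_ops gauss (column_map s A) k' (expect_op gauss (column_map s A j) g).
  elim: k' g => //= k' IH g ug; rewrite IH; last exact: ufun_gauss_op.
  by congr (expect_ops _ _ _ _); apply: expect_op_comm => // i; exact: mcol.
elim: k f => [|k IH] f uf /=; first by elim: n {n0 s ui comm1} => //= n ->.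
rewrite -(iter_gauss_op A k n0 uf) -IH; last exact: ui.
rewrite -/s.
suff H m : iter m (fun f0 => expect_ops gauss (column_map s A) k
      (expect_op gauss (column_map s A k) f0)) f =
    iter m (expect_ops gauss (column_map s A) k)
      (iter m (expect_op gauss (column_map s A k)) f) by exact: H.
elim: m => //= m ->; congr (expect_ops _ _ _ _).
have H p : expect_op gauss (column_map s A k) (iter p (expect_ops gauss (column_map s A) k)
    (iter m (expect_op gauss (column_map s A k)) f)) =
   iter p (expect_ops gauss (column_map s A) k)
     (iter m.+1 (expect_op gauss (column_map s A k)) f).
  elim: p => //= p IHp; rewrite comm1; last first.
    by elim: p {IHp} => /= [|p IHp]; [exact: ui|exact: ufun_gauss_ops].
  by rewrite IHp.
exact: H.
Qed.

Lemma shift_opsZ d (S : measurableType d) (mu : probability S R)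
    (g : nat -> S -> I -> R) k (r : R) (f : (I -> R) -> \bar R) w :
  (forall k i, measurable_fun setT (fun x => g k x i)) ->
  0 <= r -> cmeas f -> (forall w, 0 <= f w)%E ->
  (shift_ops mu g k (fun w => r%:E * f w) w = r%:E * shift_ops mu g k f w)%E.
Proof.
move=> mg r0; elim: k f => //= k IH f mf f0.
rewrite (_ : shift_op mu (g k) _ = (fun w => r%:E * shift_op mu (g k) f w)%E).
  by apply: IH; [exact: cmeas_shift_op|move=> w'; exact: shift_op_ge0].
apply/funext => w'; rewrite /shift_op ge0_integralZl //; exact: cmeas_translate.
Qed.

Lemma shift_ops_translate d (S : measurableType d) (mu : probability S R)
    (g : nat -> S -> I -> R) k (v : I -> R) (f : (I -> R) -> \bar R) w :
  shift_ops mu g k (fun w => f (addv w v)) w = shift_ops mu g k f (addv w v).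
Proof.
elim: k f w => //= k IH f w; rewrite -IH; congr (shift_ops _ _ _ _ _).
apply/funext => w'; apply: eq_integral => x _; congr f.
by apply/funext => i; rewrite /addv addrAC.
Qed.

Definition gram A (k : nat) (i j : I) : R := \sum_(m < k) A m i * A m j.

(* Cameron-Martin: exponential tilting of a Gaussian vector along a coordinate
   is a translation by the corresponding column of its covariance. *)
Lemma gauss_ops_tilt A k (t : R) (j : I) (f : (I -> R) -> \bar R) w :
  cmeas f -> (forall w, 0 <= f w)%E ->
  (shift_ops gauss (column_map 1 A) k (fun w => f w * (expR (t * w j)%R)%:E) w =
   (expR (t * w j + t ^+ 2 * gram A k j j / 2)%R)%:E *
   shift_ops gauss (column_map 1 A) k f (addv w (fun i => t * gram A k i j)%R))%E.
Proof.
have mc m i : measurable_fun setT (fun z => column_map 1 A m z i) by exact: mcol.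
elim: k f w => /= [|k IH] f w mf f0.
  rewrite /gram !big_ord0 mulr0 mul0r addr0 muleC; congr (_ * f _)%E.
  by apply/funext => i; rewrite /addv big_ord0 mulr0 addr0.
pose r := t * A k j.
have mt f' : cmeas f' -> cmeas (fun w => (f' w * (expR (t * w j)%R)%:E)%E).
  move=> mf' d T v mv; apply: emeasurable_funM; first exact: mf'.
  apply/measurable_EFinP; apply: (measurableT_comp (@measurable_expR R)).
  exact: measurable_funM.
pose f1 := fun w => ((expR (r ^+ 2 / 2)%R)%:E *
   shift_op gauss (column_map 1 A k) f (addv w (fun i => r * A k i)%R))%E.
have mop : cmeas (shift_op gauss (column_map 1 A k) f).
  by apply: cmeas_shift_op => // i; exact: mc.
have op0 w' : (0 <= shift_op gauss (column_map 1 A k) f w')%E by exact: shift_op_ge0.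
have mtr (v : I -> R) (f' : (I -> R) -> \bar R) : cmeas f' -> cmeas (fun w => f' (addv w v)).
  by move=> mf' d T u mu'; apply: mf' => i; exact: measurable_funD.
rewrite (_ : shift_op _ _ _ = (fun w => f1 w * (expR (t * w j)%R)%:E)%E).
  rewrite IH; last 2 first.
  - move=> d T v mv; apply: emeasurable_funM => //.
    exact: (mtr _ _ mop).
  - by move=> w'; rewrite mule_ge0 ?lee_fin ?expR_ge0.
  have mf1 := mtr (fun i => r * A k i) _ mop.
  rewrite /f1 shift_opsZ ?expR_ge0 //.
  have e1 : t * w j + t ^+ 2 * gram A k j j / 2 + r ^+ 2 / 2 =
      t * w j + t ^+ 2 * gram A k.+1 j j / 2.
    by rewrite /gram big_ord_recr /= /r; field.
  have e2 : addv (addv w (fun i => t * gram A k i j)) (fun i => r * A k i) =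
      addv w (fun i => t * gram A k.+1 i j).
    by apply/funext => i; rewrite /addv /gram big_ord_recr /= /r; ring.
  by rewrite shift_ops_translate muleA -EFinM -expRD e1 e2.
apply/funext => w'; rewrite /f1 /shift_op.
pose h (x : R) := f (addv w' (column_map 1 A k x)).
have mh : measurable_fun setT h by apply: cmeas_translate => // i; exact: mc.
have h0 x : (0 <= h x)%E by exact: f0.
have := @ge0_integral_gauss_shift R r h mh h0 => H.
rewrite (_ : (\int[gauss]_x f (addv (addv w' _) _))%E = (\int[gauss]_x h (x + r)%R)%E); last first.
  apply: eq_integral => x _; congr f; apply/funext => i.
  by rewrite /addv /column_map; ring.
rewrite H -muleA [X in (_ * X)%E]muleC muleA -EFinM -ge0_integralZl //; last 2 first.
- apply: emeasurable_funM => //; apply/measurable_EFinP.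
  apply: (measurableT_comp (@measurable_expR R)).
  by apply: measurable_funB => //; exact: measurable_funM.
- by move=> x _; rewrite mule_ge0 ?lee_fin ?expR_ge0.
apply: eq_integral => x _; rewrite muleCA; congr (_ * _)%E.
rewrite -EFinM -expRD -expRD; congr (expR _)%:E.
by rewrite /addv /column_map /r; field.
Qed.

End gaussian_operators.

Lemma le_shift_ops {R : realType} (I : finType) d (S : measurableType d)
    (mu : probability S R) (g : nat -> S -> I -> R) k
    (f1 f2 : (I -> R) -> \bar R) w :
  (forall k i, measurable_fun setT (fun x => g k x i)) ->
  cmeas f1 -> cmeas f2 -> (forall w, 0 <= f1 w)%E ->
  (forall w, f1 w <= f2 w)%E ->
  (shift_ops mu g k f1 w <= shift_ops mu g k f2 w)%E.
Proof.
move=> mg; elim: k f1 f2 => //= k IH f1 f2 m1 m2 f10 f12.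
have f20 w' : (0 <= f2 w')%E by exact: le_trans (f12 w').
apply: IH; [exact: cmeas_shift_op|exact: cmeas_shift_op|..].
  by move=> w'; exact: shift_op_ge0.
move=> w'; apply: ge0_le_integral => //; exact: cmeas_translate.
Qed.

Lemma shift_ops_ge0 {R : realType} (I : finType) d (S : measurableType d)
    (mu : probability S R) (g : nat -> S -> I -> R) k (f : (I -> R) -> \bar R) w :
  (forall w, 0 <= f w)%E -> (0 <= shift_ops mu g k f w)%E.
Proof.
by elim: k f => //= k IH f f0; apply: IH => w'; exact: shift_op_ge0.
Qed.

Section gaussian_functional.
Context {R : realType} (I : finType) (A : nat -> I -> R) (k : nat).

Definition gauss_mean (f : (I -> R) -> R) : R :=
  expect_ops gauss (column_map 1 A) k f (fun=> 0).

Let mc m i : measurable_fun setT (fun z => column_map 1 A m z i).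
Proof. exact: measurable_column_map. Qed.

Lemma averaging_gauss_mean : averaging gauss_mean.
Proof.
rewrite /gauss_mean; elim: k => [|k' IH]; first exact: averaging_at.
exact: (@averaging_expect_op _ _ (fun f => expect_ops gauss (column_map 1 A) k' f (fun=> 0))).
Qed.

Lemma EFin_gauss_mean f : ufun f ->
  (gauss_mean f)%:E = shift_ops gauss (column_map 1 A) k (EFin \o f) (fun=> 0).
Proof.
rewrite /gauss_mean; elim: k f => //= k' IH f uf.
rewrite IH; last exact: ufun_gauss_op.
congr (shift_ops _ _ _ _ _); apply/funext => w' /=.
by rewrite EFin_expect_op_ufun.
Qed.

(** Translating by [t] times column [j] of the covariance costs the factor [expR (t * w j)], at most
    [expR (t * M)] where [f2] does not vanish. The normalization [expR (t ^+ 2 * gram A k j j / 2)]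
    is at least 1 and works in the right direction. *)
Lemma gauss_mean_tilt_le (f1 f2 : (I -> R) -> R) (t M : R) (j : I) :
  ufun f1 -> ufun f2 -> 0 <= t ->
  (forall y, f1 y <= f2 (addv y (fun i => t * gram A k i j))) ->
  (forall y, M < y j -> f2 y = 0) ->
  gauss_mean f1 <= expR (t * M) * gauss_mean f2.
Proof.
move=> u1 u2 t0 f12 f2M.
rewrite -lee_fin EFinM !EFin_gauss_mean //.
have [m1 p1] := ufun_EFin u1; have [m2 p2] := ufun_EFin u2.
have m2t : cmeas (fun w => ((EFin \o f2) w * (expR (t * w j)%R)%:E)%E).
  move=> d T v mv; apply: emeasurable_funM; first exact: m2.
  apply/measurable_EFinP; apply: (measurableT_comp (@measurable_expR R)).
  exact: measurable_funM.
pose v := (fun i => t * gram A k i j).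
have m2v : cmeas (fun w => (EFin \o f2) (addv w v)).
  by move=> d T u mu'; apply: m2 => i; exact: measurable_funD.
have T := @gauss_ops_tilt R I A k t j _ (fun=> 0) m2 p2.
rewrite mulr0 add0r in T.
have g0 : 0 <= gram A k j j.
  by apply: sumr_ge0 => m _; rewrite -expr2 sqr_ge0.
pose z0 : I -> R := fun=> 0.
have L1 : (shift_ops gauss (column_map 1 A) k (EFin \o f1) z0 <=
    (expR (t ^+ 2 * gram A k j j / 2))%:E *
    shift_ops gauss (column_map 1 A) k (EFin \o f2) (addv z0 v))%E.
  rewrite -shift_ops_translate.
  apply: (@le_trans _ _ (shift_ops gauss (column_map 1 A) k (fun w => (EFin \o f2) (addv w v)) z0)).
    by apply: le_shift_ops => // w; rewrite lee_fin; exact: f12.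
  rewrite -[leLHS]mul1e; apply: lee_wpmul2r; first by apply: shift_ops_ge0.
  by rewrite lee_fin -expR0 ler_expR mulr_ge0 // mulr_ge0 // sqr_ge0.
apply: (le_trans L1); rewrite -T -shift_opsZ ?expR_ge0 //.
apply: le_shift_ops => //.
- by move=> d T' u mu'; apply: emeasurable_funM => //; exact: m2.
- by move=> w; apply: mule_ge0; [exact: p2|rewrite lee_fin expR_ge0].
move=> w /=; have [wM|wM] := ltP M (w j); first by rewrite (f2M _ wM) mul0e mule0.
have fw : 0 <= f2 w by case: u2 => _ /(_ w) /andP[].
rewrite -!EFinM lee_fin mulrC; apply: ler_wpM2r => //.
by rewrite ler_expR; exact: ler_wpM2l.
Qed.

Definition above (j : I) (a : R) (w : I -> R) : R := if a < w j then 1 else 0.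

Lemma ufun_above j a : ufun (above j a).
Proof.
split; last by move=> w; rewrite /above; case: ifP; rewrite ?lexx ler01.
move=> d T v mv; rewrite /above.
by apply: measurable_fun_ifT => //; exact: measurable_fun_ltr.
Qed.

Lemma gauss_mean_mgf (t : R) (j : I) :
  shift_ops gauss (column_map 1 A) k (fun w => (expR (t * w j)%R)%:E) (fun=> 0) =
  (expR (t ^+ 2 * gram A k j j / 2))%:E.
Proof.
have m1 : @cmeas R I _ (\bar R) (fun=> 1%E).
  move=> d T v mv /=; exact: measurable_cst.
have := @gauss_ops_tilt R I A k t j (fun=> 1%E) (fun=> 0) m1 (fun=> lee01).
rewrite mulr0 add0r => T.
rewrite (_ : (fun w => _) = (fun w => (1 * (expR (t * w j)%R)%:E)%E)); last first.
  by apply/funext => w; rewrite mul1e.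
rewrite T (_ : shift_ops _ _ _ (fun=> 1%E) _ = 1%E) ?mule1 //.
elim: k (addv _ _) => //= k' IH w'.
rewrite (_ : shift_op _ _ _ = (fun=> 1%E)) //; apply/funext => w''.
rewrite /shift_op integral_cst // mul1e; exact: (@probability_setT _ _ _ gauss).
Qed.

(** Chernoff's bound at the optimal [t = a / gram A k j j]. *)
Lemma gauss_tail (j : I) (a : R) : 0 <= a -> 0 < gram A k j j ->
  gauss_mean (above j a) <= expR (- (a ^+ 2 / (2 * gram A k j j))).
Proof.
move=> a0 g0; pose t := a / gram A k j j.
have t0 : 0 <= t by rewrite divr_ge0 // ltW.
rewrite -lee_fin EFin_gauss_mean; last exact: ufun_above.
have mt : cmeas (fun w : I -> R => (expR (t * w j)%R)%:E).
  move=> d T v mv; apply/measurable_EFinP; apply: (measurableT_comp (@measurable_expR R)).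
  exact: measurable_funM.
rewrite (_ : expR _ = expR (- (t * a)) * expR (t ^+ 2 * gram A k j j / 2)); last first.
  by rewrite -expRD; congr expR; rewrite /t; field; rewrite gt_eqF.
rewrite EFinM -gauss_mean_mgf -shift_opsZ ?expR_ge0 //.
have [ma pa] := ufun_EFin (ufun_above j a).
apply: le_shift_ops => //.
  move=> d T v mv; apply: emeasurable_funM => //; exact: mt.
move=> w /=; rewrite -EFinM lee_fin -expRD /above; case: ifPn => [aw|_]; last exact: expR_ge0.
by rewrite -expR0 ler_expR addrC -mulrBr mulr_ge0 // subr_ge0 ltW.
Qed.

End gaussian_functional.

(** * Anti-concentration of Gaussian orthant probabilities *)

Section nazarov.
Context {R : realType} (I : finType) (A : nat -> I -> R) (k : nat).
Let G := gram A k.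
Variables (b l : R).
Hypotheses (b_gt0 : 0 < b) (Gb : forall i, b <= G i i).
Hypotheses (l_ge1 : 1 <= l) (card_le : ln #|I|%:R <= l).

Let sd i := Num.sqrt (G i i).
Let G_gt0 i : 0 < G i i. Proof. exact: lt_le_trans (Gb i). Qed.
Let sd_gt0 i : 0 < sd i. Proof. by rewrite sqrtr_gt0. Qed.
Let sdK i : sd i ^+ 2 = G i i. Proof. by rewrite sqr_sqrtr // ltW. Qed.
Let sd_ge i : Num.sqrt b <= sd i. Proof. exact: ler_wsqrtr. Qed.

Lemma gram_cauchy_schwarz i j : G i j <= sd i * sd j.
Proof.
have : 0 <= \sum_(m < k) (sd j * A m i - sd i * A m j) ^+ 2.
  by apply: sumr_ge0 => m _; exact: sqr_ge0.
rewrite (_ : \sum_(m < k) _ = sd j ^+ 2 * G i i - 2 * (sd i * sd j) * G i j + sd i ^+ 2 * G j j).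
  rewrite !sdK -!sdK => h.
  have p : 0 < sd i * sd j by rewrite mulr_gt0.
  rewrite -(ler_pM2l p); move: h; nra.
rewrite /G /gram !mulr_sumr -sumrB -big_split /=; apply: eq_bigr => m _; ring.
Qed.

Variable c : I -> R.
(** A standardized threshold above [T] is exceeded with probability at most [expR (- (2 * l))],
    small even after summation over at most [expR l] coordinates. *)
Let T := 2 * Num.sqrt l.
Let z i := c i / sd i.
Let near i := z i <= T.
Let v i (w : I -> R) := w i / sd i - z i.

Let box (t : R) (w : I -> R) : R := [forall i, near i ==> (v i w <= t)]%:R.

(** The layer between [t] and [t + e] is split by the near coordinate where [v] is largest; ties go
    to the lowest rank, so the pieces are disjoint. *)
Let top (e t : R) (i : I) (w : I -> R) : R :=
  [&& near i, t < v i w, v i w <= t + e & [forall j, near j ==>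
    (if (enum_rank j < enum_rank i)%N then v j w < v i w else v j w <= v i w)]]%:R.

Let measurable_natr d (S : measurableType d) (p : S -> bool) :
  measurable_fun setT p -> measurable_fun setT (fun x => (p x)%:R : R).
Proof.
move=> mp; rewrite (_ : (fun x => _) = (fun x => if p x then 1 else 0)).
  exact: measurable_fun_ifT.
by apply/funext => x; case: (p x).
Qed.

Let measurable_all d (S : measurableType d) (p : I -> S -> bool) :
  (forall i, measurable_fun setT (p i)) ->
  measurable_fun setT (fun x => [forall i, p i x]).
Proof.
move=> mp; rewrite (_ : (fun x => _) = (fun x => all (fun i => p i x) (enum I))).
  elim: (enum I) => [|i s IH] /=; first exact: measurable_cst.
  exact: measurable_and.
apply/funext => x; apply/forallP/allP => [h i _|h i]; first exact: h.
by apply: h; rewrite mem_enum.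
Qed.

Let measurable_v d (S : measurableType d) (u : I -> S -> R) i :
  (forall i, measurable_fun setT (u i)) ->
  measurable_fun setT (fun x => v i (u^~ x)).
Proof. by move=> mu; apply: measurable_funB => //; exact: measurable_funM. Qed.

Let le_natb (p q : bool) : (p -> q) -> p%:R <= q%:R :> R.
Proof. by case: p q => [] [] // /(_ isT). Qed.

Let ufun_box t : ufun (box t).
Proof.
split; last by move=> w; rewrite /box; case: [forall i, _]; rewrite ?lexx ler01.
move=> d S u mu; apply: measurable_natr; apply: measurable_all => i.
case: (near i); last exact: measurable_cst.
by apply: measurable_fun_ler => //; exact: measurable_v.
Qed.

Let ufun_top e t i : ufun (top e t i).
Proof.
split; last by move=> w; rewrite /top; case: [&& _, _, _ & _]; rewrite ?lexx ler01.
move=> d S u mu; apply: measurable_natr.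
apply: measurable_and; first exact: measurable_cst.
apply: measurable_and; first by apply: measurable_fun_ltr => //; exact: measurable_v.
apply: measurable_and; first by apply: measurable_fun_ler => //; exact: measurable_v.
apply: measurable_all => j.
case: (near j); last exact: measurable_cst.
have mi := measurable_v i mu; have mj := measurable_v j mu.
by case: (enum_rank j < enum_rank i)%N => /=; [exact: measurable_fun_ltr|exact: measurable_fun_ler].
Qed.

Let box_le t e w : 0 <= e -> box t w <= box (t + e) w.
Proof.
move=> e0; apply: le_natb => /forallP h.
by apply/forallP => i; apply/implyP => /(implyP (h i)); move: e0; lra.
Qed.

Let box_top e t w : 0 <= e -> box (t + e) w - box t w <= \sum_i top e t i w.
Proof.
move=> e0.
have t0 : 0 <= \sum_i top e t i w by apply: sumr_ge0 => i _; exact: ler0n.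
have b0 : 0 <= box t w by exact: ler0n.
rewrite {1}/box; case: forallP => [h|_] /=; last by move: t0 b0; lra.
rewrite {1}/box; case: (boolP [forall i, near i ==> (v i w <= t)]) => [_|].
  by rewrite subrr.
rewrite negb_forall => /existsP[i1]; rewrite negb_imply -ltNge => /andP[n1 v1].
(* [i2] attains the maximum, and [i3] is the first coordinate with the same value, as the tie rule
   demands. *)
pose i2 := [arg max_(i > i1 | near i) v i w]%O.
have [n2 m2] : near i2 /\ forall j, near j -> v j w <= v i2 w.
  by rewrite /i2; case: Order.TotalTheory.arg_maxP => // i ni mi; split.
pose i3 := [arg min_(i < i2 | near i && (v i w == v i2 w)) enum_rank i].
have [n3 /eqP v3 m3] : [/\ near i3, v i3 w == v i2 w &
    forall j, near j -> v j w = v i2 w -> (enum_rank i3 <= enum_rank j)%N].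
  rewrite /i3; case: arg_minnP; first by rewrite n2 eqxx.
  by move=> i /andP[ni vi] mi; split => // j nj vj; apply: mi; rewrite nj vj eqxx.
rewrite (bigD1 i3) //= {1}/top n3 v3.
have -> : t < v i2 w by apply: lt_le_trans v1 _; exact: m2.
have -> /= : v i2 w <= t + e by apply: (implyP (h i2)).
have -> : [forall j, near j ==>
   (if (enum_rank j < enum_rank i3)%N then v j w < v i2 w else v j w <= v i2 w)].
  apply/forallP => j; apply/implyP => nj; case: ifPn => [jlt|_]; last exact: m2.
  rewrite lt_neqAle m2 // andbT; apply/eqP => vj.
  by have := m3 j nj vj; rewrite leqNgt jlt.
by rewrite subr0 lerDl; apply: sumr_ge0 => i _; exact: ler0n.
Qed.

Let top_box e t w : 0 <= e -> \sum_i top e t i w <= box (t + e) w - box t w.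
Proof.
move=> e0; have := box_le t w e0; rewrite -subr_ge0 => bb.
have [/existsP[i ti]|] := boolP [exists i, top e t i w != 0]; last first.
  rewrite negb_exists => /forallP h; rewrite big1 // => i _.
  by apply/eqP; have := h i; rewrite negbK.
have {ti} : top e t i w = 1.
  by move: ti; rewrite /top; case: [&& _, _, _ & _]; rewrite ?eqxx.
rewrite {1}/top; case: (boolP [&& _, _, _ & _]) => [|_ /esym/eqP]; last by rewrite oner_eq0.
move=> /and4P[ni tv vt /forallP m] _.
rewrite (bigD1 i) //= [X in _ + X <= _]big1 ?addr0; last first.
  move=> j ji; rewrite /top; case: (boolP [&& _, _, _ & _]) => // /and4P[nj _ _ /forallP mj].
  have := implyP (m j) nj; have := implyP (mj i) ni.
  case: ltnP => h1; case: ltnP => h2 h3 h4; try by move: h3 h4; lra.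
  move: ji; rewrite -(inj_eq enum_rank_inj) -(inj_eq val_inj) /= eqn_leq.
  by rewrite h1 h2.
rewrite /box; case: (boolP [forall i, near i ==> (v i w <= t)]) => [/forallP h|_].
  by have := implyP (h i) ni; move: tv; lra.
case: (boolP [forall i, near i ==> (v i w <= t + e)]) => [_|].
  by rewrite subr0 /top; case: [&& _, _, _ & _]; rewrite ?ler01.
rewrite negb_forall => /existsP[j]; rewrite negb_imply => /andP[nj].
have := implyP (m j) nj; case: ifP => _; move: vt; lra.
Qed.

Let mean := gauss_mean A k.
Let am : averaging mean. Proof. exact: averaging_gauss_mean. Qed.

(** The tilt [t / sd i] along [i] raises [v i] by [t] and, by Cauchy-Schwarz, no other standardized
    coordinate by more, so [i] stays maximal. On the target layer [w i] is at most
    [sd i * (T + t + e)]; the cost is [expR (t * (T + t + e))], and [t + e <= T^-1] keeps this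
    exponent below 2. *)
Let shift_top e t i : 0 <= e -> 0 <= t -> t + e <= T^-1 ->
  mean (top e 0 i) <= expR 2 * mean (top e t i).
Proof.
move=> e0 t0 te.
have T2 : 2 <= T.
  by rewrite /T ler_peMr // -[leLHS]sqrtr1 ler_wsqrtr.
have T0 : 0 < T by apply: lt_le_trans T2.
have m0 : 0 <= mean (top e t i).
  have [_ _ HC AL] := am; rewrite -[leLHS](HC 0); apply: AL; first exact: bfun_cst.
    by apply: ufun_bfun; exact: ufun_top.
  by move=> w; exact: ler0n.
have ts : 0 <= t / sd i by rewrite divr_ge0 // ltW.
have := @gauss_mean_tilt_le R I A k (top e 0 i) (top e t i) (t / sd i)
  (sd i * (T + t + e)) i (ufun_top e 0 i) (ufun_top e t i) ts.
rewrite -/G -/mean => H.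
have [ni|ni] := boolP (near i); last first.
  have E s : top e s i = fun=> 0.
    by apply/funext => w; rewrite /top (negbTE ni).
  rewrite !E; have [_ _ HC _] := am; by rewrite HC mulr0.
apply: le_trans (H _ _) _; last 1 first.
- apply: ler_wpM2r => //; rewrite ler_expR mulrA divfK ?gt_eqF //.
  have Ti : T^-1 * T = 1 by rewrite mulVf // gt_eqF.
  have h1 : t * T <= 1.
    rewrite -Ti ler_wpM2r //; first exact: ltW.
    by move: te e0; lra.
  have h3 : T^-1 <= 2^-1 by rewrite lef_pV2 ?posrE.
  have h4 : t + e <= 2^-1 by exact: le_trans te h3.
  have : t * (t + e) <= 2^-1 * 2^-1 by apply: ler_pM => //; move: h4 t0 e0; lra.
  by move: h1 h4; rewrite -addrA mulrDr; lra.
- move=> y.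
  have vs j : v j (addv y (fun i' => t / sd i * G i' i)) = v j y + t * (G j i / (sd i * sd j)).
    by rewrite /v /addv; field; rewrite !gt_eqF.
  have vi : v i (addv y (fun i' => t / sd i * G i' i)) = v i y + t.
    by rewrite vs -sdK expr2 divff ?mulr1 // mulf_neq0 // gt_eqF.
  have vj j : v j (addv y (fun i' => t / sd i * G i' i)) <= v j y + t.
    rewrite vs lerD2l ler_piMr // ler_pdivrMr ?mulr_gt0 // mul1r mulrC.
    exact: gram_cauchy_schwarz.
  apply: le_natb => /and4P[_ v0 ve /forallP m].
  rewrite ni vi /=; apply/and3P; split; [move: v0; lra|move: ve; lra|].
  apply/forallP => j; apply/implyP => nj; have := implyP (m j) nj; have := vj j.
  by case: ifP => _; lra.
- move=> y yM; rewrite /top.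
  suff : t + e < v i y by move=> h; rewrite [v i y <= _]leNgt h /= !andbF.
  have : T + t + e < y i / sd i by rewrite ltr_pdivlMr // mulrC.
  by move: ni; rewrite /near /v; lra.
Qed.

Let box_increment e t : 0 <= e -> 0 <= t -> t + e <= T^-1 ->
  mean (box e) - mean (box 0) <= expR 2 * (mean (box (t + e)) - mean (box t)).
Proof.
move=> e0 t0 te; have [AD AZ HC AL] := am.
have bb s : bfun (box s) by apply: ufun_bfun; exact: ufun_box.
have bt s i : bfun (top e s i) by apply: ufun_bfun; exact: ufun_top.
have S s (r : seq I) : bfun (fun w => \sum_(i <- r) top e s i w) /\
    mean (fun w => \sum_(i <- r) top e s i w) = \sum_(i <- r) mean (top e s i).
  elim: r => [|i r [br IH]].
    under eq_fun do rewrite big_nil; rewrite big_nil; split; [exact: bfun_cst|exact: HC].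
  under eq_fun do rewrite big_cons; rewrite big_cons -IH.
  by split; [exact: bfunD|exact: AD].
rewrite -!averagingB //.
have [b1 S1] := S 0 (index_enum I); have [b2 S2] := S t (index_enum I).
apply: (@le_trans _ _ (mean (fun w => \sum_i top e 0 i w))).
  apply: AL => //; first exact: bfunB.
  by move=> w; have := box_top 0 w e0; rewrite add0r.
apply: (@le_trans _ _ (expR 2 * mean (fun w => \sum_i top e t i w))); last first.
  rewrite ler_wpM2l ?expR_ge0 //; apply: AL => //; first exact: bfunB.
  by move=> w; exact: top_box.
rewrite S1 S2 mulr_sumr; apply: ler_sum => i _; exact: shift_top.
Qed.

Let mean_box01 s : 0 <= mean (box s) <= 1.
Proof.
have [_ _ HC AL] := am; have bb : bfun (box s) by apply: ufun_bfun; exact: ufun_box.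
apply/andP; split; [rewrite -[leLHS](HC 0)|rewrite -[leRHS](HC 1)];
  apply: AL => //; try exact: bfun_cst; move=> w; rewrite /box;
  by case: [forall i, _]; rewrite ?lexx ?ler01.
Qed.

(** About [1 / (T * e)] disjoint layers of width [e] fit below [T^-1]; each has at least
    [expR (- 2)] times the probability of the first, and together at most 1. If none fits, the
    right-hand side exceeds 1. *)
Let box_small e : 0 < e -> mean (box e) - mean (box 0) <= expR 2 * (2 * T * e).
Proof.
move=> e0.
have T0 : 0 < T by rewrite mulr_gt0 // sqrtr_gt0 (lt_le_trans ltr01).
have Te : 0 < T * e by rewrite mulr_gt0.
have e21 : 1 <= expR 2 :> R by rewrite -expR0 ler_expR.
have /andP[h0 h1] := mean_box01 e; have /andP[h2 h3] := mean_box01 0.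
have [big|small] := lerP 1 (T * e).
  apply: (@le_trans _ _ (1 * 1)); first by rewrite mul1r; move: h0 h1 h2; lra.
  by apply: ler_pM => //; move: big; lra.
pose K := Num.truncn (T * e)^-1.
have iTe : 0 <= (T * e)^-1 by rewrite invr_ge0 ltW.
have K1 : K%:R <= (T * e)^-1 by have := truncn_itv iTe => /andP[].
have K2 : (T * e)^-1 < K.+1%:R by have := truncn_itv iTe => /andP[].
have Kge1 : 1 <= K%:R :> R.
  rewrite ler1n lt0n; apply/eqP => K0; move: K2; rewrite K0 => h.
  have := ltr_pM2r Te (T * e)^-1 1; rewrite mulVf ?gt_eqF // h mul1r => /esym.
  by move: small; lra.
have N : forall m : nat, (m <= K)%N ->
    m%:R * (mean (box e) - mean (box 0)) <= expR 2 * (mean (box (m%:R * e)) - mean (box 0)).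
  elim=> [_|m IH mK]; first by rewrite !mul0r subrr mulr0.
  have h4 := IH (ltnW mK).
  have me : 0 <= m%:R * e by rewrite mulr_ge0 // ltW.
  have h5 : m%:R * e + e <= T^-1.
    have : m.+1%:R <= (T * e)^-1 by apply: le_trans K1; rewrite ler_nat.
    rewrite -natr1 invfM => h; have := ler_wpM2r (ltW e0) h.
    by rewrite -mulrA mulVf ?gt_eqF // mulr1 mulrDl mul1r.
  have := box_increment (ltW e0) me h5.
  rewrite -[m.+1%:R]natr1 !mulrDl !mul1r; move: h4; lra.
have := N K (leqnn K); have /andP[h4 h5] := mean_box01 (K%:R * e).
have : expR 2 * (mean (box (K%:R * e)) - mean (box 0)) <= expR 2 * 1.
  by rewrite ler_wpM2l ?expR_ge0 //; lra.
rewrite mulr1 => h6 h7; have h8 := le_trans h7 h6.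
have K3 : 1 <= K%:R * (2 * (T * e)).
  have : 1 < K.+1%:R * (T * e) by rewrite -ltr_pdivrMr // div1r.
  by rewrite -natr1; move: Kge1 Te; nra.
rewrite -(@ler_pM2l _ K%:R) ?(lt_le_trans ltr01) //; apply: le_trans h8 _.
rewrite mulrCA ler_peMr ?expR_ge0 //; by rewrite -mulrA.
Qed.

(* Coordinates with a large standardized threshold are handled by Chernoff
   bounds.  For the others, the increment of the box is split according to the
   coordinate attaining the maximum; by Cameron-Martin, moving the threshold up by
   m steps changes the probability of such a layer at most by a bounded factor,
   and the layers for different m are disjoint. *)
Lemma nazarov (a : R) : 0 < a ->
  mean (below (raise c a)) - mean (below c) <=
  4 * expR 2 * Num.sqrt l / Num.sqrt b * a + expR (- l).
Proof.
move=> a0; have [AD AZ HC AL] := am.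
have sb0 : 0 < Num.sqrt b by rewrite sqrtr_gt0.
(* Standard deviations are at least [sqrt b], so a shift by [a] moves every standardized coordinate
   by at most [e]. *)
pose e := a / Num.sqrt b; have e0 : 0 < e by rewrite divr_gt0.
have bb (c' : I -> R) : bfun (below c') by apply: ufun_bfun; exact: ufun_below.
have bx s : bfun (box s) by apply: ufun_bfun; exact: ufun_box.
have ba (i : I) : bfun (above i (c i)) by apply: ufun_bfun; exact: ufun_above.
pose far := [seq i <- enum I | ~~ near i].
have S (r : seq I) : bfun (fun w => \sum_(i <- r) above i (c i) w) /\
    mean (fun w => \sum_(i <- r) above i (c i) w) = \sum_(i <- r) mean (above i (c i)).
  elim: r => [|i r [br IH]].
    under eq_fun do rewrite big_nil; rewrite big_nil; split; [exact: bfun_cst|exact: HC].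
  under eq_fun do rewrite big_cons; rewrite big_cons -IH.
  by split; [exact: bfunD|exact: AD].
have [bS ES] := S far.
have split_near w : below (raise c a) w - below c w <=
    (box e w - box 0 w) + \sum_(i <- far) above i (c i) w.
  have a01 i : 0 <= above i (c i) w by rewrite /above; case: ifP.
  have s0 : 0 <= \sum_(i <- far) above i (c i) w by apply: sumr_ge0 => i _.
  have := box_le 0 w (ltW e0); rewrite add0r => bl.
  have [[-> ha]|[-> _]] := belowP (raise c a) w; last first.
    by have /andP[h _] := below01 c w; move: h s0 bl; lra.
  have [[-> _]|[-> [i hi]]] := belowP c w; first by move: s0 bl; lra.
  have [ni|ni] := boolP (near i); last first.
    have : 1 <= \sum_(i <- far) above i (c i) w.
      rewrite (big_rem i) /=; last by rewrite mem_filter ni mem_enum.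
      rewrite {1}/above hi lerDl; apply: sumr_ge0 => j _; exact: a01.
    by move: bl; lra.
  have -> : box 0 w = 0.
    rewrite /box; case: forallP => // h; have := implyP (h i) ni.
    rewrite /v /z -mulrBl pmulr_lle0 ?invr_gt0 //; move: hi; lra.
  have -> : box e w = 1.
    rewrite /box; case: forallP => // h; exfalso; apply: h => j; apply/implyP => _.
    rewrite /v /z -mulrBl /e ler_pdivrMr // mulrAC ler_pdivlMr //.
    apply: (@le_trans _ _ (a * Num.sqrt b)).
      by apply: ler_wpM2r; [exact: ltW|have := ha j; rewrite /raise; lra].
    by rewrite ler_wpM2l // ltW.
  by move: s0; lra.
have bxe : bfun (fun w => box e w - box 0 w) by exact: bfunB.
rewrite -averagingB //.
apply: le_trans (AL _ _ _ _ split_near) _; [exact: bfunB|exact: bfunD|].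
rewrite AD // averagingB // ES; apply: lerD.
  apply: le_trans (box_small e0) _; rewrite /T /e le_eqVlt; apply/orP; left.
  by apply/eqP; field; rewrite gt_eqF.
have fi i : i \in far -> mean (above i (c i)) <= expR (- (2 * l)).
  rewrite mem_filter -ltNge => /andP[ni _].
  have T0 : 0 < T by rewrite mulr_gt0 // sqrtr_gt0 (lt_le_trans ltr01).
  have c0 : 0 <= c i.
    by move: (ltW (lt_trans T0 ni)); rewrite /z pmulr_lge0 // invr_gt0.
  apply: le_trans (gauss_tail c0 (G_gt0 i)) _.
  rewrite ler_expR lerN2 -/G.
  rewrite (_ : c i ^+ 2 / _ = z i ^+ 2 / 2); last first.
    by rewrite -sdK /z; field; rewrite gt_eqF.
  have : T ^+ 2 <= z i ^+ 2 by rewrite lerXn2r ?nnegrE ?ltW // (lt_trans T0).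
  rewrite /T exprMn sqr_sqrtr; last by move: l_ge1; lra.
  by lra.
apply: (@le_trans _ _ (\sum_(i <- far) expR (- (2 * l)))).
  rewrite big_seq [leRHS]big_seq; exact: ler_sum.
rewrite big_const_seq count_predT iter_addr addr0.
apply: (@le_trans _ _ (expR (- (2 * l)) * expR l)); last first.
  by rewrite -expRD ler_expR; lra.
rewrite -[_ *+ size far]mulr_natr; apply: ler_wpM2l; first exact: expR_ge0.
have [/eqP I0|I0] := boolP (#|I| == 0)%N.
  rewrite (_ : size far = 0%N) ?expR_ge0 //; apply/eqP; rewrite -leqn0 -I0.
  by rewrite size_filter cardE count_size.
have I1 : 0 < #|I|%:R :> R by rewrite ltr0n lt0n.
apply: (@le_trans _ _ #|I|%:R).
  by rewrite ler_nat size_filter cardE count_size.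
by rewrite -[leLHS](lnK I1) ler_expR.
Qed.

End nazarov.

(** * Moments and tails from exponential integrability *)

Section exponential_bounds.
Context {R : realType}.
Implicit Types x t : R.

Lemma le_expR_id x : x <= expR x.
Proof. by apply: le_trans (expR_ge1Dx x); rewrite lerDr. Qed.

Lemma exprn_le_expR x n : (0 < n)%N -> 0 <= x -> x ^+ n <= n%:R ^+ n * expR x.
Proof.
move=> n0 x0; have n0R : 0 < n%:R :> R by rewrite ltr0n.
rewrite (_ : expR x = expR (x / n%:R) ^+ n); last first.
  by rewrite -expRM_natr divfK ?gt_eqF.
rewrite -exprMn lerXn2r ?nnegrE ?mulr_ge0 ?expR_ge0 //.
by rewrite -ler_pdivrMl // mulrC le_expR_id.
Qed.

Lemma expR_normr_le x : expR `|x| <= expR x + expR (- x).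
Proof.
case: (ger0P x) => _; [rewrite lerDl|rewrite lerDr]; exact: expR_ge0.
Qed.

Let der_expR_line x t : is_derive (t : R) (1 : R) (fun s => expR (s * x)) (x * expR (t * x)).
Proof.
apply: der_eq (der_comp (is_derive_expR _) (derM (der_id t) (der_cst x t))) _.
by rewrite mulr0 mul1r addr0 mulrC.
Qed.

Lemma expR_taylor2 x : `|expR x - 1 - x - x ^+ 2 / 2| <= `|x| ^+ 3 * expR `|x|.
Proof.
have := @taylor2 R (fun s => expR (s * x)) (fun s => x * expR (s * x))
  (fun s => x ^+ 2 * expR (s * x)) (fun s => x ^+ 3 * expR (s * x)) (`|x| ^+ 3 * expR `|x|).
rewrite mul1r mul0r expR0 !mulr1; apply.
- exact: der_expR_line.
- move=> t; apply: der_eq (derZ x (der_expR_line x t)) _; ring.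
- move=> t; apply: der_eq (derZ (x ^+ 2) (der_expR_line x t)) _; ring.
move=> t /andP[t0 t1]; rewrite normrM normrX ler_wpM2l ?exprn_ge0 //.
rewrite ger0_norm ?expR_ge0 // ler_expR (le_trans (ler_norm _)) // normrM ger0_norm //.
by rewrite ler_piMl.
Qed.

Lemma small_linear_eq0 (a K : R) : (forall t, 0 < t <= 1 -> `|a| <= K * t) -> a = 0.
Proof.
move=> h; apply/eqP; rewrite -normr_le0 leNgt; apply/negP => a0.
pose t := Num.min 1 (`|a| / (2 * (`|K| + 1))).
have K1 : 0 < 2 * (`|K| + 1) by rewrite mulr_gt0 // addr_gt0 // ltr_pwDr.
have t0 : 0 < t by rewrite lt_min ltr01 divr_gt0.
have t1 : t <= 1 by rewrite ge_min lexx.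
have t2 : t <= `|a| / (2 * (`|K| + 1)) by rewrite ge_min lexx orbT.
have := h t; rewrite t0 t1 => /(_ isT) h1.
have : (`|K| + 1) * t <= `|a| / 2.
  move: t2; rewrite ler_pdivlMr //; lra.
have : K * t <= `|K| * t by rewrite ler_wpM2r ?ler_norm // ltW.
move: h1 t0 a0; rewrite mulrDl mul1r; lra.
Qed.

(** Dividing by [t], then by [t ^+ 2], and taking [t] small isolates the coefficients one after the
    other. *)
Lemma cubic_remainder_eq0 (a b K : R) :
  (forall t, 0 < t <= 1 -> `|t * a + t ^+ 2 * b| <= K * t ^+ 3) -> a = 0 /\ b = 0.
Proof.
move=> h; have a0 : a = 0.
  apply: (@small_linear_eq0 _ (`|b| + K)) => t /andP[t0 t1].
  have := h t; rewrite t0 t1 => /(_ isT); rewrite (_ : t * a + t ^+ 2 * b = t * (a + t * b)); last by ring.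
  rewrite exprS mulrCA normrM gtr0_norm // ler_pM2l // => h1.
  have K0 : 0 <= K.
    have := h 1; rewrite ltr01 lexx => /(_ isT); rewrite !expr1n mulr1.
    exact: le_trans.
  have : `|a| <= `|a + t * b| + `|t * b|.
    by rewrite -{1}(addrK (t * b) a); exact: ler_normB.
  rewrite normrM (gtr0_norm t0) => h2; apply: le_trans h2 _.
  rewrite mulrDl addrC mulrC lerD2l; apply: le_trans h1 _.
  by rewrite ler_wpM2l // expr2 ler_piMr // ltW.
split => //; apply: (@small_linear_eq0 _ K) => t t01; have /andP[t0 _] := t01.
have := h t t01; rewrite a0 mulr0 add0r normrM normrX gtr0_norm //.
by rewrite (_ : K * t ^+ 3 = t ^+ 2 * (K * t)); [rewrite ler_pM2l ?exprn_gt0|ring].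
Qed.

End exponential_bounds.

Section mgf_moments.
Context {R : realType} d (S : measurableType d) (mu : probability S R).
Variables (V : S -> R) (s2 : R).
Hypothesis mV : measurable_fun setT V.
Hypothesis V_mgf : forall t : R,
  (\int[mu]_x (expR (t * V x))%:E = (expR (t ^+ 2 * s2 / 2))%:E)%E.

Let mexp (t : R) : measurable_fun setT (fun x => expR (t * V x)).
Proof. by apply: (measurableT_comp (@measurable_expR R)); exact: measurable_funM. Qed.

Let mabs (t : R) : measurable_fun setT (fun x => expR (t * `|V x|)).
Proof.
apply: (measurableT_comp (@measurable_expR R)); apply: measurable_funM => //.
exact: (measurableT_comp (@normr_measurable R setT) mV).
Qed.

Lemma mgf_exp_abs (t : R) : 0 <= t ->
  (\int[mu]_x (expR (t * `|V x|))%:E <= (2 * expR (t ^+ 2 * s2 / 2))%:E)%E.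
Proof.
move=> t0.
apply: (@le_trans _ _ (\int[mu]_x ((expR (t * V x))%:E + (expR (- t * V x))%:E))%E).
  apply: ge0_le_integral => //; try (by apply/measurable_EFinP).
    by apply: emeasurable_funD; apply/measurable_EFinP.
  move=> x _; rewrite -EFinD lee_fin -{1}(ger0_norm t0) -normrM mulNr.
    exact: expR_normr_le.
have me t' : measurable_fun setT (fun x => (expR (t' * V x))%:E) by exact/measurable_EFinP.
have e0 t' x : (setT : set S) x -> (0 <= (expR (t' * V x))%:E)%E by rewrite lee_fin expR_ge0.
rewrite (ge0_integralD mu measurableT (e0 t) (me t) (e0 (- t)) (me (- t))).
by rewrite !V_mgf sqrrN -EFinD lee_fin mulr2n mulrDl mul1r.
Qed.

Lemma mgf_exp_abs_integrable (t : R) : 0 <= t ->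
  mu.-integrable setT (EFin \o (fun x => expR (t * `|V x|))).
Proof.
move=> t0; apply/integrableP; split; first exact/measurable_EFinP.
rewrite (_ : (\int[mu]_x _)%E = (\int[mu]_x (expR (t * `|V x|))%:E)%E); last first.
  by apply: eq_integral => x _ /=; rewrite ger0_norm ?expR_ge0.
exact: le_lt_trans (mgf_exp_abs t0) (ltry _).
Qed.

Let dominated (f : S -> R) (K : R) : measurable_fun setT f ->
  (forall x, `|f x| <= K * expR (2 * `|V x|)) -> mu.-integrable setT (EFin \o f).
Proof.
move=> mf fK.
apply: (@le_integrable _ _ _ mu setT measurableT _
   (EFin \o (fun x => K * expR (2 * `|V x|)))) => //.
- exact/measurable_EFinP.
- by move=> x _ /=; rewrite lee_fin (le_trans (fK x)) // ler_norm.
- by apply: integrableZR; apply: mgf_exp_abs_integrable.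
Qed.

Let exp12 x : expR `|V x| <= expR (2 * `|V x|).
Proof. by rewrite ler_expR ler_peMl // ler1n. Qed.

Let pow_dominated n : (0 < n)%N -> forall x, `|V x| ^+ n <= n%:R ^+ n * expR (2 * `|V x|).
Proof.
move=> n0 x; apply: le_trans (exprn_le_expR n0 (normr_ge0 (V x))) _.
by rewrite ler_wpM2l ?exprn_ge0.
Qed.

Lemma mgf_integrable1 : mu.-integrable setT (EFin \o V).
Proof.
by apply: (@dominated _ 1) => // x; have := pow_dominated (ltn0Sn 0) x; rewrite !expr1.
Qed.

Lemma mgf_integrable2 : mu.-integrable setT (EFin \o (fun x => V x ^+ 2)).
Proof.
apply: (@dominated _ (2%:R ^+ 2)) => [|x]; first exact: measurable_funX.
by rewrite normrX; exact: pow_dominated.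
Qed.

Lemma mgf_integrable3 : mu.-integrable setT (EFin \o (fun x => `|V x| ^+ 3)).
Proof.
apply: (@dominated _ (3%:R ^+ 3)) => [|x].
  by apply: measurable_funX; exact: (measurableT_comp (@normr_measurable R setT) mV).
by rewrite normrX normr_id; exact: pow_dominated.
Qed.

(** The second-order expansions of [expR (t * V x)] and of the moment generating function differ by
    a quadratic polynomial in [t] of size [t ^+ 3], whose coefficients must vanish. No
    differentiation under the integral is involved. *)
Lemma mgf_moments12 : \int[mu]_x V x = 0 /\ \int[mu]_x (V x ^+ 2) = s2.
Proof.
pose a := \int[mu]_x V x; pose b := \int[mu]_x (V x ^+ 2).
(* 27 = 3^3 is the price in [exprn_le_expR] for bounding a cube by an exponential. *)
pose K := 27 * \int[mu]_x expR (2 * `|V x|).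
have i1 := mgf_integrable1; have i2 := mgf_integrable2.
have main t : 0 < t <= 1 ->
    `|expR (t ^+ 2 * s2 / 2) - 1 - t * a - t ^+ 2 / 2 * b| <= K * t ^+ 3.
  move=> /andP[t0 t1].
  have ie : mu.-integrable setT (EFin \o (fun x => expR (t * V x))).
    apply: (@dominated _ 1) => // x; rewrite ger0_norm ?expR_ge0 // mul1r.
    rewrite ler_expR; apply: le_trans (ler_norm _) _; rewrite normrM gtr0_norm //.
    apply: ler_wpM2r => //; move: t1; lra.
  have ic : mu.-integrable setT (EFin \o (fun=> 1 : R)).
    exact: finite_measure_integrable_cst.
  have E : \int[mu]_x (expR (t * V x) - 1 - t * V x - t ^+ 2 / 2 * V x ^+ 2) =
     expR (t ^+ 2 * s2 / 2) - 1 - t * a - t ^+ 2 / 2 * b.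
    rewrite RintegralB //; last 2 first.
    - by apply: integrableBR; [exact: integrableBR|exact: integrableZR].
    - exact: integrableZR.
    rewrite RintegralB //; last 2 first.
    - exact: integrableBR.
    - exact: integrableZR.
    rewrite RintegralB // !RintegralZl // Rintegral_cst // mul1r.
    rewrite (_ : fine _ = 1); last exact: (congr1 fine (@probability_setT _ _ _ mu)).
    by rewrite {1}/Rintegral V_mgf.
  have ii : mu.-integrable setT
      (EFin \o (fun x => expR (t * V x) - 1 - t * V x - t ^+ 2 / 2 * V x ^+ 2)).
    apply: integrableBR; last exact: integrableZR.
    by apply: integrableBR; [exact: integrableBR|exact: integrableZR].
  have iK := mgf_exp_abs_integrable (ler0n R 2).
  rewrite -E; apply: le_trans (le_normr_Rintegral _ ii) _ => //.
  rewrite /K -mulrA [_ * t ^+ 3]mulrC mulrA -RintegralZl //.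
  apply: le_Rintegral => //.
  - exact: integrable_norm.
  - exact: integrableZR.
  move=> x _.
  have := expR_taylor2 (t * V x); rewrite exprMn mulrAC => h; apply: le_trans h _.
  rewrite normrM (gtr0_norm t0) exprMn.
  rewrite -[leLHS]mulrA [27 * _]mulrC -[leRHS]mulrA.
  apply: ler_wpM2l; first by apply: exprn_ge0; exact: ltW.
  rewrite (_ : 2 * `|V x| = `|V x| + `|V x|); last by ring.
  rewrite expRD mulrA; apply: ler_pM; rewrite ?exprn_ge0 ?expR_ge0 //.
    have := exprn_le_expR (ltn0Sn 2) (normr_ge0 (V x)).
    by rewrite -natrX mulrC.
  rewrite ler_expR ler_piMl //.
pose K2 := `|s2| ^+ 2 * (1 + `|s2| * expR `|s2|).
have [] := @cubic_remainder_eq0 R a ((b - s2) / 2) (K + K2); last first.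
  by rewrite -/a -/b => -> h; split => //; move: h; lra.
move=> t t01; have := main t t01; have /andP[t0 t1] := t01.
set u := t ^+ 2 * s2 / 2.
have hu : `|u| <= t ^+ 2 * `|s2|.
  rewrite /u normrM normrM normrX [`|t|]gtr0_norm // [`|2^-1|]ger0_norm //.
  rewrite ler_piMr //; last lra.
  by rewrite mulr_ge0 // exprn_ge0 // ltW.
have h2 : `|expR u - 1 - u| <= K2 * t ^+ 3.
  have e : expR u - 1 - u = (expR u - 1 - u - u ^+ 2 / 2) + u ^+ 2 / 2 by ring.
  rewrite e; apply: le_trans (ler_normD _ _) _.
  have hu1 : `|u| <= `|s2| by apply: le_trans hu _; rewrite ler_piMl // exprn_ile1 // ltW.
  have u2 : `|u| ^+ 2 <= t ^+ 3 * `|s2| ^+ 2.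
    apply: (@le_trans _ _ ((t ^+ 2 * `|s2|) ^+ 2)).
      by rewrite lerXn2r ?nnegrE // mulr_ge0 // exprn_ge0 // ltW.
    rewrite exprMn; apply: ler_wpM2r; first exact: exprn_ge0.
    by rewrite -exprM ler_wiXn2l // ltW.
  apply: (@le_trans _ _ (`|u| ^+ 2 * (`|u| * expR `|u|) + `|u| ^+ 2)).
    apply: lerD; first by have := expR_taylor2 u; rewrite [`|u| ^+ 3]exprSr -mulrA.
    rewrite normrM normrX [`|2^-1|]ger0_norm // ler_piMr ?exprn_ge0 //; lra.
  rewrite (_ : _ + _ = `|u| ^+ 2 * (1 + `|u| * expR `|u|)); last by ring.
  rewrite (_ : K2 * t ^+ 3 = (t ^+ 3 * `|s2| ^+ 2) * (1 + `|s2| * expR `|s2|)); last by rewrite /K2; ring.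
  apply: ler_pM => //.
  by rewrite lerD2l; apply: ler_pM; rewrite ?expR_ge0 // ler_expR.
move=> h1; rewrite [leRHS]mulrDl.
rewrite (_ : t * a + _ = - (expR u - 1 - t * a - t ^+ 2 / 2 * b) + (expR u - 1 - u)).
  by apply: le_trans (ler_normD _ _) _; rewrite normrN; exact: lerD.
by rewrite /u; field.
Qed.

(** [(t |V|)^3 <= 27 expR (t |V|)] is integrated at [t = 1 / sqrt s2]: 108 = 27 * 2 * 2, one factor
    2 for the two signs of [V] and one for [expR (1 / 2)]. If [s2 = 0], arbitrarily large [t] force
    the value 0. *)
Lemma mgf_third_moment : 0 <= s2 -> \int[mu]_x (`|V x| ^+ 3) <= 108 * Num.sqrt s2 ^+ 3.
Proof.
move=> s0.
have key t : 0 < t -> t ^+ 3 * \int[mu]_x (`|V x| ^+ 3) <= 54 * expR (t ^+ 2 * s2 / 2).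
  move=> t0; have it := mgf_exp_abs_integrable (ltW t0).
  rewrite -RintegralZl //; last exact: mgf_integrable3.
  apply: (@le_trans _ _ (\int[mu]_x (27 * expR (t * `|V x|)))).
    apply: le_Rintegral => //.
    - by apply: integrableZR; exact: mgf_integrable3.
    - exact: integrableZR.
    move=> x _; rewrite -exprMn.
    have tV : 0 <= t * `|V x| by rewrite mulr_ge0 // ltW.
    by have := exprn_le_expR (ltn0Sn 2) tV; rewrite -natrX.
  rewrite RintegralZl // (_ : 54 = 27 * 2); last by rewrite -natrM.
  rewrite -mulrA ler_wpM2l // -lee_fin.
  have := mgf_exp_abs (ltW t0); rewrite /Rintegral fineK //.
  exact: integrable_fin_num it.
have e2 : expR (1 / 2) <= 2 :> R.
  have := expR_ge1Dx (- (1 / 2) : R); have := expR_gt0 (1 / 2 : R).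
  have : expR (1 / 2) * expR (- (1 / 2)) = 1 :> R by rewrite expRN mulfV // gt_eqF // expR_gt0.
  move: (expR (1 / 2)) (expR (- (1 / 2))) => x y; nra.
have m0 : 0 <= \int[mu]_x (`|V x| ^+ 3) by apply: Rintegral_ge0 => x _; rewrite exprn_ge0.
have [s20|s20] := eqVneq s2 0.
  rewrite s20 sqrtr0 expr0n mulr0 le_eqVlt; apply/orP; left; apply/eqP.
  apply: (@small_linear_eq0 _ _ 54) => t /andP[t0 t1]; rewrite ger0_norm //.
  have it : 0 < t^-1 by rewrite invr_gt0.
  have := key _ it; rewrite s20 mulr0 mul0r expR0 mulr1 exprVn ler_pdivrMl ?exprn_gt0 // mulrC.
  move=> h; apply: le_trans h _; rewrite ler_wpM2l // exprSr ler_piMl //; first exact: ltW.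
  by rewrite exprn_ile1 // ltW.
have s1 : 0 < s2 by rewrite lt_neqAle eq_sym s20.
have q0 : 0 < Num.sqrt s2 by rewrite sqrtr_gt0.
have iq : 0 < (Num.sqrt s2)^-1 by rewrite invr_gt0.
have := key _ iq; rewrite !exprVn sqr_sqrtr // mulVf // ler_pdivrMl ?exprn_gt0 //.
rewrite mulrC => h; apply: le_trans h _; apply: ler_wpM2r; first by rewrite exprn_ge0 // ltW.
move: e2; lra.
Qed.

End mgf_moments.

Section exponential_tails.
Context {R : realType} (I : finType) (i0 : I) (l phi : R).
Hypotheses (l_gt0 : 0 < l) (phi_gt0 : 0 < phi).
Let beta := bandwidth l phi.

Lemma vmax_attained (y : I -> R) : exists i, vmax y = `|y i|.
Proof.
pose i := [arg max_(i > i0) `|y i|]%O.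
have mi j : `|y j| <= `|y i|.
  by rewrite /i; case: Order.TotalTheory.arg_maxP => // k _; apply.
by exists i; apply/eqP; rewrite eq_le vmax_ge vmax_le.
Qed.

Lemma measurable_cubic_excess d (S : measurableType d) (g : I -> S -> R) :
  (forall i, measurable_fun setT (g i)) ->
  measurable_fun setT (fun x => cubic_excess l phi (g^~ x)).
Proof.
move=> mg; have mv := measurable_vmax mg.
apply: measurable_fun_ifT => //; last exact: measurable_funX.
by apply: measurable_fun_ler => //; exact: measurable_funM.
Qed.

Lemma cubic_excess_ge0 (y : I -> R) : 0 <= cubic_excess l phi y.
Proof. by rewrite /cubic_excess; case: ifP => // _; rewrite exprn_ge0 // vmax_ge0. Qed.

(** Half of the exponent [|V| / D] dominates the cube, at the price 216 = 2^3 * 3^3; the other half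
    is at least [1 / E] wherever the excess is nonzero. The exponential moment 4 gives 864 = 216 *
    4. *)
Lemma exp_tail_excess d (S : measurableType d) (mu : probability S R)
    (V : I -> S -> R) (D s : R) : 0 < D -> 0 < s ->
  (forall i, measurable_fun setT (V i)) ->
  (forall i, (\int[mu]_x (expR (`|V i x| / D))%:E <= 4%:E)%E) ->
  mu.-integrable setT (EFin \o (fun x => cubic_excess l phi (fun i => s * V i x))) /\
  \int[mu]_x cubic_excess l phi (fun i => s * V i x) <=
    #|I|%:R * (864 * (s * D) ^+ 3 * expR (- (2 * D * beta * s)^-1)).
Proof.
move=> D0 s0 mV Vexp.
have beta_gt0 : 0 < beta by exact: mulr_gt0.
set E := expR (- _).
have ie i : mu.-integrable setT (EFin \o (fun x => expR (`|V i x| / D))).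
  apply/integrableP; split.
    apply/measurable_EFinP; apply: (measurableT_comp (@measurable_expR R)).
    apply: measurable_funM => //.
    exact: (measurableT_comp (@normr_measurable R setT) (mV i)).
  rewrite (_ : (\int[mu]_x _)%E = (\int[mu]_x (expR (`|V i x| / D))%:E)%E).
    exact: le_lt_trans (Vexp i) (ltry _).
  by apply: eq_integral => x _ /=; rewrite ger0_norm ?expR_ge0.
pose B i x := 216 * (s * D) ^+ 3 * E * expR (`|V i x| / D).
have B0 i x : 0 <= B i x.
  by rewrite /B !mulr_ge0 ?expR_ge0 // ?exprn_ge0 ?mulr_ge0 ?ltW.
have iB i : mu.-integrable setT (EFin \o B i) by exact: integrableZR.
have iS : mu.-integrable setT (EFin \o (fun x => \sum_i B i x)) by exact: integrable_sumR.
have key x : cubic_excess l phi (fun i => s * V i x) <= \sum_i B i x.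
  rewrite /cubic_excess -/beta; case: ifPn => [_|]; first exact: sumr_ge0.
  rewrite -ltNge => big; have [i vi] := vmax_attained (fun i => s * V i x).
  rewrite (bigD1 i) //=; apply: (@le_trans _ _ (B i x)); last by rewrite lerDl sumr_ge0.
  move: big; rewrite vi normrM (gtr0_norm s0) => big.
  have v0 : 0 <= `|V i x| / (2 * D) by rewrite divr_ge0 // mulr_ge0 // ltW.
  have h3 := exprn_le_expR (ltn0Sn 2) v0.
  have h1 : 1 <= E * expR (`|V i x| / (2 * D)).
    rewrite /E -expRD -[leLHS]expR0 ler_expR addrC subr_ge0.
    rewrite (_ : (2 * D * beta * s)^-1 = (beta * s)^-1 / (2 * D)); last by field; rewrite !gt_eqF.
    apply: ler_wpM2r; first by rewrite invr_ge0 mulr_ge0 // ltW.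
    rewrite -[leLHS]mul1r ler_pdivrMr ?mulr_gt0 //.
    by rewrite ltW // mulrC -mulrA.
  rewrite /B (_ : `|V i x| / D = `|V i x| / (2 * D) + `|V i x| / (2 * D)); last first.
    by field; rewrite gt_eqF.
  rewrite expRD; set e := expR (_ / (2 * D)) in h1 h3 *.
  rewrite (_ : _ * `|V i x| = (2 * (s * D)) * (`|V i x| / (2 * D))); last first.
    by field; rewrite gt_eqF.
  rewrite exprMn (_ : 216 * _ * E * _ = ((2 * (s * D)) ^+ 3 * (27 * e)) * (E * e)); last by ring.
  rewrite -[leLHS]mulr1; apply: ler_pM => //.
    by apply: mulr_ge0; apply: exprn_ge0 => //; rewrite mulr_ge0 // mulr_ge0 // ltW.
  apply: ler_wpM2l; first by rewrite exprn_ge0 // mulr_ge0 // mulr_ge0 // ltW.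
  by move: h3; rewrite -natrX.
have mc := @measurable_cubic_excess _ S (fun i x => s * V i x)
  (fun i => measurable_funM (measurable_cst s) (mV i)).
have ic : mu.-integrable setT (EFin \o (fun x => cubic_excess l phi (fun i => s * V i x))).
  apply: (@le_integrable _ _ _ mu setT measurableT _ (EFin \o (fun x => \sum_i B i x))) => //.
    exact/measurable_EFinP.
  move=> x _ /=; rewrite lee_fin ger0_norm ?cubic_excess_ge0 // ger0_norm ?sumr_ge0 //.
split => //; apply: (@le_trans _ _ (\int[mu]_x (\sum_i B i x))).
  exact: le_Rintegral.
rewrite Rintegral_sumR // mulr_natl -sumr_const; apply: ler_sum => i _.
rewrite RintegralZl // (_ : 864 = 216 * 4); last by rewrite -natrM.
rewrite (_ : 216 * 4 * _ * E = 216 * (s * D) ^+ 3 * E * 4); last by ring.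
apply: ler_wpM2l; first by rewrite !mulr_ge0 ?expR_ge0 // ?exprn_ge0 ?mulr_ge0 ?ltW.
rewrite -lee_fin; have := Vexp i; rewrite /Rintegral fineK //.
exact: integrable_fin_num (ie i).
Qed.

End exponential_tails.

Section gaussian_increments.
Context {R : realType} d (Om : measurableType d) (P : probability Om R) (k : nat).
Variable Z : nat -> Om -> R.
Hypothesis iZ : iid_seq P (@gauss R) k Z.

Lemma linear_form_mgf (a : nat -> R) (t : R) :
  (\int[P]_x (expR (t * \sum_(m < k) a m * Z m x))%:E =
   (expR (t ^+ 2 * (\sum_(m < k) a m ^+ 2) / 2))%:E)%E.
Proof.
(* A linear form is a Gaussian vector with one coordinate, indexed by [unit]. *)
pose A (m : nat) (_ : unit) := a m.
pose f (w : unit -> R) := (expR (t * w tt))%:E.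
have mf : cmeas f.
  move=> d' T v mv; apply/measurable_EFinP; apply: (measurableT_comp (@measurable_expR R)).
  exact: measurable_funM.
have f0 w : (0 <= f w)%E by rewrite lee_fin expR_ge0.
have := integral_iid_sum (fun=> 0) (@measurable_column_map R unit 1 A) mf f0 iZ.
rewrite (gauss_mean_mgf A k t tt) => E; transitivity (\int[P]_x f
   (addv (fun=> 0%R) (fun i => (\sum_(j < k) column_map 1 A j (Z j x) i)%R)))%E.
  apply: eq_integral => x _; rewrite /f /addv add0r; congr (expR (t * _))%:E.
  by apply: eq_bigr => j _; rewrite /column_map mul1r.
by rewrite E.
Qed.

Variables (I : finType) (i0 : I) (A : nat -> I -> R) (s : R).
Hypothesis s_gt0 : 0 < s.

Definition linear_form (i : I) (x : Om) : R := \sum_(m < k) A m i * Z m x.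

Lemma measurable_linear_form i : measurable_fun setT (linear_form i).
Proof.
have [mZ _ _] := iZ.
by apply: measurable_sum => m; apply: measurable_funM => //; exact: mZ.
Qed.

Lemma expect_op_gaussian f : ufun f ->
  expect_op P (fun x i => s * linear_form i x) f = expect_ops (@gauss R) (column_map s A) k f.
Proof.
move=> uf; apply/funext => w.
rewrite -(Rintegral_iid_sum w (@measurable_column_map R I s A) uf iZ).
apply: eq_Rintegral => x _; congr f; apply/funext => i; rewrite /addv; congr (_ + _).
by rewrite /linear_form mulr_sumr; apply: eq_bigr => m _; rewrite /column_map mulrA.
Qed.

Let mgfL i (t : R) : (\int[P]_x (expR (t * linear_form i x))%:E =
   (expR (t ^+ 2 * gram A k i i / 2))%:E)%E.
Proof.
by rewrite (linear_form_mgf (fun m => A m i)).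
Qed.

Let mgfD i j (t : R) : (\int[P]_x (expR (t * (linear_form i x + linear_form j x)))%:E =
   (expR (t ^+ 2 * (gram A k i i + gram A k j j + 2 * gram A k i j) / 2))%:E)%E.
Proof.
have := linear_form_mgf (fun m => A m i + A m j) t.
rewrite (_ : \sum_(m < k) (A m i + A m j) ^+ 2 =
  gram A k i i + gram A k j j + 2 * gram A k i j); last first.
  rewrite /gram mulr_sumr -!big_split /=; apply: eq_bigr => m _; ring.
move=> <-; apply: eq_integral => x _; congr (expR (t * _))%:E.
by rewrite /linear_form -big_split /=; apply: eq_bigr => m _; rewrite mulrDl.
Qed.

(** Polarization: the sum of two linear forms is again a linear form, with known second moment. *)
Lemma gaussian_covariance i j :
  P.-integrable setT (EFin \o (fun x => linear_form i x * linear_form j x)) /\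
  \int[P]_x (linear_form i x * linear_form j x) = gram A k i j.
Proof.
have mL := measurable_linear_form.
have ms : measurable_fun setT (fun x => linear_form i x + linear_form j x).
  exact: measurable_funD.
have [_ ei] := mgf_moments12 (mL i) (mgfL i).
have [_ ej] := mgf_moments12 (mL j) (mgfL j).
have [_ es] := mgf_moments12 ms (mgfD i j).
have ii := mgf_integrable2 (mL i) (mgfL i).
have ij := mgf_integrable2 (mL j) (mgfL j).
have is' := mgf_integrable2 ms (mgfD i j).
have E : (fun x => linear_form i x * linear_form j x) =
    fun x => 2^-1 * ((linear_form i x + linear_form j x) ^+ 2 -
      linear_form i x ^+ 2 - linear_form j x ^+ 2).
  by apply/funext => x; field.
have i3 : P.-integrable setT (EFin \o (fun x => (linear_form i x + linear_form j x) ^+ 2 -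
      linear_form i x ^+ 2 - linear_form j x ^+ 2)).
  by apply: integrableBR => //; exact: integrableBR.
rewrite E; split; first exact: integrableZR.
rewrite RintegralZl // RintegralB //; last exact: integrableBR.
by rewrite RintegralB // ei ej es; field.
Qed.

Lemma gaussian_increment_moments (l phi D L tau : R) : 0 < l -> 0 < phi -> 0 < D ->
  (forall i, gram A k i i <= D ^+ 2) ->
  (forall i, 108 * (s * Num.sqrt (gram A k i i)) ^+ 3 <= L) ->
  #|I|%:R * (864 * (s * D) ^+ 3 * expR (- (2 * D * bandwidth l phi * s)^-1)) <= tau ->
  increment_moments l phi P (fun x i => s * linear_form i x)
    (fun i j => s ^+ 2 * gram A k i j) L tau.
Proof.
move=> l0 phi0 D0 gD gL gtau.
have mL := measurable_linear_form.
have g0 i : 0 <= gram A k i i by apply: sumr_ge0 => m _; rewrite -expr2 sqr_ge0.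
have s0 := ltW s_gt0.
have Vexp i : (\int[P]_x (expR (`|linear_form i x| / D))%:E <= 4%:E)%E.
  have iD : 0 <= D^-1 by rewrite invr_ge0 ltW.
  under eq_integral do rewrite mulrC.
  apply: le_trans (mgf_exp_abs (mL i) (mgfL i) iD) _.
  rewrite lee_fin (_ : 4 = 2 * 2); last by rewrite -natrM.
  rewrite ler_wpM2l //; apply: (@le_trans _ _ (expR (1 / 2))).
    rewrite ler_expR ler_wpM2r // exprVn mulrC ler_pdivrMr ?exprn_gt0 // mul1r.
    exact: gD.
  have := expR_ge1Dx (- (1 / 2) : R); have := expR_gt0 (1 / 2 : R).
  have : expR (1 / 2) * expR (- (1 / 2)) = 1 :> R by rewrite expRN mulfV // gt_eqF // expR_gt0.
  move: (expR (1 / 2)) (expR (- (1 / 2))) => x y; nra.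
have [ic lec] := exp_tail_excess i0 l0 phi0 D0 s_gt0 mL Vexp.
split.
- by move=> i; exact: measurable_funM.
- by move=> i; apply: integrableZR; exact: mgf_integrable1 (mL i) (mgfL i).
- move=> i; rewrite RintegralZl //; last exact: mgf_integrable1 (mL i) (mgfL i).
  by have [-> _] := mgf_moments12 (mL i) (mgfL i); rewrite mulr0.
- move=> i j; rewrite (_ : (fun x => _) = fun x => s ^+ 2 * (linear_form i x * linear_form j x)).
    by apply: integrableZR; have [] := gaussian_covariance i j.
  by apply/funext => x; ring.
- move=> i j; have [h1 h2] := gaussian_covariance i j.
  under eq_Rintegral do rewrite mulrACA -expr2.
  by rewrite RintegralZl // h2.
- move=> i; under eq_fun do rewrite normrM exprMn.
  by apply: integrableZR; exact: mgf_integrable3 (mL i) (mgfL i).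
- move=> i; under eq_Rintegral do rewrite normrM exprMn.
  have i3 := mgf_integrable3 (mL i) (mgfL i).
  rewrite RintegralZl //; apply: le_trans (gL i).
  rewrite exprMn mulrCA ger0_norm //; apply: ler_wpM2l; first exact: exprn_ge0.
  exact: mgf_third_moment (mL i) (mgfL i) (g0 i).
- exact: ic.
- exact: le_trans lec gtau.
Qed.

End gaussian_increments.

(** * Degenerate U-statistics *)

Ltac nonneg := repeat first [assumption | apply: ltW; assumption | exact: sqr_ge0
  | exact: ler0n | exact: ler01 | exact: expR_ge0 | exact: sqrtr_ge0 | exact: normr_ge0
  | apply: addr_ge0 | apply: mulr_ge0 | apply: exprn_ge0 | rewrite invr_ge0].

Section symmetric_softmax.
Context {R : realType} (I : finType) (i0 : I) (beta : R).
Hypothesis beta_gt0 : 0 < beta.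
Implicit Types w y : I -> R.

(** Doubling the index by a sign lets the soft maximum control absolute values. *)
Definition signed w (j : I * bool) : R := if j.2 then w j.1 else - w j.1.

Definition slse w : R := lse beta (signed w).

Let j0 := (i0, true).

Lemma slse_ge w i : `|w i| <= slse w.
Proof.
have h1 := lse_ge j0 beta_gt0 (signed w) (i, true).
have h2 := lse_ge j0 beta_gt0 (signed w) (i, false).
by rewrite ler_norml -[- slse w <= _]lerNl; apply/andP.
Qed.

Lemma slse_ge0 w : 0 <= slse w.
Proof. exact: le_trans (slse_ge w i0). Qed.

Lemma vmax_le_slse w : vmax w <= slse w.
Proof. by apply: vmax_le; [exact: slse_ge0|exact: slse_ge]. Qed.

Lemma slse0 (lam : R) : ln #|{: I * bool}|%:R <= lam -> slse (fun=> 0) <= lam / beta.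
Proof.
move=> hl; rewrite -[leRHS]add0r; apply: (lse_le j0 beta_gt0 hl) => -[i []];
by rewrite /signed /= ?oppr0.
Qed.

Lemma signed_le_vmax y j : `|signed y j| <= vmax y.
Proof. by case: j => i []; rewrite /signed /= ?normrN; exact: vmax_ge. Qed.

Let signedD w y : signed (addv w y) = fun j => signed w j + signed y j.
Proof. by apply/funext => -[i []]; rewrite /signed /addv //= opprD. Qed.

Lemma slse_taylor w y : slse (addv w y) <=
  slse w + \sum_j softweight beta (signed w) j * signed y j + 2 * beta * vmax y ^+ 2.
Proof. by rewrite /slse signedD; apply: (lse_taylor j0 beta_gt0); exact: signed_le_vmax. Qed.

Let slse_lip1 w y : slse (addv w y) <= slse w + vmax y.
Proof.
rewrite /slse /lse ler_pdivrMl // mulrDr mulVKf ?gt_eqF //.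
have P (u : I * bool -> R) : 0 < \sum_j expR (beta * u j).
  exact: (sum_expR_gt0 j0 beta u).
rewrite -[X in _ + X]expRK -lnM ?posrE ?expR_gt0 // ler_ln ?posrE ?mulr_gt0 ?expR_gt0 //.
rewrite mulr_suml; apply: ler_sum => j _; rewrite -expRD ler_expR signedD mulrDr lerD2l.
by rewrite ler_pM2l //; apply: le_trans (ler_norm _) (signed_le_vmax y j).
Qed.

Lemma slse_lip w y : `|slse (addv w y) - slse w| <= vmax y.
Proof.
have h1 := slse_lip1 w y; have := slse_lip1 (addv w y) (fun i => - y i).
rewrite (_ : addv (addv w y) _ = w); last by apply/funext => i; rewrite /addv addrK.
rewrite (_ : vmax (fun i => - y i) = vmax y); last first.
  by rewrite /vmax; apply: eq_bigr => i _; rewrite normrN.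
by move=> h2; rewrite ler_norml; move: h1 h2; lra.
Qed.

Lemma cmeas_slse : cmeas slse.
Proof.
move=> d T v mv; apply: (@measurable_lse _ _ _ _ beta (fun j t => signed (v^~ t) j)).
by move=> -[i []]; rewrite /signed //=; exact: measurableT_comp.
Qed.

(** Quadratics in the soft maximum are preserved, up to new lower coefficients, by averaging over
    one centred increment. Tracking three numbers thus bounds a second moment along the whole
    sample. *)
Definition quad (a b c s : R) : R := a * s ^+ 2 + b * s + c.

Lemma quad_ge0 (a b c s : R) : 0 <= a -> 0 <= b -> 0 <= c -> 0 <= s -> 0 <= quad a b c s.
Proof. by move=> *; rewrite /quad !addr_ge0 // !mulr_ge0 // sqr_ge0. Qed.

Lemma quad_slse_taylor (a b c : R) w y : 0 <= a -> 0 <= b ->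
  quad a b c (slse (addv w y)) <= quad a b c (slse w)
    + (2 * a * slse w + b) *
        (\sum_j softweight beta (signed w) j * signed y j + 2 * beta * vmax y ^+ 2)
    + a * vmax y ^+ 2.
Proof.
move=> a0 b0; have h1 := slse_taylor w y; have h2 := slse_lip w y.
have s0 := slse_ge0 w.
set L := \sum_j _ in h1 *; set q := vmax y ^+ 2 in h1 *.
have h3 : (slse (addv w y) - slse w) ^+ 2 <= q.
  by rewrite -[leLHS]ger0_norm ?sqr_ge0 // normrX lerXn2r ?nnegrE // (le_trans _ h2).
rewrite (_ : quad a b c (slse (addv w y)) = quad a b c (slse w) +
   (2 * a * slse w + b) * (slse (addv w y) - slse w) +
   a * (slse (addv w y) - slse w) ^+ 2); last by rewrite /quad; ring.
apply: lerD; last exact: ler_wpM2l.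
rewrite lerD2l; apply: ler_wpM2l; last by move: h1; lra.
by rewrite addr_ge0 // mulr_ge0 // mulr_ge0.
Qed.

Section one_increment.
Context d (S : measurableType d) (mu : probability S R) (y : S -> I -> R).
Hypotheses (my : forall i, measurable_fun setT (fun x => y x i))
  (iy : forall i, mu.-integrable setT (EFin \o (fun x => y x i)))
  (ymean : forall i, \int[mu]_x y x i = 0).

Lemma quad_slse_step (a b c v : R) w : 0 <= a -> 0 <= b -> 0 <= c ->
  (\int[mu]_x (vmax (y x) ^+ 2)%:E <= v%:E)%E ->
  (\int[mu]_x (quad a b c (slse (addv w (y x))))%:E <=
   (quad a b c (slse w) + ((2 * a * slse w + b) * (2 * beta) + a) * v)%:E)%E.
Proof.
move=> a0 b0 c0 hv.
have mv : measurable_fun setT (fun x => vmax (y x)) := measurable_vmax my.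
have iv : mu.-integrable setT (EFin \o (fun x => vmax (y x) ^+ 2)).
  apply/integrableP; split; first by apply/measurable_EFinP; exact: measurable_funX.
  rewrite (_ : (\int[mu]_x _)%E = (\int[mu]_x (vmax (y x) ^+ 2)%:E)%E).
    exact: le_lt_trans hv (ltry _).
  by apply: eq_integral => x _ /=; rewrite ger0_norm ?sqr_ge0.
pose p := softweight beta (signed w).
have isg j : mu.-integrable setT (EFin \o (fun x => signed (y x) j)).
  case: j => i []; rewrite /signed /=; first exact: iy.
  by under eq_fun do rewrite -mulN1r; exact: integrableZR.
have sgmean j : \int[mu]_x (signed (y x) j) = 0.
  case: j => i []; rewrite /signed /=; first exact: ymean.
  under eq_Rintegral do rewrite -mulN1r.
  by rewrite RintegralZl // ymean mulr0.
have iL : mu.-integrable setT (EFin \o (fun x => \sum_j p j * signed (y x) j)).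
  by apply: integrable_sumR => j; exact: integrableZR.
have Lmean : \int[mu]_x (\sum_j p j * signed (y x) j) = 0.
  rewrite Rintegral_sumR; last by move=> j; exact: integrableZR.
  by rewrite big1 // => j _; rewrite RintegralZl // sgmean mulr0.
pose H x := quad a b c (slse w) + (2 * a * slse w + b) *
   (\sum_j p j * signed (y x) j + 2 * beta * vmax (y x) ^+ 2) + a * vmax (y x) ^+ 2.
have ic (r : R) : mu.-integrable setT (EFin \o (fun=> r)).
  exact: finite_measure_integrable_cst.
have i2v : mu.-integrable setT (EFin \o (fun x => 2 * beta * vmax (y x) ^+ 2)) by exact: integrableZR.
have i1 : mu.-integrable setT (EFin \o (fun x => (2 * a * slse w + b) *
   (\sum_j p j * signed (y x) j + 2 * beta * vmax (y x) ^+ 2))).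
  by apply: integrableZR; exact: integrableDR.
have iav : mu.-integrable setT (EFin \o (fun x => a * vmax (y x) ^+ 2)) by exact: integrableZR.
have iH : mu.-integrable setT (EFin \o H).
  by apply: integrableDR => //; exact: integrableDR.
have EH : \int[mu]_x H x = quad a b c (slse w) + ((2 * a * slse w + b) * (2 * beta) + a) *
    \int[mu]_x (vmax (y x) ^+ 2).
  rewrite /H; move: (quad a b c (slse w)) => Q.
  rewrite RintegralD //; last exact: integrableDR.
  rewrite RintegralD // RintegralZl //; last exact: integrableDR.
  rewrite RintegralD // Lmean add0r !RintegralZl // Rintegral_cst //.
  rewrite (_ : fine _ = 1); last exact: (congr1 fine (@probability_setT _ _ _ mu)).
  ring.
apply: (@le_trans _ _ (\int[mu]_x (H x)%:E)%E).
  apply: ge0_le_integral => //.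
  - move=> x _; by rewrite lee_fin quad_ge0 // slse_ge0.
  - apply/measurable_EFinP; rewrite /quad.
    have ms : measurable_fun setT (fun x => slse (addv w (y x))).
      by apply: (cmeas_translate my w); exact: cmeas_slse.
    apply: measurable_funD => //; apply: measurable_funD; apply: measurable_funM => //.
    exact: measurable_funX.
  - by case/integrableP: iH.
  - by move=> x _; rewrite lee_fin; exact: quad_slse_taylor.
rewrite (_ : (\int[mu]_x (H x)%:E)%E = (\int[mu]_x H x)%:E); last first.
  by rewrite /Rintegral fineK //; exact: integrable_fin_num iH.
rewrite lee_fin EH lerD2l; apply: ler_wpM2l.
  have s0 := slse_ge0 w.
  by nonneg.
rewrite -lee_fin; apply: le_trans hv; rewrite /Rintegral fineK //.
exact: integrable_fin_num iv.
Qed.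

Lemma quad_slse_steps (k : nat) (a b c v : R) w : 0 <= a -> 0 <= b -> 0 <= c -> 0 <= v ->
  (\int[mu]_x (vmax (y x) ^+ 2)%:E <= v%:E)%E ->
  (shift_ops mu (fun=> y) k (fun w => (quad a b c (slse w))%:E) w <=
   (quad a (b + 4 * beta * v * a * k%:R)
      (c + k%:R * a * v + 2 * beta * v * b * k%:R + 8 * beta ^+ 2 * v ^+ 2 * a * k%:R ^+ 2)
      (slse w))%:E)%E.
Proof.
move=> + + + v0 hv; elim: k a b c w => [|k IH] a b c w a0 b0 c0 /=.
  by rewrite !(mulr0, mul0r, addr0, expr0n).
have bt0 := ltW beta_gt0.
have mq a' b' c' : cmeas (fun w => (quad a' b' c' (slse w))%:E).
  move=> d' T u mu'; apply/measurable_EFinP.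
  have ms : measurable_fun setT (fun t => slse (fun i => u i t)) by exact: cmeas_slse.
  apply: measurable_funD => //; apply: measurable_funD; apply: measurable_funM => //.
  exact: measurable_funX.
have q0 a' b' c' w' : 0 <= a' -> 0 <= b' -> 0 <= c' -> (0 <= (quad a' b' c' (slse w'))%:E)%E.
  move=> h1 h2 h3; by rewrite lee_fin quad_ge0 // slse_ge0.
pose b' := b + 4 * beta * v * a; pose c' := c + a * v + 2 * beta * v * b.
have b'0 : 0 <= b' by rewrite addr_ge0 // !mulr_ge0.
have c'0 : 0 <= c' by rewrite !addr_ge0 // !mulr_ge0.
apply: (@le_trans _ _ (shift_ops mu (fun=> y) k (fun w => (quad a b' c' (slse w))%:E) w)).
  apply: le_shift_ops => //.
  - by apply: cmeas_shift_op => // w'; exact: q0.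
  - by move=> w'; apply: shift_op_ge0 => w2; exact: q0.
  move=> w'; apply: le_trans (quad_slse_step w' a0 b0 c0 hv) _.
  rewrite lee_fin le_eqVlt; apply/orP; left; apply/eqP; rewrite /quad /b' /c'; ring.
apply: le_trans (IH a b' c' w a0 b'0 c'0) _; rewrite lee_fin /quad.
have -> : b' + 4 * beta * v * a * k%:R = b + 4 * beta * v * a * k.+1%:R.
  by rewrite /b' -natr1; ring.
(* The exact recursion would give [4 k (k - 1)] in place of [8 k^2]; the looser square closes the
   induction. *)
rewrite lerD2l -natr1 /c' /b' -subr_ge0.
rewrite (_ : _ - _ = 8 * beta ^+ 2 * v ^+ 2 * a * (k%:R + 1)); last by ring.
by rewrite !mulr_ge0 // ?sqr_ge0 // addr_ge0.
Qed.

End one_increment.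
End symmetric_softmax.

Lemma integral_prob_cst {R : realType} d (S : measurableType d)
    (mu : probability S R) (r : R) : (\int[mu]_x r%:E = r%:E)%E.
Proof.
rewrite integral_cst // -[RHS]mule1; congr (_ * _)%E.
exact: (@probability_setT _ _ _ mu).
Qed.

Section degenerate_kernel.
Context {R : realType} (I : finType) (i0 : I).
Context dO (Om : measurableType dO) (P : probability Om R)
  d (S : measurableType d) (F : probability S R) (n : nat) (X : nat -> Om -> S).
Hypothesis iX : iid_seq P F n X.
Variables (lam : R).
Hypotheses (lam_ge1 : 1 <= lam) (card_le : ln #|{: I * bool}|%:R <= lam).

(** [beta] balances [lam / beta] against [beta * n * v']; then 14 = 1 + 4 + 1 + 8 collects the four
    terms of the quadratic. [v'] is separate from [v] because [v] may be 0, while [beta] needs a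
    positive scale. *)
Lemma iid_sum_vmax2 (g : S -> I -> R) (v v' : R) (k : nat) :
  (forall i, measurable_fun setT (fun x => g x i)) ->
  (forall i, F.-integrable setT (EFin \o (fun x => g x i))) ->
  (forall i, \int[F]_x g x i = 0) ->
  0 <= v -> v <= v' -> 0 < v' -> (k <= n)%N -> (0 < n)%N ->
  (\int[F]_x (vmax (g x) ^+ 2)%:E <= v%:E)%E ->
  (\int[P]_t (vmax (fun i => \sum_(j < k) g (X j t) i)%R ^+ 2)%:E <=
   (14 * lam * n%:R * v')%:E)%E.
Proof.
move=> mg ig gmean v0 vv' v'0 kn n0 hv.
have lam0 : 0 < lam by exact: lt_le_trans lam_ge1.
have nR : 0 < n%:R :> R by rewrite ltr0n.
have nv : 0 < n%:R * v' by rewrite mulr_gt0.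
pose beta := Num.sqrt (lam / (n%:R * v')).
have b2 : beta ^+ 2 = lam / (n%:R * v') by rewrite sqr_sqrtr // divr_ge0 // ltW.
have b0 : 0 < beta by rewrite sqrtr_gt0 divr_gt0.
pose z0 : I -> R := fun=> 0.
pose q1 (w : I -> R) := (quad 1 0 0 (slse beta w))%:E.
have mq1 : cmeas q1.
  move=> d' T u mu'; apply/measurable_EFinP.
  have ms : measurable_fun setT (fun t => slse beta (fun i => u i t)) by exact: cmeas_slse.
  apply: measurable_funD => //; apply: measurable_funD; apply: measurable_funM => //.
  exact: measurable_funX.
have q10 w : (0 <= q1 w)%E by rewrite lee_fin quad_ge0 // slse_ge0.
have mX j : measurable_fun setT (X j) by case: iX.
have mS i : measurable_fun setT (fun t => \sum_(j < k) g (X j t) i).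
  by apply: measurable_sum => j; exact: measurableT_comp (mg i) (mX j).
apply: (@le_trans _ _ (\int[P]_t q1 (addv z0 (fun i => \sum_(j < k) g (X j t) i)%R))%E).
  apply: ge0_le_integral => //.
  - by move=> t _; rewrite lee_fin sqr_ge0.
  - by apply/measurable_EFinP; apply: measurable_funX; exact: (measurable_vmax mS).
  - by apply: mq1 => i; exact: measurable_funD.
  move=> t _; rewrite lee_fin /quad mul1r mul0r !addr0.
  rewrite (_ : addv z0 _ = fun i => \sum_(j < k) g (X j t) i); last first.
    by apply/funext => i; rewrite /addv add0r.
  by rewrite lerXn2r ?nnegrE ?vmax_ge0 ?slse_ge0 // vmax_le_slse.
rewrite (integral_iid_sum z0 (fun _ => mg) mq1 q10 (iid_seq_widen kn iX)).
apply: le_trans (quad_slse_steps i0 b0 mg ig gmean k z0 ler01 (lexx 0) (lexx 0) v0 hv) _.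
rewrite lee_fin /quad !(mulr0, mul0r, addr0, add0r, mul1r, mulr1).
have s0 := slse_ge0 i0 b0 z0; have sl := slse0 i0 b0 card_le.
rewrite -/z0 in sl; set s := slse beta z0 in s0 sl *.
have kR : k%:R <= n%:R :> R by rewrite ler_nat.
have k0 : 0 <= k%:R :> R by exact: ler0n.
have t1 : s ^+ 2 <= lam * n%:R * v'.
  apply: (@le_trans _ _ ((lam / beta) ^+ 2)).
    by rewrite lerXn2r ?nnegrE // divr_ge0 // ltW.
  by rewrite expr_div_n b2 le_eqVlt; apply/orP; left; apply/eqP; field; rewrite !gt_eqF.
have kv : k%:R * v <= n%:R * v' by apply: ler_pM.
have t2 : 4 * beta * v * k%:R * s <= 4 * lam * (n%:R * v').
  apply: (@le_trans _ _ (4 * beta * (k%:R * v) * (lam / beta))).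
    rewrite (_ : 4 * beta * v * k%:R * s = 4 * beta * (k%:R * v) * s); last by ring.
    by apply: ler_wpM2l => //; nonneg.
  rewrite (_ : _ * (lam / beta) = 4 * lam * (k%:R * v)); last by field; rewrite gt_eqF.
  by apply: ler_wpM2l => //; nonneg.
have t3 : 8 * beta ^+ 2 * v ^+ 2 * k%:R ^+ 2 <= 8 * lam * (n%:R * v').
  rewrite (_ : _ * k%:R ^+ 2 = 8 * beta ^+ 2 * (k%:R * v) ^+ 2); last by ring.
  apply: (@le_trans _ _ (8 * beta ^+ 2 * (n%:R * v') ^+ 2)).
    by apply: ler_wpM2l; [nonneg|rewrite lerXn2r ?nnegrE //; nonneg].
  by rewrite b2 le_eqVlt; apply/orP; left; apply/eqP; field; rewrite !gt_eqF.
have t4 : n%:R * v' <= lam * (n%:R * v') by rewrite ler_peMl // ltW.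
rewrite (_ : 14 * lam * n%:R * v' = 14 * (lam * (n%:R * v'))); last by ring.
move: t1 t2 t3 t4 kv; rewrite -!mulrA; set a := lam * (n%:R * v'); lra.
Qed.

Variables (f : S -> S -> I -> R) (V : R).
Hypotheses (V_gt0 : 0 < V)
  (mf : forall i, measurable_fun [set: S * S] (fun z => f z.1 z.2 i))
  (if1 : forall x i, F.-integrable setT (EFin \o (fun y => f y x i)))
  (fmean1 : forall x i, \int[F]_y f y x i = 0)
  (if2 : forall x i, F.-integrable setT (EFin \o (fun y => f x y i)))
  (fmean2 : forall x i, \int[F]_y f x y i = 0)
  (fin_v : forall x, (\int[F]_y (vmax (f y x) ^+ 2)%:E < +oo)%E)
  (le_V : (\int[F]_x \int[F]_y (vmax (f y x) ^+ 2)%:E <= V%:E)%E)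
  (n_gt0 : (0 < n)%N).

Definition pair_sum (k : nat) (t : Om) (i : I) : R :=
  \sum_(j < k) \sum_(m < k) if (m < j)%N then f (X m t) (X j t) i else 0.

Let cross (k : nat) (t : Om) (x : S) (i : I) : R := \sum_(m < k) f (X m t) x i.

Let pair_sumS k t : pair_sum k.+1 t = addv (pair_sum k t) (cross k t (X k t)).
Proof.
apply/funext => i; rewrite /pair_sum /addv big_ord_recr /=; congr (_ + _).
  by apply: eq_bigr => j _; rewrite big_ord_recr /= ltnNge ltnW //= addr0.
rewrite big_ord_recr /= ltnn addr0; apply: eq_bigr => m _.
by rewrite ltn_ord.
Qed.

Let mX j : measurable_fun setT (X j). Proof. by case: iX. Qed.

Let measurable_f dT (T : measurableType dT) (u v : T -> S) i :
  measurable_fun setT u -> measurable_fun setT v ->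
  measurable_fun setT (fun t => f (u t) (v t) i).
Proof.
move=> mu mv.
exact: (measurableT_comp (mf i) (measurable_fun_pair mu mv)).
Qed.

Lemma measurable_pair_sum k i : measurable_fun setT (fun t => pair_sum k t i).
Proof.
apply: measurable_sum => j; apply: measurable_sum => m.
by case: (m < j)%N; [exact: measurable_f|exact: measurable_cst].
Qed.

Section with_beta.
Variable beta : R.
Hypothesis beta_gt0 : 0 < beta.

(** Conditional second moment, given the past, of the increment brought by observation [k]. *)
Let energy k t := (\int[F]_x (vmax (cross k t x) ^+ 2)%:E)%E.

Let energy_ge0 k t : (0 <= energy k t)%E.
Proof. by apply: integral_ge0 => x _; rewrite lee_fin sqr_ge0. Qed.

Let measurable_cross2 k : measurable_fun [set: Om * S]
  (fun z => (vmax (cross k z.1 z.2) ^+ 2)%:E).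
Proof.
apply/measurable_EFinP; apply: measurable_funX.
apply: (@measurable_vmax R I _ _ (fun i z => cross k z.1 z.2 i)) => i.
apply: measurable_sum => m; apply: measurable_f; last exact: measurable_snd.
by apply: measurableT_comp => //; exact: measurable_fst.
Qed.

Let measurable_energy k : measurable_fun setT (energy k).
Proof.
apply: (@measurable_fun_fubini_tonelli_F _ _ Om S R F _ (measurable_cross2 k)).
by move=> z; rewrite lee_fin sqr_ge0.
Qed.

(** Tonelli puts the new point outside. For a fixed [x] the cross term is a sum of independent
    centred vectors, so [iid_sum_vmax2] applies at the scale [v x + V], which is positive and has
    mean at most [2 * V]; hence 28 = 2 * 14. *)
Let energy_bound k : (k <= n)%N ->
  (\int[P]_t energy k t <= (28 * lam * n%:R * V)%:E)%E.
Proof.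
move=> kn; have lam0 : 0 <= lam by apply: le_trans lam_ge1.
rewrite /energy (@fubini_tonelli _ _ _ _ _ P F _ (measurable_cross2 k)) /=; last first.
  by move=> z; rewrite lee_fin sqr_ge0.
pose v x := (\int[F]_y (vmax (f y x) ^+ 2)%:E)%E.
have v0 x : (0 <= v x)%E by apply: integral_ge0 => y _; rewrite lee_fin sqr_ge0.
have mvf : measurable_fun setT (fun z : S * S => (vmax (f z.2 z.1) ^+ 2)%:E).
  apply/measurable_EFinP; apply: measurable_funX.
  apply: (@measurable_vmax R I _ _ (fun i z => f z.2 z.1 i)) => i.
  by apply: measurable_f; [exact: measurable_snd|exact: measurable_fst].
have mv : measurable_fun setT v.
  apply: (@measurable_fun_fubini_tonelli_F _ _ S S R F _ mvf).
  by move=> z; rewrite lee_fin sqr_ge0.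
have c0 : 0 <= 14 * lam * n%:R by nonneg.
apply: (@le_trans _ _ (\int[F]_x ((14 * lam * n%:R)%:E * (v x + V%:E)))%E).
  apply: ge0_le_integral => //.
  - by move=> x _; apply: integral_ge0 => t _; rewrite lee_fin sqr_ge0.
  - apply: (@measurable_fun_fubini_tonelli_G _ _ Om S R P _ (measurable_cross2 k)).
    by move=> z; rewrite lee_fin sqr_ge0.
  - by apply: emeasurable_funM => //; exact: emeasurable_funD.
  move=> x _.
  have vf : v x = (fine (v x))%:E by rewrite fineK // ge0_fin_numE //; exact: fin_v.
  have fv0 : 0 <= fine (v x) by exact: fine_ge0.
  have mg i : measurable_fun setT (fun y => f y x i) by apply: measurable_f.
  have := @iid_sum_vmax2 (fun y => f y x) (fine (v x)) (fine (v x) + V) k mg (if1 x) (fmean1 x) fv0.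
  rewrite lerDl => /(_ (ltW V_gt0)) H.
  rewrite vf -EFinD -EFinM; apply: H => //.
  - by rewrite ltr_wpDl.
  - by rewrite -vf.
rewrite ge0_integralZl //; last 2 first.
- exact: emeasurable_funD.
- by move=> x _; rewrite adde_ge0 // lee_fin ltW.
rewrite (_ : 28 * lam * n%:R * V = 14 * lam * n%:R * (V + V)); last by ring.
rewrite [leRHS]EFinM; apply: lee_wpmul2l; first by rewrite lee_fin.
rewrite ge0_integralD //; last by move=> x _; rewrite lee_fin ltW.
by rewrite (integral_prob_cst F) EFinD; apply: leeD; first exact: le_V.
Qed.

Let mean_slse k := (\int[P]_t (slse beta (pair_sum k t))%:E)%E.

Let measurable_slse_pair k : measurable_fun setT (fun t => (slse beta (pair_sum k t))%:E).
Proof.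
apply/measurable_EFinP; apply: (@cmeas_slse R I beta) => i; exact: measurable_pair_sum.
Qed.

Let mean_slse_step k : (k < n)%N ->
  (mean_slse k.+1 <= mean_slse k + (2 * beta * (28 * lam * n%:R * V))%:E)%E.
Proof.
move=> kn; have bt0 := ltW beta_gt0.
pose Wh (h : k.-tuple S) (i : I) := \sum_(j < k) \sum_(m < k)
  if (m < j)%N then f (tnth h m) (tnth h j) i else 0.
pose Dh (h : k.-tuple S) (x : S) (i : I) := \sum_(m < k) f (tnth h m) x i.
pose Phi (z : k.-tuple S * S) := (slse beta (addv (Wh z.1) (Dh z.1 z.2)))%:E.
have WhE t : Wh (history X k t) = pair_sum k t.
  apply/funext => i; apply: eq_bigr => j _; apply: eq_bigr => m _.
  by rewrite !tnth_mktuple.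
have DhE t x : Dh (history X k t) x = cross k t x.
  by apply/funext => i; apply: eq_bigr => m _; rewrite tnth_mktuple.
have mPhi : measurable_fun setT Phi.
  have mt (m : 'I_k) : measurable_fun [set: k.-tuple S * S] (fun z => tnth z.1 m).
    exact: (measurableT_comp (measurable_tnth m) measurable_fst).
  apply/measurable_EFinP.
  apply: (@cmeas_slse R I beta _ _ (fun i z => addv (Wh z.1) (Dh z.1 z.2) i)) => i.
  apply: measurable_funD.
    apply: measurable_sum => j; apply: measurable_sum => m.
    by case: (m < j)%N; [exact: measurable_f|exact: measurable_cst].
  by apply: measurable_sum => m; apply: measurable_f => //; exact: measurable_snd.
have Phi0 z : (0 <= Phi z)%E by rewrite lee_fin slse_ge0.
have [_ XF _] := iX.
have -> : mean_slse k.+1 = (\int[P]_t \int[F]_x Phi (history X k t, x))%E.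
  rewrite -(independent2_integral (measurable_history mX) (mX k) _
    (history_independent iX kn) mPhi Phi0); last by move=> B mB; exact: XF.
  by apply: eq_integral => t _; rewrite /Phi /= WhE DhE pair_sumS.
apply: (@le_trans _ _ (\int[P]_t ((slse beta (pair_sum k t))%:E + (2 * beta)%:E * energy k t))%E).
  apply: ge0_le_integral => //.
  - by move=> t _; apply: integral_ge0 => x _; exact: Phi0.
  - have := @measurable_fun_fubini_tonelli_F _ _ _ S R F Phi mPhi Phi0.
    by move=> /measurableT_comp; apply; exact: measurable_history.
  - by apply: emeasurable_funD => //; apply: emeasurable_funM.
  move=> t _; have e0 : (0 <= energy k t)%E.
    by apply: integral_ge0 => x _; rewrite lee_fin sqr_ge0.
  (* On a history of infinite energy the bound is void; elsewhere the energy is a real number. *)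
  have [einf|efin] := eqVneq (energy k t) +oo%E.
    rewrite einf gt0_muley ?lte_fin ?mulr_gt0 //; exact: leey.
  have ef : energy k t = (fine (energy k t))%:E.
    by rewrite fineK // ge0_fin_numE // ltey.
  rewrite ef -EFinM.
  have mD i : measurable_fun setT (fun x => cross k t x i).
    by apply: measurable_sum => m; exact: measurable_f.
  have iD i : F.-integrable setT (EFin \o (fun x => cross k t x i)).
    by apply: integrable_sumR => m; exact: if2.
  have meanD i : \int[F]_x cross k t x i = 0.
    by rewrite Rintegral_sumR // big1 // => m _; exact: fmean2.
  have := quad_slse_step i0 beta_gt0 mD iD meanD (pair_sum k t) (lexx 0) ler01 (lexx 0) (v := fine (energy k t)).
  rewrite -ef => /(_ (lexx _)).
  have q1 s : quad 0 1 0 s = s :> R by rewrite /quad mul0r add0r mul1r addr0.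
  under eq_integral do rewrite q1.
  rewrite q1 !(mulr0, mul0r, addr0, add0r, mul1r) => H.
  apply: le_trans H; rewrite le_eqVlt; apply/orP; left; apply/eqP.
  by apply: eq_integral => x _; rewrite /Phi /= WhE DhE.
have c0 : (0 <= (2 * beta)%:E)%E by rewrite lee_fin; nonneg.
have s0 t : setT t -> (0 <= (slse beta (pair_sum k t))%:E)%E by rewrite lee_fin slse_ge0.
have e0 t : setT t -> (0 <= energy k t)%E by [].
have ce0 t : setT t -> (0 <= (2 * beta)%:E * energy k t)%E by move=> _; exact: mule_ge0.
have mce : measurable_fun setT (fun t => (2 * beta)%:E * energy k t)%E.
  exact: emeasurable_funM.
rewrite (ge0_integralD P measurableT s0 (measurable_slse_pair k) ce0 mce).
apply: leeD => //.
rewrite (ge0_integralZl P measurableT (measurable_energy k) e0 c0).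
rewrite [leRHS]EFinM; apply: lee_wpmul2l; first by rewrite lee_fin; nonneg.
exact: energy_bound (ltnW kn).
Qed.

Lemma mean_slse_pair_sum : (\int[P]_t (slse beta (pair_sum n t))%:E <=
  (lam / beta + n%:R * (2 * beta * (28 * lam * n%:R * V)))%:E)%E.
Proof.
suff : forall k, (k <= n)%N -> (mean_slse k <=
    (lam / beta + k%:R * (2 * beta * (28 * lam * n%:R * V)))%:E)%E by move/(_ n (leqnn n)).
elim=> [_|k IH kn].
  rewrite mul0r addr0 /mean_slse.
  have E t : pair_sum 0 t = fun=> 0 by apply/funext => i; rewrite /pair_sum big_ord0.
  under eq_integral do rewrite E.
  by rewrite (integral_prob_cst P) lee_fin; exact: slse0.
apply: le_trans (mean_slse_step kn) _.
have := IH (ltnW kn); set Q := 2 * beta * _ => {}IH.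
rewrite (_ : lam / beta + k.+1%:R * Q = lam / beta + k%:R * Q + Q); last first.
  by rewrite -[k.+1%:R]natr1; ring.
by rewrite EFinD; apply: leeD.
Qed.

End with_beta.

(* Adding the observations one at a time, each new increment of the degenerate
   sum has conditional mean zero, so only the second-order term of the soft
   maximum contributes. *)
Lemma mean_vmax_pair_sum :
  (\int[P]_t (vmax (pair_sum n t))%:E <= (57 * lam * n%:R * Num.sqrt V)%:E)%E.
Proof.
have nR : 0 < n%:R :> R by rewrite ltr0n.
have sV : 0 < Num.sqrt V by rewrite sqrtr_gt0.
(* This [beta] makes [lam / beta] equal to [lam * n * sqrt V], and the accumulated second-order
   terms 56 times that, in total 57. *)
have b0 : 0 < (n%:R * Num.sqrt V)^-1 by rewrite invr_gt0 mulr_gt0.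
have := mean_slse_pair_sum b0.
rewrite (_ : _ + _ = 57 * lam * n%:R * Num.sqrt V); last first.
  move: (sqr_sqrtr (ltW V_gt0)) sV; move: (Num.sqrt V) => s <- s0.
  by field; rewrite !gt_eqF.
apply: le_trans; apply: ge0_le_integral => //.
- by move=> t _; rewrite lee_fin vmax_ge0.
- by apply/measurable_EFinP; exact: (measurable_vmax (measurable_pair_sum n)).
- apply/measurable_EFinP; apply: (@cmeas_slse R I) => i; exact: measurable_pair_sum.
- by move=> t _; rewrite lee_fin vmax_le_slse.
Qed.

End degenerate_kernel.

(** * The Hoeffding decomposition *)

Section integrability_criteria.
Context {R : realType} d (S : measurableType d) (mu : probability S R).
Implicit Types u v : S -> R.

Lemma integrable_lty u : measurable_fun setT u ->
  (\int[mu]_x (`|u x|)%:E < +oo)%E -> mu.-integrable setT (EFin \o u).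
Proof.
move=> meas_u fin_u; apply/integrableP; split; first exact/measurable_EFinP.
exact: fin_u.
Qed.

Lemma integrable_dominated u v : measurable_fun setT u ->
  mu.-integrable setT (EFin \o v) -> (forall x, `|u x| <= v x) ->
  mu.-integrable setT (EFin \o u).
Proof.
move=> meas_u iv uv.
apply: (@le_integrable _ _ _ mu setT measurableT _ (EFin \o v)) => //.
- exact/measurable_EFinP.
- by move=> x _ /=; rewrite lee_fin (le_trans (uv x)) // ler_norm.
Qed.

Lemma integrable_cstR (r : R) : mu.-integrable setT (EFin \o (fun=> r)).
Proof. exact: finite_measure_integrable_cst. Qed.

Lemma EFin_Rintegral u : mu.-integrable setT (EFin \o u) ->
  (\int[mu]_x u x)%:E = (\int[mu]_x (u x)%:E)%E.
Proof. by move=> iu; rewrite /Rintegral fineK //; exact: integrable_fin_num iu. Qed.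

Lemma Rintegral_cst1 (r : R) : \int[mu]_x (fun=> r) x = r.
Proof.
rewrite Rintegral_cst // -[RHS]mulr1; congr (_ * _).
exact: (congr1 fine (@probability_setT _ _ _ mu)).
Qed.

Lemma measurable_normr u : measurable_fun setT u -> measurable_fun setT (fun x => `|u x|).
Proof. by move=> mu'; exact: (measurableT_comp (@normr_measurable R setT) mu'). Qed.

Lemma integrable_power u k m : (k <= m)%N -> measurable_fun setT u ->
  (\int[mu]_x (`|u x| ^+ m)%:E < +oo)%E ->
  mu.-integrable setT (EFin \o (fun x => `|u x| ^+ k)).
Proof.
move=> km meas_u fin_m.
have im : mu.-integrable setT (EFin \o (fun x => `|u x| ^+ m)).
  apply: integrable_lty; first by apply: measurable_funX; exact: measurable_normr.
  by under eq_integral do rewrite ger0_norm ?exprn_ge0 //.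
apply: (integrable_dominated _ (integrableDR (integrable_cstR 1) im)).
  by apply: measurable_funX; exact: measurable_normr.
move=> x; rewrite normrX normr_id.
have [u1|u1] := lerP `|u x| 1.
  by rewrite (le_trans (exprn_ile1 _ (normr_ge0 _) u1)) // lerDl exprn_ge0.
by rewrite (le_trans (ler_weXn2l (ltW u1) km)) // lerDr.
Qed.

(** Jensen's inequality by integrating a supporting line at the mean; when the right-hand side is
    infinite there is nothing to show. *)
Lemma jensen_tangent (psi : R -> R) (c : R) u :
  mu.-integrable setT (EFin \o u) ->
  measurable_fun setT (fun x => psi (u x)) -> (forall x, 0 <= psi (u x)) ->
  (forall x, psi (\int[mu]_x u x) + c * (u x - \int[mu]_x u x) <= psi (u x)) ->
  ((psi (\int[mu]_x u x))%:E <= \int[mu]_x (psi (u x))%:E)%E.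
Proof.
move=> iu mpsi psi0; set m := \int[mu]_x u x => tangent.
have [inf|fin] := eqVneq (\int[mu]_x (psi (u x))%:E)%E +oo%E; first by rewrite inf leey.
have ip : mu.-integrable setT (EFin \o (fun x => psi (u x))).
  apply: integrable_lty => //; under eq_integral do rewrite ger0_norm //.
  by rewrite ltey.
have il : mu.-integrable setT (EFin \o (fun x => psi m + c * (u x - m))).
  apply: integrableDR; first exact: integrable_cstR.
  by apply: integrableZR; apply: integrableBR => //; exact: integrable_cstR.
rewrite -EFin_Rintegral // lee_fin.
have <- : \int[mu]_x (psi m + c * (u x - m)) = psi m.
  rewrite RintegralD //; last 2 first.
  - exact: integrable_cstR.
  - by apply: integrableZR; apply: integrableBR => //; exact: integrable_cstR.
  rewrite Rintegral_cst1 RintegralZl //; last by apply: integrableBR => //; exact: integrable_cstR.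
  rewrite RintegralB //; last exact: integrable_cstR.
  by rewrite Rintegral_cst1 -/m subrr mulr0 addr0.
exact: le_Rintegral.
Qed.

Lemma jensen_power u k : (0 < k)%N -> mu.-integrable setT (EFin \o u) ->
  measurable_fun setT u ->
  ((`|\int[mu]_x u x| ^+ k)%:E <= \int[mu]_x (`|u x| ^+ k)%:E)%E.
Proof.
move=> k0 iu meas_u.
have ia : mu.-integrable setT (EFin \o (fun x => `|u x|)) by exact: integrable_norm.
have m0 : 0 <= \int[mu]_x `|u x| by apply: Rintegral_ge0.
apply: (@le_trans _ _ ((\int[mu]_x `|u x|) ^+ k)%:E).
  rewrite lee_fin lerXn2r ?nnegrE //; exact: le_normr_Rintegral.
apply: (@jensen_tangent (fun r => r ^+ k) (k%:R * (\int[mu]_x `|u x|) ^+ k.-1)).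
- exact: ia.
- by apply: measurable_funX; exact: measurable_normr.
- by move=> x; exact: exprn_ge0.
move=> x; move: (\int[mu]_x `|u x|) m0 (normr_ge0 (u x)) => m m0.
move: `|u x| => r r0; case: k k0 => // k _ /=.
elim: k => [|k IH]; first by rewrite !expr1 expr0; lra.
have h : r ^+ k.+2 >= r * (m ^+ k.+1 + k.+1%:R * m ^+ k * (r - m)).
  by rewrite [r ^+ k.+2]exprS; exact: ler_wpM2l.
apply: le_trans h; rewrite -subr_ge0.
rewrite (_ : _ - _ = k.+1%:R * m ^+ k * (r - m) ^+ 2); last by rewrite -!natr1 !exprS; ring.
by nonneg.
Qed.

End integrability_criteria.

Lemma ge0_le_integralT {R : realType} d (S : measurableType d)
    (mu : {measure set S -> \bar R}) (f1 f2 : S -> \bar R) :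
  (forall x, 0 <= f1 x)%E -> measurable_fun setT f1 -> measurable_fun setT f2 ->
  (forall x, f1 x <= f2 x)%E -> (\int[mu]_x f1 x <= \int[mu]_x f2 x)%E.
Proof. by move=> f0 m1 m2 f12; apply: ge0_le_integral. Qed.

Section product_integrals.
Context {R : realType} d (S : measurableType d) (F : probability S R).

Lemma measurable_Rintegral2 (u : S * S -> R) : measurable_fun setT u ->
  (forall x, F.-integrable setT (EFin \o (fun y => u (x, y)))) ->
  measurable_fun setT (fun x => \int[F]_y u (x, y)).
Proof.
move=> meas_u iu.
have pos (v : S * S -> R) : measurable_fun setT v -> (forall z, 0 <= v z) ->
    measurable_fun setT (fun x => \int[F]_y v (x, y)).
  move=> mv v0; apply: (measurableT_comp (@fine_measurable R setT measurableT)).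
  apply: (@measurable_fun_fubini_tonelli_F _ _ S S R F (EFin \o v)).
    exact/measurable_EFinP.
  by move=> z; rewrite lee_fin.
have ma : measurable_fun setT (fun z => `|u z|) by exact: measurable_normr.
(* Tonelli's measurability covers nonnegative integrands, so [u] is written as the sum of [u] and
   its absolute value, minus the latter. *)
rewrite (_ : (fun x => _) = fun x => \int[F]_y (u (x, y) + `|u (x, y)|) - \int[F]_y `|u (x, y)|).
  apply: measurable_funB; last exact: (pos (fun z => `|u z|)).
  apply: (pos (fun z => u z + `|u z|)); first exact: measurable_funD.
  by move=> z; rewrite -lerBlDl sub0r -normrN ler_norm.
apply/funext => x; have ia := integrable_norm (iu x).
by rewrite RintegralD // addrK.
Qed.

End product_integrals.

Section kernel.
Context {R : realType} (I : finType) (i0 : I) d (S : measurableType d)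
  (F : probability S R) (H : S -> S -> I -> R) (B M2 : R).
Hypotheses (B_ge1 : 1 <= B)
  (mH : forall i, measurable_fun [set: S * S] (fun z => H z.1 z.2 i))
  (H_sym : forall x y, H x y = H y x)
  (H_sq : forall x i, (\int[F]_y (`|H x y i| ^+ 2)%:E < +oo)%E)
  (H_cube : forall i, (\int[F]_x \int[F]_y (`|H x y i| ^+ 3)%:E <= B%:E)%E)
  (H_max2 : (\int[F]_x \int[F]_y (vmax (H x y) ^+ 2)%:E <= M2%:E)%E).

Definition kernel_mean (x : S) (i : I) : R := \int[F]_y H x y i.
Definition kernel_total (i : I) : R := \int[F]_x kernel_mean x i.
Definition kernel_proj (x : S) (i : I) : R := kernel_mean x i - kernel_total i.
(** The completely degenerate part of the kernel: averaging either argument gives 0. *)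
Definition kernel_rest (x y : S) (i : I) : R :=
  H x y i - kernel_total i - kernel_proj x i - kernel_proj y i.
(** An envelope for all coordinates of [kernel_mean] at once, from which the sup norm bounds follow
    without a union over coordinates. *)
Definition kernel_max_mean (x : S) : R := \int[F]_y vmax (H x y).

Let mHx x i : measurable_fun setT (fun y => H x y i).
Proof. exact: (measurableT_comp (mH i) (pair1_measurable x)). Qed.

Let iH2 x i : F.-integrable setT (EFin \o (fun y => `|H x y i| ^+ 2)).
Proof. exact: integrable_power (leqnn 2) (mHx x i) (H_sq x i). Qed.

Lemma kernel_integrable x i : F.-integrable setT (EFin \o (fun y => H x y i)).
Proof.
apply: (integrable_dominated (mHx x i) (integrable_power (leqnSn 1) (mHx x i) (H_sq x i))).
by move=> y; rewrite expr1.
Qed.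

Lemma measurable_kernel_mean i : measurable_fun setT (fun x => kernel_mean x i).
Proof.
by apply: (@measurable_Rintegral2 _ _ S F (fun z => H z.1 z.2 i)) => // x; exact: kernel_integrable.
Qed.

Lemma kernel_mean_power3 i :
  (\int[F]_x (`|kernel_mean x i| ^+ 3)%:E <= B%:E)%E.
Proof.
apply: le_trans (H_cube i).
have m3 : measurable_fun setT (fun z : S * S => (`|H z.1 z.2 i| ^+ 3)%:E).
  by apply/measurable_EFinP; apply: measurable_funX; exact: measurable_normr.
apply: ge0_le_integralT.
- by move=> x; rewrite lee_fin exprn_ge0.
- by apply/measurable_EFinP; apply: measurable_funX; apply: measurable_normr; exact: measurable_kernel_mean.
- apply: (@measurable_fun_fubini_tonelli_F _ _ S S R F _ m3).
  by move=> z; rewrite lee_fin exprn_ge0.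
by move=> x; apply: jensen_power => //; exact: kernel_integrable.
Qed.

Let mean_fin3 i : (\int[F]_x (`|kernel_mean x i| ^+ 3)%:E < +oo)%E.
Proof. exact: le_lt_trans (kernel_mean_power3 i) (ltry _). Qed.

Lemma kernel_mean_integrable i : F.-integrable setT (EFin \o (fun x => kernel_mean x i)).
Proof.
have mm := measurable_kernel_mean i.
apply: (integrable_dominated mm (integrable_power (m:=3) (k:=1) isT mm (mean_fin3 i))).
by move=> x; rewrite expr1.
Qed.

Lemma kernel_total_power3 i : `|kernel_total i| ^+ 3 <= B.
Proof.
rewrite -lee_fin; apply: le_trans (kernel_mean_power3 i).
by apply: jensen_power => //; [exact: kernel_mean_integrable|exact: measurable_kernel_mean].
Qed.

Lemma measurable_kernel_proj i : measurable_fun setT (fun x => kernel_proj x i).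
Proof. by apply: measurable_funB => //; exact: measurable_kernel_mean. Qed.

Lemma kernel_proj_integrable i : F.-integrable setT (EFin \o (fun x => kernel_proj x i)).
Proof. by apply: integrableBR; [exact: kernel_mean_integrable|exact: integrable_cstR]. Qed.

Lemma kernel_proj_mean i : \int[F]_x kernel_proj x i = 0.
Proof.
rewrite RintegralB //; [|exact: kernel_mean_integrable|exact: integrable_cstR].
by rewrite (Rintegral_cst1 F) subrr.
Qed.

Let proj_power3_le x i : `|kernel_proj x i| ^+ 3 <= 4 * (`|kernel_mean x i| ^+ 3 + B).
Proof.
apply: (@le_trans _ _ ((`|kernel_mean x i| + `|kernel_total i|) ^+ 3)).
  by rewrite lerXn2r ?nnegrE ?addr_ge0 // ler_normB.
have := kernel_total_power3 i.
move: (normr_ge0 (kernel_mean x i)) (normr_ge0 (kernel_total i)).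
move: `|kernel_mean x i| `|kernel_total i| => a t a0 t0 t3.
have : (a + t) ^+ 3 <= 4 * (a ^+ 3 + t ^+ 3).
  rewrite -subr_ge0 (_ : _ - _ = 3 * (a + t) * (a - t) ^+ 2); last by ring.
  by nonneg.
by move: t3; lra.
Qed.

Lemma kernel_proj_integrable3 i :
  F.-integrable setT (EFin \o (fun x => `|kernel_proj x i| ^+ 3)).
Proof.
have mm := measurable_kernel_mean i.
have i3 := integrable_power (leqnn 3) mm (mean_fin3 i).
have ib : F.-integrable setT (EFin \o (fun x => 4 * (`|kernel_mean x i| ^+ 3 + B))).
  by apply: integrableZR; apply: integrableDR => //; exact: integrable_cstR.
apply: (integrable_dominated _ ib).
  by apply: measurable_funX; apply: measurable_normr; exact: measurable_kernel_proj.
by move=> x; rewrite normrX normr_id.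
Qed.

Lemma kernel_proj_third i : \int[F]_x (`|kernel_proj x i| ^+ 3) <= 8 * B.
Proof.
have mm := measurable_kernel_mean i.
have i3 := integrable_power (leqnn 3) mm (mean_fin3 i).
apply: (@le_trans _ _ (\int[F]_x (4 * (`|kernel_mean x i| ^+ 3 + B)))).
  apply: le_Rintegral => //; first exact: kernel_proj_integrable3.
  by apply: integrableZR; apply: integrableDR => //; exact: integrable_cstR.
rewrite RintegralZl //; last by apply: integrableDR => //; exact: integrable_cstR.
rewrite RintegralD //; last exact: integrable_cstR.
rewrite (Rintegral_cst1 F).
have : \int[F]_x (`|kernel_mean x i| ^+ 3) <= B.
  by rewrite -lee_fin EFin_Rintegral //; exact: kernel_mean_power3.
lra.
Qed.

Lemma kernel_proj_integrable2 i j :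
  F.-integrable setT (EFin \o (fun x => kernel_proj x i * kernel_proj x j)).
Proof.
have i1 := kernel_proj_integrable3 i; have i2 := kernel_proj_integrable3 j.
have ib : F.-integrable setT (EFin \o (fun x =>
    1 + `|kernel_proj x i| ^+ 3 + `|kernel_proj x j| ^+ 3)).
  by apply: integrableDR => //; apply: integrableDR => //; exact: integrable_cstR.
apply: (integrable_dominated _ ib).
  by apply: measurable_funM; exact: measurable_kernel_proj.
suff key (a c : R) : 0 <= a -> 0 <= c -> a * c <= 1 + a ^+ 3 + c ^+ 3.
  by move=> x; rewrite normrM; exact: key.
move=> a0 c0.
have sq (r : R) : 0 <= r -> r ^+ 2 <= 1 + r ^+ 3.
  move=> r0; have [r1|r1] := lerP r 1.
    by rewrite (le_trans (exprn_ile1 2 r0 r1)) // lerDl exprn_ge0.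
  by rewrite (le_trans (ler_weXn2l (ltW r1) (leqnSn 2))) // lerDr.
have ac : 2 * (a * c) <= a ^+ 2 + c ^+ 2.
  by rewrite -subr_ge0 (_ : _ - _ = (a - c) ^+ 2) ?sqr_ge0 //; ring.
have := sq _ a0; have := sq _ c0.
have a3 : 0 <= a ^+ 3 by exact: exprn_ge0.
have c3 : 0 <= c ^+ 3 by exact: exprn_ge0.
move: ac; move: (a ^+ 3) (c ^+ 3) a3 c3 => p q p0 q0; move: (a ^+ 2) (a * c) (c ^+ 2) => *; lra.
Qed.

Lemma kernel_proj_var_le i : \int[F]_x (kernel_proj x i * kernel_proj x i) <= 9 * B.
Proof.
have i3 := kernel_proj_integrable3 i.
apply: (@le_trans _ _ (\int[F]_x (1 + `|kernel_proj x i| ^+ 3))).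
  apply: le_Rintegral => //; first exact: kernel_proj_integrable2.
    by apply: integrableDR => //; exact: integrable_cstR.
  move=> x _; rewrite -expr2 -real_normK ?num_real //.
  have r0 := normr_ge0 (kernel_proj x i).
  have [r1|r1] := lerP `|kernel_proj x i| 1.
    by rewrite (le_trans (exprn_ile1 2 r0 r1)) // lerDl exprn_ge0.
  by rewrite (le_trans (ler_weXn2l (ltW r1) (leqnSn 2))) // lerDr.
rewrite RintegralD //; last exact: integrable_cstR.
rewrite (Rintegral_cst1 F); have := kernel_proj_third i; move: B_ge1; lra.
Qed.

(* The supporting line of r^3 at the standard deviation s gives
   3 s r^2 <= 2 |r|^3 + s^3, hence s^3 <= E |r|^3. *)
Lemma kernel_proj_sd3 i :
  Num.sqrt (\int[F]_x (kernel_proj x i * kernel_proj x i)) ^+ 3 <= 8 * B.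
Proof.
have i3 := kernel_proj_integrable3 i; have i2 := kernel_proj_integrable2 i i.
set v := \int[F]_x _.
have v0 : 0 <= v by apply: Rintegral_ge0 => x _; rewrite -expr2 sqr_ge0.
have s0 := sqrtr_ge0 v; have s2 := sqr_sqrtr v0; move: s0 s2; set s := Num.sqrt v => s0 s2.
apply: le_trans (kernel_proj_third i).
have : 3 * s * v <= 2 * \int[F]_x (`|kernel_proj x i| ^+ 3) + s ^+ 3.
  rewrite -RintegralZl // -[in X in _ + X](Rintegral_cst1 F (s ^+ 3)) -RintegralZl //.
  rewrite -RintegralD //; [|exact: integrableZR|exact: integrable_cstR].
  apply: le_Rintegral => //; first exact: integrableZR.
    by apply: integrableDR; [exact: integrableZR|exact: integrable_cstR].
  move=> x _; rewrite -expr2 -real_normK ?num_real //.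
  move: `|kernel_proj x i| (normr_ge0 (kernel_proj x i)) => r r0.
  rewrite -subr_ge0 (_ : _ - _ = (r - s) ^+ 2 * (2 * r + s)); last by ring.
  by nonneg.
rewrite -s2 (_ : 3 * s * s ^+ 2 = 3 * s ^+ 3); last by ring.
lra.
Qed.


Lemma measurable_kernel_max x : measurable_fun setT (fun y => vmax (H x y)).
Proof. exact: (measurable_vmax (mHx x)). Qed.

Lemma kernel_max_integrable2 x :
  F.-integrable setT (EFin \o (fun y => vmax (H x y) ^+ 2)).
Proof.
have iS : F.-integrable setT (EFin \o (fun y => \sum_i `|H x y i| ^+ 2)).
  by apply: integrable_sumR => i; exact: iH2.
apply: (integrable_dominated _ iS).
  by apply: measurable_funX; exact: measurable_kernel_max.
move=> y; rewrite ger0_norm ?sqr_ge0 //.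
have [i ->] := vmax_attained i0 (H x y).
by rewrite (bigD1 i) //= lerDl; apply: sumr_ge0 => j _; rewrite exprn_ge0.
Qed.

Let max_fin2 x : (\int[F]_y (`|vmax (H x y)| ^+ 2)%:E < +oo)%E.
Proof.
have := integrable_fin_num measurableT (kernel_max_integrable2 x).
rewrite ge0_fin_numE; last by apply: integral_ge0 => y _; rewrite lee_fin sqr_ge0.
rewrite (_ : (\int[F]_y (`|vmax (H x y)| ^+ 2)%:E)%E =
  (\int[F]_y (EFin \o (fun y => (vmax (H x y) ^+ 2)%R)) y)%E) //.
by apply: eq_integral => y _ /=; rewrite ger0_norm ?vmax_ge0.
Qed.

Lemma kernel_max_integrable x : F.-integrable setT (EFin \o (fun y => vmax (H x y))).
Proof.
have mm := measurable_kernel_max x.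
apply: (integrable_dominated mm (integrable_power (m:=2) (k:=1) isT mm (max_fin2 x))).
by move=> y; rewrite expr1.
Qed.

Lemma measurable_kernel_max_mean : measurable_fun setT kernel_max_mean.
Proof.
apply: (@measurable_Rintegral2 _ _ S F (fun z => vmax (H z.1 z.2))) => [|x].
  exact: (@measurable_vmax R I _ _ (fun i z => H z.1 z.2 i)).
exact: kernel_max_integrable.
Qed.

Lemma kernel_max_mean_ge0 x : 0 <= kernel_max_mean x.
Proof. by apply: Rintegral_ge0 => y _; exact: vmax_ge0. Qed.

Lemma kernel_mean_le_max x i : `|kernel_mean x i| <= kernel_max_mean x.
Proof.
apply: le_trans (le_normr_Rintegral _ (kernel_integrable x i)) _ => //.
apply: le_Rintegral => //; [|exact: kernel_max_integrable|].
  exact: integrable_norm (kernel_integrable x i).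
by move=> y _; exact: vmax_ge.
Qed.

Lemma kernel_max_mean_power2 : (\int[F]_x (kernel_max_mean x ^+ 2)%:E <= M2%:E)%E.
Proof.
apply: le_trans H_max2.
have mv : measurable_fun setT (fun z : S * S => (vmax (H z.1 z.2) ^+ 2)%:E).
  apply/measurable_EFinP; apply: measurable_funX.
  exact: (@measurable_vmax R I _ _ (fun i z => H z.1 z.2 i)).
apply: ge0_le_integralT.
- by move=> x; rewrite lee_fin sqr_ge0.
- by apply/measurable_EFinP; apply: measurable_funX; exact: measurable_kernel_max_mean.
- apply: (@measurable_fun_fubini_tonelli_F _ _ S S R F _ mv).
  by move=> z; rewrite lee_fin sqr_ge0.
move=> x; have := @jensen_power _ _ _ F (fun y => vmax (H x y)) 2 isT
  (kernel_max_integrable x) (measurable_kernel_max x).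
rewrite -/(kernel_max_mean x) ger0_norm ?kernel_max_mean_ge0 //.
by under eq_integral do rewrite ger0_norm ?vmax_ge0 //.
Qed.

Let mean_max_fin2 : (\int[F]_x (`|kernel_max_mean x| ^+ 2)%:E < +oo)%E.
Proof.
apply: le_lt_trans (ltry M2); apply: le_trans kernel_max_mean_power2.
by under eq_integral do rewrite ger0_norm ?kernel_max_mean_ge0 //.
Qed.

Definition kernel_max_total : R := \int[F]_x kernel_max_mean x.

Lemma kernel_max_mean_integrable : F.-integrable setT (EFin \o kernel_max_mean).
Proof.
have mm := measurable_kernel_max_mean.
apply: (integrable_dominated mm (integrable_power (m:=2) (k:=1) isT mm mean_max_fin2)).
by move=> x; rewrite expr1.
Qed.

Lemma kernel_max_total_ge0 : 0 <= kernel_max_total.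
Proof. by apply: Rintegral_ge0 => x _; exact: kernel_max_mean_ge0. Qed.

Lemma kernel_total_le_max i : `|kernel_total i| <= kernel_max_total.
Proof.
apply: le_trans (le_normr_Rintegral _ (kernel_mean_integrable i)) _ => //.
apply: le_Rintegral => //; last by move=> x _; exact: kernel_mean_le_max.
  exact: integrable_norm (kernel_mean_integrable i).
exact: kernel_max_mean_integrable.
Qed.

Lemma kernel_max_total_power2 : kernel_max_total ^+ 2 <= M2.
Proof.
rewrite -lee_fin; apply: le_trans kernel_max_mean_power2.
have := @jensen_power _ _ _ F kernel_max_mean 2 isT kernel_max_mean_integrable measurable_kernel_max_mean.
rewrite -/kernel_max_total ger0_norm ?kernel_max_total_ge0 //.
by under eq_integral do rewrite ger0_norm ?kernel_max_mean_ge0 //.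
Qed.

Let proj_le_max x i : `|kernel_proj x i| <= kernel_max_mean x + kernel_max_total.
Proof.
apply: le_trans (ler_normB _ _) _; apply: lerD.
  exact: kernel_mean_le_max.
exact: kernel_total_le_max.
Qed.

Lemma kernel_proj_vmax_le x : vmax (kernel_proj x) <= kernel_max_mean x + kernel_max_total.
Proof.
apply: vmax_le => [|i]; last exact: proj_le_max.
by rewrite addr_ge0 ?kernel_max_mean_ge0 ?kernel_max_total_ge0.
Qed.

Lemma measurable_kernel_rest i :
  measurable_fun [set: S * S] (fun z => kernel_rest z.1 z.2 i).
Proof.
apply: measurable_funB; first apply: measurable_funB; first exact: measurable_funB.
  exact: (measurableT_comp (measurable_kernel_proj i) measurable_fst).
exact: (measurableT_comp (measurable_kernel_proj i) measurable_snd).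
Qed.

Lemma kernel_rest_sym x y : kernel_rest x y = kernel_rest y x.
Proof. by apply/funext => i; rewrite /kernel_rest H_sym; ring. Qed.

Lemma kernel_rest_integrable x i :
  F.-integrable setT (EFin \o (fun y => kernel_rest x y i)).
Proof.
apply: integrableBR; last exact: kernel_proj_integrable.
by do 2 (apply: integrableBR; last exact: integrable_cstR); exact: kernel_integrable.
Qed.

Lemma kernel_rest_degenerate x i : \int[F]_y kernel_rest x y i = 0.
Proof.
have i1 := kernel_integrable x i; have ic := integrable_cstR F.
rewrite /kernel_rest RintegralB //; last 2 first.
- by do 2 (apply: integrableBR; last exact: integrable_cstR).
- exact: kernel_proj_integrable.
rewrite RintegralB //; last by apply: integrableBR.
rewrite RintegralB // !(Rintegral_cst1 F) kernel_proj_mean.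
by rewrite /kernel_proj -/(kernel_mean x i); ring.
Qed.

Let rest_le x y : vmax (kernel_rest x y) ^+ 2 <=
  4 * (vmax (H x y) ^+ 2 + kernel_max_mean x ^+ 2 + kernel_max_mean y ^+ 2 + kernel_max_total ^+ 2).
Proof.
have h : vmax (kernel_rest x y) <=
    vmax (H x y) + kernel_max_mean x + kernel_max_mean y + kernel_max_total.
  have g0 := kernel_max_mean_ge0; have v0 := vmax_ge0 i0 (H x y).
  apply: vmax_le => [|i]; first by rewrite !addr_ge0 // kernel_max_total_ge0.
  rewrite (_ : kernel_rest x y i = H x y i - kernel_mean x i - kernel_mean y i + kernel_total i);
    last by rewrite /kernel_rest /kernel_proj; ring.
  apply: le_trans (ler_normD _ _) _; apply: lerD; last exact: kernel_total_le_max.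
  apply: le_trans (ler_normB _ _) _; apply: lerD; last exact: kernel_mean_le_max.
  apply: le_trans (ler_normB _ _) _; apply: lerD; last exact: kernel_mean_le_max.
  exact: vmax_ge.
apply: (@le_trans _ _ ((vmax (H x y) + kernel_max_mean x + kernel_max_mean y + kernel_max_total) ^+ 2)).
  by rewrite lerXn2r ?nnegrE ?vmax_ge0 // (le_trans _ h) ?vmax_ge0.
move: (vmax (H x y)) (kernel_max_mean x) (kernel_max_mean y) kernel_max_total => a b c e.
rewrite -subr_ge0 (_ : _ - _ = (a - b) ^+ 2 + (a - c) ^+ 2 + (a - e) ^+ 2 + (b - c) ^+ 2 +
   (b - e) ^+ 2 + (c - e) ^+ 2); last by ring.
by nonneg.
Qed.

Let mean_max_integrable2 : F.-integrable setT (EFin \o (fun x => kernel_max_mean x ^+ 2)).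
Proof.
have := integrable_power (leqnn 2) measurable_kernel_max_mean mean_max_fin2.
apply: eq_integrable => // x _ /=; by rewrite ger0_norm ?kernel_max_mean_ge0.
Qed.

Let rest_bound_integrable x : F.-integrable setT (EFin \o (fun y =>
  4 * (vmax (H x y) ^+ 2 + kernel_max_mean x ^+ 2 + kernel_max_mean y ^+ 2 + kernel_max_total ^+ 2))).
Proof.
apply: integrableZR; apply: integrableDR; last exact: integrable_cstR.
apply: integrableDR => //; apply: integrableDR; last exact: integrable_cstR.
exact: kernel_max_integrable2.
Qed.

Let measurable_rest_max : measurable_fun [set: S * S] (fun z => (vmax (kernel_rest z.1 z.2) ^+ 2)%:E).
Proof.
apply/measurable_EFinP; apply: measurable_funX.
by apply: (@measurable_vmax R I _ _ (fun i z => kernel_rest z.1 z.2 i)); exact: measurable_kernel_rest.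
Qed.

Let rest_max_le x : (\int[F]_y (vmax (kernel_rest x y) ^+ 2)%:E <=
  (4 * (\int[F]_y (vmax (H x y) ^+ 2) + kernel_max_mean x ^+ 2
    + \int[F]_y (kernel_max_mean y ^+ 2) + kernel_max_total ^+ 2))%:E)%E.
Proof.
have ic := integrable_cstR F; have i2 := kernel_max_integrable2 x.
have <- : \int[F]_y (4 * (vmax (H x y) ^+ 2 + kernel_max_mean x ^+ 2 + kernel_max_mean y ^+ 2
    + kernel_max_total ^+ 2)) = 4 * (\int[F]_y (vmax (H x y) ^+ 2) + kernel_max_mean x ^+ 2
    + \int[F]_y (kernel_max_mean y ^+ 2) + kernel_max_total ^+ 2).
  have iab := integrableDR i2 (ic (kernel_max_mean x ^+ 2)).
  have iabc := integrableDR iab mean_max_integrable2.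
  rewrite RintegralZl //; last exact: integrableDR.
  by rewrite RintegralD // RintegralD // RintegralD // !(Rintegral_cst1 F).
rewrite EFin_Rintegral; last exact: rest_bound_integrable.
apply: ge0_le_integralT.
- by move=> y; rewrite lee_fin sqr_ge0.
- exact: (measurableT_comp measurable_rest_max (pair1_measurable x)).
- by case/integrableP: (rest_bound_integrable x).
by move=> y; rewrite lee_fin; exact: rest_le.
Qed.

Lemma kernel_rest_fin x : (\int[F]_y (vmax (kernel_rest x y) ^+ 2)%:E < +oo)%E.
Proof. exact: le_lt_trans (rest_max_le x) (ltry _). Qed.

(** 16 = 4 * 4: the square of a sum of four envelopes is at most four times the sum of their
    squares, and each of these has mean at most [M2], the last three by Jensen's inequality. *)
Lemma kernel_rest_max2 :
  (\int[F]_x \int[F]_y (vmax (kernel_rest x y) ^+ 2)%:E <= (16 * M2)%:E)%E.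
Proof.
pose q x := \int[F]_y (vmax (H x y) ^+ 2).
have qE x : (q x)%:E = (\int[F]_y (vmax (H x y) ^+ 2)%:E)%E.
  by rewrite EFin_Rintegral //; exact: kernel_max_integrable2.
have q0 x : 0 <= q x by apply: Rintegral_ge0 => y _; exact: sqr_ge0.
have mq : measurable_fun setT q.
  apply: (@measurable_Rintegral2 _ _ S F (fun z => vmax (H z.1 z.2) ^+ 2)) => [|x].
    apply: measurable_funX; exact: (@measurable_vmax R I _ _ (fun i z => H z.1 z.2 i)).
  exact: kernel_max_integrable2.
have iq : F.-integrable setT (EFin \o q).
  apply: integrable_lty => //; under eq_integral do rewrite ger0_norm // qE.
  exact: le_lt_trans H_max2 (ltry _).
have qM : \int[F]_x q x <= M2.
  by rewrite -lee_fin EFin_Rintegral //; under eq_integral do rewrite qE.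
pose m := \int[F]_y (kernel_max_mean y ^+ 2).
have mM : m <= M2.
  by rewrite -lee_fin EFin_Rintegral //; exact: kernel_max_mean_power2.
have ic := integrable_cstR F.
have iab := integrableDR iq mean_max_integrable2.
have iabc := integrableDR iab (ic m).
have iabcd := integrableDR iabc (ic (kernel_max_total ^+ 2)).
apply: (@le_trans _ _ (\int[F]_x (4 * (q x + kernel_max_mean x ^+ 2 + m + kernel_max_total ^+ 2))%:E)%E).
  apply: ge0_le_integralT.
  - by move=> x; apply: integral_ge0 => y _; rewrite lee_fin sqr_ge0.
  - apply: (@measurable_fun_fubini_tonelli_F _ _ S S R F _ measurable_rest_max).
    by move=> z; rewrite lee_fin sqr_ge0.
  - by case/integrableP: (integrableZR 4 iabcd).
  by move=> x; exact: rest_max_le.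
rewrite -EFin_Rintegral; last exact: integrableZR.
rewrite lee_fin RintegralZl // RintegralD // RintegralD // RintegralD // !(Rintegral_cst1 F).
have := kernel_max_total_power2; rewrite -/m; move: qM mM; lra.
Qed.

End kernel.

Section hoeffding_decomposition.
Context {R : realType} (I : finType) d (S : measurableType d)
  (F : probability S R) (H : S -> S -> I -> R).
Context dO (Om : measurableType dO) (X : nat -> Om -> S) (n : nat).
Hypotheses (H_sym : forall x y, H x y = H y x) (n_ge2 : (2 <= n)%N).

Definition kernel_stat (t : Om) (i : I) : R :=
  Num.sqrt n%:R * ((n * n.-1)%:R^-1 *
    (\sum_(a < n) \sum_(c < n | a != c) H (X a t) (X c t) i) - kernel_total F H i) / 2.

Lemma sum_offdiag_sym (r : nat -> nat -> R) : (forall a c, r a c = r c a) ->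
  \sum_(a < n) \sum_(c < n | a != c) r a c =
  2 * \sum_(j < n) \sum_(m < n) if (m < j)%N then r m j else 0.
Proof.
move=> rsym; rewrite mulr2n mulrDl mul1r {2}exchange_big -big_split /=.
apply: eq_bigr => a _; rewrite big_mkcond -big_split /=; apply: eq_bigr => c _.
rewrite -(inj_eq val_inj) /=.
by case: ltngtP => _; rewrite ?addr0 ?add0r // rsym.
Qed.

Lemma sum_offdiag_add (u : nat -> R) (q : R) :
  \sum_(a < n) \sum_(c < n | a != c) (q + u a + u c) =
  n%:R * (n%:R - 1) * q + 2 * (n%:R - 1) * \sum_(a < n) u a.
Proof.
pose U := \sum_(a < n) u a.
have E (a : 'I_n) : \sum_(c < n | a != c) (q + u a + u c) =
    (n%:R - 1) * q + U + (n%:R - 2) * u a.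
  have : \sum_(c < n) (q + u a + u c) = q + u a + u a + \sum_(c < n | a != c) (q + u a + u c).
    by rewrite (bigD1 a) //=; congr (_ + _); apply: eq_bigl => c; rewrite eq_sym.
  rewrite big_split /= sumr_const card_ord -[_ *+ n]mulr_natr -/U => h.
  by move: h; set s := \sum_(c < n | _) _ => h; lra.
rewrite (eq_bigr _ (fun a _ => E a)) !big_split /= -mulr_sumr -/U !sumr_const card_ord.
by rewrite -mulr_sumr -/U -[q *+ n]mulr_natr -[U *+ n]mulr_natr; ring.
Qed.

(** Each projection occurs in [2 * (n - 1)] of the ordered pairs; the factor [1 / 2] in the
    statistic then leaves a normalized sum without further constant. *)
Lemma kernel_statE t i : kernel_stat t i =
  \sum_(j < n) (Num.sqrt n%:R)^-1 * kernel_proj F H (X j t) i +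
  (Num.sqrt n%:R * n.-1%:R)^-1 * pair_sum X (kernel_rest F H) n t i.
Proof.
have n0 : 0 < n%:R :> R by rewrite ltr0n (leq_trans _ n_ge2).
have n1 : n.-1%:R = n%:R - 1 :> R by case: (n) n_ge2 => // m _; rewrite -natr1 addrK.
have n1p : 0 < n%:R - 1 :> R by rewrite -n1 ltr0n; case: (n) n_ge2 => [|[]].
have s0 : 0 < Num.sqrt n%:R :> R by rewrite sqrtr_gt0.
rewrite /kernel_stat natrM n1.
have -> : \sum_(a < n) \sum_(c < n | a != c) H (X a t) (X c t) i =
   n%:R * (n%:R - 1) * kernel_total F H i +
   2 * (n%:R - 1) * \sum_(a < n) kernel_proj F H (X a t) i +
   2 * pair_sum X (kernel_rest F H) n t i.
  rewrite -(sum_offdiag_add (fun a => kernel_proj F H (X a t) i)) /pair_sum.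
  rewrite -(@sum_offdiag_sym (fun a c => kernel_rest F H (X a t) (X c t) i)).
    rewrite -big_split /=; apply: eq_bigr => a _; rewrite -big_split /=.
    by apply: eq_bigr => c _; rewrite /kernel_rest; ring.
  by move=> a c; rewrite (kernel_rest_sym F H_sym).
rewrite -mulr_sumr; set g := \sum_(a < n) _; set r := pair_sum _ _ _ _ _.
have sE : Num.sqrt n%:R ^+ 2 = n%:R :> R by rewrite sqr_sqrtr // ltW.
move: sE s0 n1p n0; set s := Num.sqrt n%:R; move: s => s <- s0 n1p n0.
by field; rewrite !gt_eqF.
Qed.

End hoeffding_decomposition.

(** * Comparison of orthant probabilities *)

Section orthant_comparison.
Context {R : realType} (I : finType) (i0 : I) d (S : measurableType d)
  (F : probability S R) (H : S -> S -> I -> R) (B M2 : R).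
Hypotheses (B_ge1 : 1 <= B) (M2_gt0 : 0 < M2)
  (mH : forall i, measurable_fun [set: S * S] (fun z => H z.1 z.2 i))
  (H_sym : forall x y, H x y = H y x)
  (H_sq : forall x i, (\int[F]_y (`|H x y i| ^+ 2)%:E < +oo)%E)
  (H_cube : forall i, (\int[F]_x \int[F]_y (`|H x y i| ^+ 3)%:E <= B%:E)%E)
  (H_max2 : (\int[F]_x \int[F]_y (vmax (H x y) ^+ 2)%:E <= M2%:E)%E).
Context dO (Om : measurableType dO) (P : probability Om R) (X : nat -> Om -> S) (n : nat).
Hypotheses (n_ge2 : (2 <= n)%N) (iX : iid_seq P F n X).
Context dZ (OmZ : measurableType dZ) (PZ : probability OmZ R) (k : nat)
  (Z : nat -> OmZ -> R) (A : nat -> I -> R).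
Hypotheses (iZ : iid_seq PZ (@gauss R) k Z)
  (A_cov : forall i j, gram A k i j = \int[F]_x (kernel_proj F H x i * kernel_proj F H x j)).
Variables (b l phi D tau : R).
Hypotheses (b_gt0 : 0 < b) (var_ge : forall i, b <= gram A k i i)
  (l_ge1 : 1 <= l) (card_le : ln #|{: I * bool}|%:R <= l) (phi_gt0 : 0 < phi)
  (D_gt0 : 0 < D) (var_le : forall i, gram A k i i <= D ^+ 2).

Let s := (Num.sqrt (n%:R : R))^-1.
Let beta := bandwidth l phi.
Let C := 13312 * expR 2 * (phi * beta ^+ 2).
(** 864 = 108 * 8 is the constant of [mgf_third_moment] times that of [kernel_proj_sd3]; one [L]
    must serve both laws, and the projections need only 8. *)
Let L := 864 * B * s ^+ 3.

Hypotheses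
  (excess_int : F.-integrable setT
     (EFin \o (fun x => cubic_excess l phi (fun i => s * kernel_proj F H x i))))
  (excess_le : \int[F]_x cubic_excess l phi (fun i => s * kernel_proj F H x i) <= tau)
  (gauss_excess_le :
     #|I|%:R * (864 * (s * D) ^+ 3 * expR (- (2 * D * beta * s)^-1)) <= tau)
  (tau_small : beta ^+ 3 * tau <= 1 / 2)
  (L_small : n%:R * (2 * C * L) <= 1 / 8).

Let n_gt0 : (0 < n)%N. Proof. exact: leq_trans n_ge2. Qed.
Let nR : 0 < n%:R :> R. Proof. by rewrite ltr0n. Qed.
Let s_gt0 : 0 < s. Proof. by rewrite invr_gt0 sqrtr_gt0. Qed.

Let card_I : ln #|I|%:R <= l.
Proof.
apply: le_trans card_le; have I0 : (0 < #|I|)%N by apply/card_gt0P; exists i0.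
rewrite ler_ln ?posrE ?ltr0n //; last by apply/card_gt0P; exists (i0, true).
by rewrite ler_nat card_prod card_bool leq_pmulr.
Qed.

Let m1 : increment_moments l phi F (fun x i => s * kernel_proj F H x i)
  (fun i j => s ^+ 2 * gram A k i j) L tau.
Proof.
have mp := measurable_kernel_proj mH H_sq.
have ip := kernel_proj_integrable mH H_sq H_cube.
have i2 := kernel_proj_integrable2 mH H_sq H_cube.
have i3 := kernel_proj_integrable3 mH H_sq H_cube.
have E i j : (fun x => s * kernel_proj F H x i * (s * kernel_proj F H x j)) =
    fun x => s ^+ 2 * (kernel_proj F H x i * kernel_proj F H x j).
  by apply/funext => x; ring.
have E3 i : (fun x => `|s * kernel_proj F H x i| ^+ 3) =
    fun x => s ^+ 3 * `|kernel_proj F H x i| ^+ 3.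
  by apply/funext => x; rewrite normrM exprMn gtr0_norm.
split.
- by move=> i; apply: measurable_funM => //; exact: mp.
- by move=> i; exact: integrableZR.
- by move=> i; rewrite RintegralZl // (kernel_proj_mean mH H_sq H_cube) mulr0.
- by move=> i j; rewrite E; exact: integrableZR.
- by move=> i j; rewrite E RintegralZl // A_cov.
- by move=> i; rewrite E3; exact: integrableZR.
- move=> i; rewrite E3 RintegralZl // /L mulrC; apply: ler_wpM2r.
    by rewrite exprn_ge0 // ltW.
  apply: le_trans (kernel_proj_third mH H_sq H_cube i) _; move: B_ge1; lra.
- exact: excess_int.
- exact: excess_le.
Qed.

Let m2 : increment_moments l phi PZ (fun x i => s * linear_form k Z A i x)
  (fun i j => s ^+ 2 * gram A k i j) L tau.
Proof.
apply: (gaussian_increment_moments iZ i0 s_gt0) gauss_excess_le => //.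
  exact: lt_le_trans l_ge1.
move=> i; rewrite exprMn A_cov /L.
have := kernel_proj_sd3 mH H_sq H_cube i => h.
rewrite (_ : 108 * _ = s ^+ 3 * (108 * Num.sqrt (\int[F]_x (kernel_proj F H x i * kernel_proj F H x i)) ^+ 3)); last by ring.
rewrite [leRHS]mulrC; apply: ler_wpM2l; first by rewrite exprn_ge0 // ltW.
move: h B_ge1; lra.
Qed.

Let z0 : I -> R := fun=> 0.
Let hyb := hybrid F (fun x i => s * kernel_proj F H x i) PZ
  (fun x i => s * linear_form k Z A i x) n z0.

(** With all increments Gaussian, the [n] scaled copies recombine into one vector with the full
    covariance. *)
Let hyb0 f : ufun f -> hyb 0 f = gauss_mean A k f.
Proof.
move=> uf; rewrite /hyb /hybrid subn0 /=.
transitivity (iter n (expect_ops (@gauss R) (column_map s A) k) f z0).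
  congr (_ z0); elim: (n) => //= m <-; apply: expect_op_gaussian => //.
  elim: m => //= m IH; apply: ufun_expect_op => // i.
  by apply: measurable_funM => //; exact: (measurable_linear_form iZ A i).
by rewrite (iter_gauss_ops A k n_gt0 uf).
Qed.

Let hybn f : ufun f -> hyb n f =
  \int[P]_t f (fun i => \sum_(j < n) s * kernel_proj F H (X j t) i).
Proof.
move=> uf; have mp := measurable_kernel_proj mH H_sq.
rewrite /hyb /hybrid subnn /=.
have := @Rintegral_iid_sum _ _ _ _ F _ _ P n X (fun _ x i => s * kernel_proj F H x i) f z0 _ uf iX.
move=> E; transitivity (expect_ops F (fun=> fun x i => s * kernel_proj F H x i) n f z0).
  by elim: (n) f {uf E} => //= m IH f; rewrite -IH -iterS iterSr.
rewrite -E; last by move=> _ i; apply: measurable_funM => //; exact: mp.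
by apply: eq_Rintegral => t _; congr f; apply/funext => i; rewrite /addv add0r.
Qed.

Let kappa := 4 * expR 2 * Num.sqrt l / Num.sqrt b.

Let sum_comparison c :
  `|\int[P]_t below c (fun i => \sum_(j < n) s * kernel_proj F H (X j t) i)
    - gauss_mean A k (below c)| <= 16 * kappa / phi + 4 * expR (- l) + 2 * n%:R * (2 * C * tau).
Proof.
rewrite -hybn; last exact: ufun_below.
rewrite -hyb0; last exact: ufun_below.
apply: (lindeberg_bound i0 l_ge1 card_I phi_gt0 m1 m2 tau_small _ (expR_ge0 _)) => //.
- by rewrite /kappa; apply: mulr_ge0; [nonneg|rewrite invr_ge0 sqrtr_ge0].
- move=> c' a a0; rewrite -/hyb !hyb0; [|exact: ufun_below|exact: ufun_below].
  exact: (nazarov b_gt0 var_ge l_ge1 card_I c' a0).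
Qed.

Let rest_scale := (Num.sqrt (n%:R : R) * n.-1%:R)^-1.
Let rest t i := rest_scale * pair_sum X (kernel_rest F H) n t i.

Let mX j : measurable_fun setT (X j). Proof. by case: iX. Qed.

Let measurable_rest i : measurable_fun setT (fun t => rest t i).
Proof.
apply: measurable_funM => //.
exact: (measurable_pair_sum iX (measurable_kernel_rest mH H_sq)).
Qed.

(** The degenerate part moves thresholds by at most [1 / phi] unless [phi] times its norm reaches 1,
    and the indicator of that event is at most this very product. The shift costs one more
    [nazarov], which turns 16 and 4 into 17 and 5. *)
Lemma orthant_comparison c :
  `|\int[P]_t below c (kernel_stat F H X n t) - gauss_mean A k (below c)| <=
  17 * kappa / phi + 5 * expR (- l) + 2 * n%:R * (2 * C * tau)
   + phi * (rest_scale * (57 * l * n%:R * Num.sqrt (16 * M2))).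
Proof.
pose Sn t i := \sum_(j < n) s * kernel_proj F H (X j t) i.
have mp := measurable_kernel_proj mH H_sq.
have mS i : measurable_fun setT (fun t => Sn t i).
  apply: measurable_sum => j; apply: measurable_funM => //.
  exact: measurableT_comp (mp i) (mX j).
have ibelow c' : P.-integrable setT (EFin \o (fun t => below c' (Sn t))).
  have [mb b01] := ufun_below c'.
  apply: (@bounded_integrable _ _ _ _ _ 1); first by apply: (mb _ _ (fun i t => Sn t i)).
  by move=> t; have /andP[h0 h1] := b01 (Sn t); rewrite ger0_norm.
have mpair := measurable_pair_sum iX (measurable_kernel_rest mH H_sq).
have rs0 : 0 <= rest_scale by rewrite invr_ge0 mulr_ge0.
have ivmax : P.-integrable setT (EFin \o (fun t => vmax (pair_sum X (kernel_rest F H) n t))) /\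
    \int[P]_t vmax (pair_sum X (kernel_rest F H) n t) <= 57 * l * n%:R * Num.sqrt (16 * M2).
  have V0 : 0 < 16 * M2 by rewrite mulr_gt0.
  have mr := measurable_kernel_rest mH H_sq.
  have i2 := kernel_rest_integrable mH H_sq H_cube.
  have z2 := kernel_rest_degenerate mH H_sq H_cube.
  have fr := kernel_rest_fin i0 mH H_sq H_cube H_max2.
  have r2 := kernel_rest_max2 i0 mH H_sq H_cube H_max2.
  have sy := kernel_rest_sym F H_sym.
  have bound := @mean_vmax_pair_sum _ _ i0 _ _ _ _ _ _ _ _ iX _ l_ge1 card_le
    (kernel_rest F H) (16 * M2) V0 mr _ _ i2 z2 _ _ n_gt0.
  have {}bound : (\int[P]_t (vmax (pair_sum X (kernel_rest F H) n t))%:E <=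
      (57 * l * n%:R * Num.sqrt (16 * M2))%:E)%E.
    apply: bound.
    - by move=> x i; under eq_fun do rewrite sy; exact: i2.
    - by move=> x i; under eq_Rintegral do rewrite sy; exact: z2.
    - by move=> x; under eq_integral do rewrite sy; exact: fr.
    - by under eq_integral do under eq_integral do rewrite sy.
  have ii : P.-integrable setT (EFin \o (fun t => vmax (pair_sum X (kernel_rest F H) n t))).
    apply: integrable_lty; first exact: (measurable_vmax (mpair n)).
    apply: le_lt_trans (ltry (57 * l * n%:R * Num.sqrt (16 * M2))).
    apply: le_trans bound; rewrite le_eqVlt; apply/orP; left; apply/eqP.
    by apply: eq_integral => t _; rewrite ger0_norm ?vmax_ge0.
  by split => //; rewrite -lee_fin EFin_Rintegral.
have [iv lev] := ivmax.
have iE : P.-integrable setT (EFin \o (fun t => phi * (rest_scale *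
    vmax (pair_sum X (kernel_rest F H) n t)))).
  by apply: integrableZR; exact: integrableZR.
pose Err := phi * (rest_scale * (57 * l * n%:R * Num.sqrt (16 * M2))).
have EE : \int[P]_t (phi * (rest_scale * vmax (pair_sum X (kernel_rest F H) n t))) <= Err.
  rewrite !RintegralZl //; last exact: integrableZR.
  by apply: ler_wpM2l; [exact: ltW|exact: ler_wpM2l].
have statE t : kernel_stat F H X n t = addv (Sn t) (rest t).
  by apply/funext => i; rewrite (kernel_statE F X H_sym n_ge2).
have ips : 0 < phi^-1 by rewrite invr_gt0.
have small t : phi * (rest_scale * vmax (pair_sum X (kernel_rest F H) n t)) < 1 ->
    forall i, `|rest t i| <= phi^-1.
  move=> h i; rewrite /rest normrM (ger0_norm rs0).
  rewrite -[leRHS]mul1r ler_pdivlMr // mulrC; apply: le_trans (ltW h).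
  apply: ler_wpM2l; first exact: ltW.
  by apply: ler_wpM2l => //; exact: vmax_ge.
have e0 t : 0 <= phi * (rest_scale * vmax (pair_sum X (kernel_rest F H) n t)).
  by apply: mulr_ge0; [exact: ltW|apply: mulr_ge0; [exact: rs0|exact: vmax_ge0]].
have up t : below c (kernel_stat F H X n t) <= below (raise c phi^-1) (Sn t)
    + phi * (rest_scale * vmax (pair_sum X (kernel_rest F H) n t)).
  have /andP[b0 b1] := below01 c (kernel_stat F H X n t).
  have /andP[b2 b3] := below01 (raise c phi^-1) (Sn t).
  have [h|h] := lerP 1 (phi * (rest_scale * vmax (pair_sum X (kernel_rest F H) n t))).
    by apply: le_trans b1 _; move: b2 h; lra.
  have [[-> hc]|[-> _]] := belowP c (kernel_stat F H X n t); last by rewrite addr_ge0.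
  rewrite below_eq1 ?lerDl // => i; have := hc i; rewrite statE /addv /raise.
  by have := small t h i; rewrite ler_norml => /andP[? ?]; lra.
have low t : below (raise c (- phi^-1)) (Sn t) <= below c (kernel_stat F H X n t)
    + phi * (rest_scale * vmax (pair_sum X (kernel_rest F H) n t)).
  have /andP[b0 b1] := below01 c (kernel_stat F H X n t).
  have /andP[b2 b3] := below01 (raise c (- phi^-1)) (Sn t).
  have [h|h] := lerP 1 (phi * (rest_scale * vmax (pair_sum X (kernel_rest F H) n t))).
    by apply: le_trans b3 _; move: b0 h; lra.
  have [[-> hc]|[-> _]] := belowP (raise c (- phi^-1)) (Sn t); last by rewrite addr_ge0.
  rewrite below_eq1 ?lerDl // => i; have := hc i; rewrite statE /addv /raise.
  by have := small t h i; rewrite ler_norml => /andP[? ?]; lra.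
have istat : P.-integrable setT (EFin \o (fun t => below c (kernel_stat F H X n t))).
  have [mb b01] := ufun_below c.
  apply: (@bounded_integrable _ _ _ _ _ 1).
    apply: (mb _ _ (fun i t => kernel_stat F H X n t i)) => i.
    by under eq_fun do rewrite statE; exact: measurable_funD.
  by move=> t; have /andP[h0 h1] := b01 (kernel_stat F H X n t); rewrite ger0_norm.
have U : \int[P]_t below c (kernel_stat F H X n t) <=
    \int[P]_t below (raise c phi^-1) (Sn t) + Err.
  apply: le_trans (le_Rintegral measurableT istat (integrableDR (ibelow (raise c phi^-1)) iE) (fun t _ => up t)) _.
  by rewrite RintegralD // lerD2l.
have W : \int[P]_t below (raise c (- phi^-1)) (Sn t) <=
    \int[P]_t below c (kernel_stat F H X n t) + Err.
  apply: le_trans (le_Rintegral measurableT (ibelow (raise c (- phi^-1))) (integrableDR istat iE) (fun t _ => low t)) _.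
  by rewrite RintegralD // lerD2l.
have k1 := sum_comparison (raise c phi^-1); have k2 := sum_comparison (raise c (- phi^-1)).
have n1 := nazarov b_gt0 var_ge l_ge1 card_I c ips.
have n2 := nazarov b_gt0 var_ge l_ge1 card_I (raise c (- phi^-1)) ips.
rewrite -/kappa (_ : raise (raise c (- phi^-1)) phi^-1 = c) in n1 n2; last first.
  by apply/funext => i; rewrite /raise subrK.
move: k1 k2 U W; rewrite -/Err !ler_norml => /andP[_ k1] /andP[k2 _] U W.
rewrite -/(Sn _) in k1 k2.
have E17 : 17 * kappa / phi = 17 * (kappa / phi) by rewrite mulrA.
have E16 : 16 * kappa / phi = 16 * (kappa / phi) by rewrite mulrA.
move: k1 k2 n1 n2; rewrite E17 E16.
move: (kappa / phi) (2 * n%:R * (2 * C * tau)) (expR (- l)) => q1 q2 q3.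
rewrite /Sn in U W; move=> k1 k2 n1 n2; apply/andP; split; lra.
Qed.

End orthant_comparison.

(** * Choice of the parameters *)

Section parameters.
Context {R : realType}.
Variables (B l w N : R).
Hypotheses (B_ge1 : 1 <= B) (l_ge1 : 1 <= l) (w_gt0 : 0 < w) (w_le1 : w <= 1)
  (N_gt0 : 0 < N) (N_le : N <= expR l) (rate_ge : B ^+ 2 * l ^+ 7 <= w ^+ 6 * N).

(* The absolute constants are kept abstract: as concrete numerals they would be
   unfolded in unary. *)
Variables (K c1 c2 delta : R).
Hypotheses (K_gt0 : 0 < K) (c1_ge0 : 0 <= c1) (c2_ge0 : 0 <= c2) (delta_ge0 : 0 <= delta)
  (K_c12 : 2 * c1 * c2 * 16 * 8 <= K ^+ 3) (K_c2 : c2 * 64 <= delta * K ^+ 3)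
  (K_ge32 : 32 <= K) (c1_delta : c1 * delta * 128 <= 20) (delta_le : delta <= 1 / 4)
  (K_rest : 57 * 48 * 2 <= 3 * K).

(** The value making [sqrt l / phi = K * w], so that the anti-concentration error is a multiple of
    the target [w]. *)
Definition smoothing : R := Num.sqrt l / (K * w).

Let r := Num.sqrt l.
Let s := (Num.sqrt N)^-1.
Let phi := smoothing.
Let beta := bandwidth l phi.

Let l0 : 0 <= l. Proof. exact: le_trans l_ge1. Qed.
Let r2 : r ^+ 2 = l. Proof. exact: sqr_sqrtr. Qed.
Let r_ge1 : 1 <= r.
Proof. by rewrite -[leLHS]sqrtr1 ler_wsqrtr. Qed.
Let r_gt0 : 0 < r. Proof. exact: lt_le_trans r_ge1. Qed.
Let B_gt0 : 0 < B. Proof. exact: lt_le_trans B_ge1. Qed.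
Let s_gt0 : 0 < s. Proof. by rewrite invr_gt0 sqrtr_gt0. Qed.
Let s2N : s ^+ 2 * N = 1.
Proof. by rewrite exprVn sqr_sqrtr ?mulVf ?gt_eqF // ltW. Qed.

Lemma smoothing_gt0 : 0 < phi.
Proof. by rewrite divr_gt0 // mulr_gt0. Qed.

(** The square root of [rate_ge], where [r ^+ 7] stands for [l] to the power 7/2. *)
Let scale : B * s * r ^+ 7 <= w ^+ 3.
Proof.
rewrite -ler_sqr ?nnegrE; [|by nonneg|by nonneg].
rewrite (_ : (B * s * r ^+ 7) ^+ 2 = B ^+ 2 * (r ^+ 2) ^+ 7 * s ^+ 2); last by ring.
rewrite r2 -exprM; apply: le_trans (ler_wpM2r (sqr_ge0 s) rate_ge) _.
by rewrite -mulrA [N * _]mulrC s2N mulr1.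
Qed.

Let phiE : phi = r / (K * w). Proof. by []. Qed.
Let betaE : beta = r ^+ 3 / (K * w).
Proof. by rewrite /beta /bandwidth phiE -r2; field; rewrite !gt_eqF. Qed.

Lemma expR2_le16 : expR 2 <= 16 :> R.
Proof.
have h : expR (1 / 2) <= 2 :> R.
  have := expR_ge1Dx (- (1 / 2) : R); have := expR_gt0 (1 / 2 : R).
  have : expR (1 / 2) * expR (- (1 / 2)) = 1 :> R by rewrite expRN mulfV // gt_eqF // expR_gt0.
  move: (expR (1 / 2)) (expR (- (1 / 2))) => x y; nra.
rewrite (_ : 2 = (1 / 2) * 4%:R); last by field.
rewrite expRM_natr; apply: le_trans (_ : 2 ^+ 4 <= _).
  by rewrite lerXn2r ?nnegrE ?expR_ge0.
by rewrite -natrX ler_nat.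
Qed.

Lemma beta_scale : B * beta * s <= w ^+ 2 / (K * l ^+ 2).
Proof.
rewrite betaE (_ : B * _ * s = (B * s * r ^+ 7) / (K * w * r ^+ 4)); last first.
  by field; rewrite !gt_eqF.
apply: (@le_trans _ _ (w ^+ 3 / (K * w * r ^+ 4))).
  by apply: ler_wpM2r => //; rewrite invr_ge0; nonneg.
by rewrite le_eqVlt; apply/orP; left; apply/eqP; rewrite -r2; field; rewrite !gt_eqF.
Qed.

(** Since [phi = r / (K w)] and [beta = r^3 / (K w)], the product [phi * beta ^+ 2 * (B * s)] is
    [B s r^7 / (K w)^3], at most [K^-3] by [scale]. The powers 7 and 1/6 of the first rate originate
    here. *)
Lemma third_order_small : N * (2 * (c1 * expR 2 * (phi * beta ^+ 2)) * (c2 * B * s ^+ 3)) <= 1 / 8.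
Proof.
have -> : N * (2 * (c1 * expR 2 * (phi * beta ^+ 2)) * (c2 * B * s ^+ 3)) =
   (2 * c1 * c2) * (expR 2 * (phi * beta ^+ 2 * (B * s))) * (s ^+ 2 * N) by ring.
rewrite s2N mulr1.
have -> : phi * beta ^+ 2 * (B * s) = (B * s * r ^+ 7) / (K * w) ^+ 3.
  by rewrite phiE betaE; field; rewrite !gt_eqF.
have K3 : 0 < K ^+ 3 by exact: exprn_gt0.
have h1 : (B * s * r ^+ 7) / (K * w) ^+ 3 <= (K ^+ 3)^-1.
  rewrite ler_pdivrMr ?exprn_gt0 ?mulr_gt0 //.
  by rewrite (_ : _ * (K * w) ^+ 3 = w ^+ 3) //; field; rewrite gt_eqF.
have h0 : 0 <= (B * s * r ^+ 7) / (K * w) ^+ 3 by nonneg.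
have hX := ler_pM (expR_ge0 2) h0 expR2_le16 h1.
apply: (@le_trans _ _ ((2 * c1 * c2) * (16 * (K ^+ 3)^-1))).
  by apply: ler_wpM2l; [nonneg|exact: hX].
rewrite mulrA ler_pdivrMr //; move: K_c12; lra.
Qed.

Lemma expRN_le_rate : expR (- l) <= w.
Proof.
have h : N^-1 <= w.
  apply: (@le_trans _ _ (w ^+ 6)); last by rewrite -[leRHS]expr1 ler_wiXn2l // ltW.
  rewrite -[leLHS]mul1r ler_pdivrMr //; apply: le_trans rate_ge.
  by rewrite -[leLHS]mulr1; apply: ler_pM => //; exact: exprn_ege1.
by apply: le_trans h; rewrite expRN lef_pV2 ?posrE ?expR_gt0.
Qed.

Definition exp_excess (card : R) : R :=
  card * (c2 * (s * (4 * B)) ^+ 3 * expR (- (2 * (4 * B) * beta * s)^-1)).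

Let beta_gt0 : 0 < beta.
Proof. by rewrite /beta /bandwidth mulr_gt0 ?smoothing_gt0 // (lt_le_trans _ l_ge1). Qed.

(** The rate condition makes the tail exponent at least [4 * l]; the union over coordinates costs
    [l] and leaves [3 * l]. *)
Lemma exp_excess_le card : 0 <= card -> card <= expR l ->
  beta ^+ 3 * exp_excess card <= delta * expR (- (3 * l)).
Proof.
move=> c0 cl; rewrite /exp_excess.
have Bbs := beta_scale.
have Bbs0 : 0 < B * beta * s by rewrite mulr_gt0 // mulr_gt0.
have exponent : 4 * l <= (2 * (4 * B) * beta * s)^-1.
  rewrite (_ : 2 * (4 * B) * beta * s = 8 * (B * beta * s)); last by ring.
  rewrite -[leRHS]mul1r ler_pdivlMr; last by rewrite mulr_gt0.
  rewrite (_ : 4 * l * _ = 32 * l * (B * beta * s)); last by ring.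
  apply: (@le_trans _ _ (32 * l * (w ^+ 2 / (K * l ^+ 2)))).
    by apply: ler_wpM2l => //; nonneg.
  have lp : 0 < l by exact: lt_le_trans l_ge1.
  rewrite (_ : _ * _ = (32 / K) * (w ^+ 2 / l)); last by field; rewrite !gt_eqF.
  have h1 : w ^+ 2 / l <= 1.
    by rewrite ler_pdivrMr // mul1r (le_trans _ l_ge1) // exprn_ile1 // ltW.
  have h2 : 32 / K <= 1 by rewrite ler_pdivrMr // mul1r.
  rewrite -[leRHS]mulr1; apply: ler_pM => //; nonneg.
have Ebound : card * expR (- (2 * (4 * B) * beta * s)^-1) <= expR (- (3 * l)).
  apply: (@le_trans _ _ (expR l * expR (- (4 * l)))).
    by apply: ler_pM; rewrite ?expR_ge0 // ler_expR lerN2.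
  by rewrite -expRD ler_expR; lra.
have cube : (B * beta * s) ^+ 3 <= (K ^+ 3)^-1.
  have h : B * beta * s <= K^-1.
    apply: le_trans Bbs _; rewrite ler_pdivrMr; last by rewrite mulr_gt0 // exprn_gt0 // (lt_le_trans _ l_ge1).
    rewrite mulrA mulVf ?gt_eqF // mul1r; apply: (@le_trans _ _ 1).
      by rewrite exprn_ile1 // ltW.
    exact: exprn_ege1.
  by rewrite -exprVn lerXn2r ?nnegrE ?invr_ge0 // ltW.
rewrite (_ : beta ^+ 3 * _ = (c2 * 64) * ((B * beta * s) ^+ 3 *
  (card * expR (- (2 * (4 * B) * beta * s)^-1)))); last by ring.
have p0 : 0 <= (B * beta * s) ^+ 3 by rewrite exprn_ge0 // ltW.
have q0 : 0 <= card * expR (- (2 * (4 * B) * beta * s)^-1) by rewrite mulr_ge0 // expR_ge0.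
have hX := ler_pM p0 q0 cube Ebound; have e30 := expR_ge0 (- (3 * l)).
have c264 : 0 <= c2 * 64 by nonneg.
apply: le_trans (ler_wpM2l c264 hX) _; rewrite mulrA; apply: ler_wpM2r => //.
by rewrite ler_pdivrMr ?exprn_gt0.
Qed.

(** Summing over the sample costs a factor [N <= expR l], which [expR (- (3 * l))] absorbs, leaving
    at most [expR (- l) <= w]. *)
Lemma excess_terms (card tau_q : R) : 0 <= card -> card <= expR l -> 0 <= tau_q ->
  N * (beta ^+ 3 * tau_q) <= delta * w -> 1 <= N ->
  beta ^+ 3 * (exp_excess card + tau_q) <= 1 / 2 /\
  2 * N * (2 * (c1 * expR 2 * (phi * beta ^+ 2)) * (exp_excess card + tau_q)) <= 20 * w.
Proof.
move=> c0 cl q0 hq N1; have he := exp_excess_le c0 cl.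
have e3l : expR (- (3 * l)) <= 1 by rewrite -expR0 ler_expR oppr_le0; nonneg.
have e30 := expR_ge0 (- (3 * l)).
have Ne3 : N * expR (- (3 * l)) <= w.
  apply: (@le_trans _ _ (expR l * expR (- (3 * l)))).
    by apply: ler_wpM2r.
  rewrite -expRD; apply: le_trans expRN_le_rate; rewrite ler_expR; move: l_ge1; lra.
have b3 : 0 <= beta ^+ 3 by rewrite exprn_ge0 // ltW.
have bq : 0 <= beta ^+ 3 * tau_q by exact: mulr_ge0.
have Nbq : beta ^+ 3 * tau_q <= N * (beta ^+ 3 * tau_q) by rewrite ler_peMl.
have ex0 : 0 <= exp_excess card by rewrite /exp_excess; nonneg.
split.
  rewrite mulrDr.
  have h1 : delta * expR (- (3 * l)) <= delta by rewrite ler_piMr.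
  have h2 : delta * w <= delta by rewrite ler_piMr.
  by move: he h1 hq h2 Nbq delta_le; lra.
set T := exp_excess card + tau_q.
have T0 : 0 <= T by exact: addr_ge0.
have NT : N * (beta ^+ 3 * T) <= 2 * delta * w.
  rewrite /T !mulrDr.
  have h1 := ler_wpM2l (ltW N_gt0) he; rewrite [N * (delta * _)]mulrCA in h1.
  have h2 := ler_wpM2l delta_ge0 Ne3.
  by move: h1 h2 hq; lra.
have pb : phi * beta ^+ 2 <= beta ^+ 3.
  rewrite [beta ^+ 3]exprS; apply: ler_wpM2r; first exact: sqr_ge0.
  by rewrite /beta /bandwidth ler_peMr // ltW // smoothing_gt0.
rewrite (_ : 2 * N * _ = (4 * c1) * (expR 2 * (N * (phi * beta ^+ 2 * T)))); last by ring.
have h1 : N * (phi * beta ^+ 2 * T) <= N * (beta ^+ 3 * T).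
  by apply: ler_wpM2l; [exact: ltW|exact: ler_wpM2r].
have h0 : 0 <= N * (phi * beta ^+ 2 * T).
  have := ltW smoothing_gt0 => ?; nonneg.
have hX := ler_pM (expR_ge0 2) h0 expR2_le16 (le_trans h1 NT).
have c40 : 0 <= 4 * c1 by nonneg.
apply: le_trans (ler_wpM2l c40 hX) _.
rewrite (_ : 4 * c1 * _ = (c1 * delta * 128) * w); last by ring.
by apply: ler_wpM2r => //; exact: ltW.
Qed.

Lemma smoothing_error (b : R) : 0 < b ->
  17 * (4 * expR 2 * Num.sqrt l / Num.sqrt b) / phi <= 68 * 16 * K / Num.sqrt b * w.
Proof.
move=> b0; have sb : 0 < Num.sqrt b by rewrite sqrtr_gt0.
rewrite phiE -/r (_ : 17 * _ / _ = 68 * expR 2 * K / Num.sqrt b * w); last first.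
  by field; rewrite !gt_eqF.
apply: ler_wpM2r; first exact: ltW.
apply: ler_wpM2r; first by rewrite invr_ge0 ltW.
apply: ler_wpM2r; first exact: ltW.
by apply: ler_wpM2l; [exact: ler0n|exact: expR2_le16].
Qed.

Lemma rest_error (m : R) : 0 <= m -> N <= 2 * m ->  0 < m ->
  phi * ((Num.sqrt N * m)^-1 * (57 * l * N * Num.sqrt (16 * (144 * B ^+ 2 * l ^+ 2)))) <= 3 * w.
Proof.
move=> m0 Nm mp.
have -> : Num.sqrt (16 * (144 * B ^+ 2 * l ^+ 2)) = 48 * B * l.
  rewrite (_ : 16 * _ = (48 * B * l) ^+ 2); last by ring.
  by rewrite sqrtr_sqr ger0_norm //; nonneg.
have lp : 0 < l by exact: lt_le_trans l_ge1.
rewrite invfM -/s phiE.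
rewrite (_ : _ * _ = (57 * 48 / K) * (((B * s * r ^+ 7) / (w * l)) * (N / m))); last first.
  by rewrite -r2; field; rewrite !gt_eqF.
have h1 : (B * s * r ^+ 7) / (w * l) <= w.
  rewrite ler_pdivrMr ?mulr_gt0 //; apply: le_trans scale _.
  rewrite mulrA -expr2 exprSr; apply: ler_wpM2l; first exact: sqr_ge0.
  exact: le_trans l_ge1.
have h2 : N / m <= 2 by rewrite ler_pdivrMr.
have h10 : 0 <= (B * s * r ^+ 7) / (w * l) by nonneg.
have h20 : 0 <= N / m by nonneg.
have hX := ler_pM h10 h20 h1 h2.
have cK : 0 <= 57 * 48 / K by nonneg.
apply: le_trans (ler_wpM2l cK hX) _.
rewrite (_ : _ * (w * 2) = (57 * 48 * 2 / K) * w); last by field; rewrite gt_eqF.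
by apply: ler_wpM2r; [exact: ltW|rewrite ler_pdivrMr].
Qed.

End parameters.

(** * Tail conditions on the kernel *)

Section jensen_instances.
Context {R : realType} d (S : measurableType d) (mu : probability S R).

Lemma jensen_exp (u : S -> R) (a : R) : 0 < a -> mu.-integrable setT (EFin \o u) ->
  measurable_fun setT u ->
  ((expR (`|\int[mu]_x u x| / a))%:E <= \int[mu]_x (expR (`|u x| / a))%:E)%E.
Proof.
move=> a0 iu mu'; have ia : mu.-integrable setT (EFin \o (fun x => `|u x|)).
  exact: integrable_norm.
apply: (@le_trans _ _ (expR ((\int[mu]_x `|u x|) / a))%:E).
  rewrite lee_fin ler_expR; apply: ler_wpM2r; first by rewrite invr_ge0 ltW.
  exact: le_normr_Rintegral.
apply: (@jensen_tangent _ _ _ mu (fun r => expR (r / a)) (expR ((\int[mu]_x `|u x|) / a) / a)).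
- exact: ia.
- apply: (measurableT_comp (@measurable_expR R)); apply: measurable_funM => //.
  exact: measurable_normr.
- by move=> x; exact: expR_ge0.
move=> x; set m := \int[mu]_x0 _; move: m `|u x| => m r.
rewrite (_ : r / a = m / a + (r - m) / a); last by field; rewrite gt_eqF.
rewrite expRD; have := expR_ge1Dx ((r - m) / a) => h.
rewrite (_ : _ + _ = expR (m / a) * (1 + (r - m) / a)); last by field; rewrite gt_eqF.
by apply: ler_wpM2l => //; exact: expR_ge0.
Qed.

(** Young's inequality with exponents [q] and [q / (q - 1)] is exactly the supporting line of the
    power at [m]. *)
Lemma powR_tangent (q r m : R) : 1 < q -> 0 <= r -> 0 < m ->
  m `^ q + q * m `^ (q - 1) * (r - m) <= r `^ q.
Proof.
move=> q1 r0 m0; have q0 : 0 < q by exact: lt_trans q1.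
have qm : 0 < q - 1 by rewrite subr_gt0.
have pm : 0 <= m `^ (q - 1) by exact: powR_ge0.
have := @conjugate_powR R r (m `^ (q - 1)) q (q / (q - 1)) r0 pm q0 (divr_gt0 q0 qm).
rewrite (_ : q^-1 + (q / (q - 1))^-1 = 1); last by field; rewrite !gt_eqF.
move=> /(_ erefl); rewrite -powRrM (_ : (q - 1) * (q / (q - 1)) = q); last by field; rewrite gt_eqF.
move=> h; have mE : m * m `^ (q - 1) = m `^ q by rewrite mulr_powRB1 // ltW.
have := ler_wpM2l (ltW q0) h.
rewrite (_ : q * (r `^ q / q + m `^ q / (q / (q - 1))) = r `^ q + (q - 1) * m `^ q); last first.
  by field; rewrite !gt_eqF.
rewrite -mE; move: (m `^ (q - 1)) (r `^ q) => p t; lra.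
Qed.

Lemma jensen_powR (u : S -> R) (q : R) : 1 < q -> mu.-integrable setT (EFin \o u) ->
  measurable_fun setT u -> (forall x, 0 <= u x) ->
  (((\int[mu]_x u x) `^ q)%:E <= \int[mu]_x (u x `^ q)%:E)%E.
Proof.
move=> q1 iu mu' u0; set m := \int[mu]_x u x.
have m_ge0 : 0 <= m by exact: Rintegral_ge0.
have q0 : q != 0 by rewrite gt_eqF // (lt_trans _ q1).
have [m0|m0] := eqVneq m 0.
  by rewrite m0 powR0 //; apply: integral_ge0 => x _; rewrite lee_fin powR_ge0.
apply: (@jensen_tangent _ _ _ mu (fun r => r `^ q) (q * m `^ (q - 1))).
- exact: iu.
- exact: (measurableT_comp (measurable_powR q) mu').
- by move=> x; exact: powR_ge0.
by move=> x; apply: powR_tangent => //; rewrite lt_neqAle eq_sym m0.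
Qed.

End jensen_instances.

Section exponential_kernel.
Context {R : realType} (I : finType) (i0 : I) d (S : measurableType d)
  (F : probability S R) (H : S -> S -> I -> R) (B : R).
Hypotheses (B_ge1 : 1 <= B)
  (mH : forall i, measurable_fun [set: S * S] (fun z => H z.1 z.2 i))
  (H_sq : forall x i, (\int[F]_y (`|H x y i| ^+ 2)%:E < +oo)%E)
  (H_cube : forall i, (\int[F]_x \int[F]_y (`|H x y i| ^+ 3)%:E <= B%:E)%E)
  (H_exp : forall i, (\int[F]_x \int[F]_y (expR (`|H x y i| / (2 * B)))%:E <= 2%:E)%E).

Let B0 : 0 < B. Proof. exact: lt_le_trans B_ge1. Qed.
Let B20 : 0 < 2 * B. Proof. exact: mulr_gt0. Qed.

Let mexp i : measurable_fun [set: S * S] (fun z => (expR (`|H z.1 z.2 i| / (2 * B)))%:E).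
Proof.
apply/measurable_EFinP; apply: (measurableT_comp (@measurable_expR R)).
by apply: measurable_funM => //; exact: measurable_normr.
Qed.

Let mexp1 (u : S -> R) a : measurable_fun setT u ->
  measurable_fun setT (fun x => (expR (`|u x| / a))%:E).
Proof.
move=> mu; apply/measurable_EFinP; apply: (measurableT_comp (@measurable_expR R)).
by apply: measurable_funM => //; exact: measurable_normr.
Qed.

Let mHx x i : measurable_fun setT (fun y => H x y i).
Proof. exact: (measurableT_comp (mH i) (pair1_measurable x)). Qed.

Lemma kernel_mean_exp i : (\int[F]_x (expR (`|kernel_mean F H x i| / (2 * B)))%:E <= 2%:E)%E.
Proof.
apply: le_trans (H_exp i); apply: ge0_le_integralT.
- by move=> x; rewrite lee_fin expR_ge0.
- by apply: mexp1; exact: measurable_kernel_mean.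
- apply: (@measurable_fun_fubini_tonelli_F _ _ S S R F _ (mexp i)).
  by move=> z; rewrite lee_fin expR_ge0.
move=> x; apply: jensen_exp => //; exact: kernel_integrable.
Qed.

(** A difference is at most twice its larger term, so doubling the scale from [2 * B] to [4 * B]
    reduces to the mean or to the total; 4 = 2 + 2 adds the two. *)
Lemma kernel_proj_exp i :
  (\int[F]_x (expR (`|kernel_proj F H x i| / (4 * B)))%:E <= 4%:E)%E.
Proof.
have mm := measurable_kernel_mean mH H_sq i.
have tot : expR (`|kernel_total F H i| / (2 * B)) <= 2.
  rewrite -lee_fin; apply: le_trans (kernel_mean_exp i).
  by apply: jensen_exp => //; exact: kernel_mean_integrable mH H_sq H_cube i.
apply: (@le_trans _ _ (\int[F]_x ((expR (`|kernel_mean F H x i| / (2 * B)))%:E + 2%:E))%E).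
  apply: ge0_le_integralT.
  - by move=> x; rewrite lee_fin expR_ge0.
  - by apply: mexp1; exact: measurable_kernel_proj.
  - by apply: emeasurable_funD => //; exact: mexp1.
  move=> x; rewrite -EFinD lee_fin.
  apply: (@le_trans _ _ (expR (`|kernel_mean F H x i| / (2 * B)) + expR (`|kernel_total F H i| / (2 * B)))).
    have i4B : 0 <= (4 * B)^-1 by rewrite invr_ge0 mulr_ge0 // ltW.
    have le_half (p r : R) : `|kernel_proj F H x i| <= 2 * r -> `|kernel_proj F H x i| / (4 * B) <= r / (2 * B).
      move=> h; apply: le_trans (ler_wpM2r i4B h) _.
      by rewrite le_eqVlt; apply/orP; left; apply/eqP; field; rewrite gt_eqF.
    have tri := ler_normB (kernel_mean F H x i) (kernel_total F H i).
    have [c|c] := lerP `|kernel_mean F H x i| `|kernel_total F H i|.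
      apply: (@le_trans _ _ (expR (`|kernel_total F H i| / (2 * B)))); last first.
        by rewrite lerDr expR_ge0.
      rewrite ler_expR; apply: (le_half 0); rewrite /kernel_proj; move: tri c; lra.
    apply: (@le_trans _ _ (expR (`|kernel_mean F H x i| / (2 * B)))); last first.
      by rewrite lerDl expR_ge0.
    rewrite ler_expR; apply: (le_half 0); rewrite /kernel_proj; move: tri c; lra.
  by rewrite lerD2l.
have e0 x : setT x -> (0 <= (expR (`|kernel_mean F H x i| / (2 * B)))%:E)%E.
  by rewrite lee_fin expR_ge0.
have t0 x : (setT : set S) x -> (0 <= (2 : R)%:E)%E by rewrite lee_fin.
rewrite (ge0_integralD F measurableT e0 (mexp1 (2 * B) mm) t0 (measurable_cst _)).
rewrite (integral_prob_cst F) (_ : 4 = 2 + 2); last by lra.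
by rewrite [leRHS]EFinD; apply: leeD => //; exact: kernel_mean_exp.
Qed.

(** The square is split at [|H| = 4 * B * l]. Above it, half of the exponent pays for the square and
    the other half yields [expR (- l)], which absorbs the union over coordinates: 144 = 16 + 128. *)
Lemma kernel_max2_exp (l : R) : 1 <= l -> #|I|%:R <= expR l ->
  (\int[F]_x \int[F]_y (vmax (H x y) ^+ 2)%:E <= (144 * B ^+ 2 * l ^+ 2)%:E)%E.
Proof.
move=> l1 cardI.
pose c := 64 * B ^+ 2 * expR (- l); pose a := 16 * B ^+ 2 * l ^+ 2.
have c0 : 0 <= c by rewrite /c; nonneg.
have l0 : 0 <= l by exact: le_trans ler01 l1.
have a0 : 0 <= a by rewrite /a; nonneg.
pose e x y i := (c * expR (`|H x y i| / (2 * B)))%:E.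
have key x y : ((vmax (H x y) ^+ 2)%:E <= a%:E + \sum_i e x y i)%E.
  rewrite sumEFin -EFinD lee_fin.
  have [i vi] := vmax_attained i0 (H x y).
  have e0 j : 0 <= c * expR (`|H x y j| / (2 * B)) by rewrite mulr_ge0 ?expR_ge0.
  rewrite vi; set h := `|H x y i|; have h0 : 0 <= h by exact: normr_ge0.
  have [small|big] := lerP (h / (2 * B)) (2 * l).
    apply: (@le_trans _ _ a); last by rewrite lerDl sumr_ge0.
    have : h <= 4 * B * l by move: small; rewrite ler_pdivrMr //; lra.
    move=> hl; rewrite /a (_ : 16 * _ * _ = (4 * B * l) ^+ 2); last by ring.
    by rewrite lerXn2r ?nnegrE //; nonneg.
  apply: (@le_trans _ _ (c * expR (h / (2 * B)))); last first.
    rewrite (bigD1 i) //= -/h addrA [a + _]addrC -addrA lerDl.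
    by rewrite addr_ge0 // sumr_ge0.
  have h4 : 0 <= h / (4 * B) by nonneg.
  have := exprn_le_expR (ltn0Sn 1) h4.
  rewrite (_ : h / (2 * B) = h / (4 * B) + h / (4 * B)); last by field; rewrite gt_eqF.
  rewrite expRD; set E := expR _ => hE.
  have E0 : 0 <= E by exact: expR_ge0.
  have El : 1 <= expR (- l) * E.
    rewrite -expRD -[leLHS]expR0 ler_expR.
    rewrite (_ : h / (4 * B) = (h / (2 * B)) / 2); last by field; rewrite gt_eqF.
    by move: big; lra.
  rewrite /c (_ : _ * (E * E) = 64 * B ^+ 2 * E * (expR (- l) * E)); last by ring.
  rewrite -[leLHS]mulr1; apply: ler_pM => //; first exact: sqr_ge0.
  rewrite (_ : h = 4 * B * (h / (4 * B))); last by field; rewrite gt_eqF.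
  rewrite exprMn (_ : 64 * B ^+ 2 * E = (4 * B) ^+ 2 * (2 ^+ 2 * E)); last by ring.
  by apply: ler_wpM2l; [exact: sqr_ge0|exact: hE].
have me i : measurable_fun [set: S * S] (fun z => e z.1 z.2 i).
  apply/measurable_EFinP; apply: measurable_funM => //.
  by have /measurable_EFinP := mexp i.
have e0 x y i : (0 <= e x y i)%E by rewrite lee_fin mulr_ge0 ?expR_ge0.
have mex x i : measurable_fun setT (fun y => e x y i).
  exact: (measurableT_comp (me i) (pair1_measurable x)).
have mv : measurable_fun setT (fun z : S * S => (vmax (H z.1 z.2) ^+ 2)%:E).
  apply/measurable_EFinP; apply: measurable_funX.
  exact: (@measurable_vmax R I _ _ (fun i z => H z.1 z.2 i)).
pose E x i := (\int[F]_y e x y i)%E.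
have E0 x i : (0 <= E x i)%E by apply: integral_ge0.
have mE i : measurable_fun setT (fun x => E x i).
  by apply: (@measurable_fun_fubini_tonelli_F _ _ S S R F _ (me i)) => z; exact: e0.
have inner x : (\int[F]_y (vmax (H x y) ^+ 2)%:E <= a%:E + \sum_i E x i)%E.
  apply: (@le_trans _ _ (\int[F]_y (a%:E + \sum_i e x y i))%E).
    apply: ge0_le_integralT.
    - by move=> y; rewrite lee_fin sqr_ge0.
    - exact: (measurableT_comp mv (pair1_measurable x)).
    - by apply: emeasurable_funD => //; apply: emeasurable_sum.
    - exact: key.
  have a0' y : (setT : set S) y -> (0 <= a%:E)%E by rewrite lee_fin.
  have s0 y : setT y -> (0 <= \sum_i e x y i)%E by move=> _; apply: sume_ge0.
  have ms : measurable_fun setT (fun y => \sum_i e x y i)%E by apply: emeasurable_sum.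
  rewrite (ge0_integralD F measurableT a0' (measurable_cst _) s0 ms).
  rewrite (integral_prob_cst F); apply: leeD => //.
  by rewrite ge0_integral_sum.
apply: (@le_trans _ _ (\int[F]_x (a%:E + \sum_i E x i))%E).
  apply: ge0_le_integralT.
  - by move=> x; apply: integral_ge0 => y _; rewrite lee_fin sqr_ge0.
  - apply: (@measurable_fun_fubini_tonelli_F _ _ S S R F _ mv).
    by move=> z; rewrite lee_fin sqr_ge0.
  - by apply: emeasurable_funD => //; apply: emeasurable_sum.
  - exact: inner.
have a0' x : (setT : set S) x -> (0 <= a%:E)%E by rewrite lee_fin.
have s0 x : setT x -> (0 <= \sum_i E x i)%E by move=> _; apply: sume_ge0.
have ms : measurable_fun setT (fun x => \sum_i E x i)%E by apply: emeasurable_sum.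
rewrite (ge0_integralD F measurableT a0' (measurable_cst _) s0 ms).
rewrite (integral_prob_cst F) ge0_integral_sum //.
have bound i : (\int[F]_x E x i <= (c * 2)%:E)%E.
  rewrite /E; under eq_integral => x _.
    rewrite (_ : (\int[F]_y e x y i)%E = (c%:E * \int[F]_y (expR (`|H x y i| / (2 * B)))%:E)%E); last first.
      have z1 y : (setT : set S) y -> (0 <= (expR (`|H x y i| / (2 * B)))%:E)%E by rewrite lee_fin expR_ge0.
      by rewrite -(ge0_integralZl F measurableT (mexp1 (2 * B) (mHx x i)) z1).
    over.
  have z2 x : (setT : set S) x -> (0 <= \int[F]_y (expR (`|H x y i| / (2 * B)))%:E)%E.
    by move=> _; apply: integral_ge0 => y _; rewrite lee_fin expR_ge0.
  have m2 : measurable_fun setT (fun x => \int[F]_y (expR (`|H x y i| / (2 * B)))%:E)%E.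
    apply: (@measurable_fun_fubini_tonelli_F _ _ S S R F _ (mexp i)).
    by move=> z; rewrite lee_fin expR_ge0.
  have c0' : (0 <= c%:E)%E by rewrite lee_fin.
  rewrite (ge0_integralZl F measurableT m2 z2 c0') [leRHS]EFinM.
  by apply: lee_wpmul2l.
apply: (@le_trans _ _ (a%:E + \sum_(i : I) (c * 2)%:E)%E).
  by apply: leeD => //; apply: lee_sum => i _; exact: bound.
rewrite sumEFin -EFinD lee_fin sumr_const -[_ *+ _]mulr_natr.
have cc : c * 2 * #|I|%:R <= 128 * B ^+ 2.
  have E1 : expR (- l) * #|I|%:R <= 1.
    by rewrite -[leRHS](mulVf (lt0r_neq0 (expR_gt0 l))) -expRN; apply: ler_wpM2l; [exact: expR_ge0|exact: cardI].
  rewrite /c (_ : _ * 2 * _ = 128 * B ^+ 2 * (expR (- l) * #|I|%:R)); last by ring.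
  by rewrite ler_piMr //; nonneg.
apply: (@le_trans _ _ (16 * B ^+ 2 * l ^+ 2 + 128 * B ^+ 2)); first by rewrite lerD2l.
have B2 : 0 <= B ^+ 2 by exact: sqr_ge0.
have l2 : 1 <= l ^+ 2 by exact: exprn_ege1.
have := ler_peMr B2 l2; rewrite -!mulrA; lra.
Qed.

End exponential_kernel.

Section power_kernel.
Context {R : realType} (I : finType) (i0 : I) d (S : measurableType d)
  (F : probability S R) (H : S -> S -> I -> R) (B M2 q : R).
Hypotheses (B_ge1 : 1 <= B) (q_ge4 : 4 <= q)
  (mH : forall i, measurable_fun [set: S * S] (fun z => H z.1 z.2 i))
  (H_sq : forall x i, (\int[F]_y (`|H x y i| ^+ 2)%:E < +oo)%E)
  (H_cube : forall i, (\int[F]_x \int[F]_y (`|H x y i| ^+ 3)%:E <= B%:E)%E)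
  (H_max2 : (\int[F]_x \int[F]_y (vmax (H x y) ^+ 2)%:E <= M2%:E)%E)
  (H_q : (\int[F]_x \int[F]_y ((vmax (H x y) / B) `^ q)%:E <= 1%:E)%E).

Let B0 : 0 < B. Proof. exact: lt_le_trans B_ge1. Qed.
Let q_gt1 : 1 < q. Proof. by apply: lt_le_trans q_ge4; rewrite ltr1n. Qed.
Let q_ge0 : 0 <= q. Proof. exact: ltW (lt_trans ltr01 q_gt1). Qed.

Let mvmax : measurable_fun [set: S * S] (fun z => vmax (H z.1 z.2)).
Proof. exact: (@measurable_vmax R I _ _ (fun i z => H z.1 z.2 i)). Qed.

Let mq : measurable_fun [set: S * S] (fun z => ((vmax (H z.1 z.2) / B) `^ q)%:E).
Proof.
apply/measurable_EFinP; apply: (measurableT_comp (measurable_powR q)).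
exact: measurable_funM.
Qed.

Let q0 (z : S * S) : (0 <= ((vmax (H z.1 z.2) / B) `^ q)%:E)%E.
Proof. by rewrite lee_fin powR_ge0. Qed.

Lemma kernel_max_mean_powR :
  (\int[F]_x ((kernel_max_mean F H x / B) `^ q)%:E <= 1%:E)%E.
Proof.
have mm := measurable_kernel_max_mean i0 mH H_sq.
apply: le_trans H_q; apply: ge0_le_integralT.
- by move=> x; rewrite lee_fin powR_ge0.
- apply/measurable_EFinP; apply: (measurableT_comp (measurable_powR q)).
  exact: measurable_funM.
- by apply: (@measurable_fun_fubini_tonelli_F _ _ S S R F _ mq) => z; exact: q0.
move=> x; have iv := kernel_max_integrable i0 mH H_sq x.
rewrite (_ : kernel_max_mean F H x / B = \int[F]_y (B^-1 * vmax (H x y))); last first.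
  by rewrite RintegralZl // mulrC.
under [leRHS]eq_integral do rewrite mulrC.
apply: jensen_powR => //; first exact: integrableZR.
  by apply: measurable_funM => //; exact: (measurable_kernel_max mH x).
by move=> y; rewrite mulr_ge0 ?invr_ge0 ?vmax_ge0 // ltW.
Qed.

Lemma kernel_max_total_powR : (kernel_max_total F H / B) `^ q <= 1.
Proof.
have mm := measurable_kernel_max_mean i0 mH H_sq.
rewrite -lee_fin; apply: le_trans kernel_max_mean_powR.
have im := kernel_max_mean_integrable i0 mH H_sq H_max2.
rewrite (_ : kernel_max_total F H / B = \int[F]_x (B^-1 * kernel_max_mean F H x)); last first.
  by rewrite RintegralZl // mulrC.
under [leRHS]eq_integral do rewrite mulrC.
apply: jensen_powR => //; first exact: integrableZR.
  exact: measurable_funM.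
by move=> x; rewrite mulr_ge0 ?invr_ge0 ?kernel_max_mean_ge0 // ltW.
Qed.

(** Where the excess is nonzero, [beta] times the increment exceeds 1 and its cube is at most its
    power [q]. The factor 2 adds the moments of the envelope mean and of its total. *)
Lemma power_excess (l phi s : R) : 0 < l -> 0 < phi -> 0 < s ->
  F.-integrable setT (EFin \o (fun x => cubic_excess l phi (fun i => s * kernel_proj F H x i))) /\
  \int[F]_x cubic_excess l phi (fun i => s * kernel_proj F H x i) <=
    2 * (bandwidth l phi ^+ 3)^-1 * (2 * B * bandwidth l phi * s) `^ q.
Proof.
move=> l0 phi0 s0; set beta := bandwidth l phi.
have b0 : 0 < beta by exact: mulr_gt0.
have b3 : 0 < beta ^+ 3 by exact: exprn_gt0.
have mm := measurable_kernel_max_mean i0 mH H_sq.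
set y := 2 * B * beta * s.
have y0 : 0 <= y by rewrite /y; nonneg.
pose u x := (kernel_max_mean F H x / B) `^ q; pose t := (kernel_max_total F H / B) `^ q.
have u0 x : 0 <= u x by exact: powR_ge0.
have mu : measurable_fun setT u.
  by apply: (measurableT_comp (measurable_powR q)); exact: measurable_funM.
have iu : F.-integrable setT (EFin \o u).
  apply: integrable_lty => //; apply: le_lt_trans (ltry 1); apply: le_trans kernel_max_mean_powR.
  by rewrite le_eqVlt; apply/orP; left; apply/eqP; apply: eq_integral => x _; rewrite ger0_norm.
pose bound x := (beta ^+ 3)^-1 * y `^ q * (u x + t).
have ib : F.-integrable setT (EFin \o bound).
  by apply: integrableZR; apply: integrableDR => //; exact: integrable_cstR.
have key x : cubic_excess l phi (fun i => s * kernel_proj F H x i) <= bound x.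
  have bnd0 : 0 <= bound x.
    rewrite /bound; apply: mulr_ge0; last by rewrite addr_ge0 // powR_ge0.
    by rewrite mulr_ge0 ?powR_ge0 // invr_ge0 ltW.
  rewrite /cubic_excess -/beta; case: ifPn => [//|]; rewrite -ltNge.
  set v := vmax _ => bv.
  have v0 : 0 <= v by exact: vmax_ge0.
  have vle : v <= s * (kernel_max_mean F H x + kernel_max_total F H).
    apply: vmax_le => [|i].
      by rewrite mulr_ge0 ?(ltW s0) // addr_ge0 ?kernel_max_mean_ge0 ?kernel_max_total_ge0.
    rewrite normrM (gtr0_norm s0); apply: ler_wpM2l; first exact: ltW.
    apply: le_trans (vmax_ge _ i) _.
    exact: (kernel_proj_vmax_le i0 mH H_sq H_cube H_max2 x).
  rewrite /bound -mulrA ler_pdivlMl // -exprMn.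
  apply: (@le_trans _ _ ((beta * v) `^ q)).
    rewrite -powR_mulrn; last by rewrite mulr_ge0 // ltW.
    by apply: ler_powR; [exact: ltW|apply: le_trans q_ge4; rewrite ler_nat].
  pose m := Num.max (kernel_max_mean F H x / B) (kernel_max_total F H / B).
  have um : kernel_max_mean F H x / B <= m by rewrite le_max lexx.
  have tm : kernel_max_total F H / B <= m by rewrite le_max lexx orbT.
  have m0 : 0 <= m.
    by apply: le_trans um; rewrite divr_ge0 ?kernel_max_mean_ge0 // ltW.
  have bvm : beta * v <= y * m.
    apply: (@le_trans _ _ (beta * (s * (kernel_max_mean F H x + kernel_max_total F H)))).
      by apply: ler_wpM2l => //; exact: ltW.
    rewrite (_ : _ * _ = B * beta * s * (kernel_max_mean F H x / B + kernel_max_total F H / B)); last first.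
      by field; rewrite gt_eqF.
    rewrite (_ : y * m = B * beta * s * (m + m)); last by rewrite /y; ring.
    by apply: ler_wpM2l; [nonneg|exact: lerD].
  apply: (@le_trans _ _ ((y * m) `^ q)).
    apply: ge0_ler_powR => //; rewrite ?nnegrE //; first by rewrite mulr_ge0 // ltW.
    exact: mulr_ge0.
  rewrite powRM //; apply: ler_wpM2l; first exact: powR_ge0.
  rewrite /m; case: (leP (kernel_max_mean F H x / B) (kernel_max_total F H / B)) => _.
    by rewrite lerDr.
  by rewrite lerDl powR_ge0.
have mp := measurable_kernel_proj mH H_sq.
have mc := @measurable_cubic_excess _ I l phi _ S (fun i x => s * kernel_proj F H x i)
  (fun i => measurable_funM (measurable_cst s) (mp i)).
have ic : F.-integrable setT
    (EFin \o (fun x => cubic_excess l phi (fun i => s * kernel_proj F H x i))).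
  by apply: (integrable_dominated mc ib) => x; rewrite ger0_norm ?cubic_excess_ge0.
split => //; apply: le_trans (le_Rintegral measurableT ic ib (fun x _ => key x)) _.
rewrite /bound RintegralZl //; last by apply: integrableDR => //; exact: integrable_cstR.
rewrite RintegralD //; last exact: integrable_cstR.
rewrite (Rintegral_cst1 F) -[2 * _ * _]mulrA [2 * _]mulrC; apply: ler_wpM2l.
  by rewrite mulr_ge0 ?powR_ge0 // invr_ge0 ltW.
have := kernel_max_total_powR; rewrite -/t.
have : \int[F]_x u x <= 1.
  by rewrite -lee_fin EFin_Rintegral //; exact: kernel_max_mean_powR.
lra.
Qed.

End power_kernel.

(** [r^2 <= 1 + r^q] already gives [2 * B ^+ 2]. The bound is loosened to the form of the
    exponential case so that [orthant_rate] serves both. *)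
Lemma kernel_max2_powR {R : realType} (I : finType) (i0 : I) d (S : measurableType d)
    (F : probability S R) (H : S -> S -> I -> R) (B q l : R) :
  1 <= B -> 4 <= q -> 1 <= l ->
  (forall i, measurable_fun [set: S * S] (fun z => H z.1 z.2 i)) ->
  (\int[F]_x \int[F]_y ((vmax (H x y) / B) `^ q)%:E <= 1%:E)%E ->
  (\int[F]_x \int[F]_y (vmax (H x y) ^+ 2)%:E <= (144 * B ^+ 2 * l ^+ 2)%:E)%E.
Proof.
move=> B1 q4 l1 mH H_q.
have B0 : 0 < B by exact: lt_le_trans B1.
pose c := B ^+ 2; have c0 : 0 <= c by exact: sqr_ge0.
pose e x y := ((vmax (H x y) / B) `^ q)%:E.
have e0 x y : (0 <= e x y)%E by rewrite lee_fin powR_ge0.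
have mvm : measurable_fun [set: S * S] (fun z => vmax (H z.1 z.2)).
  exact: (@measurable_vmax R I _ _ (fun i z => H z.1 z.2 i)).
have mv : measurable_fun setT (fun z : S * S => (vmax (H z.1 z.2) ^+ 2)%:E).
  by apply/measurable_EFinP; exact: measurable_funX.
have me : measurable_fun [set: S * S] (fun z => e z.1 z.2).
  apply/measurable_EFinP; apply: (measurableT_comp (measurable_powR q)).
  exact: measurable_funM.
have key x y : ((vmax (H x y) ^+ 2)%:E <= c%:E * (1%:E + e x y))%E.
  rewrite -EFinD -EFinM lee_fin.
  have v0 : 0 <= vmax (H x y) by exact: vmax_ge0.
  rewrite (_ : vmax (H x y) ^+ 2 = c * (vmax (H x y) / B) ^+ 2); last first.
    by rewrite /c; field; rewrite gt_eqF.
  apply: ler_wpM2l => //.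
  have r0 : 0 <= vmax (H x y) / B by rewrite divr_ge0 // ltW.
  have [r1|r1] := lerP (vmax (H x y) / B) 1.
    by rewrite (le_trans (exprn_ile1 2 r0 r1)) // lerDl powR_ge0.
  rewrite -powR_mulrn //; apply: (@le_trans _ _ ((vmax (H x y) / B) `^ q)); last by rewrite lerDr.
  by apply: ler_powR; [exact: ltW|apply: le_trans q4; rewrite ler_nat].
have c0' : (0 <= c%:E)%E by rewrite lee_fin.
have o0 x : (setT : set S) x -> (0 <= (1 : R)%:E)%E by rewrite lee_fin.
have inner x : (\int[F]_y (vmax (H x y) ^+ 2)%:E <= c%:E * (1%:E + \int[F]_y e x y))%E.
  have mex : measurable_fun setT (e x) by exact: (measurableT_comp me (pair1_measurable x)).
  apply: (@le_trans _ _ (\int[F]_y (c%:E * (1%:E + e x y)))%E).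
    apply: ge0_le_integralT.
    - by move=> y; rewrite lee_fin sqr_ge0.
    - exact: (measurableT_comp mv (pair1_measurable x)).
    - by apply: emeasurable_funM => //; exact: emeasurable_funD.
    - exact: key.
  have a1 y : (setT : set S) y -> (0 <= 1%:E + e x y)%E by move=> _; rewrite adde_ge0 // lee_fin.
  have a2 : measurable_fun setT (fun y => 1%:E + e x y)%E by exact: emeasurable_funD.
  rewrite (ge0_integralZl F measurableT a2 a1 c0').
  rewrite (ge0_integralD F measurableT o0 (measurable_cst _) (fun y _ => e0 x y) mex).
  by rewrite (integral_prob_cst F).
pose E x := (\int[F]_y e x y)%E.
have E0 x : (0 <= E x)%E by apply: integral_ge0.
have mE : measurable_fun setT E.
  by apply: (@measurable_fun_fubini_tonelli_F _ _ S S R F _ me) => z; exact: e0.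
apply: (@le_trans _ _ (\int[F]_x (c%:E * (1%:E + E x)))%E).
  apply: ge0_le_integralT.
  - by move=> x; apply: integral_ge0 => y _; rewrite lee_fin sqr_ge0.
  - apply: (@measurable_fun_fubini_tonelli_F _ _ S S R F _ mv).
    by move=> z; rewrite lee_fin sqr_ge0.
  - by apply: emeasurable_funM => //; exact: emeasurable_funD.
  - exact: inner.
have a1 x : (setT : set S) x -> (0 <= 1%:E + E x)%E by move=> _; rewrite adde_ge0 // lee_fin.
have a2 : measurable_fun setT (fun x => 1%:E + E x)%E by exact: emeasurable_funD.
rewrite (ge0_integralZl F measurableT a2 a1 c0').
rewrite (ge0_integralD F measurableT o0 (measurable_cst _) (fun x _ => E0 x) mE).
rewrite (integral_prob_cst F).
apply: (@le_trans _ _ (c%:E * (1%:E + 1%:E))%E).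
  by apply: lee_wpmul2l => //; exact: leeD.
rewrite -EFinD -EFinM lee_fin /c.
have l2 : 1 <= l ^+ 2 by exact: exprn_ege1.
have := ler_peMr (sqr_ge0 B) l2; have := sqr_ge0 B; rewrite -!mulrA; lra.
Qed.

(** * Rates under the two tail conditions *)

Section orthant_rate.
Context {R : realType} (I : finType) (i0 : I) d (S : measurableType d)
  (F : probability S R) (H : S -> S -> I -> R) (B l w b K : R).
Context dO (Om : measurableType dO) (P : probability Om R) (X : nat -> Om -> S) (n : nat).
Context dZ (OmZ : measurableType dZ) (PZ : probability OmZ R) (k : nat)
  (Z : nat -> OmZ -> R) (A : nat -> I -> R).
Hypotheses (B_ge1 : 1 <= B)
  (mH : forall i, measurable_fun [set: S * S] (fun z => H z.1 z.2 i))
  (H_sym : forall x y, H x y = H y x)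
  (H_sq : forall x i, (\int[F]_y (`|H x y i| ^+ 2)%:E < +oo)%E)
  (H_cube : forall i, (\int[F]_x \int[F]_y (`|H x y i| ^+ 3)%:E <= B%:E)%E).
Hypotheses (n_ge2 : (2 <= n)%N) (iX : iid_seq P F n X)
  (iZ : iid_seq PZ (@gauss R) k Z)
  (A_cov : forall i j, gram A k i j = \int[F]_x (kernel_proj F H x i * kernel_proj F H x j))
  (b_gt0 : 0 < b) (var_ge : forall i, b <= gram A k i i)
  (l_ge1 : 1 <= l) (card_le : ln #|{: I * bool}|%:R <= l)
  (w_gt0 : 0 < w) (w_le1 : w <= 1) (n_le : n%:R <= expR l)
  (rate_ge : B ^+ 2 * l ^+ 7 <= w ^+ 6 * n%:R) (KE : K = 2000).

Let phi := smoothing l w K.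
Let beta := bandwidth l phi.
Let s := (Num.sqrt (n%:R : R))^-1.

Let n_gt0 : (0 < n)%N. Proof. exact: leq_trans n_ge2. Qed.
Let nR : 0 < n%:R :> R. Proof. by rewrite ltr0n. Qed.
Let n1R : 1 <= n%:R :> R. Proof. by rewrite ler1n. Qed.
Let s_gt0 : 0 < s. Proof. by rewrite invr_gt0 sqrtr_gt0. Qed.
Let K_gt0 : 0 < K. Proof. by rewrite KE; lra. Qed.
Let B_gt0 : 0 < B. Proof. exact: lt_le_trans B_ge1. Qed.
Let l_gt0 : 0 < l. Proof. exact: lt_le_trans l_ge1. Qed.
Let phi_gt0 : 0 < phi. Proof. exact: smoothing_gt0. Qed.
Let beta_gt0 : 0 < beta. Proof. exact: mulr_gt0. Qed.

Let card_I : #|I|%:R <= expR l.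
Proof.
have I0 : (0 < #|I|)%N by apply/card_gt0P; exists i0.
rewrite -[leLHS]lnK ?posrE ?ltr0n // ler_expR; apply: le_trans card_le.
rewrite ler_ln ?posrE ?ltr0n //; last by apply/card_gt0P; exists (i0, true).
by rewrite ler_nat card_prod card_bool leq_pmulr.
Qed.

Let var_le i : gram A k i i <= (4 * B) ^+ 2.
Proof.
rewrite A_cov; apply: le_trans (kernel_proj_var_le B_ge1 mH H_sq H_cube i) _.
rewrite (_ : (4 * B) ^+ 2 = 16 * (B * B)); last by ring.
have := ler_peMr (ltW B_gt0) B_ge1; move: B_gt0; lra.
Qed.

(** 28 = 5 + 20 + 3 stands for the far coordinates, the large increments and the degenerate part.
    [tau_q] is the share of the large increments that is not exponentially small. *)
Lemma orthant_rate (tau_q : R) c :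
  (\int[F]_x \int[F]_y (vmax (H x y) ^+ 2)%:E <= (144 * B ^+ 2 * l ^+ 2)%:E)%E ->
  F.-integrable setT (EFin \o (fun x => cubic_excess l phi (fun i => s * kernel_proj F H x i))) ->
  \int[F]_x cubic_excess l phi (fun i => s * kernel_proj F H x i) <=
    exp_excess B l w n%:R K 864 #|I|%:R + tau_q ->
  0 <= tau_q -> n%:R * (beta ^+ 3 * tau_q) <= (50 * K)^-1 * w ->
  `|\int[P]_t below c (kernel_stat F H X n t) - gauss_mean A k (below c)| <=
  (68 * 16 * K / Num.sqrt b + 28) * w.
Proof.
move=> H_max2 iexc exc tq0 tq.
have M20 : 0 < 144 * B ^+ 2 * l ^+ 2.
  by apply: mulr_gt0; [apply: mulr_gt0; [rewrite ltr0n|exact: exprn_gt0]|exact: exprn_gt0].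
have c10 : 0 <= 13312 :> R by exact: ler0n.
have c20 : 0 <= 864 :> R by exact: ler0n.
(* [delta = 1 / (50 * K)] lies just below [20 / (13312 * 128)]; among the conditions on [K], the one
   for the degenerate part requires 1824. *)
have dl0 : 0 <= (50 * K)^-1 by rewrite KE; lra.
have K12 : 2 * 13312 * 864 * 16 * 8 <= K ^+ 3 by rewrite KE; lra.
have K2 : 864 * 64 <= (50 * K)^-1 * K ^+ 3 by rewrite KE; lra.
have K32 : 32 <= K by rewrite KE; lra.
have c1d : 13312 * (50 * K)^-1 * 128 <= 20 by rewrite KE; lra.
have dle : (50 * K)^-1 <= 1 / 4 by rewrite KE; lra.
have Kr : 57 * 48 * 2 <= 3 * K by rewrite KE; lra.
have D0 : 0 < 4 * B by apply: mulr_gt0 => //; rewrite ltr0n.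
have third := third_order_small B_ge1 l_ge1 w_gt0 nR rate_ge K_gt0 c10 c20 K12.
have [ts te] := excess_terms B_ge1 l_ge1 w_gt0 w_le1 nR n_le rate_ge K_gt0 c10 c20 dl0
  K2 K32 c1d dle (ler0n R #|I|) card_I tq0 tq n1R.
have main := orthant_comparison i0 B_ge1 M20 mH H_sym H_sq H_cube H_max2 n_ge2 iX iZ A_cov
  b_gt0 var_ge l_ge1 card_le phi_gt0 D0 var_le iexc exc _ ts third c.
have tq1 : #|I|%:R * (864 * (s * (4 * B)) ^+ 3 * expR (- (2 * (4 * B) * beta * s)^-1)) <=
    exp_excess B l w n%:R K 864 #|I|%:R + tau_q.
  by rewrite -/(exp_excess B l w n%:R K 864 #|I|%:R) lerDl.
have {}main := main tq1.
have sm := smoothing_error l_ge1 w_gt0 K_gt0 b_gt0.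
have ee := expRN_le_rate B_ge1 l_ge1 w_gt0 w_le1 nR n_le rate_ge.
have m0 : 0 < n.-1%:R :> R by rewrite ltr0n; case: (n) n_ge2 => [|[]].
have nm : n%:R <= 2 * n.-1%:R :> R.
  rewrite -natrM ler_nat; case: (n) n_ge2 => [|[|m]] // _.
  by rewrite /= mul2n -addnn addSn ltnS leq_addl.
have rest := rest_error B_ge1 l_ge1 w_gt0 w_le1 nR rate_ge K_gt0 Kr (ltW m0) nm m0.
apply: le_trans main _; move: (68 * 16 * K / Num.sqrt b) sm => r sm.
rewrite (_ : (r + 28) * w = r * w + 5 * w + 20 * w + 3 * w); last by ring.
exact: lerD (lerD (lerD sm (ler_wpM2l (ler0n R 5) ee)) te) rest.
Qed.

Lemma orthant_rate_exp c :
  (forall i, (\int[F]_x \int[F]_y (expR (`|H x y i| / (2 * B)))%:E <= 2%:E)%E) ->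
  `|\int[P]_t below c (kernel_stat F H X n t) - gauss_mean A k (below c)| <=
  (68 * 16 * K / Num.sqrt b + 28) * w.
Proof.
move=> H_exp.
have max2 := kernel_max2_exp i0 B_ge1 mH H_exp l_ge1 card_I.
have mp := measurable_kernel_proj mH H_sq.
have pe := kernel_proj_exp B_ge1 mH H_sq H_cube H_exp.
have D0 : 0 < 4 * B by apply: mulr_gt0 => //; rewrite ltr0n.
have [ie le_e] := exp_tail_excess i0 l_gt0 phi_gt0 D0 s_gt0 mp pe.
apply: (orthant_rate c max2 ie _ (lexx 0)); first by rewrite addr0; exact: le_e.
by rewrite !mulr0; apply: mulr_ge0; [rewrite KE; lra|exact: ltW].
Qed.

(** The large increments cost [2 n y^q] with [y = 2 B beta s]. The second rate gives
    [y^2 <= a n^(-2/q)], whose power [q / 2] cancels [n] exactly. Since [a <= 1] and [q >= 4], at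
    most [2 a^2] remains, a small multiple of [w]. *)
Lemma orthant_rate_power (q : R) c : 4 <= q ->
  B ^+ 2 * l ^+ 3 <= w ^+ 3 * n%:R `^ (1 - 2 / q) ->
  (\int[F]_x \int[F]_y ((vmax (H x y) / B) `^ q)%:E <= 1%:E)%E ->
  `|\int[P]_t below c (kernel_stat F H X n t) - gauss_mean A k (below c)| <=
  (68 * 16 * K / Num.sqrt b + 28) * w.
Proof.
move=> q4 rate2 H_q.
have max2 := kernel_max2_powR i0 B_ge1 q4 l_ge1 mH H_q.
have [ie le_e] := power_excess i0 B_ge1 q4 mH H_sq H_cube max2 H_q l_gt0 phi_gt0 s_gt0.
set tau_q := 2 * _ * _ in le_e.
have b3 : 0 < beta ^+ 3 by exact: exprn_gt0.
have tq0 : 0 <= tau_q.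
  by apply: mulr_ge0; [apply: mulr_ge0 => //; rewrite invr_ge0 ltW|exact: powR_ge0].
have ex0 : 0 <= exp_excess B l w n%:R K 864 #|I|%:R.
  rewrite /exp_excess; apply: mulr_ge0; first exact: ler0n.
  by apply: mulr_ge0; [nonneg|exact: expR_ge0].
apply: (orthant_rate c max2 ie (le_trans le_e _) tq0); first by rewrite lerDr.
have q0 : 0 < q by apply: lt_le_trans q4; rewrite ltr0n.
pose y := 2 * B * bandwidth l phi * s.
have y0 : 0 <= y by rewrite /y; nonneg.
pose a := 4 / K ^+ 2 * w.
have a0 : 0 <= a by rewrite /a; nonneg.
have y2 : y ^+ 2 <= a * n%:R `^ (- (2 / q)).
  have -> : y ^+ 2 = (4 / (K ^+ 2 * w ^+ 2)) * (B ^+ 2 * l ^+ 3) / n%:R.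
    have s2 : s ^+ 2 = n%:R^-1 by rewrite exprVn sqr_sqrtr // ltW.
    have r2 : Num.sqrt l ^+ 2 = l by rewrite sqr_sqrtr // ltW.
    have -> : y ^+ 2 = 4 * B ^+ 2 * l ^+ 2 * (Num.sqrt l ^+ 2 / (K * w) ^+ 2) * s ^+ 2.
      by rewrite /y /bandwidth /phi /smoothing; field; rewrite !gt_eqF.
    by rewrite s2 r2; field; rewrite !gt_eqF.
  have h0 : 0 <= 4 / (K ^+ 2 * w ^+ 2) by nonneg.
  have := ler_wpM2l h0 rate2; rewrite -(ler_pM2r (_ : 0 < n%:R^-1)) ?invr_gt0 //.
  move/le_trans; apply; rewrite powRB; last by apply/implyP => _; rewrite gt_eqF.
  rewrite (powRr1 (ltW nR)) powRN /a le_eqVlt; apply/orP; left; apply/eqP.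
  have p0 : 0 < n%:R `^ (2 / q) by exact: powR_gt0.
  by move: (n%:R `^ (2 / q)) p0 => p p0; field; rewrite !gt_eqF.
have yq : n%:R * y `^ q <= a ^+ 2.
  have qE : q = 2%:R * (q / 2) by field.
  have -> : y `^ q = (y ^+ 2) `^ (q / 2) by rewrite {1}qE powRrM powR_mulrn.
  have h : (y ^+ 2) `^ (q / 2) <= (a * n%:R `^ (- (2 / q))) `^ (q / 2).
    apply: ge0_ler_powR => //; rewrite ?nnegrE ?sqr_ge0 //; first by nonneg.
    by rewrite mulr_ge0 ?powR_ge0.
  rewrite (powRM _ a0 (powR_ge0 _ _)) -powRrM in h.
  rewrite (_ : - (2 / q) * (q / 2) = - 1) in h; last by field; rewrite gt_eqF.
  rewrite (powR_inv1 (ltW nR)) in h.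
  have a1 : a <= 1.
    rewrite /a; apply: (@le_trans _ _ (4 / K ^+ 2)).
      by rewrite ler_piMr //; nonneg.
    by rewrite ler_pdivrMr ?exprn_gt0 // mul1r KE; lra.
  have ap : 0 < a.
    by rewrite /a; apply: mulr_gt0 => //; apply: divr_gt0; [rewrite ltr0n|exact: exprn_gt0].
  have aq : a `^ (q / 2) <= a ^+ 2.
    rewrite -powR_mulrn //; apply: ger_powR; first by rewrite ap a1.
    by rewrite ler_pdivlMr // -natrM.
  apply: le_trans (ler_wpM2l (ltW nR) h) _.
  by rewrite mulrCA divff ?gt_eqF // mulr1.
rewrite -/beta (_ : n%:R * (beta ^+ 3 * tau_q) = 2 * (n%:R * y `^ q)); last first.
  rewrite /tau_q -/y -/beta; move: (y `^ q) (beta ^+ 3) b3 => p t t0; field; rewrite gt_eqF //.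
apply: (@le_trans _ _ (2 * a ^+ 2)); first by apply: ler_wpM2l.
rewrite (_ : 2 * a ^+ 2 = (32 / K ^+ 4 * w) * w); last by rewrite /a; field; rewrite gt_eqF.
apply: ler_wpM2r; first exact: ltW.
apply: (@le_trans _ _ (32 / K ^+ 4)).
  by rewrite ler_piMr //; nonneg.
rewrite ler_pdivrMr ?exprn_gt0 // KE; lra.
Qed.

End orthant_rate.

(** * Reduction of the sample and of the kernel *)

Section change_of_variables.
Context {R : realType} dO (Om : measurableType dO) (P : probability Om R).

Lemma integral_law_ge0 d (S : measurableType d) (G : {measure set S -> \bar R})
    (X : Om -> S) (f : S -> \bar R) : measurable_fun setT X ->
  (forall A, measurable A -> P (X @^-1` A) = G A) ->
  measurable_fun setT f -> (forall x, 0 <= f x)%E ->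
  (\int[P]_w f (X w) = \int[G]_x f x)%E.
Proof.
move=> mX XF mf f0; have [X' eX] := mfun_of mX.
rewrite (@eq_measure_integral _ _ _ setT (distribution P X') G); last first.
  move=> A mA _; rewrite -(XF _ mA).
  by suff: P (X' @^-1` A) = P (X @^-1` A) by []; rewrite eX.
by rewrite ge0_integral_distribution //; apply: eq_integral => w _; rewrite /= eX.
Qed.

Lemma integral_law d (S : measurableType d) (G : {measure set S -> \bar R})
    (X : Om -> S) (f : S -> \bar R) : measurable_fun setT X ->
  (forall A, measurable A -> P (X @^-1` A) = G A) ->
  measurable_fun setT f -> (\int[P]_w f (X w) = \int[G]_x f x)%E.
Proof.
move=> mX XF mf; rewrite [LHS]integralE [RHS]integralE.
have p := integral_law_ge0 mX XF (measurable_funepos mf) (funepos_ge0 f).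
have q := integral_law_ge0 mX XF (measurable_funeneg mf) (funeneg_ge0 f).
rewrite -p -q; congr (_ - _)%E; apply: eq_integral => w _.
  by rewrite !funeposE.
by rewrite !funenegE.
Qed.

Lemma Rintegral_law d (S : measurableType d) (G : {measure set S -> \bar R})
    (X : Om -> S) (f : S -> R) : measurable_fun setT X ->
  (forall A, measurable A -> P (X @^-1` A) = G A) ->
  measurable_fun setT f -> \int[P]_w f (X w) = \int[G]_x f x.
Proof.
move=> mX XF mf; rewrite /Rintegral.
by rewrite (integral_law (f := fun x => (f x)%:E) mX XF) //; exact/measurable_EFinP.
Qed.

Context d (S : measurableType d) (F : probability S R).
Variables (X X' : Om -> S).
Hypotheses (mX : measurable_fun setT X) (mX' : measurable_fun setT X')
  (XF : forall A, measurable A -> P (X @^-1` A) = F A)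
  (X'F : forall A, measurable A -> P (X' @^-1` A) = F A)
  (XX' : independent2 P X X').

Lemma pair_law A : measurable A ->
  P ((fun w => (X w, X' w)) @^-1` A) = (F \x F)%E A.
Proof.
move=> mA.
have mXX : measurable_fun setT (fun w => (X w, X' w)) by exact: measurable_fun_pair.
have [XX eXX] := mfun_of mXX.
rewrite (@product_measure_unique _ _ _ _ _ F F (distribution P XX)) //.
  by suff: P ((fun w => (X w, X' w)) @^-1` A) = P (XX @^-1` A) by []; rewrite eXX.
move=> A1 A2 mA1 mA2.
have := XX' mA1 mA2; rewrite (XF mA1) (X'F mA2) => <-.
by suff: P (XX @^-1` (A1 `*` A2)) = P (X @^-1` A1 `&` X' @^-1` A2) by []; rewrite eXX.
Qed.

Lemma integral_pair (f : S * S -> \bar R) : measurable_fun setT f ->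
  (forall z, 0 <= f z)%E ->
  (\int[P]_w f (X w, X' w) = \int[F]_x \int[F]_y f (x, y))%E.
Proof.
move=> mf f0; rewrite (independent2_integral mX mX' X'F XX' mf f0).
apply: (integral_law_ge0 (f := fun x => (\int[F]_y f (x, y))%E) mX XF).
  exact: (@measurable_fun_fubini_tonelli_F _ _ S S R F f mf f0).
by move=> x; apply: integral_ge0.
Qed.

Lemma integral_pair_fubini (f : S * S -> R) : measurable_fun setT f ->
  P.-integrable setT (EFin \o (fun w => f (X w, X' w))) ->
  (\int[P]_w (f (X w, X' w))%:E = \int[F]_x \int[F]_y (f (x, y))%:E)%E.
Proof.
move=> mf fi.
have mXX : measurable_fun setT (fun w => (X w, X' w)) by exact: measurable_fun_pair.
have mfE : measurable_fun setT (EFin \o f) by exact/measurable_EFinP.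
rewrite (integral_law (f := EFin \o f) mXX pair_law mfE).
rewrite -integral12_prod_meas1 //.
apply/integrableP; split => //.
rewrite -(integral_law_ge0 (f := fun z => `|(EFin \o f) z|%E) mXX pair_law) //.
  by have /integrableP[] := fi.
exact: measurableT_comp.
Qed.

End change_of_variables.

(** * Null sets and truncation of the kernel *)

Section almost_everywhere.
Context {R : realType} d (T : measurableType d) (mu : {measure set T -> \bar R}).
Variable N : set T.
Hypotheses (mN : measurable N) (N0 : mu N = 0%E).

Lemma integral_off_null (f g : T -> \bar R) :
  measurable_fun setT f -> measurable_fun setT g ->
  (forall x, ~ N x -> f x = g x) -> (\int[mu]_x f x = \int[mu]_x g x)%E.
Proof.
move=> mf mg fg; apply: ae_eq_integral => //.
exists N; split => // x; apply: contra_notP => Nx _; exact: fg.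
Qed.

Lemma Rintegral_off_null (f g : T -> R) :
  measurable_fun setT f -> measurable_fun setT g ->
  (forall x, ~ N x -> f x = g x) -> \int[mu]_x f x = \int[mu]_x g x.
Proof.
move=> mf mg fg; rewrite /Rintegral.
rewrite (@integral_off_null (fun x => (f x)%:E) (fun x => (g x)%:E)) //.
- exact/measurable_EFinP.
- exact/measurable_EFinP.
- by move=> x Nx; rewrite fg.
Qed.

End almost_everywhere.

Lemma measurable_section_integral {R : realType} d (S : measurableType d)
    (F : probability S R) (f : S * S -> \bar R) : measurable_fun setT f ->
  measurable_fun setT (fun x => \int[F]_y f (x, y))%E.
Proof.
move=> mf.
rewrite (_ : (fun x => _) = (fun x => \int[F]_y f^\+ (x, y) - \int[F]_y f^\- (x, y))%E);
    last first.
  apply/funext => x; rewrite integralE; congr (_ - _)%E; apply: eq_integral => y _.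
    by rewrite !funeposE.
  by rewrite !funenegE.
apply: emeasurable_funB.
  apply: (@measurable_fun_fubini_tonelli_F _ _ S S R F _ (measurable_funepos mf)).
  exact: funepos_ge0.
apply: (@measurable_fun_fubini_tonelli_F _ _ S S R F _ (measurable_funeneg mf)).
exact: funeneg_ge0.
Qed.

Section truncated_kernel.
Context {R : realType} (I : finType) d (S : measurableType d)
  (F : probability S R) (h : S -> S -> I -> R).
Hypotheses (mh : forall i, measurable_fun [set: S * S] (fun z => h z.1 z.2 i))
  (h_cube : forall i, (\int[F]_x \int[F]_y (`|h x y i| ^+ 3)%:E < +oo)%E).

Let v i x := (\int[F]_y (`|h x y i| ^+ 2)%:E)%E.

(* The moment bounds only give square integrable sections outside a null set, on
   which the kernel is replaced by zero. *)
Definition bad_points : set S :=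
  \bigcup_(i in [set: I]) [set x | (\int[F]_y (`|h x y i| ^+ 2)%:E = +oo)%E].

Definition trunc_kernel (x y : S) (i : I) : R :=
  \1_(~` bad_points) x * \1_(~` bad_points) y * h x y i.

Let mhp (k : nat) i : measurable_fun [set: S * S] (fun z => (`|h z.1 z.2 i| ^+ k)%:E).
Proof. by apply/measurable_EFinP; apply: measurable_funX; exact: measurable_normr. Qed.

Let hp_ge0 (k : nat) i (z : S * S) : (0 <= (`|h z.1 z.2 i| ^+ k)%:E)%E.
Proof. by rewrite lee_fin exprn_ge0. Qed.

Let mv i : measurable_fun setT (v i).
Proof.
exact: (@measurable_fun_fubini_tonelli_F _ _ S S R F _ (mhp 2 i) (hp_ge0 2 i)).
Qed.

Let v_ge0 i x : (0 <= v i x)%E.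
Proof. by apply: integral_ge0 => y _; exact: (hp_ge0 2 i (x, y)). Qed.

Let mh_section x i : measurable_fun setT (fun y => h x y i).
Proof. exact: (measurableT_comp (mh i) (pair1_measurable x)). Qed.

Lemma measurable_bad_points : measurable bad_points.
Proof.
apply: fin_bigcup_measurable; first exact: finite_finset.
move=> i _; rewrite (_ : [set x | _] = v i @^-1` [set +oo%E]) //.
by rewrite -[X in measurable X]setTI; apply: mv => //; exact: emeasurable_set1.
Qed.

(** [r^2 <= 1 + r^3] makes the iterated integral of the square finite, and a function with finite
    integral is finite almost everywhere. *)
Let bad_points_negligible i : F.-negligible [set x | v i x = +oo%E].
Proof.
have fin2 : (\int[F]_x v i x < +oo)%E.
  have i3 : (\int[F]_x \int[F]_y (1 + `|h x y i| ^+ 3)%:E < +oo)%E.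
    have m3 := mhp 3 i; have g3 := hp_ge0 3 i.
    have s3 x : (setT : set S) x -> (0 <= \int[F]_y (`|h x y i| ^+ 3)%:E)%E.
      by move=> _; apply: integral_ge0 => y _; exact: (g3 (x, y)).
    rewrite (eq_integral (fun x => 1 + \int[F]_y (`|h x y i| ^+ 3)%:E)%E); last first.
      move=> x _; under eq_integral do rewrite EFinD.
      rewrite (ge0_integralD F measurableT (fun y _ => lee01) (measurable_cst _)
        (fun y _ => g3 (x, y)) (measurableT_comp m3 (pair1_measurable x))).
      by rewrite (integral_prob_cst F).
    rewrite (ge0_integralD F measurableT (fun y _ => lee01) (measurable_cst _)
      s3
      (@measurable_fun_fubini_tonelli_F _ _ S S R F _ m3 g3)).
    by rewrite (integral_prob_cst F) lte_add_pinfty // ltry.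
  apply: le_lt_trans i3.
  have m3 : measurable_fun [set: S * S] (fun z => (1 + `|h z.1 z.2 i| ^+ 3)%:E).
    apply/measurable_EFinP; apply: measurable_funD => //.
    by apply: measurable_funX; exact: measurable_normr.
  have g3 (z : S * S) : (0 <= (1 + `|h z.1 z.2 i| ^+ 3)%:E)%E.
    by rewrite lee_fin addr_ge0.
  apply: ge0_le_integralT.
  - exact: v_ge0.
  - exact: mv.
  - exact: (@measurable_fun_fubini_tonelli_F _ _ S S R F _ m3 g3).
  move=> x; apply: ge0_le_integralT.
  - by move=> y; exact: (hp_ge0 2 i (x, y)).
  - exact: (measurableT_comp (mhp 2 i) (pair1_measurable x)).
  - exact: (measurableT_comp m3 (pair1_measurable x)).
  move=> y; rewrite lee_fin; have r0 := normr_ge0 (h x y i).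
  have [r1|r1] := lerP `|h x y i| 1.
    by rewrite (le_trans (exprn_ile1 _ r0 r1)) // lerDl exprn_ge0.
  by rewrite (le_trans (ler_weXn2l (ltW r1) (leqnSn 2))) // lerDr.
have iv : F.-integrable setT (v i).
  apply/integrableP; split; first exact: mv.
  by rewrite (eq_integral (v i)) // => x _; rewrite gee0_abs.
have := integrable_ae measurableT iv.
by apply: negligibleS => x /= vx /(_ Logic.I); rewrite vx.
Qed.

Lemma bad_points_null : F bad_points = 0%E.
Proof.
apply: measure_negligible; first exact: measurable_bad_points.
rewrite (_ : bad_points = \big[setU/set0]_(i <- enum I) [set x | v i x = +oo%E]).
  apply: (big_ind (fun A => F.-negligible A)) => [|A1 A2|i _].
  - exact: negligible_set0.
  - exact: negligibleU.
  - exact: bad_points_negligible.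
rewrite -bigcup_seq /bad_points; apply: eq_bigcupl; split => i _ //.
by rewrite /= mem_enum.
Qed.

Lemma measurable_trunc_kernel i :
  measurable_fun [set: S * S] (fun z => trunc_kernel z.1 z.2 i).
Proof.
have mI : measurable_fun setT (\1_(~` bad_points) : S -> R).
  by apply: measurable_indic; apply: measurableC; exact: measurable_bad_points.
apply: measurable_funM => //; apply: measurable_funM.
  exact: (measurableT_comp mI measurable_fst).
exact: (measurableT_comp mI measurable_snd).
Qed.

Lemma trunc_kernel_sym : (forall x y, h x y = h y x) ->
  forall x y, trunc_kernel x y = trunc_kernel y x.
Proof.
by move=> hs x y; apply/funext => i; rewrite /trunc_kernel hs; congr (_ * _); rewrite mulrC.
Qed.

Lemma trunc_kernelE x y : ~ bad_points x -> ~ bad_points y ->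
  trunc_kernel x y = h x y.
Proof.
move=> bx by_; apply/funext => i; rewrite /trunc_kernel !indicE.
by rewrite !mem_set // !mul1r.
Qed.

Lemma trunc_kernel_le x y i : `|trunc_kernel x y i| <= `|h x y i|.
Proof.
rewrite /trunc_kernel !normrM !indicE !normr_nat -[leRHS]mul1r.
by apply: ler_wpM2r => //; do 2![case: (_ \in _)]; rewrite ?mulr1 ?mulr0.
Qed.

Lemma trunc_kernel_sq x i : (\int[F]_y (`|trunc_kernel x y i| ^+ 2)%:E < +oo)%E.
Proof.
have [bx|bx] := pselect (bad_points x).
  rewrite (eq_integral (fun=> 0%E)) ?integral0 // => y _.
  rewrite /trunc_kernel indicE memNset; last by move=> /=; apply.
  by rewrite !mul0r normr0 expr0n.
have vx : (v i x < +oo)%E.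
  by rewrite ltey; apply/negP => /eqP vx; apply: bx; exists i.
apply: le_lt_trans vx; apply: ge0_le_integralT.
- by move=> y; rewrite lee_fin exprn_ge0.
- apply/measurable_EFinP; apply: measurable_funX; apply: measurable_normr.
  exact: (measurableT_comp (measurable_trunc_kernel i) (pair1_measurable x)).
- exact: (measurableT_comp (mhp 2 i) (pair1_measurable x)).
by move=> y; rewrite lee_fin lerXn2r ?nnegrE //; exact: trunc_kernel_le.
Qed.

(** One monotone transform covers cubes and exponentials alike, so these hypotheses on the raw
    kernel pass to the truncated one. *)
Lemma trunc_kernel_mono (phi : R -> R) i : (forall r, 0 <= r -> 0 <= phi r) ->
  (forall r s, 0 <= r -> r <= s -> phi r <= phi s) -> measurable_fun setT phi ->
  (\int[F]_x \int[F]_y (phi `|trunc_kernel x y i|)%:E <=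
   \int[F]_x \int[F]_y (phi `|h x y i|)%:E)%E.
Proof.
move=> phi0 phiM mphi.
have m1 : measurable_fun [set: S * S] (fun z => (phi `|trunc_kernel z.1 z.2 i|)%:E).
  apply/measurable_EFinP; apply: (measurableT_comp mphi); apply: measurable_normr.
  exact: measurable_trunc_kernel.
have m2 : measurable_fun [set: S * S] (fun z => (phi `|h z.1 z.2 i|)%:E).
  by apply/measurable_EFinP; apply: (measurableT_comp mphi); exact: measurable_normr.
have p1 (z : S * S) : (0 <= (phi `|trunc_kernel z.1 z.2 i|)%:E)%E by rewrite lee_fin phi0.
have p2 (z : S * S) : (0 <= (phi `|h z.1 z.2 i|)%:E)%E by rewrite lee_fin phi0.
apply: ge0_le_integralT.
- by move=> x; apply: integral_ge0 => y _; exact: (p1 (x, y)).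
- exact: (@measurable_fun_fubini_tonelli_F _ _ S S R F _ m1 p1).
- exact: (@measurable_fun_fubini_tonelli_F _ _ S S R F _ m2 p2).
move=> x; apply: ge0_le_integralT.
- by move=> y; exact: (p1 (x, y)).
- exact: (measurableT_comp m1 (pair1_measurable x)).
- exact: (measurableT_comp m2 (pair1_measurable x)).
by move=> y; rewrite lee_fin; apply: phiM => //; exact: trunc_kernel_le.
Qed.

Lemma kernel_integrable_off_bad x i : ~ bad_points x ->
  F.-integrable setT (EFin \o (fun y => h x y i)).
Proof.
move=> bx; have vx : (v i x < +oo)%E.
  by rewrite ltey; apply/negP => /eqP vx; apply: bx; exists i.
have i1 := integrable_power (ltnW (ltnSn 1)) (mh_section x i) vx.
by apply: (integrable_dominated _ i1) => // y; rewrite expr1.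
Qed.

Lemma trunc_kernel_mean x i : ~ bad_points x ->
  kernel_mean F trunc_kernel x i = kernel_mean F h x i.
Proof.
move=> bx; apply: (Rintegral_off_null measurable_bad_points bad_points_null).
- exact: (measurableT_comp (measurable_trunc_kernel i) (pair1_measurable x)).
- exact: mh_section.
by move=> y by_; rewrite trunc_kernelE.
Qed.

Lemma measurable_raw_mean i : measurable_fun setT (fun x => kernel_mean F h x i).
Proof.
apply: (measurableT_comp (fine_measurable measurableT)).
have mE : measurable_fun [set: S * S] (fun z => (h z.1 z.2 i)%:E) by exact/measurable_EFinP.
exact: (measurable_section_integral F mE).
Qed.

Let measurable_trunc_mean i : measurable_fun setT (fun x => kernel_mean F trunc_kernel x i).
Proof. exact: (measurable_kernel_mean measurable_trunc_kernel trunc_kernel_sq). Qed.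

Lemma trunc_kernel_total i : kernel_total F trunc_kernel i = kernel_total F h i.
Proof.
apply: (Rintegral_off_null measurable_bad_points bad_points_null) => //.
- exact: measurable_raw_mean.
- by move=> x bx; exact: trunc_kernel_mean.
Qed.

Lemma trunc_kernel_proj x i : ~ bad_points x ->
  kernel_proj F trunc_kernel x i = kernel_proj F h x i.
Proof. by move=> bx; rewrite /kernel_proj trunc_kernel_mean // trunc_kernel_total. Qed.

Lemma trunc_kernel_proj_cov i j :
  \int[F]_x (kernel_proj F trunc_kernel x i * kernel_proj F trunc_kernel x j) =
  \int[F]_x (kernel_proj F h x i * kernel_proj F h x j).
Proof.
apply: (Rintegral_off_null measurable_bad_points bad_points_null).
- by apply: measurable_funM; exact: measurable_kernel_proj measurable_trunc_kernel trunc_kernel_sq _.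
- by apply: measurable_funM; apply: measurable_funB => //; exact: measurable_raw_mean.
by move=> x bx; rewrite !trunc_kernel_proj.
Qed.

Lemma trunc_kernel_vmax x y : vmax (trunc_kernel x y) <= vmax (h x y).
Proof.
apply: vmax_le => [|i]; first by rewrite /vmax; elim/big_ind: _ => // a b a0 b0; rewrite le_max a0.
by apply: le_trans (trunc_kernel_le _ _ _) _; exact: vmax_ge.
Qed.

Section statistic.
Context dO (Om : measurableType dO) (P : probability Om R) (X : nat -> Om -> S) (n : nat).
Hypothesis iX : iid_seq P F n X.

(** Only [n] observations enter the statistic, so the event where truncation can alter it is a
    finite union of null events. *)
Definition bad_sample : set Om := \bigcup_(a in `I_n) X a @^-1` bad_points.

Lemma measurable_bad_sample : measurable bad_sample.
Proof.
have [mX _ _] := iX; apply: bigcup_measurable => a _.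
by rewrite -[X in measurable X]setTI; apply: mX => //; exact: measurable_bad_points.
Qed.

Lemma bad_sample_null : P bad_sample = 0%E.
Proof.
have [mX XF _] := iX.
apply: measure_negligible; first exact: measurable_bad_sample.
rewrite (_ : bad_sample = \bigcup_a (if (a < n)%N then X a @^-1` bad_points else set0)).
  apply: negligible_bigcup => a; case: ifP => an; last exact: negligible_set0.
  have mb : measurable (X a @^-1` bad_points).
    by rewrite -[X in measurable X]setTI; apply: mX => //; exact: measurable_bad_points.
  apply/negligibleP => //; have mbp := measurable_bad_points.
  exact: etrans (XF a _ an mbp) bad_points_null.
apply/seteqP; split => w /=; first by move=> [a an aw]; exists a => //; rewrite /= an.
by move=> [a _]; case: ifP => // an aw; exists a.
Qed.

Lemma trunc_kernel_stat t : ~ bad_sample t ->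
  kernel_stat F trunc_kernel X n t = kernel_stat F h X n t.
Proof.
move=> bt; apply/funext => i; rewrite /kernel_stat trunc_kernel_total.
have bX (a : 'I_n) : ~ bad_points (X a t) by move=> ba; apply: bt; exists a => //=.
congr (_ * (_ * _ - _) / _); apply: eq_bigr => a _; apply: eq_bigr => c _.
by rewrite trunc_kernelE.
Qed.

Lemma measurable_kernel_stat (G : S -> S -> I -> R) i :
  (forall i, measurable_fun [set: S * S] (fun z => G z.1 z.2 i)) ->
  measurable_fun setT (fun t => kernel_stat F G X n t i).
Proof.
move=> mG; have [mX _ _] := iX.
apply: measurable_funM => //; apply: measurable_funM => //; apply: measurable_funB => //.
apply: measurable_funM => //; apply: measurable_sum => a.
under eq_fun do rewrite big_mkcond /=.
apply: measurable_sum => c; case: (a != c) => //.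
exact: (measurableT_comp (mG i) (measurable_fun_pair (mX a) (mX c))).
Qed.

Lemma integral_trunc_kernel_stat (c : I -> R) :
  \int[P]_t below c (kernel_stat F trunc_kernel X n t) =
  \int[P]_t below c (kernel_stat F h X n t).
Proof.
have [bmeas _] := ufun_below c.
apply: (Rintegral_off_null measurable_bad_sample bad_sample_null).
- by apply: bmeas => i; exact: measurable_kernel_stat measurable_trunc_kernel.
- by apply: bmeas => i; exact: measurable_kernel_stat mh.
by move=> t bt; rewrite trunc_kernel_stat.
Qed.

End statistic.
End truncated_kernel.

Section raw_kernel_rate.
Context {R : realType} (I : finType) (i0 : I) d (S : measurableType d)
  (F : probability S R) (H : S -> S -> I -> R) (B l w b K : R).
Context dO (Om : measurableType dO) (P : probability Om R) (X : nat -> Om -> S) (n : nat).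
Context dZ (OmZ : measurableType dZ) (PZ : probability OmZ R) (k : nat)
  (Z : nat -> OmZ -> R) (A : nat -> I -> R).
Hypotheses (B_ge1 : 1 <= B)
  (mH : forall i, measurable_fun [set: S * S] (fun z => H z.1 z.2 i))
  (H_sym : forall x y, H x y = H y x)
  (H_cube : forall i, (\int[F]_x \int[F]_y (`|H x y i| ^+ 3)%:E <= B%:E)%E).
Hypotheses (n_ge2 : (2 <= n)%N) (iX : iid_seq P F n X)
  (iZ : iid_seq PZ (@gauss R) k Z)
  (A_cov : forall i j, gram A k i j = \int[F]_x (kernel_proj F H x i * kernel_proj F H x j))
  (b_gt0 : 0 < b) (var_ge : forall i, b <= gram A k i i)
  (l_ge1 : 1 <= l) (card_le : ln #|{: I * bool}|%:R <= l)
  (w_gt0 : 0 < w) (w_le1 : w <= 1) (n_le : n%:R <= expR l)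
  (rate_ge : B ^+ 2 * l ^+ 7 <= w ^+ 6 * n%:R) (KE : K = 2000).

Let B_gt0 : 0 < B. Proof. exact: lt_le_trans B_ge1. Qed.

Let H_cube_fin i : (\int[F]_x \int[F]_y (`|H x y i| ^+ 3)%:E < +oo)%E.
Proof. exact: le_lt_trans (H_cube i) (ltry _). Qed.

Let H' := trunc_kernel F H.
Let mH' := measurable_trunc_kernel F mH.
Let H'_sq := @trunc_kernel_sq _ _ _ _ F _ mH.
Let H'_sym : forall x y, H' x y = H' y x. Proof. exact: trunc_kernel_sym. Qed.

Let H'_cube i : (\int[F]_x \int[F]_y (`|H' x y i| ^+ 3)%:E <= B%:E)%E.
Proof.
apply: le_trans (H_cube i).
apply: (@trunc_kernel_mono _ _ _ _ F H mH (fun r => r ^+ 3)) => [r r0|r s r0 rs|].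
- exact: exprn_ge0.
- by rewrite lerXn2r // nnegrE // (le_trans r0).
- exact: measurable_funX.
Qed.

Let A_cov' i j : gram A k i j =
  \int[F]_x (kernel_proj F H' x i * kernel_proj F H' x j).
Proof. by rewrite (trunc_kernel_proj_cov mH H_cube_fin). Qed.

Lemma raw_orthant_rate_exp c :
  (forall i, (\int[F]_x \int[F]_y (expR (`|H x y i| / (2 * B)))%:E <= 2%:E)%E) ->
  `|\int[P]_t below c (kernel_stat F H X n t) - gauss_mean A k (below c)| <=
  (68 * 16 * K / Num.sqrt b + 28) * w.
Proof.
move=> H_exp; rewrite -(integral_trunc_kernel_stat mH H_cube_fin iX).
apply: (orthant_rate_exp i0 B_ge1 mH' H'_sym H'_sq H'_cube n_ge2 iX iZ A_cov' b_gt0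
  var_ge l_ge1 card_le w_gt0 w_le1 n_le rate_ge KE) => i.
have B2 : 0 < 2 * B by exact: mulr_gt0.
apply: le_trans (H_exp i).
apply: (@trunc_kernel_mono _ _ _ _ F H mH (fun r => expR (r / (2 * B)))) => [r r0|r s r0 rs|].
- exact: expR_ge0.
- by rewrite ler_expR ler_pM2r ?invr_gt0.
- by apply: (measurableT_comp (@measurable_expR R)); exact: measurable_funM.
Qed.

Lemma raw_orthant_rate_power (q : R) c : 4 <= q ->
  B ^+ 2 * l ^+ 3 <= w ^+ 3 * n%:R `^ (1 - 2 / q) ->
  (\int[F]_x \int[F]_y ((vmax (H x y) / B) `^ q)%:E <= 1%:E)%E ->
  `|\int[P]_t below c (kernel_stat F H X n t) - gauss_mean A k (below c)| <=
  (68 * 16 * K / Num.sqrt b + 28) * w.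
Proof.
move=> q4 rate2 H_q; rewrite -(integral_trunc_kernel_stat mH H_cube_fin iX).
apply: (orthant_rate_power i0 B_ge1 mH' H'_sym H'_sq H'_cube n_ge2 iX iZ A_cov' b_gt0
  var_ge l_ge1 card_le w_gt0 w_le1 n_le rate_ge KE _ q4 rate2).
apply: le_trans H_q.
have q0 : 0 <= q by apply: le_trans q4.
have m (G : S -> S -> I -> R) : (forall i, measurable_fun [set: S * S] (fun z => G z.1 z.2 i)) ->
    measurable_fun [set: S * S] (fun z => ((vmax (G z.1 z.2) / B) `^ q)%:E).
  move=> mG; apply/measurable_EFinP; apply: (measurableT_comp (measurable_powR _)).
  by apply: measurable_funM => //; exact: (measurable_vmax (v := fun i z => G z.1 z.2 i)).
have p (G : S -> S -> I -> R) (z : S * S) : (0 <= ((vmax (G z.1 z.2) / B) `^ q)%:E)%E.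
  by rewrite lee_fin powR_ge0.
apply: ge0_le_integralT.
- by move=> x; apply: integral_ge0 => y _; exact: (p H' (x, y)).
- exact: (@measurable_fun_fubini_tonelli_F _ _ S S R F _ (m _ mH') (p H')).
- exact: (@measurable_fun_fubini_tonelli_F _ _ S S R F _ (m _ mH) (p H)).
move=> x; apply: ge0_le_integralT.
- by move=> y; exact: (p H' (x, y)).
- exact: (measurableT_comp (m _ mH') (pair1_measurable x)).
- exact: (measurableT_comp (m _ mH) (pair1_measurable x)).
move=> y; rewrite lee_fin; apply: ge0_ler_powR => //.
- by rewrite nnegrE divr_ge0 ?(ltW B_gt0) ?(vmax_ge0 i0).
- by rewrite nnegrE divr_ge0 ?(ltW B_gt0) ?(vmax_ge0 i0).
by rewrite ler_pM2r ?invr_gt0 //; exact: trunc_kernel_vmax.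
Qed.

End raw_kernel_rate.

(** * Hyperrectangles *)

Section finite_samples.
Context {R : realType} dO (Om : measurableType dO) (P : probability Om R)
  dS (S : measurableType dS) (F : set S -> \bar R).

(** A finite family is prolonged by the filler [D] to an index set [nat]; of the terms beyond [n],
    [iid_seq] asks only measurability. *)
Definition ord_seq (n : nat) (Z : 'I_n -> Om -> S) (D : Om -> S) (i : nat) : Om -> S :=
  if insub i is Some o then Z o else D.

Lemma ord_seqE n (Z : 'I_n -> Om -> S) D (i : 'I_n) : ord_seq Z D i = Z i.
Proof. by rewrite /ord_seq valK. Qed.

Lemma ord_seq_iid n (Z : 'I_n -> {RV P >-> S}) (D : Om -> S) :
  measurable_fun setT D -> iid F Z -> iid_seq P F n (ord_seq (fun i => Z i) D).
Proof.
move=> mD [ZF Zind]; split.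
- by move=> i; rewrite /ord_seq; case: insub.
- by move=> i A lt_in mA; rewrite /ord_seq insubT; exact: ZF.
move=> A mA.
under eq_bigr do rewrite ord_seqE.
rewrite -(Zind (fun i : 'I_n => A i)) //; congr (P _).
apply/seteqP; split => w Aw i.
  by move=> _; have := Aw i (ltn_ord i); rewrite ord_seqE.
by move=> /= lt_in; rewrite /ord_seq insubT; exact: (Aw (Ordinal lt_in) Logic.I).
Qed.

Lemma with_copies_iid n (Xs : 'I_n -> {RV P >-> S}) (X X' : {RV P >-> S}) :
  iid F (with_copies Xs X X') -> iid F Xs.
Proof.
move=> [ZF Zind]; split; first by move=> i A mA; exact: (ZF (inl i)).
move=> A mA.
have := Zind (fun s => if s is inl i then A i else setT) (fun s => match s with inl i => mA i | _ => measurableT end).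
rewrite big_sumType /= [X in _ = (_ * X)%E]big1 ?mule1 => [<-|b _]; last first.
  by case: b => /=; rewrite preimage_setT; exact: probability_setT.
congr (P _); apply/seteqP; split => w Aw i _.
  by case: i => [i|b] //=; exact: (Aw i Logic.I).
exact: (Aw (inl i) Logic.I).
Qed.

Lemma with_copies_pair n (Xs : 'I_n -> {RV P >-> S}) (X X' : {RV P >-> S}) :
  iid F (with_copies Xs X X') -> independent2 P X X'.
Proof.
move=> [ZF Zind] A A' mA mA'.
pose D (s : 'I_n + bool) := match s with inl _ => setT | inr true => A | inr false => A' end.
have mD s : measurable (D s) by case: s => [?|[]] //; exact: measurableT.
have := Zind D mD.
rewrite big_sumType /= big1 ?mul1e; last first.
  by move=> i _; rewrite preimage_setT; exact: probability_setT.
rewrite big_bool /= => <-; congr (P _); apply/seteqP; split => w.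
  by move=> [Aw A'w] [i|[]] _.
by move=> Dw; split; [exact: (Dw (inr true) Logic.I)|exact: (Dw (inr false) Logic.I)].
Qed.

End finite_samples.

Section rectangles.
Context {R : realType} (d : nat).
Implicit Types a b : 'I_d -> \bar R.

Definition finite_side a b (z : 'I_d * bool) : bool :=
  (if z.2 then b z.1 else a z.1) \is a fin_num.

(* One index per finite bound of the rectangle, the boolean being true for an
   upper bound; the rectangle then becomes an orthant indexed by its sides. *)
Definition side a b := {z : 'I_d * bool | finite_side a b z}.

Definition side_coord a b (i : side a b) : 'I_d := (val i).1.
Definition side_sign a b (i : side a b) : R := if (val i).2 then 1 else - 1.
Definition side_bound a b (i : side a b) : R :=
  if (val i).2 then fine (b (val i).1) else - fine (a (val i).1).

Lemma card_side a b : (#|{: side a b}| <= 2 * d)%N.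
Proof.
rewrite card_sig; apply: leq_trans (max_card _) _.
by rewrite card_prod card_ord card_bool mulnC.
Qed.

(** An infinite bound constrains nothing, except [a j = +oo] or [b j = -oo]; those make the
    rectangle empty and are excluded here. *)
Lemma rectangle_sides a b (x : 'I_d -> R) :
  (forall j, a j != +oo%E) -> (forall j, b j != -oo%E) ->
  (forall j, (a j <= (x j)%:E <= b j)%E) <->
  (forall i : side a b, side_sign i * x (side_coord i) <= side_bound i).
Proof.
move=> ay bNy; split=> [H [[j s] fs]|H j].
  rewrite /side_sign /side_coord /side_bound /=; move: fs (H j); rewrite /finite_side /=.
  case: s => fs /andP[l u].
    by rewrite mul1r -lee_fin fineK.
  by rewrite mulN1r lerN2 -lee_fin fineK.
apply/andP; split.
  case aE : (a j) (ay j) => [r| |] // _.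
    have fs : finite_side a b (j, false) by rewrite /finite_side /= aE.
    have := H (exist _ (j, false) fs); rewrite /side_sign /side_coord /side_bound /= aE /=.
    by rewrite mulN1r lerN2 lee_fin.
  by rewrite leNye.
case bE : (b j) (bNy j) => [r| |] // _; last by rewrite leey.
have fs : finite_side a b (j, true) by rewrite /finite_side /= bE.
have := H (exist _ (j, true) fs); rewrite /side_sign /side_coord /side_bound /= bE /=.
by rewrite mul1r lee_fin.
Qed.

Lemma rectangle_probability dO (Om : measurableType dO) (P : probability Om R)
    (V : Om -> 'I_d -> R) a b : (forall j, measurable_fun setT (fun t => V t j)) ->
  (forall j, a j != +oo%E) -> (forall j, b j != -oo%E) ->
  measurable [set t | forall j, (a j <= (V t j)%:E <= b j)%E] /\
  P [set t | forall j, (a j <= (V t j)%:E <= b j)%E] =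
  (\int[P]_t below (@side_bound a b) (fun i => side_sign i * V t (side_coord i)))%:E.
Proof.
move=> mV ay bNy; set E := [set t | _].
pose u (t : Om) (i : side a b) := side_sign i * V t (side_coord i).
have [bmeas b01] := ufun_below (@side_bound a b).
have mb : measurable_fun setT (fun t => below (@side_bound a b) (u t)).
  by apply: bmeas => i; exact: measurable_funM.
have EE : below (@side_bound a b) \o u = \1_E.
  apply/funext => t; rewrite /= /below indicE; congr (_ %:R); congr nat_of_bool.
  apply/forallP/idP => [H|]; first by rewrite inE; apply/(rectangle_sides _ ay bNy) => i; exact: H.
  by rewrite inE => /(rectangle_sides _ ay bNy) H i; exact: H.
have mE : measurable E.
  rewrite (_ : E = (below (@side_bound a b) \o u) @^-1` [set 1]).
    by rewrite -[X in measurable X]setTI; apply: mb => //; exact: measurable_set1.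
  rewrite EE; apply/seteqP; split => t /=; rewrite indicE.
    by move=> Et; rewrite mem_set.
  by case: (boolP (t \in E)) => [|_ /eqP]; [rewrite inE|rewrite eq_sym oner_eq0].
split => //; rewrite EFin_Rintegral; last first.
  apply: (bounded_integrable (M := 1) _ mb) => t.
  by have /andP[f0 f1] := b01 (u t); rewrite ger0_norm.
rewrite (eq_integral (EFin \o \1_E)) ?integral_indic ?setIT //.
by move=> t _; rewrite -EE.
Qed.

End rectangles.

Section signed_kernel.
Context {R : realType} dO (Om : measurableType dO) (P : probability Om R)
  (n p d : nat) (F : probability (p.-tuple R) R)
  (h : p.-tuple R -> p.-tuple R -> d.-tuple R)
  (Xs : 'I_n -> {RV P >-> p.-tuple R}) (X X' : {RV P >-> p.-tuple R})
  (b bbar B : R).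
Hypothesis hyp : assumptions h Xs X X' b bbar B F.
Context (I : finType) (co : I -> 'I_d) (sg : I -> R).
Hypothesis sg1 : forall i, `|sg i| = 1.

(** Each side of a rectangle picks a coordinate and a sign. Signs of modulus one leave absolute
    moments unchanged and multiply the covariances. *)
Definition signed_kernel (x y : p.-tuple R) (i : I) : R :=
  sg i * tnth (h x y) (co i).

Let S := (p.-tuple R : measurableType _).

Let mX : measurable_fun setT X. Proof. exact: measurable_funPT. Qed.
Let mX' : measurable_fun setT X'. Proof. exact: measurable_funPT. Qed.

Let XF A : measurable A -> P (X @^-1` A) = F A.
Proof. by have [ZF _] := sample_iid hyp; exact: (ZF (inr true)). Qed.

Let X'F A : measurable A -> P (X' @^-1` A) = F A.
Proof. by have [ZF _] := sample_iid hyp; exact: (ZF (inr false)). Qed.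

Let XX' : independent2 P X X'. Proof. exact: with_copies_pair (sample_iid hyp). Qed.

Let mh m : measurable_fun [set: S * S] (fun z => tnth (h z.1 z.2) m).
Proof. exact: (measurableT_comp (measurable_tnth m) (h_measurable hyp)). Qed.

Lemma measurable_signed_kernel i :
  measurable_fun [set: S * S] (fun z => signed_kernel z.1 z.2 i).
Proof. by apply: measurable_funM. Qed.

Lemma signed_kernel_sym x y : signed_kernel x y = signed_kernel y x.
Proof. by apply/funext => i; rewrite /signed_kernel (h_symmetric hyp). Qed.

Lemma signed_kernel_norm x y i : `|signed_kernel x y i| = `|tnth (h x y) (co i)|.
Proof. by rewrite /signed_kernel normrM sg1 mul1r. Qed.

Let signed_pair (phi : R -> R) i : measurable_fun setT phi -> (forall r, 0 <= r -> 0 <= phi r) ->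
  (\int[F]_x \int[F]_y (phi `|signed_kernel x y i|)%:E =
   \int[P]_w (phi `|hXX h X X' (co i) w|)%:E)%E.
Proof.
move=> mphi phi0.
rewrite -(@integral_pair _ _ _ P _ _ F X X' mX mX' XF X'F XX'
  (fun z => (phi `|signed_kernel z.1 z.2 i|)%:E)).
- by apply: eq_integral => w _; rewrite signed_kernel_norm.
- apply/measurable_EFinP; apply: (measurableT_comp mphi); apply: measurable_normr.
  exact: measurable_signed_kernel.
by move=> z; rewrite lee_fin phi0.
Qed.

Lemma signed_kernel_cube i :
  (\int[F]_x \int[F]_y (`|signed_kernel x y i| ^+ 3)%:E <= B%:E)%E.
Proof.
rewrite (signed_pair (phi := fun r => r ^+ 3)).
- by have := h_moments hyp (l := 1) (co i) isT; rewrite unlock expr1.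
- exact: measurable_funX.
by move=> r; exact: exprn_ge0.
Qed.

(** The infimum defining the norm need not be attained, so admissibility of [B] itself is not at
    hand; some admissible [C] lies below [2 * B], whence the doubled scale. *)
Lemma signed_kernel_exp i : (psi1_norm P (hXX h X X' (co i)) <= B%:E)%E ->
  (\int[F]_x \int[F]_y (expR (`|signed_kernel x y i| / (2 * B)))%:E <= 2%:E)%E.
Proof.
have B0 : 0 < B by exact: lt_le_trans (B_ge1 hyp).
move=> psi.
have : (psi1_norm P (hXX h X X' (co i)) < (2 * B)%:E)%E.
  by apply: le_lt_trans psi _; rewrite lte_fin ltr_pMl // ltr1n.
move=> /ereal_inf_lt[_ [C [C0 EC] <-]]; rewrite lte_fin => CB.
rewrite (signed_pair (phi := fun r => expR (r / (2 * B)))); last 2 first.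
- by apply: (measurableT_comp (@measurable_expR R)); exact: measurable_funM.
- by move=> r _; exact: expR_ge0.
have mhX : measurable_fun setT (hXX h X X' (co i)).
  exact: (measurableT_comp (mh (co i)) (measurable_fun_pair mX mX')).
have mE (D : R) : measurable_fun setT (fun w => expR (`|hXX h X X' (co i) w| / D)).
  apply: (measurableT_comp (@measurable_expR R)); apply: measurable_funM => //.
  exact: measurable_normr.
apply: (@le_trans _ _ (\int[P]_w (expR (`|hXX h X X' (co i) w| / C))%:E)%E).
  apply: ge0_le_integralT.
  - by move=> w; rewrite lee_fin expR_ge0.
  - by apply/measurable_EFinP; exact: mE.
  - by apply/measurable_EFinP; exact: mE.
  move=> w; rewrite lee_fin ler_expR; apply: ler_wpM2l => //.
  by rewrite lef_pV2 ?posrE ?mulr_gt0 // ltW.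
rewrite unlock in EC.
rewrite (eq_integral (fun w => 1%:E + (expR (`|hXX h X X' (co i) w| / C) - 1)%:E)%E); last first.
  by move=> w _; rewrite -EFinD addrC subrK.
have e0 w : (setT : set Om) w -> (0 <= (expR (`|hXX h X X' (co i) w| / C) - 1)%:E)%E.
  move=> _; rewrite lee_fin subr_ge0 -expR0 ler_expR.
  by apply: mulr_ge0 => //; rewrite invr_ge0 ltW.
have mE1 : measurable_fun setT (fun w => (expR (`|hXX h X X' (co i) w| / C) - 1)%:E).
  by apply/measurable_EFinP; apply: measurable_funB => //; exact: mE.
rewrite (ge0_integralD P measurableT (fun w _ => lee01) (measurable_cst _) e0 mE1).
rewrite (integral_prob_cst P) (_ : 2%:E = 1%:E + 1%:E)%E; last by rewrite -EFinD.
exact: leeD2l.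
Qed.

(** Taking roots passes from the maximum of the powers to the power of the maximum. Only an
    inequality results, since some coordinates may carry no side. *)
Lemma signed_kernel_power (q : R) : 0 < q ->
  ('E_P[(fun w => \big[Num.max/0]_(m < d)
     ((`|hXX h X X' m w| / B) `^ q))%R] <= 1)%E ->
  (\int[F]_x \int[F]_y ((vmax (signed_kernel x y) / B) `^ q)%:E <= 1%:E)%E.
Proof.
move=> q0 Eq; apply: le_trans Eq.
have B0 : 0 < B by exact: lt_le_trans (B_ge1 hyp).
have mv : measurable_fun [set: S * S] (fun z => ((vmax (signed_kernel z.1 z.2) / B) `^ q)%:E).
  apply/measurable_EFinP; apply: (measurableT_comp (measurable_powR _)).
  apply: measurable_funM => //.
  by apply: (measurable_vmax (v := fun i z => signed_kernel z.1 z.2 i)); exact: measurable_signed_kernel.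
rewrite -(@integral_pair _ _ _ P _ _ F X X' mX mX' XF X'F XX' _ mv); last first.
  by move=> z; rewrite lee_fin powR_ge0.
rewrite unlock; apply: ge0_le_integralT.
- by move=> w; rewrite lee_fin powR_ge0.
- exact: (measurableT_comp mv (measurable_fun_pair mX mX')).
- apply/measurable_EFinP.
  suff : forall s : seq 'I_d, measurable_fun setT
     (fun w => \big[Num.max/0]_(m <- s) ((`|hXX h X X' m w| / B) `^ q)) by apply.
  elim=> [|m s IH]; first by under eq_fun do rewrite big_nil; exact: measurable_cst.
  under eq_fun do rewrite big_cons.
  apply: measurable_maxr => //.
  apply: (measurableT_comp (measurable_powR _)); apply: measurable_funM => //.
  apply: measurable_normr.
  exact: (measurableT_comp (mh m) (measurable_fun_pair mX mX')).
move=> w; rewrite lee_fin /=.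
set M := \big[_/_]_(m < d) _.
have M0 : 0 <= M. by exact: bigmax_ge_id.
have hM m : (`|hXX h X X' m w| / B) `^ q <= M by exact: le_bigmax.
have qV : 0 <= q^-1 by rewrite invr_ge0 ltW.
have qq : q^-1 * q = 1 by rewrite mulVf // gt_eqF.
rewrite -[leRHS](powRr1 M0) -qq powRrM; apply: ge0_ler_powR.
- exact: ltW.
- by rewrite nnegrE divr_ge0 ?(ltW B0) //; exact: bigmax_ge_id.
- by rewrite nnegrE powR_ge0.
rewrite ler_pdivrMr //; apply: vmax_le => [|i]; first by rewrite mulr_ge0 ?powR_ge0 // ltW.
rewrite signed_kernel_norm -ler_pdivrMr //.
have r0 : 0 <= `|tnth (h (X w) (X' w)) (co i)| / B by rewrite divr_ge0 // ltW.
rewrite -[leLHS](powRr1 r0) -(_ : q * q^-1 = 1); last by rewrite mulfV // gt_eqF.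
by rewrite powRrM; apply: ge0_ler_powR => //; rewrite ?nnegrE ?powR_ge0 //; exact: hM.
Qed.

Let hX_int m : P.-integrable setT (EFin \o (fun w => (fun z => tnth (h z.1 z.2) m) (X w, X' w))).
Proof. exact: (h_integrable hyp). Qed.

Let bad := bad_points F signed_kernel.

Let signed_cube_fin i : (\int[F]_x \int[F]_y (`|signed_kernel x y i| ^+ 3)%:E < +oo)%E.
Proof. exact: le_lt_trans (signed_kernel_cube i) (ltry _). Qed.

Let mbad : measurable bad := measurable_bad_points F measurable_signed_kernel.
Let bad0 : F bad = 0%E := bad_points_null measurable_signed_kernel signed_cube_fin.

Let sg_sq i : sg i * sg i = 1.
Proof. by rewrite -expr2 -[LHS]ger0_norm ?sqr_ge0 // normrX sg1 expr1n. Qed.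

Let section_integrable x i : ~ bad x ->
  F.-integrable setT (EFin \o (fun y => tnth (h x y) (co i))).
Proof.
move=> bx.
have := integrableZR (sg i) (kernel_integrable_off_bad measurable_signed_kernel i bx).
by apply: eq_integrable => // y _; rewrite /= /signed_kernel mulrA sg_sq mul1r.
Qed.

Let signed_mean x i : ~ bad x ->
  kernel_mean F signed_kernel x i = sg i * \int[F]_y tnth (h x y) (co i).
Proof.
by move=> bx; rewrite /kernel_mean RintegralZl //; exact: section_integrable.
Qed.

Let raw_meanE x m : ('E_P[fun w => tnth (h x (X' w)) m] = \int[F]_y (tnth (h x y) m)%:E)%E.
Proof.
rewrite unlock; apply: (integral_law (f := fun y => (tnth (h x y) m)%:E) mX' X'F).
by apply/measurable_EFinP; exact: (measurableT_comp (mh m) (pair1_measurable x)).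
Qed.

(** Off the bad points all sections are integrable, so the iterated mean is a Fubini integral. On
    them [fine] may return a conventional value, harmless on a null set. *)
Lemma signed_kernel_total i : kernel_total F signed_kernel i = sg i * theta h X X' (co i).
Proof.
have mf := measurable_signed_kernel i.
have mfE : measurable_fun [set: S * S] (fun z => (signed_kernel z.1 z.2 i)%:E).
  exact/measurable_EFinP.
have fi : P.-integrable setT (EFin \o (fun w => signed_kernel (X w) (X' w) i)).
  exact: (integrableZR (sg i) (hX_int (co i))).
have E := integral_pair_fubini mX mX' XF X'F XX' mf fi.
have -> : kernel_total F signed_kernel i = fine (\int[F]_x \int[F]_y (signed_kernel x y i)%:E)%E.
  congr fine; apply: (integral_off_null mbad bad0).
  - by apply/measurable_EFinP; exact: measurable_raw_mean measurable_signed_kernel i.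
  - exact: (measurable_section_integral F mfE).
  by move=> x bx; rewrite EFin_Rintegral //; exact: (kernel_integrable_off_bad measurable_signed_kernel i bx).
rewrite -E -[LHS]/(\int[P]_w (sg i * hXX h X X' (co i) w)) RintegralZl //.
  by rewrite /theta unlock.
exact: hX_int.
Qed.

Let proj_hajek x i : ~ bad x ->
  kernel_proj F signed_kernel x i = sg i * hajek h X X' (co i) x.
Proof.
by move=> bx; rewrite /kernel_proj signed_mean // signed_kernel_total /hajek raw_meanE mulrBr.
Qed.

Let measurable_hajek m : measurable_fun setT (hajek h X X' m).
Proof.
apply: measurable_funB => //.
apply: (eq_measurable_fun (fun x => kernel_mean F (fun x y m => tnth (h x y) m) x m)).
  by move=> x _; rewrite raw_meanE.
exact: (@measurable_raw_mean _ _ _ _ F (fun x y m => tnth (h x y) m)).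
Qed.

Let tk := trunc_kernel F signed_kernel.
Let mtk := measurable_trunc_kernel F measurable_signed_kernel.
Let tk_sq := @trunc_kernel_sq _ _ _ _ F _ measurable_signed_kernel.

Let tk_cube i : (\int[F]_x \int[F]_y (`|tk x y i| ^+ 3)%:E <= B%:E)%E.
Proof.
apply: le_trans (signed_kernel_cube i).
apply: (@trunc_kernel_mono _ _ _ _ F _ measurable_signed_kernel (fun r => r ^+ 3))
  => [r r0|r s r0 rs|].
- exact: exprn_ge0.
- by rewrite lerXn2r // nnegrE // (le_trans r0).
- exact: measurable_funX.
Qed.

Let hajek_tk x i : ~ bad x -> hajek h X X' (co i) x = sg i * kernel_proj F tk x i.
Proof.
move=> bx; rewrite trunc_kernel_proj // ?proj_hajek //.
  by rewrite mulrA sg_sq mul1r.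
exact: measurable_signed_kernel.
Qed.

Let measurable_tk_proj i : measurable_fun setT (fun x => kernel_proj F tk x i).
Proof. exact: measurable_kernel_proj mtk tk_sq i. Qed.

Let hajek_mean i : \int[P]_w hajek h X X' (co i) (X w) = 0.
Proof.
rewrite (Rintegral_law mX XF (measurable_hajek (co i))).
have -> : \int[F]_x hajek h X X' (co i) x = \int[F]_x (sg i * kernel_proj F tk x i).
  apply: (Rintegral_off_null mbad bad0) => //; first exact: measurable_funM.
  by move=> x bx; rewrite hajek_tk.
rewrite RintegralZl //; first by rewrite (kernel_proj_mean mtk tk_sq tk_cube) mulr0.
exact: (kernel_proj_integrable mtk tk_sq tk_cube).
Qed.

Let GammaE i j : Gamma h X X' (co i) (co j) =
  \int[F]_x (hajek h X X' (co i) x * hajek h X X' (co j) x).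
Proof.
have mG : measurable_fun setT (fun x => hajek h X X' (co i) x * hajek h X X' (co j) x).
  exact: measurable_funM.
rewrite mxE -(Rintegral_law mX XF mG) !unlock.
have e i' : fine (\int[P]_w ((hajek h X X' (co i') \o X) w)%:E)%E = 0 by exact: hajek_mean.
by rewrite !e; congr fine; apply: eq_integral => w _;
  rewrite -[LHS]/(((hajek h X X' (co i) (X w) - 0) * (hajek h X X' (co j) (X w) - 0))%:E) !subr0.
Qed.

Lemma signed_kernel_cov i j :
  \int[F]_x (kernel_proj F signed_kernel x i * kernel_proj F signed_kernel x j) =
  sg i * sg j * Gamma h X X' (co i) (co j).
Proof.
rewrite GammaE -(trunc_kernel_proj_cov measurable_signed_kernel signed_cube_fin).
have -> : \int[F]_x (hajek h X X' (co i) x * hajek h X X' (co j) x) =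
    \int[F]_x (sg i * sg j * (kernel_proj F tk x i * kernel_proj F tk x j)).
  apply: (Rintegral_off_null mbad bad0); first exact: measurable_funM.
    by apply: measurable_funM => //; exact: measurable_funM.
  by move=> x bx; rewrite !hajek_tk // mulrACA.
rewrite RintegralZl //; last exact: (kernel_proj_integrable2 mtk tk_sq tk_cube).
by rewrite mulrA mulrACA !sg_sq !mul1r.
Qed.

Lemma signed_kernel_var i : b <=
  \int[F]_x (kernel_proj F signed_kernel x i * kernel_proj F signed_kernel x i).
Proof.
rewrite -(trunc_kernel_proj_cov measurable_signed_kernel signed_cube_fin) -lee_fin.
rewrite EFin_Rintegral; last exact: (kernel_proj_integrable2 mtk tk_sq tk_cube).
apply: le_trans (hajek_nondegenerate hyp (co i)) _; rewrite unlock.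
have mG : measurable_fun setT (fun x => (hajek h X X' (co i) x ^+ 2)%:E).
  by apply/measurable_EFinP; exact: measurable_funX.
rewrite (integral_law mX XF mG) le_eqVlt; apply/orP; left; apply/eqP.
apply: (integral_off_null mbad bad0) => //.
  by apply/measurable_EFinP; apply: measurable_funM; exact: measurable_tk_proj.
by move=> x bx; rewrite hajek_tk // exprMn expr2 sg_sq mul1r expr2.
Qed.

Lemma kernel_stat_signed D t :
  kernel_stat F signed_kernel (ord_seq (fun i => Xs i) D) n t =
  fun i => sg i * tnth (Tstat h Xs X X' t) (co i).
Proof.
apply/funext => i; rewrite /kernel_stat signed_kernel_total tnth_mktuple /Ustat.
under eq_bigr => a _ do under eq_bigr => c _ do rewrite !ord_seqE /signed_kernel.
under eq_bigr => a _ do rewrite -mulr_sumr.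
rewrite -mulr_sumr; ring.
Qed.

End signed_kernel.

(** * From orthants to the distance over rectangles *)

Section rectangle_distance.
Context {R : realType} (d : nat).

Lemma rho_re_le dO (Om : measurableType dO) (P : probability Om R) (V : Om -> d.-tuple R)
    dY (OmY : measurableType dY) (Q : probability OmY R) (Y : {RV Q >-> d.-tuple R})
    dO' (Om' : measurableType dO') (P' : probability Om' R) (W : Om' -> 'I_d -> R) (M : R) :
  (forall j, measurable_fun setT (fun t => tnth (V t) j)) ->
  (forall j, measurable_fun setT (fun t => W t j)) ->
  (forall S : set (d.-tuple R), measurable S ->
     Q (Y @^-1` S) = P' ((fun t => [tuple W t j | j < d]) @^-1` S)) ->
  0 <= M ->
  (forall (a b : 'I_d -> \bar R), side a b ->
     `|\int[P]_t below (@side_bound _ _ a b) (fun i => side_sign i * tnth (V t) (side_coord i)) -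
       \int[P']_t below (@side_bound _ _ a b) (fun i => side_sign i * W t (side_coord i))| <= M) ->
  (rho_re P V Q Y <= M%:E)%E.
Proof.
move=> mV mW QW M0 bound; apply: ge_ereal_sup => _ [A [a [b [ab ->]]] <-].
have [/forallP ay|] := boolP [forall j, a j != +oo%E]; last first.
  rewrite negb_forall => /existsP[j]; rewrite negbK => /eqP aj.
  have -> : [set x : d.-tuple R | forall j, (a j <= (tnth x j)%:E <= b j)%E] = set0.
    apply/seteqP; split => // x /= /(_ j); rewrite aj => /andP[].
    by rewrite leye_eq.
  by rewrite !preimage_set0 !measure0 sube0 abse0 lee_fin.
have [/forallP bNy|] := boolP [forall j, b j != -oo%E]; last first.
  rewrite negb_forall => /existsP[j]; rewrite negbK => /eqP bj.
  have -> : [set x : d.-tuple R | forall j, (a j <= (tnth x j)%:E <= b j)%E] = set0.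
    apply/seteqP; split => // x /= /(_ j); rewrite bj => /andP[_].
    by rewrite leeNy_eq.
  by rewrite !preimage_set0 !measure0 sube0 abse0 lee_fin.
have [_ PV] := rectangle_probability P mV ay bNy.
have [_ PW] := rectangle_probability P' mW ay bNy.
have [mA _] := rectangle_probability (distribution Q Y) (V := fun x j => tnth x j)
  (fun j => @measurable_tnth _ _ _ j) ay bNy.
rewrite QW // (_ : _ @^-1` _ = [set t | forall j, (a j <= (tnth (V t) j)%:E <= b j)%E]) //.
rewrite PV (_ : _ @^-1` _ = [set t | forall j, (a j <= (W t j)%:E <= b j)%E]); last first.
  by apply/seteqP; split => t /= H j; move: (H j); rewrite tnth_mktuple.
rewrite PW -EFinB abse_EFin lee_fin.
(* Without any finite bound there is no index for a soft maximum; the rectangle is the whole space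
   and both integrals are 1. *)
have [i0 _|I0] := pickP (fun _ : side a b => true); first exact: bound.
have E (w : side a b -> R) : below (@side_bound _ _ a b) w = 1.
  by rewrite /below (_ : [forall i, _] = true) //; apply/forallP => i; have := I0 i.
rewrite /Rintegral; under eq_integral do rewrite E.
under [X in _ - fine X]eq_integral do rewrite E.
by rewrite -!/(Rintegral _ _ _) !(Rintegral_cst1 _ 1) subrr normr0.
Qed.

(** The trivial bound, for target rates above 1, which the choice of parameters does not cover. *)
Lemma rho_re_le1 dO (Om : measurableType dO) (P : probability Om R) (V : Om -> d.-tuple R)
    dY (OmY : measurableType dY) (Q : probability OmY R) (Y : {RV Q >-> d.-tuple R})
    dO' (Om' : measurableType dO') (P' : probability Om' R) (W : Om' -> 'I_d -> R) :
  (forall j, measurable_fun setT (fun t => tnth (V t) j)) ->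
  (forall j, measurable_fun setT (fun t => W t j)) ->
  (forall S : set (d.-tuple R), measurable S ->
     Q (Y @^-1` S) = P' ((fun t => [tuple W t j | j < d]) @^-1` S)) ->
  (rho_re P V Q Y <= 1%:E)%E.
Proof.
move=> mV mW QW; apply: (rho_re_le mV mW QW) => // a b i0.
have pr dT (T : measurableType dT) (mu : probability T R) (v : T -> side a b -> R) :
    (forall i, measurable_fun setT (fun t => v t i)) ->
    0 <= \int[mu]_t below (@side_bound _ _ a b) (v t) <= 1.
  move=> mv; have [bmeas b01] := ufun_below (@side_bound _ _ a b).
  have mb := bmeas _ _ (fun i t => v t i) mv.
  have ib : mu.-integrable setT (EFin \o (fun t => below (@side_bound _ _ a b) (v t))).
    apply: (bounded_integrable (M := 1) _ mb) => t.
    by have /andP[f0 f1] := b01 (v t); rewrite ger0_norm.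
  apply/andP; split; first by apply: Rintegral_ge0 => t _; have /andP[] := b01 (v t).
  rewrite -[leRHS](Rintegral_cst1 mu 1); apply: le_Rintegral => //.
    exact: integrable_cstR.
  by move=> t _; have /andP[] := b01 (v t).
have /andP[p0 p1] := pr _ _ P _ (fun i => measurable_funM (measurable_cst (side_sign i)) (mV (side_coord i))).
have /andP[q0 q1] := pr _ _ P' _ (fun i => measurable_funM (measurable_cst (side_sign i)) (mW (side_coord i))).
by rewrite ler_norml; apply/andP; split; lra.
Qed.

End rectangle_distance.

Section gaussian_rectangle.
Context {R : realType} (d k : nat) (A : 'M[R]_(d, k)) (I : finType)
  (co : I -> 'I_d) (sg : I -> R).

(** The columns of [A], with the signs of the sides applied to its rows and prolonged by 0 beyond
    [k]; their [gram] is the covariance of the signed kernel. *)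
Definition signed_columns (m : nat) (i : I) : R :=
  sg i * (if insub m is Some o then A (co i) o else 0).

Lemma gram_signed_columns i j : gram signed_columns k i j =
  sg i * sg j * (A *m A^T) (co i) (co j).
Proof.
rewrite /gram mxE mulr_sumr; apply: eq_bigr => l _.
by rewrite /signed_columns valK !mxE mulrACA.
Qed.

Lemma gauss_mean_signed_columns dO (Om : measurableType dO) (P : probability Om R)
    (Z : 'I_k -> {RV P >-> R}) (c : I -> R) :
  iid_seq P (@gauss R) k (ord_seq (fun l => Z l) (fun=> 0)) ->
  \int[P]_t below c (fun i => sg i * \sum_(l < k) A (co i) l * Z l t) =
  gauss_mean signed_columns k (below c).
Proof.
move=> iZ; rewrite /gauss_mean.
rewrite -(Rintegral_iid_sum (fun=> 0) (measurable_column_map 1 signed_columns) (ufun_below c) iZ).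
apply: eq_Rintegral => t _; congr (below c _); apply/funext => i.
rewrite /addv add0r mulr_sumr; apply: eq_bigr => l _.
by rewrite ord_seqE /column_map /signed_columns valK mul1r mulrA.
Qed.

End gaussian_rectangle.

Section rates.
Context {R : realType}.

(** [expR 2 <= 16] gives [expR 1 <= 4]; 12 = 4 * 3 is the least value of [n * d]. *)
Lemma ln12_ge1 : 1 <= ln (12 : R).
Proof.
rewrite -[leLHS](expRK 1) ler_ln ?posrE ?expR_gt0 //.
have e4 : expR 1 <= 4 :> R.
  rewrite -(@ler_pXn2r _ 2) ?nnegrE ?expR_ge0 // -expRM_natl.
  have := @expR2_le16 R; rewrite mulr1 (_ : 4 ^+ 2 = 16 :> R) //; ring.
by apply: le_trans e4 _; rewrite ler_nat.
Qed.

Lemma varpi1_pow6 (n d : nat) (B : R) : (0 < n)%N ->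
  0 <= ln ((n * d)%:R : R) ->
  varpi1 n d B ^+ 6 = B ^+ 2 * ln ((n * d)%:R) ^+ 7 / n%:R.
Proof.
move=> n0 l0; rewrite /varpi1 -powR_mulrn ?powR_ge0 // -powRrM.
rewrite (_ : 1 / 6 * 6%:R = 1); last by field.
by rewrite powRr1 // divr_ge0 // mulr_ge0 ?sqr_ge0 // exprn_ge0.
Qed.

Lemma varpi2_pow3 (n d : nat) (q B : R) : 0 <= ln ((n * d)%:R : R) ->
  varpi2 n d q B ^+ 3 = B ^+ 2 * ln ((n * d)%:R) ^+ 3 / n%:R `^ (1 - 2 / q).
Proof.
move=> l0; rewrite /varpi2 -powR_mulrn ?powR_ge0 // -powRrM.
rewrite (_ : 1 / 3 * 3%:R = 1); last by field.
by rewrite powRr1 // divr_ge0 ?powR_ge0 // mulr_ge0 ?sqr_ge0 // exprn_ge0.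
Qed.

End rates.

Section main_rate.
Context {R : realType} (b bbar : R) (n p d : nat) (B : R)
  dO (Om : measurableType dO) (P : probability Om R)
  (F : probability (p.-tuple R) R)
  (h : p.-tuple R -> p.-tuple R -> d.-tuple R)
  (Xs : 'I_n -> {RV P >-> p.-tuple R}) (X X' : {RV P >-> p.-tuple R})
  dY (OmY : measurableType dY) (Q : probability OmY R) (Y : {RV Q >-> d.-tuple R}).
Hypotheses (b_gt0 : 0 < b) (hyp : assumptions h Xs X X' b bbar B F)
  (normal_Y : centered_normal Y (Gamma h X X')).

Let l : R := ln (n * d)%:R.

Lemma log_dim_ge1 : 1 <= l.
Proof.
apply: le_trans ln12_ge1 _; rewrite ler_ln ?posrE ?ltr0n //.
  by rewrite ler_nat (leq_mul (n_ge4 hyp) (d_ge3 hyp)).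
exact: leq_trans (leq_mul (n_ge4 hyp) (d_ge3 hyp)).
Qed.

Let n_gt0 : (0 < n)%N. Proof. exact: leq_trans (n_ge4 hyp). Qed.
Let d_gt0 : (0 < d)%N. Proof. exact: leq_trans (d_ge3 hyp). Qed.
Let nd_gt0 : 0 < (n * d)%:R :> R. Proof. by rewrite ltr0n muln_gt0 n_gt0. Qed.

Let measurable_Tstat j : measurable_fun setT (fun t => tnth (Tstat h Xs X X' t) j).
Proof.
under eq_fun do rewrite tnth_mktuple.
apply: measurable_funM => //; apply: measurable_funM => //; apply: measurable_funB => //.
apply: measurable_funM => //; apply: measurable_sum => a.
under eq_fun do rewrite big_mkcond /=.
apply: measurable_sum => c; case: (a != c) => //.
apply: (measurableT_comp (measurable_tnth j)).
exact: (measurableT_comp (h_measurable hyp) (measurable_fun_pair _ _)).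
Qed.

Lemma rho_re_rate (w : R) : 0 < w ->
  B ^+ 2 * l ^+ 7 <= w ^+ 6 * n%:R ->
  (forall m : 'I_d, (psi1_norm P (hXX h X X' m) <= B%:E)%E) \/
  (exists q : R, [/\ 4 <= q, B ^+ 2 * l ^+ 3 <= w ^+ 3 * n%:R `^ (1 - 2 / q) &
     ('E_P[(fun w => \big[Num.max/0]_(m < d)
                        ((`|hXX h X X' m w| / B) `^ q))%R] <= 1)%E]) ->
  (rho_re P (Tstat h Xs X X') Q Y <= ((68 * 16 * 2000 / Num.sqrt b + 28) * w)%:E)%E.
Proof.
move=> w_gt0 rate tails.
have [k [A [AG [dZ [OmZ [PZ [Z [iidZ lawY]]]]]]]] := normal_Y.
pose W (t : OmZ) (j : 'I_d) := \sum_(m < k) A j m * Z m t.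
have mW j : measurable_fun setT (fun t => W t j).
  by apply: measurable_sum => m; exact: measurable_funM.
have C28 : 28 <= 68 * 16 * 2000 / Num.sqrt b + 28.
  by rewrite lerDr; apply: divr_ge0; [lra|exact: sqrtr_ge0].
(* The parameter choice needs [w <= 1]; for larger [w] the constant, at least 28, makes the claim
   weaker than the trivial bound. *)
have [w1|w1] := leP w 1; last first.
  have rho1 : (rho_re P (Tstat h Xs X X') Q Y <= 1%:E)%E.
    exact: (@rho_re_le1 _ _ _ _ P (Tstat h Xs X X') _ _ Q Y _ _ PZ W measurable_Tstat mW lawY).
  apply: le_trans rho1 _; rewrite lee_fin.
  apply: mulr_ege1 (ltW w1); apply: le_trans C28; by rewrite ler1n.
apply: (@rho_re_le _ _ _ _ P (Tstat h Xs X X') _ _ Q Y _ _ PZ W _ measurable_Tstat mW lawY).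
  by apply: mulr_ge0 (ltW w_gt0); apply: le_trans C28; exact: ler0n.
move=> lo up i0.
set I := side lo up in i0; pose co : I -> 'I_d := @side_coord _ _ lo up.
pose sg : I -> R := @side_sign _ _ lo up; pose c : I -> R := @side_bound _ _ lo up.
have sg1 i : `|sg i| = 1.
  by rewrite /sg /side_sign; case: ((val i).2); rewrite ?normrN normr1.
have iX : iid_seq P F n (ord_seq (fun i => Xs i) X).
  by apply: ord_seq_iid => //; exact: with_copies_iid (sample_iid hyp).
have iZ : iid_seq PZ (@gauss R) k (ord_seq (fun m => Z m) (fun=> 0)) by exact: ord_seq_iid.
have A_cov i j : gram (signed_columns A co sg) k i j =
    \int[F]_x (kernel_proj F (signed_kernel h co sg) x i *
               kernel_proj F (signed_kernel h co sg) x j).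
  by rewrite gram_signed_columns (signed_kernel_cov hyp co sg1) -AG.
have var_ge i : b <= gram (signed_columns A co sg) k i i.
  by rewrite A_cov; exact: (signed_kernel_var hyp co sg1 i).
have card_le : ln #|{: I * bool}|%:R <= l.
  (* There are at most [2 * d] sides, doubled once more for absolute values, and [4 * d <= n * d]
     because [n >= 4]. *)
  have I2 : (#|{: I * bool}| <= n * d)%N.
    rewrite card_prod card_bool; apply: (@leq_trans (2 * d * 2)).
      by rewrite leq_mul2r; exact: card_side.
    by rewrite mulnC mulnA leq_mul2r (n_ge4 hyp) orbT.
  have I0 : (0 < #|{: I * bool}|)%N by apply/card_gt0P; exists (i0, true).
  by rewrite ler_ln ?posrE ?ltr0n ?ler_nat //; rewrite muln_gt0 n_gt0.
have n_le : n%:R <= expR l.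
  by rewrite lnK ?posrE // ler_nat leq_pmulr.
have n_ge2 : (2 <= n)%N by exact: leq_trans (n_ge4 hyp).
suff : `|\int[P]_t below c (fun i => sg i * tnth (Tstat h Xs X X' t) (co i)) -
    \int[PZ]_t below c (fun i => sg i * \sum_(m < k) A (co i) m * Z m t)| <=
    (68 * 16 * 2000 / Num.sqrt b + 28) * w by [].
rewrite (gauss_mean_signed_columns A co sg c iZ).
have -> : \int[P]_t below c (fun i => sg i * tnth (Tstat h Xs X X' t) (co i)) =
    \int[P]_t below c (kernel_stat F (signed_kernel h co sg) (ord_seq (fun i => Xs i) X) n t).
  by apply: eq_Rintegral => t _; rewrite (kernel_stat_signed hyp co sg1).
have mH := measurable_signed_kernel hyp co sg.
have Hs := signed_kernel_sym hyp co sg.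
have Hc := signed_kernel_cube hyp co sg1.
case: tails => [psi|[q [q4 rate2 Eq]]].
  apply: (raw_orthant_rate_exp i0 (B_ge1 hyp) mH Hs Hc n_ge2 iX iZ A_cov b_gt0 var_ge
    log_dim_ge1 card_le w_gt0 w1 n_le rate erefl) => i.
  exact: (signed_kernel_exp hyp sg1 (psi (co i))).
apply: (raw_orthant_rate_power i0 (B_ge1 hyp) mH Hs Hc n_ge2 iX iZ A_cov b_gt0 var_ge
  log_dim_ge1 card_le w_gt0 w1 n_le rate erefl _ q4 rate2).
by apply: (signed_kernel_power hyp co sg1) => //; apply: lt_le_trans q4.
Qed.

End main_rate.

Theorem theorem2p1 (R : realType) (b bbar : R) (b_gt0 : 0 < b)
    (bbar_gt0 : 0 < bbar) :
  (exists2 C : R, 0 < C &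
    forall (n p d : nat) (B : R)
      (dO : measure_display) (Om : measurableType dO) (P : probability Om R)
      (F : probability (p.-tuple R) R)
      (h : p.-tuple R -> p.-tuple R -> d.-tuple R)
      (Xs : 'I_n -> {RV P >-> p.-tuple R}) (X X' : {RV P >-> p.-tuple R})
      (dY : measure_display) (OmY : measurableType dY)
      (Q : probability OmY R) (Y : {RV Q >-> d.-tuple R}),
      assumptions h Xs X X' b bbar B F ->
      centered_normal Y (Gamma h X X') ->
      (forall m : 'I_d, (psi1_norm P (hXX h X X' m) <= B%:E)%E) ->
      (rho_re P (Tstat h Xs X X') Q Y <= (C * varpi1 n d B)%:E)%E) /\
  (forall q : R, 4 <= q ->
   exists2 C : R, 0 < C &
    forall (n p d : nat) (B : R)
      (dO : measure_display) (Om : measurableType dO) (P : probability Om R)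
      (F : probability (p.-tuple R) R)
      (h : p.-tuple R -> p.-tuple R -> d.-tuple R)
      (Xs : 'I_n -> {RV P >-> p.-tuple R}) (X X' : {RV P >-> p.-tuple R})
      (dY : measure_display) (OmY : measurableType dY)
      (Q : probability OmY R) (Y : {RV Q >-> d.-tuple R}),
      assumptions h Xs X X' b bbar B F ->
      centered_normal Y (Gamma h X X') ->
      ('E_P[(fun w => \big[Num.max/0]_(m < d)
                        ((`|hXX h X X' m w| / B) `^ q))%R] <= 1)%E ->
      (rho_re P (Tstat h Xs X X') Q Y
         <= (C * (varpi1 n d B + varpi2 n d q B))%:E)%E).
Proof.
have C_gt0 : 0 < 68 * 16 * 2000 / Num.sqrt b + 28.
  by apply: ltr_wpDl; [apply: divr_ge0; [lra|exact: sqrtr_ge0]|rewrite ltr0n].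
have facts n p d B dO (Om : measurableType dO) (P : probability Om R)
    (F : probability (p.-tuple R) R) (h : p.-tuple R -> p.-tuple R -> d.-tuple R)
    (Xs : 'I_n -> {RV P >-> p.-tuple R}) (X X' : {RV P >-> p.-tuple R}) :
    assumptions h Xs X X' b bbar B F ->
    [/\ 0 < n%:R :> R, 0 <= ln ((n * d)%:R : R) & 0 < varpi1 n d B].
  move=> hyp; have n0 : (0 < n)%N by exact: leq_trans (n_ge4 hyp).
  have l1 := log_dim_ge1 hyp; have l0 : 0 < ln ((n * d)%:R : R) by exact: lt_le_trans l1.
  split; [by rewrite ltr0n|exact: ltW|].
  apply: powR_gt0; apply: divr_gt0; last by rewrite ltr0n.
  by rewrite mulr_gt0 ?exprn_gt0 // (lt_le_trans _ (B_ge1 hyp)).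
split.
  exists (68 * 16 * 2000 / Num.sqrt b + 28) => //.
  move=> n p d B dO Om P F h Xs X X' dY OmY Q Y hyp nY psi.
  have [n0 l0 v0] := facts _ _ _ _ _ _ _ _ _ _ _ _ hyp.
  apply: (rho_re_rate b_gt0 hyp nY v0); last by left.
  rewrite varpi1_pow6 //; last by move: n0; rewrite ltr0n.
  by rewrite divfK // gt_eqF.
move=> q q4; exists (68 * 16 * 2000 / Num.sqrt b + 28) => //.
move=> n p d B dO Om P F h Xs X X' dY OmY Q Y hyp nY Eq.
have [n0 l0 v0] := facts _ _ _ _ _ _ _ _ _ _ _ _ hyp.
have v20 : 0 <= varpi2 n d q B by exact: powR_ge0.
(* [w] is the sum of the two rates: each of the two conditions holds at one summand and persists
   when [w] grows. *)
apply: (rho_re_rate b_gt0 hyp nY).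
- by rewrite ltr_pwDl.
- apply: (@le_trans _ _ (varpi1 n d B ^+ 6 * n%:R)).
    rewrite varpi1_pow6 //; last by move: n0; rewrite ltr0n.
    by rewrite divfK // gt_eqF.
  rewrite ler_pM2r // lerXn2r ?nnegrE ?(ltW v0) ?lerDl //.
  by rewrite addr_ge0 // ltW.
right; exists q; split => //.
have p0 : 0 < n%:R `^ (1 - 2 / q) by exact: powR_gt0.
apply: (@le_trans _ _ (varpi2 n d q B ^+ 3 * n%:R `^ (1 - 2 / q))).
  by rewrite varpi2_pow3 // divfK // gt_eqF.
rewrite ler_pM2r // lerXn2r ?nnegrE ?lerDr ?(ltW v0) //.
by rewrite addr_ge0 // ltW.
Qed.
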